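(* Assume the following conjecture (Dom): for every iterated induced module $\mathscr H_1\otimes_{J_1}\cdots\otimes_{J_{d-1}}\mathscr H_d$ with $W_1$ of type $A$ and $W_1$-graph $\Lambda$ on it, if $\mathbf y\le_\Lambda\mathbf z$ with $\mathbf y,\mathbf z\in\Lambda$ in different cells whose local labels have shapes $\lambda,\mu$ respectively, then $\lambda<\mu$ in dominance order. Let $W=\mathcal S_n$, $S=\{s_1,\dots,s_{n-1}\}$, $J=S\setminus\{s_{n-1}\}$, $\lambda\vdash n$, and let $X_\lambda$ be the two-sided cell of $\mathscr H$ consisting of the left cells labeled by tableaux of shape $\lambda$. Let $\Gamma$ be a cell of $\mathscr H\otimes_J X_\lambda$ with local sequence $P_1,P_2$, both tableaux of shape $\lambda$, and let $\Upsilon$ be a left cell of $X_\lambda$. Let $$A\Gamma\xrightarrow{\ \beta\ }X_\lambda\xrightarrow{\ p\ }A\Upsilon\cong A\Gamma$$ be the composition defined in the context. If the square $P_1\setminus (P_1)_{<n}$ lies in the $k$-th row, then this composition is $[k]\,\mathrm{Id}$ if $\Upsilon$ is labeled by $P_2$, and $0$ otherwise.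
   Context: Hecke algebras and $W$-graphs. Let $A=\mathbb Z[u,u^{-1}]$, $A^-=\mathbb Z[u^{-1}]$, $\bar u=u^{-1}$, $[k]=\frac{u^k-u^{-k}}{u-u^{-1}}$. The Hecke algebra $\mathscr H$ of a Coxeter group $(W,S)$ is the free $A$-module on $\{T_w\}$ with $T_vT_w=T_{vw}$ if $\ell(vw)=\ell(v)+\ell(w)$ and $(T_s-u)(T_s+u^{-1})=0$; semilinear involution $\overline{T_w}=T_{w^{-1}}^{-1}$; $C'_s=T_s+u^{-1}$. $\Gamma_W=\{C'_w\}$ is the Kazhdan-Lusztig basis: $\bar{\cdot}$-invariant with $C'_w\equiv T_w\bmod u^{-1}A^-\{T_x:x\in W\}$. For $J\subseteq S$: $W_J$ is the parabolic subgroup, $\mathscr H_J$ its Hecke algebra, $W^J$ (resp. ${}^JW$) the minimal length representatives of cosets $wW_J$ (resp. $W_Jw$). A $W$-graph is a set $\Gamma$ with weights $\mu(\delta,\gamma)\in\mathbb Z$ and descent sets $L(\gamma)\subseteq S$ such that $A\Gamma$ is a left $\mathscr H$-module via $C'_s\gamma=[2]\gamma$ if $s\in L(\gamma)$ and $C'_s\gamma=\sum_{\delta:s\in L(\delta)}\mu(\delta,\gamma)\delta$ otherwise. $W$-graphs are isomorphic if there is a bijection of vertex sets preserving $L$ and preserving $\mu(\delta,\gamma)$ whenever $L(\delta)\not\subseteq L(\gamma)$. $\Gamma_W$ is a $W$-graph; restricting to $\mathscr H_J$ gives a $W_J$-graph. Write $\mathscr H\otimes_J E:=\mathscr H\otimes_{\mathscr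 H_J}E$, with pure tensors $h\boxtimes e$. If $\Gamma$ is a $W_J$-graph, $\mathscr H\otimes_J A\Gamma$ has involution $\overline{h\boxtimes e}=\bar h\boxtimes\bar e$ (elements of $\Gamma$ being fixed) and a unique $\bar{\cdot}$-invariant basis $\tilde C'_{w,\gamma}$ ($w\in W^J,\gamma\in\Gamma$) with $\tilde C'_{w,\gamma}\equiv T_w\boxtimes\gamma\bmod u^{-1}A^-\{T_x\boxtimes\delta\}$; this is a $W$-graph (Howlett-Yin). For a $W$-graph $\Lambda$, $\le_\Lambda$ is the preorder generated by $\delta\le\gamma$ if $\delta$ appears with nonzero coefficient in $h\gamma$ for some $h\in\mathscr H$; cells are its equivalence classes; cellular submodules and (sub)quotients are those spanned by subsets of $\Lambda$. Iterated induction and local sequences. Given Coxeter groups $(W_i,S_i)$ ($1\le i\le d$) with Hecke algebras $\mathscr H_i$ and sets $J_i$ embedded in both $S_i$ and $S_{i+1}$ generating isomorphic parabolic Coxeter subgroups, the $W_1$-graph on $\mathscr H_1\otimes_{J_1}\cdots\otimes_{J_{d-1}}\mathscr H_d$ is obtained by iterating induction (starting with $\Gamma_{W_d}$, alternately restricting to $J_i$ and inducing to $W_i$). Its elements are indexed by $\mathbf z=(w_1,\dots,w_d)$ with $w_i\in W_i^{J_i}$ for $i<d$, $w_d\in W_d$, modulo the relation $(\dots,w_iw,w_{i+1},\dots)\sim(\dots,w_i,ww_{i+1},\dots)$ for $w\in W_{J_i}$ on general tuples. The tuple has for each $i$ a unique representative with $j$-th component in $W_j^{J_j}$ for $j<i$,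 in $W_i$ for $j=i$, and in ${}^{J_{j-1}}W_j$ for $j>i$; let $z_i$ be its $i$-th component. The local label of the cell containing the element indexed by $\mathbf z$ is the left cell of $\Gamma_{W_1}$ containing $C'_{z_1}$, and the local sequence is the sequence of left cells of $\Gamma_{W_i}$ containing $C'_{z_i}$, $i=1,\dots,d$. Type $A$. For $w\in\mathcal S_n$, its word is $w^{-1}(1)\,w^{-1}(2)\cdots w^{-1}(n)$, and $P(w)$ is the RSK insertion tableau of this word. The left cells of $\Gamma_{\mathcal S_n}$ are labeled by standard tableaux: the cell labeled by $P$ is $\{C'_w:P(w)=P\}$. (The cell with decreasing word, spanning the trivial representation, is labeled by shape $1^n$.) The shape of a left cell or local label is the shape of its tableau. $P_{<n}$ denotes the subtableau of entries less than $n$. In the case $\mathscr H\otimes_J\mathscr H$ with $J=S\setminus\{s_{n-1}\}$, a cell is determined by its local sequence $P_1,P_2$. The maps. $X_\lambda$ is regarded as a left $\mathscr H$-module (cellular subquotient of $\mathscr H$ spanned by $\{C'_w:\mathrm{sh}(P(w))=\lambda\}$). The counit $\mathscr H\otimes_J X_\lambda\to X_\lambda$ is $\beta(h\boxtimes e)=he$. Let $X$ be the cellular submodule of $\mathscr H\otimes_J X_\lambda$ consisting of those cells with local label of shape $<\lambda$ in dominance order. Under (Dom), $A\Gamma$ is a submodule of $(\mathscr H\otimes_JX_\lambda)/X$ and $\beta(X)=0$, so $\beta$ induces a map $A\Gamma\xrightarrow{\beta}X_\lambda$. The map $p:X_\lambda\to A\Upsilon$ is the cellular quotient map (fixing basis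 elements in $\Upsilon$ and killing the other basis elements of $X_\lambda$), and $A\Upsilon\cong A\Gamma$ is the isomorphism of $W$-graphs (cells whose labels have the same shape are isomorphic as $W$-graphs). *)

(* Defs.v *)
From Stdlib Require Import Relation_Operators.
From HB Require Import structures.
From mathcomp Require Import all_boot all_order all_algebra all_fingroup.
From mathcomp Require Import finmap.
From mathcomp.multinomials Require Import monalg.
From mathcomp.classical Require Import boolp.

Set Implicit Arguments.
Unset Strict Implicit.
Unset Printing Implicit Defensive.

Import GRing.Theory Num.Theory.

Local Open Scope ring_scope.

(* [f : laurent] is the Laurent polynomial [\sum_k f@_k u^k]; [monalg] only
   provides products for monoids without units, hence the ring structure
   below. *)
Definition laurent := {malg int[int]}.
HB.instance Definition _ := GRing.Zmodule.copy laurent {malg int[int]}.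

Section LaurentRing.

Implicit Types f g h : laurent.

Definition lone : laurent := << (1 : int) *g (0 : int) >>.

Definition lmul f g : laurent :=
  \sum_(i <- msupp f) \sum_(j <- msupp g) << f@_i * g@_j *g i + j >>.

Lemma lmulw (d1 d2 : {fset int}) f g :
  (msupp f `<=` d1)%fset -> (msupp g `<=` d2)%fset ->
  lmul f g = \sum_(i <- d1) \sum_(j <- d2) << f@_i * g@_j *g i + j >>.
Proof.
move=> le1 le2; rewrite /lmul (big_fset_incl _ le1) => [|i _ /mcoeff_outdom ->].
  apply: eq_bigr => i _; rewrite (big_fset_incl _ le2) // => j _.
  by move/mcoeff_outdom=> ->; rewrite mulr0 monalgU0.
by rewrite big1 // => j _; rewrite mul0r monalgU0.
Qed.

Lemma lmulDl : left_distributive lmul +%R.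
Proof.
move=> f g h; pose d := (msupp f `|` msupp g)%fset.
rewrite (lmulw (msuppD_le f g) (fsubset_refl (msupp h))).
rewrite (lmulw (fsubsetUl (msupp f) (msupp g)) (fsubset_refl (msupp h))).
rewrite (lmulw (fsubsetUr (msupp f) (msupp g)) (fsubset_refl (msupp h))).
rewrite -big_split; apply: eq_bigr => i _ /=; rewrite -big_split.
by apply: eq_bigr => j _ /=; rewrite mcoeffD mulrDl monalgUD.
Qed.

Lemma lmulC : commutative lmul.
Proof.
move=> f g; rewrite /lmul exchange_big; apply: eq_bigr => i _.
by apply: eq_bigr => j _; rewrite mulrC addrC.
Qed.

Lemma lmulDr : right_distributive lmul +%R.
Proof. by move=> f g h; rewrite !(lmulC f) lmulDl. Qed.

Lemma lmul0g f : lmul 0 f = 0.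
Proof. by rewrite /lmul msupp0 big_nil. Qed.

Lemma lmulg0 f : lmul f 0 = 0.
Proof. by rewrite lmulC lmul0g. Qed.

Lemma lmulUU (a b : int) (i j : int) :
  lmul << a *g i >> << b *g j >> = << a * b *g i + j >>.
Proof.
rewrite (lmulw (msuppU_le (x := a)) (msuppU_le (x := b))) !big_seq_fset1.
by rewrite !mcoeffUU.
Qed.

Lemma lmul_suml (I : Type) (r : seq I) (F : I -> laurent) g :
  lmul (\sum_(i <- r) F i) g = \sum_(i <- r) lmul (F i) g.
Proof.
elim: r => [|i r IH]; first by rewrite !big_nil lmul0g.
by rewrite !big_cons lmulDl IH.
Qed.

Lemma lmul_sumr (I : Type) (r : seq I) (F : I -> laurent) g :
  lmul g (\sum_(i <- r) F i) = \sum_(i <- r) lmul g (F i).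
Proof. by rewrite lmulC lmul_suml; apply: eq_bigr => i _; rewrite lmulC. Qed.

Lemma lmulA : associative lmul.
Proof.
have UUA a b c (i j k : int) : lmul << a *g i >> (lmul << b *g j >> << c *g k >>)
    = lmul (lmul << a *g i >> << b *g j >>) << c *g k >>.
  by rewrite !lmulUU mulrA addrA.
move=> f g h; rewrite (monalgE f) (lmul_suml _ _ g) !(lmul_suml _ _ _).
apply: eq_bigr => i _.
rewrite (monalgE g) (lmul_suml _ _ h) (lmul_sumr _ _ << _ *g i >>).
rewrite (lmul_sumr _ _ << _ *g i >>) (lmul_suml _ _ h); apply: eq_bigr => j _.
rewrite (monalgE h) (lmul_sumr _ _ << _ *g j >>) (lmul_sumr _ _ << _ *g i >>).
by rewrite lmul_sumr; apply: eq_bigr => k _; apply: UUA.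
Qed.

Lemma lmul1g : left_id lone lmul.
Proof.
move=> f; rewrite {1}(monalgE f) lmul_sumr [RHS]monalgE.
by apply: eq_bigr => i _; rewrite lmulUU mul1r add0r.
Qed.

Lemma lone_neq0 : lone != 0.
Proof. by rewrite monalgU_eq0. Qed.

End LaurentRing.

HB.instance Definition _ := GRing.Zmodule_isComNzRing.Build laurent
  lmulA lmulC lmul1g lmulDl lone_neq0.

Local Notation A := laurent.

Definition upow (k : int) : A := << (1 : int) *g k >>.

Definition lbar (f : A) : A := \sum_(k <- msupp f) << f@_k *g - k >>.

(* membership in u^-1 Z[u^-1] *)
Definition in_uinvAminus (f : A) : Prop := forall k : int, f@_k != 0 -> k < 0.

Definition qint (k : nat) : A :=
  \sum_(i < k) upow (k%:Z - 1 - i.*2%:Z).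

Lemma upowD k l : upow (k + l) = upow k * upow l.
Proof. by rewrite [RHS]lmulUU. Qed.

Lemma qintE k : (upow 1 - upow (-1)) * qint k = upow k%:Z - upow (- k%:Z).
Proof.
pose F i := upow (k%:Z - i.*2%:Z).
have -> : upow k%:Z - upow (- k%:Z) = - \sum_(0 <= i < k) (F i.+1 - F i).
  rewrite telescope_sumr // /F double0 subr0 opprB -addnn PoszD opprD.
  by rewrite addrA subrr sub0r.
rewrite /qint mulr_sumr big_mkord -sumrN; apply: eq_bigr => i _.
rewrite mulrBl -!upowD opprB /F; congr (upow _ - upow _).
  by rewrite addrA (addrC 1) subrK.
rewrite doubleS -addn2 PoszD opprD.
by rewrite [LHS]addrC -!addrA; congr (_ + _); rewrite addrCA -opprD.
Qed.

Section Based.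

Context (R : algType A) (M : lmodType R) (I : choiceType).

Definition lincomb (b : I -> M) (c : {malg A[I]}) : M :=
  \sum_(i <- msupp c) (c@_i)%:A *: b i.

Definition is_basis (b : I -> M) : Prop := bijective (lincomb b).

(* the default value 0 is never used when [b] is a basis *)
Definition bcoord (b : I -> M) (m : M) : {malg A[I]} :=
  if pselect (exists c, lincomb b c = m) is left e then projT1 (cid e) else 0.

(* bar involution on coordinates: semilinear, fixes the basis vectors *)
Definition cbar (c : {malg A[I]}) : {malg A[I]} :=
  \sum_(i <- msupp c) << lbar c@_i *g i >>.

Definition appears (b : I -> M) (d g : I) : Prop :=
  exists h : R, (bcoord b (h *: b g))@_d != 0.

Definition cell_le (b : I -> M) : I -> I -> Prop :=
  clos_refl_trans I (appears b).

Definition cell_eq (b : I -> M) (d g : I) : Prop :=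
  cell_le b d g /\ cell_le b g d.

Definition is_cell (b : I -> M) (K : I -> Prop) : Prop :=
  exists g, forall d, K d <-> cell_eq b d g.

End Based.

(* The cellular subquotient spanned by the subset [P] of the basis [b]: the
   action on the remaining basis vectors, with all other coefficients dropped. *)
Definition is_cellular_subquotient (R : algType A) (M : lmodType R)
    (I : choiceType) (b : I -> M) (P : pred I)
    (N : lmodType R) (nb : {i : I | P i} -> N) : Prop :=
  is_basis nb /\
  forall (h : R) (g d : {i : I | P i}),
    (bcoord nb (h *: nb g))@_d = (bcoord b (h *: b (val g)))@_(val d).

Definition linext (I : choiceType) (V : lmodType A) (f : I -> V)
    (c : {malg A[I]}) : V :=
  \sum_(i <- msupp c) c@_i *: f i.

(* [cmat s t = 0] encodes m(s,t) = oo *)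
Record coxdata := CoxData {
  cgrp :> groupType;
  cgen : Type;
  crefl : cgen -> cgrp;
  cmat : cgen -> cgen -> nat
}.

Definition cword (C : coxdata) (ss : seq (cgen C)) : C :=
  (\prod_(s <- ss) crefl s)%g.

(* the group is presented by the generators s and the relations
   (st)^m(s,t) = 1 *)
Definition is_coxeter (C : coxdata) : Prop :=
  [/\ forall s t : cgen C, cmat s t = cmat t s,
      forall s t : cgen C, cmat s t = 1%N <-> s = t,
      forall s t : cgen C, ((crefl s * crefl t) ^+ cmat s t = 1)%g,
      forall w : C, exists ss, w = cword ss &
      forall (G : groupType) (f : cgen C -> G),
        (forall s t, (f s * f t) ^+ cmat s t = 1)%g ->
        exists F : {multiplicative C -> G}, forall s, F (crefl s) = f s].

Definition has_word_of_size (C : coxdata) (w : C) (k : nat) : bool :=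
  `[< exists ss : seq (cgen C), size ss = k /\ cword ss = w >].

(* the default value 0 is never used when the reflections generate *)
Definition len (C : coxdata) (w : C) : nat :=
  if pselect (exists k, has_word_of_size w k) is left e then ex_minn e else 0%N.

(* [a] embeds a set J in S: minimal length in w W_J, resp. in W_J w *)
Definition minR (C : coxdata) (J : Type) (a : J -> cgen C) (w : C) : bool :=
  `[< forall js : seq J, (len w <= len (w * cword (map a js))%g)%N >].

Definition minL (C : coxdata) (J : Type) (a : J -> cgen C) (w : C) : bool :=
  `[< forall js : seq J, (len w <= len (cword (map a js) * w)%g)%N >].

Record hecke (C : coxdata) := Hecke {
  halg :> algType A;
  hT : C -> halg;
  hbar : halg -> halg;
  hC : C -> halg;
  hT_basis : is_basis (hT : C -> halg^o);
  hT_mul : forall v w : C,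
    len (v * w)%g = (len v + len w)%N -> hT v * hT w = hT (v * w)%g;
  hT_quad : forall s : cgen C,
    (hT (crefl s) - (upow 1)%:A) * (hT (crefl s) + (upow (-1))%:A) = 0;
  hbarD : {morph hbar : x y / x + y};
  hbarZ : forall (a : A) x, hbar (a *: x) = lbar a *: hbar x;
  hbarT : forall w : C,
    hbar (hT w) * hT w^-1%g = 1 /\ hT w^-1%g * hbar (hT w) = 1;
  hC_basis : is_basis (hC : C -> halg^o);
  hC_bar : forall w, hbar (hC w) = hC w;
  hC_mod : forall w, exists2 c : {malg A[C]},
    (forall x, in_uinvAminus c@_x) &
    hC w = hT w + lincomb (hT : C -> halg^o) c
}.

Definition hCs (C : coxdata) (H : hecke C) (s : cgen C) : H :=
  hT H (crefl s) + (upow (-1))%:A.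

Definition is_wgraph (C : coxdata) (H : hecke C) (M : lmodType H)
    (I : choiceType) (b : I -> M) (mu : I -> I -> int)
    (L : I -> pred (cgen C)) : Prop :=
  is_basis b /\
  forall (s : cgen C) (g : I),
    if L g s then hCs H s *: b g = (qint 2)%:A *: b g
    else exists2 c : {malg A[I]},
      (forall d, c@_d = if L d s then (mu d g)%:~R else 0) &
      hCs H s *: b g = lincomb b c.

Definition vertex (I : choiceType) (K : I -> Prop) : choiceType :=
  {i : I | `[< K i >]}.

Definition is_wgraph_iso (C : coxdata)
    (I1 : choiceType) (mu1 : I1 -> I1 -> int) (L1 : I1 -> pred (cgen C))
    (K1 : I1 -> Prop)
    (I2 : choiceType) (mu2 : I2 -> I2 -> int) (L2 : I2 -> pred (cgen C))
    (K2 : I2 -> Prop) (phi : vertex K1 -> vertex K2) : Prop :=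
  [/\ bijective phi,
      forall g s, L2 (val (phi g)) s = L1 (val g) s &
      forall d g, ~ (forall s, L1 (val d) s -> L1 (val g) s) ->
        mu2 (val (phi d)) (val (phi g)) = mu1 (val d) (val g)].

(* a set J embedded in S_1 and in S_2 generating isomorphic parabolic Coxeter
   subgroups *)
Record link (C1 C2 : coxdata) := Link {
  lset : Type;
  lfst : lset -> cgen C1;
  lsnd : lset -> cgen C2;
  lfst_inj : injective lfst;
  lsnd_inj : injective lsnd;
  lmat : forall i j, cmat (lfst i) (lfst j) = cmat (lsnd i) (lsnd j)
}.

Section Induction.

Context (C1 C2 : coxdata) (H1 : hecke C1) (H2 : hecke C2) (l : link C1 C2).

(* The elements a T_w with w in W_J additively span the Hecke algebra of W_J;
   an element of W_J is given by a word in J. *)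
Definition is_balanced (N : lmodType H2) (V : zmodType) (f : H1 -> N -> V) :
    Prop :=
  [/\ forall h h' e, f (h + h') e = f h e + f h' e,
      forall h e e', f h (e + e') = f h e + f h e' &
      forall h e (a : A) (js : seq (lset l)),
        f (h * (a *: hT H1 (cword (map (@lfst _ _ l) js)))) e =
        f h ((a *: hT H2 (cword (map (@lsnd _ _ l) js))) *: e)].

Definition is_tensor (N : lmodType H2) (M : lmodType H1) (t : H1 -> N -> M) :
    Prop :=
  [/\ is_balanced t,
      forall h h' e, t (h * h') e = h *: t h' e &
      forall (V : zmodType) (f : H1 -> N -> V), is_balanced f ->
        (exists F : {additive M -> V}, forall h e, F (t h e) = f h e) /\
        (forall F G : {additive M -> V},
          (forall h e, F (t h e) = G (t h e)) -> F =1 G)].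

Definition ind_index (I : choiceType) : choiceType :=
  ({w : C1 | minR (@lfst _ _ l) w} * I)%type.

Definition is_induced_wgraph (I : choiceType) (N : lmodType H2) (nb : I -> N)
    (M : lmodType H1) (t : H1 -> N -> M) (mb : ind_index I -> M) : Prop :=
  [/\ is_tensor t,
      is_basis mb,
      exists mbar : M -> M,
        [/\ {morph mbar : x y / x + y},
            forall h c,
              mbar (t h (lincomb nb c)) = t (hbar h) (lincomb nb (cbar c)) &
            forall i, mbar (mb i) = mb i] &
      forall w g, exists2 c : {malg A[ind_index I]},
        (forall i, in_uinvAminus c@_i) &
        mb (w, g) = t (hT H1 (val w)) (nb g) +
          lincomb (fun i : ind_index I => t (hT H1 (val i.1)) (nb i.2)) c].

End Induction.

Inductive chain : coxdata -> Type :=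
| ChainLast (C : coxdata) : chain C
| ChainLink (C1 C2 : coxdata) (l : link C1 C2) (ch : chain C2) : chain C1.

Fixpoint chain_index (C : coxdata) (ch : chain C) : choiceType :=
  match ch with
  | ChainLast C => C : choiceType
  | ChainLink C1 C2 l ch' => ind_index l (chain_index ch')
  end.

Inductive iterated : forall (C : coxdata) (H : hecke C) (ch : chain C)
    (M : lmodType H), (chain_index ch -> M) -> Prop :=
| IteratedLast (C : coxdata) (H : hecke C) :
    @iterated C H (ChainLast C) (halg H)^o (@hC C H)
| IteratedLink (C1 C2 : coxdata) (H1 : hecke C1) (H2 : hecke C2)
    (l : link C1 C2) (ch : chain C2)
    (N : lmodType H2) (nb : chain_index ch -> N)
    (M : lmodType H1) (t : H1 -> N -> M)
    (mb : chain_index (ChainLink l ch) -> M) :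
    is_coxeter C2 -> @iterated C2 H2 ch N nb -> is_induced_wgraph nb t mb ->
    @iterated C1 H1 (ChainLink l ch) M mb.

Fixpoint gtuple (C : coxdata) (ch : chain C) : Type :=
  match ch with
  | ChainLast C => C
  | ChainLink C1 C2 l ch' => (C1 * gtuple ch')%type
  end.

Fixpoint index_tuple (C : coxdata) (ch : chain C) : chain_index ch -> gtuple ch :=
  match ch with
  | ChainLast C => fun w => w
  | ChainLink C1 C2 l ch' => fun z => (val z.1, index_tuple z.2)
  end.

Definition gfirst (C : coxdata) (ch : chain C) : gtuple ch -> C :=
  match ch with
  | ChainLast C => fun w => w
  | ChainLink C1 C2 l ch' => fun t => t.1
  end.

Definition gmull (C : coxdata) (ch : chain C) : C -> gtuple ch -> gtuple ch :=
  match ch with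
  | ChainLast C => fun x w => (x * w)%g
  | ChainLink C1 C2 l ch' => fun x t => ((x * t.1)%g, t.2)
  end.

(* moving an element of some W_(J_i) from one factor to the next *)
Fixpoint gmove (C : coxdata) (ch : chain C) : gtuple ch -> gtuple ch -> Prop :=
  match ch with
  | ChainLast C => fun _ _ => False
  | ChainLink C1 C2 l ch' => fun t t' =>
      (exists js : seq (lset l),
         t.1 = (t'.1 * cword (map (@lfst _ _ l) js))%g /\
         t'.2 = gmull (cword (map (@lsnd _ _ l) js)) t.2) \/
      (t.1 = t'.1 /\ gmove t.2 t'.2)
  end.

Definition gequiv (C : coxdata) (ch : chain C) : gtuple ch -> gtuple ch -> Prop :=
  clos_refl_sym_trans (gtuple ch) (@gmove C ch).

(* the components after the first one are in ^(J_(j-1))W_j *)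
Fixpoint gnormal_tail (C : coxdata) (ch : chain C) : gtuple ch -> Prop :=
  match ch with
  | ChainLast C => fun _ => True
  | ChainLink C1 C2 l ch' => fun t =>
      minL (@lsnd _ _ l) (gfirst t.2) /\ gnormal_tail t.2
  end.

(* normal form at the component [i], counted from 0 *)
Fixpoint gnormal (C : coxdata) (ch : chain C) (i : nat) : gtuple ch -> Prop :=
  match i, ch with
  | 0, ch => @gnormal_tail _ ch
  | i'.+1, ChainLast C => fun _ => False
  | i'.+1, ChainLink C1 C2 l ch' => fun t =>
      minR (@lfst _ _ l) t.1 /\ gnormal i' t.2
  end.

(* [x] is the component z_1 of the index [z] *)
Definition is_local_rep (C : coxdata) (ch : chain C) (z : chain_index ch) (x : C) :
    Prop :=
  exists t, [/\ gequiv (index_tuple z) t, gnormal 0 t & gfirst t = x].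

Section TypeA.

Variable n : nat.

Definition slo (i : 'I_n.-1) : 'I_n := widen_ord (leq_pred n) i.

Lemma shi_proof (i : 'I_n.-1) : (i.+1 < n)%N.
Proof. by rewrite -ltn_predRL. Qed.

Definition shi (i : 'I_n.-1) : 'I_n := Ordinal (shi_proof i).

(* [i : 'I_n.-1] stands for s_(i+1) *)
Definition Sn : coxdata :=
  @CoxData 'S_n 'I_n.-1 (fun i => tperm (slo i) (shi i))
    (fun i j => if i == j then 1
                else if (i.+1 == j :> nat) || (j.+1 == i :> nat) then 3
                else 2).

(* J = S \ {s_(n-1)} *)
Definition Jset : Type := {i : 'I_n.-1 | i.+1 != n.-1}.

Definition Jlink : link Sn Sn :=
  @Link Sn Sn Jset val val val_inj val_inj (fun i j => erefl).

Definition chain2 : chain Sn := ChainLink Jlink (ChainLast Sn).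

(* MathComp's product of permutations is composition from left to right:
   [(v * w) i = w (v i)].  With products of permutations being the usual
   composition of functions, w therefore corresponds to the inverse function
   in ['S_n], and the word w^-1(1) ... w^-1(n) is the list of values of the
   element of ['S_n]. *)
Definition word (w : 'S_n) : seq nat := [seq (w i).+1 | i <- enum 'I_n].

End TypeA.

Definition tableau := seq (seq nat).

Fixpoint row_insert (x : nat) (T : tableau) : tableau :=
  match T with
  | [::] => [:: [:: x]]
  | r :: T' =>
      let i := find (fun y => (x < y)%N) r in
      if (i < size r)%N then set_nth 0%N r i x :: row_insert (nth 0%N r i) T'
      else rcons r x :: T'
  end.

Definition Ptab (n : nat) (w : 'S_n) : tableau :=
  foldl (fun T x => row_insert x T) [::] (word w).

Definition tshape (T : tableau) : seq nat := map size T.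

Definition tab_lt (T : tableau) (n : nat) : tableau :=
  [seq [seq x <- r | (x < n)%N] | r <- T].

Definition is_partition (lam : seq nat) (n : nat) : bool :=
  [&& sorted geq lam, 0%N \notin lam & sumn lam == n].

(* meant for partitions of the same integer *)
Definition dom_lt (lam mu : seq nat) : Prop :=
  lam <> mu /\ forall k, (sumn (take k lam) <= sumn (take k mu))%N.

Definition Dom : Prop :=
  forall (m : nat) (H : hecke (Sn m)) (ch : chain (Sn m)) (M : lmodType H)
    (b : chain_index ch -> M), iterated b ->
  forall y z : chain_index ch, cell_le b y z -> ~ cell_eq b y z ->
  forall y1 z1 : 'S_m, is_local_rep y y1 -> is_local_rep z z1 ->
    dom_lt (tshape (Ptab y1)) (tshape (Ptab z1)).

Definition Xindex (n : nat) (lam : seq nat) : choiceType :=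
  {w : 'S_n | tshape (Ptab w) == lam}.

Definition JXindex (n : nat) (lam : seq nat) : choiceType :=
  ind_index (Jlink n) (Xindex n lam).

Definition JXtuple (n : nat) (lam : seq nat) (z : JXindex n lam) :
  gtuple (chain2 n) := (val z.1, val z.2).

Definition has_local_label (n : nat) (lam : seq nat) (z : JXindex n lam)
    (P : tableau) : Prop :=
  exists t : gtuple (chain2 n),
    [/\ gequiv (JXtuple z) t, gnormal 0 t & Ptab (t.1 : 'S_n) = P].

Definition has_local_sequence (n : nat) (lam : seq nat) (z : JXindex n lam)
    (P1 P2 : tableau) : Prop :=
  has_local_label z P1 /\
  exists t : gtuple (chain2 n),
    [/\ gequiv (JXtuple z) t, gnormal 1 t & Ptab (t.2 : 'S_n) = P2].

Section Maps.

Context (n : nat) (lam : seq nat) (H : hecke (Sn n)).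
Context (X : lmodType H) (xb : Xindex n lam -> X).
Context (M : lmodType H) (mb : JXindex n lam -> M).

(* the submodule spanned by the cells with local label of shape < lam *)
Definition in_lower (x : M) : Prop :=
  exists2 c : {malg A[JXindex n lam]}, x = lincomb mb c &
    forall z, c@_z != 0 ->
      exists2 P, has_local_label z P & dom_lt (tshape P) lam.

(* The cell module A Gamma is the free module {malg A[vertex Gam]}; this picks
   a representative in M of an element of the subquotient A Gamma of M. *)
Definition cell_lift (Gam : JXindex n lam -> Prop) (y : {malg A[vertex Gam]}) : M :=
  lincomb (fun g : vertex Gam => mb (val g)) y.

Definition cell_proj (Ups : Xindex n lam -> Prop) (x : X) :
    {malg A[vertex Ups]} :=
  linext (fun w => if insub w is Some v then << v >> else 0) (bcoord xb x).

Definition relabel (Ups : Xindex n lam -> Prop) (Gam : JXindex n lam -> Prop)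
    (phi : vertex Ups -> vertex Gam) :
    {malg A[vertex Ups]} -> {malg A[vertex Gam]} :=
  linext (fun v => << phi v >>).

End Maps.

Definition labeled_by (n : nat) (lam : seq nat) (Ups : Xindex n lam -> Prop)
    (P : tableau) : Prop :=
  forall w : Xindex n lam, Ups w <-> Ptab (val w) = P.

(* Submission.v *)
(** By (Dom) for the regular module, the span of the [C'_w] of shape below [lam]
    is a two-sided ideal, left cells are the fibres of [Ptab], and the trace form
    of the Hecke algebra shows that no nonzero element of the cell module is
    killed, modulo that ideal, by [e_K H], where [e_K] is the symmetrizer of the
    parabolic subgroup of type the conjugate partition.  Since [e_K] maps a cell
    module to a line, every endomorphism of a cell module is a scalar.  The
    composition of the theorem is such an endomorphism because [beta] kills the
    cells of smaller label: the canonical basis of [H (x)_J H] is triangular in the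
    [C'_y (x) T_x], whose image under multiplication lies in the ideal.

    The scalar is read off one element of [Gam]: reverse bumping provides an index
    [(w, g)] in [Gam] such that the last [k] letters of [g] decrease and [w] is a
    cycle of length [k]; there the canonical basis element is obtained by
    [D_(i+1) = C'_s D_i - D_(i-1)], and multiplication sends it to [[k] g], by
    [[2][i+1] = [i+2] + [i]]. *)

Require Import Defs.
From Stdlib Require Import Relation_Operators.
From HB Require Import structures.
From mathcomp Require Import all_boot all_order all_algebra all_fingroup.
From mathcomp Require Import finmap.
From mathcomp.multinomials Require Import monalg.
From mathcomp.classical Require Import boolp.
From mathcomp Require Import zify ring.

Set Implicit Arguments.
Unset Strict Implicit.
Unset Printing Implicit Defensive.

(** (Dom) speaks of modules induced from the regular module, whereas [M] is induced from the
    subquotient [X], and both are given only by their defining properties. So a model of H (x)_J H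
    is built, as functions on the cosets of W_J, and a projection from its part of second shape at
    most [lam] carries canonical basis, structure coefficients and preorder over to [M]. In the
    model the canonical basis is triangular in two bases, T_w (x) C_z and C_y (x) T_x, which span
    the same lattice over Z[u^-1]. The first defines induction; the second displays the local label
    y. Schur's lemma over a field is replaced by an argument over Laurent polynomials that rests on
    positivity: a sum of squares vanishes only termwise, so the trace form is definite, and
    Gram-Schmidt is run with denominators cleared. That [eK] has rank at most one on a cell is
    combinatorial: a Knuth class contains exactly one word that decreases inside consecutive blocks
    of the column lengths, by the equality case of Greene's theorem. *)

(** * Laurent polynomials: degree, bar involution, positivity *)

Module LaurentPolynomials.

Import Order.TTheory GRing.Theory Num.Theory.
Local Open Scope ring_scope.

Local Notation A := laurent.

Lemma mcoeffUE (c : int) (i k : int) : (<< c *g i >> : A)@_k = c *+ (i == k).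
Proof. by rewrite mcoeffU. Qed.

Lemma mcoeff_upow (i k : int) : (upow i)@_k = (i == k)%:R.
Proof. by rewrite mcoeffU. Qed.

Lemma mcoeff_lbar (f : A) k : (lbar f)@_k = f@_(- k).
Proof.
rewrite /lbar raddf_sum /=.
under eq_bigr do rewrite mcoeffUE.
have [kf|kf] := boolP (- k \in msupp f).
  rewrite (big_fsetD1 _ kf) /= opprK eqxx big1_fset ?addr0 // => i.
  by rewrite !inE => /andP[/negPf ik _] _; rewrite eqr_oppLR ik.
rewrite (mcoeff_outdom kf) big1_fset // => i ik _.
by rewrite eqr_oppLR; case: eqP ik kf => // -> ->.
Qed.

Lemma mcoeff_upowM i (f : A) k : (upow i * f)@_k = f@_(k - i).
Proof.
have -> : upow i * f = \sum_(j <- msupp f) << f@_j *g i + j >>.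
  rewrite [upow i * f](lmulw (d1 := [fset i]%fset) (d2 := msupp f)) //.
    rewrite big_seq_fset1; apply: eq_bigr => j _.
    by rewrite mcoeffUU mul1r.
  exact: msuppU_le.
rewrite raddf_sum /=.
have E (j : int) : (i + j == k) = (j == k - i) by lia.
under eq_bigr do rewrite mcoeffUE E.
have [kf|kf] := boolP (k - i \in msupp f).
  rewrite (big_fsetD1 _ kf) /= eqxx big1_fset ?addr0 // => j.
  by rewrite !inE => /andP[/negPf -> _] _.
rewrite (mcoeff_outdom kf) big1_fset // => j jf _.
by case: eqP kf jf => // -> /negPf ->.
Qed.

Lemma laurent_sum (f : A) : f = \sum_(i <- msupp f) upow i *~ f@_i.
Proof.
rewrite [LHS]monalgE; apply: eq_bigr => i _; apply/malgP => k.
rewrite mcoeffUE raddfMz /= mcoeff_upow.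
by case: eqP; rewrite ?mulr1n ?mulr0n ?mul0rz // mulrzz mul1r.
Qed.

Definition deg_le (f : A) (d : int) := forall k, d < k -> f@_k = 0.

Lemma uinvE f : in_uinvAminus f <-> deg_le f (-1).
Proof.
split=> h k kd; first by apply/eqP; apply: contraT => /h; lia.
by apply: contraTT isT => k0; move: kd; rewrite h ?eqxx //; lia.
Qed.

Lemma deg_leW f d e : d <= e -> deg_le f d -> deg_le f e.
Proof. by move=> de h k ek; apply: h; apply: le_lt_trans ek. Qed.

Lemma deg_le0 d : deg_le 0 d.
Proof. by move=> k _; rewrite mcoeff0. Qed.

Lemma deg_leD f g d : deg_le f d -> deg_le g d -> deg_le (f + g) d.
Proof. by move=> hf hg k dk; rewrite mcoeffD hf ?hg ?addr0. Qed.

Lemma deg_leN f d : deg_le f d -> deg_le (- f) d.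
Proof. by move=> hf k dk; rewrite mcoeffN hf ?oppr0. Qed.

Lemma deg_le_sum (I : Type) (r : seq I) (P : pred I) (F : I -> A) d :
  (forall i, P i -> deg_le (F i) d) -> deg_le (\sum_(i <- r | P i) F i) d.
Proof.
move=> h; elim/big_ind: _ => //; first exact: deg_le0.
by move=> f g; apply: deg_leD.
Qed.

Lemma deg_leMz f c d : deg_le f d -> deg_le (f *~ c) d.
Proof. by move=> hf k dk; rewrite raddfMz /= hf ?mul0rz. Qed.

Lemma deg_le_upow i : deg_le (upow i) i.
Proof. by move=> k ik; rewrite mcoeff_upow; case: eqP ik => //; lia. Qed.

Lemma deg_le_upowM i f d : deg_le f d -> deg_le (upow i * f) (i + d).
Proof. by move=> hf k dk; rewrite mcoeff_upowM hf; lia. Qed.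

Lemma mcoeffM_top f g d e : deg_le f d -> deg_le g e ->
  deg_le (f * g) (d + e) /\ (f * g)@_(d + e) = f@_d * g@_e.
Proof.
move=> hf hg; rewrite [in f * g](laurent_sum f) mulr_suml; split.
  move=> k dk; rewrite raddf_sum big1_fset //= => i fi _.
  rewrite mulrzAl raddfMz /= mcoeff_upowM hg ?mul0rz //.
  by move: fi; rewrite -mcoeff_neq0; case: (ltrP d i) => [/hf ->|]; rewrite ?eqxx //; lia.
rewrite raddf_sum /=.
have E i : i \in msupp f -> i != d -> ((upow i *~ f@_i) * g)@_(d + e) = 0.
  move=> fi id; rewrite mulrzAl raddfMz /= mcoeff_upowM hg ?mul0rz //.
  by move: fi; rewrite -mcoeff_neq0; case: (ltrP d i) => [/hf ->|]; rewrite ?eqxx //; lia.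
have [df|df] := boolP (d \in msupp f).
  rewrite (big_fsetD1 _ df) /= big1_fset => [|i]; last first.
    by rewrite !inE => /andP[id fi] _; apply: E.
  by rewrite addr0 mulrzAl raddfMz /= mcoeff_upowM addrAC subrr add0r mulrzz mulrC.
rewrite (mcoeff_outdom df) mul0r big1_fset // => i fi _; apply: E => //.
by apply: contraNneq df => <-.
Qed.

Lemma deg_leM f g d e : deg_le f d -> deg_le g e -> deg_le (f * g) (d + e).
Proof. by move=> hf /(mcoeffM_top hf)[]. Qed.

Lemma seq_max (s : seq int) : s != [::] ->
  exists2 d, d \in s & forall k, k \in s -> k <= d.
Proof.
elim: s => // a [_ _|b s /(_ isT) [d ds dmax] _].
  by exists a => [|k]; rewrite inE // => /eqP ->.
have [ad|da] := lerP a d.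
  by exists d => [|k]; rewrite inE ?ds ?orbT // => /orP[/eqP ->|/dmax].
exists a; first by rewrite inE eqxx.
by move=> k; rewrite inE => /orP[/eqP -> //|/dmax kd]; apply: le_trans kd (ltW da).
Qed.

Lemma top_degree_fam (T : finType) (f : T -> A) i0 : f i0 != 0 ->
  exists d, (forall i, deg_le (f i) d) /\ exists i, (f i)@_d != 0.
Proof.
move=> f0; pose s := flatten [seq (msupp (f i) : seq int) | i <- enum T].
have insP k : reflect (exists i, (f i)@_k != 0) (k \in s).
  apply: (iffP flattenP) => [[_ /mapP[i _ ->]]|[i ki]].
    by rewrite -mcoeff_neq0; exists i.
  exists (msupp (f i) : seq int); last by rewrite -mcoeff_neq0.
  by apply: map_f; rewrite mem_enum.
have [k kf] : exists k, (f i0)@_k != 0.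
  apply: contrapT => h; case/eqP: f0; apply/malgP => k; rewrite mcoeff0.
  by apply/eqP; apply: contrapT => /negP k0; apply: h; exists k.
have [|d /insP ds dmax] := @seq_max s.
  by have : k \in s by [apply/insP; exists i0]; case: (s).
exists d; split=> // i j dj; apply/eqP; apply: contraLR dj => fj.
by rewrite -leNgt; apply: dmax; apply/insP; exists i.
Qed.

Lemma top_degree (f : A) : f != 0 -> exists2 d, deg_le f d & f@_d != 0.
Proof.
by move=> f0; have [d [h [_ fd]]] := @top_degree_fam unit (fun=> f) tt f0; exists d => //; apply: h tt.
Qed.

Lemma laurent_mulf_eq0 (f g : A) : f * g = 0 -> f = 0 \/ g = 0.
Proof.
have [->|/top_degree[d hf fd]] := eqVneq f 0; first by left.
have [->|/top_degree[e hg ge]] := eqVneq g 0; first by right.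
move=> fg; have [_] := mcoeffM_top hf hg; rewrite fg mcoeff0.
by move/esym/eqP; rewrite mulf_eq0 (negPf fd) (negPf ge).
Qed.

Lemma laurent_mulf_neq0 (f g : A) : f != 0 -> g != 0 -> f * g != 0.
Proof. by move=> f0 g0; apply/eqP => /laurent_mulf_eq0[]; apply/eqP. Qed.

(** At the largest degree [d] of the family, the coefficient of the sum at [d + d] is a sum of
    squares of integers, not all zero. This makes the trace form definite. *)
Lemma sum_sqr_eq0 (T : finType) (f : T -> A) :
  \sum_i f i * f i = 0 -> forall i, f i = 0.
Proof.
move=> s0 i0; apply/eqP; apply: contraT => /top_degree_fam[d [hd [i fi]]].
have : (\sum_i f i * f i)@_(d + d) = 0 by rewrite s0 mcoeff0.
rewrite raddf_sum /=; under eq_bigr do rewrite (mcoeffM_top (hd _) (hd _)).2.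
move/eqP; rewrite psumr_eq0 => [|j _]; last by rewrite -expr2 sqr_ge0.
by move/allP/(_ i); rewrite mem_index_enum mulf_eq0 (negPf fi) => /(_ isT).
Qed.

Lemma lbarD f g : lbar (f + g) = lbar f + lbar g.
Proof. by apply/malgP => k; rewrite mcoeffD !mcoeff_lbar mcoeffD. Qed.

Lemma lbarN f : lbar (- f) = - lbar f.
Proof. by apply/malgP => k; rewrite mcoeffN !mcoeff_lbar mcoeffN. Qed.

Lemma lbarB f g : lbar (f - g) = lbar f - lbar g.
Proof. by rewrite lbarD lbarN. Qed.

Lemma lbar0 : lbar 0 = 0.
Proof. by apply/malgP => k; rewrite mcoeff_lbar !mcoeff0. Qed.

Lemma lbarK f : lbar (lbar f) = f.
Proof. by apply/malgP => k; rewrite !mcoeff_lbar opprK. Qed.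

Lemma lbar_upow k : lbar (upow k) = upow (- k).
Proof. by apply/malgP => i; rewrite mcoeff_lbar !mcoeff_upow eqr_oppLR; congr (nat_of_bool _)%:R; lia. Qed.

Lemma lbar_sum (I : Type) (r : seq I) (P : pred I) (F : I -> A) :
  lbar (\sum_(i <- r | P i) F i) = \sum_(i <- r | P i) lbar (F i).
Proof. by apply: (big_morph lbar lbarD lbar0). Qed.

Lemma lbarMz f c : lbar (f *~ c) = lbar f *~ c.
Proof. by apply/malgP => k; rewrite mcoeff_lbar !raddfMz /= mcoeff_lbar. Qed.

Lemma lbarM f g : lbar (f * g) = lbar f * lbar g.
Proof.
have M i h : lbar (upow i * h) = upow (- i) * lbar h.
  apply/malgP => k; rewrite mcoeff_lbar !mcoeff_upowM mcoeff_lbar.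
  by congr (h@_ _); lia.
rewrite [in LHS](laurent_sum f) [in RHS](laurent_sum f) mulr_suml lbar_sum.
rewrite [in RHS]lbar_sum mulr_suml; apply: eq_bigr => i _.
by rewrite mulrzAl !lbarMz M lbar_upow mulrzAl.
Qed.

Lemma lbar_int (c : int) : lbar (c%:~R : A) = c%:~R.
Proof. by rewrite lbarMz; congr (_ *~ _); apply: lbar_upow. Qed.

Lemma lbar1 : lbar 1 = 1.
Proof. exact: lbar_upow. Qed.

(** The source of all uniqueness statements on canonical bases: invariance reflects the vanishing in
    degrees at least 0 to the degrees at most 0. *)
Lemma lbar_uinv_eq0 f : lbar f = f -> deg_le f (-1) -> f = 0.
Proof.
move=> bf hf; apply/malgP => k; rewrite mcoeff0.
have [k0|k0] := ltrP (-1) k; first exact: hf.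
by rewrite -bf mcoeff_lbar hf //; lia.
Qed.

(** [p] is the part of [f] of negative degree; antisymmetry recovers the positive part and kills the
    constant coefficient. It provides the corrections in [bar_antisym]. *)
Lemma lbar_antisym f : lbar f = - f ->
  exists2 p, deg_le p (-1) & p - lbar p = f.
Proof.
move=> bf; pose p : A := \sum_(k <- msupp f | k < 0) upow k *~ f@_k.
have pE k : p@_k = if k < 0 then f@_k else 0.
  rewrite raddf_sum /= big_mkcond /=.
  under eq_bigr do rewrite raddfMz /= mcoeff_upow.
  have [kf|kf] := boolP (k \in msupp f).
    rewrite (big_fsetD1 _ kf) /= big1_fset ?addr0 => [|i]; last first.
      by rewrite !inE => /andP[/negPf -> _] _; rewrite mul0rz if_same.
    by rewrite eqxx; case: ifP => // _; rewrite mulrzz mul1r.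
  rewrite (mcoeff_outdom kf) if_same big1_fset // => i fi _.
  by case: eqP kf fi => [->/negPf -> //|_ _ _]; rewrite mul0rz if_same.
exists p => [k k0|]; first by rewrite pE; case: ifP => //; lia.
apply/malgP => k; rewrite mcoeffB mcoeff_lbar !pE.
have fN : f@_(- k) = - f@_k by rewrite -mcoeff_lbar bf mcoeffN.
rewrite fN; have [k0|k0|k0] := ltrgt0P k.
- by rewrite oppr_lt0 k0 sub0r opprK.
- by rewrite oppr_lt0 ltNge (ltW k0) subr0.
move: fN; rewrite k0 oppr0 subr0.
by move: (f@_0) => a; lia.
Qed.

(** Both sides are compared after multiplication by u - u^-1, where [qintE] applies; this factor can
    be cancelled since there are no zero divisors. *)
Lemma qint_rec k : qint 2 * qint k.+1 = qint k.+2 + qint k.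
Proof.
have reg (f g : A) : (upow 1 - upow (-1)) * f = (upow 1 - upow (-1)) * g -> f = g.
  move/eqP; rewrite -subr_eq0 -mulrBr => /eqP/laurent_mulf_eq0[h|/eqP].
    by have := congr1 (fun f : A => f@_1) h; rewrite mcoeffB !mcoeff_upow mcoeff0.
  by rewrite subr_eq0 => /eqP.
have -> : qint 2 = upow 1 + upow (-1).
  apply: reg; rewrite qintE mulrDr !mulrBl -!upowD.
  by rewrite addrA subrK.
apply: reg; rewrite mulrDr mulrCA !qintE.
rewrite mulrDl !mulrBr -!upowD.
have -> : 1 + k.+1%:Z = k.+2%:Z by lia.
have -> : (1 - k.+1%:Z) = - k%:Z by lia.
have -> : (-1 + k.+1%:Z) = k%:Z by lia.
have -> : (-1 - k.+1%:Z) = - k.+2%:Z by lia.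
ring.
Qed.

Lemma qint1 : qint 1 = 1.
Proof. by rewrite /qint big_ord1. Qed.

Lemma qint2E : qint 2 = upow 1 + upow (-1).
Proof. by rewrite /qint big_ord_recr big_ord1. Qed.

Lemma qint2_neq0 : qint 2 != 0.
Proof.
apply/eqP => /(congr1 (fun f : A => f@_1)).
by rewrite qint2E mcoeffD !mcoeff_upow mcoeff0 => /eqP.
Qed.

Lemma deg_le_int (c : int) : deg_le (c%:~R : A) 0.
Proof. by apply: deg_leMz; apply: deg_le_upow. Qed.

Lemma mcoeff_int (c : int) : (c%:~R : A)@_0 = c.
Proof. by rewrite raddfMz /= [X in X *~ _]mcoeff_upow mulrzz mul1r. Qed.

Lemma deg_le_subconst f : deg_le f 0 -> deg_le (f - (f@_0)%:~R) (-1).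
Proof.
move=> hf k k0; rewrite mcoeffB.
have [->|/eqP kn0] := eqVneq k 0; first by rewrite mcoeff_int subrr.
by rewrite hf ?deg_le_int ?subrr //; lia.
Qed.

End LaurentPolynomials.
Import LaurentPolynomials.

(** * Descents, inversions and length in the symmetric group *)

Module Inversions.

Import Order.TTheory GRing.Theory Num.Theory.
Local Open Scope group_scope.

Section Inversions.

Context (n : nat).
Implicit Types (w v x : 'S_n) (i j : 'I_n.-1).

Definition refl i : 'S_n := tperm (slo i) (shi i).

(** Products are composed from left to right, so left multiplication by [refl i] exchanges the
    letters at two adjacent positions, and a descent of the word at position [i] is a left
    descent. *)
Definition desc i w := (w (shi i) < w (slo i))%N.

Definition invset w : {set 'I_n * 'I_n} :=
  [set p : 'I_n * 'I_n | (p.1 < p.2)%N && (w p.2 < w p.1)%N].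

Definition inv w := #|invset w|.

Lemma slo_neq_shi i : slo i != shi i.
Proof. by rewrite -val_eqE /= ltn_eqF. Qed.

Lemma reflK i : refl i * refl i = 1.
Proof. exact: tperm2. Qed.

Lemma reflMK i w : refl i * (refl i * w) = w.
Proof. by rewrite mulgA reflK mul1g. Qed.

Lemma reflV i : (refl i)^-1 = refl i.
Proof. exact: tpermV. Qed.

Lemma reflM i w a : (refl i * w) a = w (refl i a).
Proof. exact: permM. Qed.

Lemma refl_lo i : refl i (slo i) = shi i. Proof. exact: tpermL. Qed.
Lemma refl_hi i : refl i (shi i) = slo i. Proof. exact: tpermR. Qed.

Lemma desc_refl i w : desc i (refl i * w) = ~~ desc i w.
Proof.
rewrite /desc !reflM refl_lo refl_hi -leqNgt [in RHS]leq_eqVlt (inj_eq (@ord_inj n)) (inj_eq perm_inj).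
by rewrite (negPf (slo_neq_shi i)).
Qed.

Lemma refl_lt i (a b : 'I_n) : (a, b) != (slo i, shi i) ->
  (a < b)%N -> (refl i a < refl i b)%N.
Proof.
have nv (x y : 'I_n) : x <> y -> x <> y :> nat by move=> xy /val_inj.
rewrite xpair_eqE /refl -!val_eqE.
by case: tpermP => [->|->|/nv + /nv]; case: tpermP => [->|->|/nv + /nv] /=; lia.
Qed.

(** Applying [refl i] to both entries maps the inversions of [refl i * w] injectively to those of
    [w], the adjacent pair being set aside; used for both elements, the inequality becomes an
    equality. *)
Lemma card_invsetD1 i w :
  #|invset (refl i * w) :\ (slo i, shi i)| = #|invset w :\ (slo i, shi i)|.
Proof.
pose f (p : 'I_n * 'I_n) := (refl i p.1, refl i p.2).
have fK : involutive f by move=> [a b]; rewrite /f /= !tpermK.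
have le v : (#|invset (refl i * v) :\ (slo i, shi i)|
              <= #|invset v :\ (slo i, shi i)|)%N.
  rewrite -(card_imset _ (can_inj fK)); apply/subset_leq_card/subsetP => p /imsetP[[a b] + ->].
  rewrite !inE /= !permM => /and3P[ab lt_ab vba]; rewrite refl_lt ?vba // andbT.
  rewrite andbT; apply/negP => /eqP[ra rb].
  have ea : a = shi i by rewrite -[a](tpermK (slo i) (shi i)) -/(refl i) ra refl_lo.
  have eb : b = slo i by rewrite -[b](tpermK (slo i) (shi i)) -/(refl i) rb refl_hi.
  by move: lt_ab; rewrite ea eb /=; lia.
by apply/eqP; rewrite eqn_leq le -{1}[w]mul1g -(reflK i) -mulgA le.
Qed.

Lemma inv_asc i w : ~~ desc i w -> inv (refl i * w) = (inv w).+1.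
Proof.
move=> d; rewrite /inv (cardsD1 (slo i, shi i)) card_invsetD1.
rewrite [X in _ = X.+1](cardsD1 (slo i, shi i)) !inE /= ltnSn /=.
have := desc_refl i w; rewrite d; move/negPf: d; rewrite /desc => -> ->.
by rewrite add0n.
Qed.

Lemma inv_desc i w : desc i w -> inv w = (inv (refl i * w)).+1.
Proof. by move=> d; rewrite -(@inv_asc i) ?desc_refl ?negbK // mulgA reflK mul1g. Qed.

Lemma inv1 : inv 1 = 0%N.
Proof.
apply/eqP; rewrite cards_eq0; apply/eqP/setP => -[a b]; rewrite !inE !perm1 /=.
by case: ltngtP.
Qed.

Lemma invV w : inv w^-1 = inv w.
Proof.
have le v : (inv v <= inv v^-1)%N.
  pose f (p : 'I_n * 'I_n) := (v p.2, v p.1).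
  have fI : injective f.
    by move=> [a b] [c d] [/perm_inj -> /perm_inj ->].
  rewrite /inv -(card_imset _ fI); apply/subset_leq_card/subsetP => p /imsetP[[a b] + ->].
  by rewrite !inE /= => /andP[ab vba]; rewrite !permK vba.
by apply/eqP; rewrite eqn_leq; apply/andP; split; [rewrite -{2}[w]invgK|]; apply: le.
Qed.

Lemma asc_homo w (a b : 'I_n) :
  (forall i, (a <= slo i)%N -> (shi i <= b)%N -> ~~ desc i w) ->
  (a < b)%N -> (w a < w b)%N.
Proof.
move=> h ab; have lebn c (cb : (c <= b)%N) : (c < n)%N by apply: leq_ltn_trans cb _.
have [d] := ubnP (b - a); elim: d b ab h {lebn} => // d IH b ab h lt_d.
have b1n : (b.-1 < n.-1)%N by have := ltn_ord b; lia.
pose i := Ordinal b1n.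
have ib : shi i = b by apply: val_inj => /=; lia.
have wlt : (w (slo i) < w b)%N.
  have := h i; rewrite /desc ib leqnn -leqNgt => /(_ _ isT) le.
  have {}le : (w (slo i) <= w b)%N by apply: le => /=; lia.
  rewrite ltn_neqAle le andbT (inj_eq (@ord_inj n)) (inj_eq perm_inj) -val_eqE /=.
  by lia.
have [ai|ai] := ltnP a (slo i).
  apply: ltn_trans wlt; apply: IH => // [j aj ji|]; last by move: ai lt_d => /=; lia.
  by apply: h => //; move: ji => /=; lia.
by have -> : a = slo i by apply: val_inj => /=; move: ai => /=; lia.
Qed.

(** A strictly increasing self-map of an interval is at least the identity; this is applied to [w]
    and to its inverse. *)
Lemma no_desc w : (forall i, ~~ desc i w) -> w = 1.
Proof.
move=> h; have hom (a b : 'I_n) : (a < b)%N -> (w a < w b)%N by apply: asc_homo.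
have ge (v : 'S_n) : (forall a b : 'I_n, (a < b)%N -> (v a < v b)%N) ->
    forall a : 'I_n, (a <= v a)%N.
  move=> hv a; case: a => k; elim: k => // k IH kn; have kn' := ltnW kn.
  by apply: leq_ltn_trans (IH kn') (hv (Ordinal kn') (Ordinal kn) (ltnSn k)).
apply/permP => a; rewrite perm1; apply/val_inj/eqP; rewrite eqn_leq ge // andbT.
suff homV (b c : 'I_n) : (b < c)%N -> (w^-1 b < w^-1 c)%N.
  by have := ge _ homV (w a); rewrite permK.
rewrite -{1}[b](permKV w) -{1}[c](permKV w); apply: contraTT; rewrite -!leqNgt.
by rewrite leq_eqVlt => /orP[/eqP/val_inj -> //|/hom/ltnW].
Qed.

Lemma desc_exists w : w != 1 -> exists i, desc i w.
Proof.
move=> w1; apply/existsP; apply: contraR w1 => /existsPn h.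
by apply/eqP/no_desc.
Qed.

Lemma desc_ind (P : 'S_n -> Prop) :
  P 1 -> (forall i w, ~~ desc i w -> P w -> P (refl i * w)) -> forall w, P w.
Proof.
move=> P1 PS w; have [k] := ubnP (inv w); elim: k w => // k IH w.
have [->//|/desc_exists[i d]] := eqVneq w 1.
rewrite (inv_desc d) ltnS => lt_k.
rewrite -[w]mul1g -(reflK i) -mulgA; apply: PS; first by rewrite desc_refl negbK.
exact: IH.
Qed.

Lemma cword_cons i ks : cword (C := Sn n) (i :: ks) = refl i * cword (C := Sn n) ks.
Proof. by rewrite /cword big_cons. Qed.

Lemma cword_nil : cword (C := Sn n) [::] = 1.
Proof. by rewrite /cword big_nil. Qed.

Lemma inv_cword (ks : seq 'I_n.-1) : (inv (cword (C := Sn n) ks) <= size ks)%N.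
Proof.
elim: ks => [|i ks IH]; first by rewrite cword_nil inv1.
rewrite cword_cons /=; have [d|d] := boolP (desc i (cword (C := Sn n) ks)).
  by apply: leq_trans (leqW IH); rewrite [X in (_ <= X)%N](inv_desc d) leqnSn.
by rewrite inv_asc.
Qed.

Lemma word_of_inv w :
  exists2 ks : seq 'I_n.-1, size ks = inv w & cword (C := Sn n) ks = w.
Proof.
elim/desc_ind: w => [|i w d [ks sz wE]].
  by exists [::]; rewrite ?inv1 ?cword_nil.
by exists (i :: ks); rewrite ?inv_asc // ?cword_cons ?wE //= sz.
Qed.

Lemma lenE w : len (w : Sn n) = inv w.
Proof.
rewrite /len; case: pselect => [e|[]]; last first.
  have [ks sz wE] := word_of_inv w.
  by exists (inv w); apply/asboolP; exists ks.
case: ex_minnP => k /asboolP[ks [<- <-]] kmin; apply/eqP; rewrite eqn_leq inv_cword andbT.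
apply: kmin; apply/asboolP.
by have [ms sz wE] := word_of_inv (cword (C := Sn n) ks); exists ms.
Qed.

End Inversions.

End Inversions.
Import Inversions.

(** * Presentation of the symmetric group by adjacent transpositions *)

Module CoxeterPresentation.

Import Order.TTheory GRing.Theory Num.Theory.
Local Open Scope group_scope.

Section Coxeter.

Context (n : nat).
Implicit Types (w v x : 'S_n) (i j : 'I_n.-1).

Lemma refl_fix i (a : 'I_n) : (a < i)%N || (i.+1 < a)%N -> refl i a = a.
Proof.
by move=> h; apply: tpermD; rewrite -val_eqE /=; move: h; case: ltngtP => //=; lia.
Qed.

Lemma shi_slo i j : i.+1 = j :> nat -> shi i = slo j.
Proof. by move=> ij; apply: val_inj. Qed.

Lemma refl_comm i j : (i.+1 < j)%N -> refl i * refl j = refl j * refl i.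
Proof.
move=> ij; apply/commgP/conjg_fixP; rewrite /refl tpermJ.
by congr tperm; apply: refl_fix => /=; lia.
Qed.

Lemma refl_braid i j : i.+1 = j :> nat ->
  refl i * refl j * refl i = refl j * refl i * refl j.
Proof.
move=> ij; have c (a b : 'I_n.-1) : refl a * refl b * refl a = refl b ^ refl a.
  by rewrite conjgE reflV mulgA.
have e := shi_slo ij.
have e1 : refl i (slo j) = slo i by rewrite -e refl_hi.
have e2 : refl i (shi j) = shi j by apply: refl_fix => /=; lia.
have e3 : refl j (shi i) = shi j by rewrite e refl_lo.
have e4 : refl j (slo i) = slo i by apply: refl_fix => /=; lia.
rewrite !c [LHS]tpermJ [RHS]tpermJ -/(refl i) -/(refl j).
by rewrite e1 e2 e3 e4.
Qed.

Lemma desc_far i j w : (i.+1 < j)%N || (j.+1 < i)%N -> desc j (refl i * w) = desc j w.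
Proof. by move=> ij; rewrite /desc !reflM !refl_fix //=; lia. Qed.

Lemma desc_succ i j w : i.+1 = j :> nat ->
  desc j (refl i * w) = (w (shi j) < w (slo i))%N.
Proof. by move=> ij; rewrite /desc !reflM -(shi_slo ij) refl_hi refl_fix //=; lia. Qed.

Lemma desc_pred i j w : i.+1 = j :> nat ->
  desc i (refl j * w) = (w (shi j) < w (slo i))%N.
Proof. by move=> ij; rewrite /desc !reflM (shi_slo ij) refl_lo refl_fix //=; lia. Qed.

(** [F] strips descents one by one, and the point is that it does not depend on the descent chosen.
    Two descents of [w] either commute, or are adjacent and then both alternating products of length
    three can be stripped; the smaller elements are covered by induction on inversions, and the
    relations in [G] compare the two results. *)
Lemma coxeter_lift (G : groupType) (f : 'I_n.-1 -> G) :
  (forall i j, (f i * f j) ^+ (cmat (c := Sn n) i j) = 1) ->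
  exists F : 'S_n -> G, F 1 = 1 /\ forall i w, F (refl i * w) = f i * F w.
Proof.
move=> rel.
have f2 i : f i * f i = 1 by have := rel i i; rewrite /= eqxx expg1.
have fV i : (f i)^-1 = f i by apply: mulg1_eq.
have fcom i j : (i.+1 < j)%N -> f i * f j = f j * f i.
  move=> ij; have := rel i j; rewrite /=.
  have -> : (i == j) = false by rewrite -val_eqE /=; lia.
  have -> : (i.+1 == j) || (j.+1 == i) = false by lia.
  by rewrite expgS expg1 => /mulg1_eq; rewrite invMg !fV.
have fbr i j : i.+1 = j :> nat -> f i * f j * f i = f j * f i * f j.
  move=> ij; have := rel i j; rewrite /=.
  have -> : (i == j) = false by rewrite -val_eqE /=; lia.
  rewrite ij eqxx /= !expgS expg0 mulg1 => h.
  have /mulg1_eq : (f i * f j * f i) * (f j * f i * f j) = 1 by rewrite -h !mulgA.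
  by rewrite !invMg !fV mulgA.
(* The fuel starts at [inv w], which drops by one with every stripped descent, so both default
   values are taken only at the identity. *)
pose fix Fk (k : nat) w {struct k} : G :=
  if k is k'.+1 then if [pick i | desc i w] is Some i then f i * Fk k' (refl i * w) else 1
  else 1.
pose F w := Fk (inv w) w.
have Fpick w : F w = if [pick i | desc i w] is Some i then f i * F (refl i * w) else 1.
  rewrite /F; case E: [pick i | desc i w] => [i|].
    have d : desc i w by move: E; case: pickP => // j dj [<-].
    by rewrite (inv_desc d) /= E.
  by case: (inv w) => //= k; rewrite E.
have F1 : F 1 = 1 by rewrite /F inv1.
have Fd w i : desc i w -> F w = f i * F (refl i * w).
  have [k] := ubnP (inv w); elim: k w i => // k IH w i lt_k d.
  have low : forall j v, desc j v -> (inv v <= inv w)%N -> (inv (refl j * v) < k)%N.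
    by move=> j v dv le_v; move: lt_k; rewrite ltnS; apply: leq_trans; rewrite -(inv_desc dv).
  rewrite [LHS]Fpick; case: pickP => [j dj|/(_ i)]; last by rewrite d.
  wlog ij : i j d dj / (i < j)%N.
    have [ij|ij|/val_inj -> //] := ltngtP i j; first by apply.
    by move=> h; apply/esym/h.
  have lw := leqnn (inv w).
  have [ij1|ij1] := eqVneq i.+1 j.
    have e := shi_slo ij1.
    have lij : (w (shi j) < w (slo i))%N.
      by apply: ltn_trans dj _; rewrite -e.
    have dji : desc j (refl i * w) by rewrite desc_succ.
    have dij : desc i (refl j * w) by rewrite desc_pred.
    have li := leqW (leqnn (inv (refl i * w))); rewrite -(inv_desc d) in li.
    have lj := leqW (leqnn (inv (refl j * w))); rewrite -(inv_desc dj) in lj.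
    have diji : desc i (refl j * (refl i * w)).
      by rewrite desc_pred // !reflM refl_lo refl_fix /= ?e //; lia.
    have djij : desc j (refl i * (refl j * w)).
      by rewrite desc_succ // !reflM refl_hi refl_fix /= -?e //; lia.
    have lji := leqW (leqnn (inv (refl j * (refl i * w)))); rewrite -(inv_desc dji) in lji.
    have lij' := leqW (leqnn (inv (refl i * (refl j * w)))); rewrite -(inv_desc dij) in lij'.
    rewrite (IH _ _ (low _ _ d lw) dji) (IH _ _ (low _ _ dj lw) dij).
    rewrite (IH _ _ (low _ _ dji li) diji) (IH _ _ (low _ _ dij lj) djij).
    by rewrite !mulgA (fbr _ _ ij1) (refl_braid ij1).
  have ij2 : (i.+1 < j)%N by lia.
  rewrite (IH _ i (low _ _ dj lw)) ?desc_far ?ij2 ?orbT //.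
  rewrite (IH _ j (low _ _ d lw)) ?desc_far ?ij2 //.
  by rewrite !mulgA (fcom _ _ ij2) (refl_comm ij2).
exists F; split=> // i w; have [d|d] := boolP (desc i w).
  by rewrite (Fd _ _ d) mulgA f2 mul1g.
by rewrite (Fd (refl i * w) i) ?desc_refl // !mulgA reflK mul1g.
Qed.

(** Needed for (Dom): [iterated] asks that the inner group of each link be given by its Coxeter
    presentation. *)
Lemma is_coxeter_Sn : is_coxeter (Sn n).
Proof.
split=> [i j|i j|i j|w|G f rel] /=.
- by rewrite eq_sym orbC.
- by case: eqP => // ij; split=> //; case: ifP.
- have [->|ij] := eqVneq i j; first by rewrite expg1 reflK.
  wlog lij : i j ij / (i < j)%N.
    have [lij|lij|/val_inj e] := ltngtP i j; last by rewrite e eqxx in ij.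
      by apply.
    rewrite orbC => /(_ j i); rewrite eq_sym => /(_ ij lij).
    set k := (if _ then _ else _) => h.
    have : (refl j * refl i) ^+ k = 1 by [].
    move/(congr1 invg); rewrite -expVgn invMg !reflV invg1 //.
  case: ifP => [/orP[/eqP e|]|/negP e]; [|lia|].
    rewrite !expgS expg0 mulg1 !mulgA -/(refl i) -/(refl j) (refl_braid e).
    by rewrite -!mulgA !reflMK reflK.
  rewrite expgS expg1 -/(refl i) -/(refl j) {1}refl_comm; last by lia.
  by rewrite -mulgA reflMK reflK.
- by have [ks _ <-] := word_of_inv w; exists ks.
have [F [F1 FM]] := coxeter_lift rel.
have Fmul : {morph F : x y / x * y}.
  move=> x y; elim/desc_ind: x => [|i w _ IH]; first by rewrite F1 !mul1g.
  by rewrite -mulgA !FM IH mulgA.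
exists (HB.pack_for {multiplicative 'S_n -> G} F (monoid.isMultiplicative.Build _ _ F Fmul)).
by move=> i; have := FM i 1; rewrite F1 !mulg1.
Qed.

End Coxeter.

End CoxeterPresentation.
Import CoxeterPresentation.

(** * The maximal parabolic subgroup and its coset representatives *)

Module MaximalParabolic.

Import Order.TTheory GRing.Theory Num.Theory.
Local Open Scope group_scope.

Section Parabolic.

Context (m : nat).
Implicit Types (w v x : 'S_m.+1) (i : 'I_m).

(** [J] omits only the last transposition, so W_J is the stabilizer of the last point; see
    [jstab_word]. *)
Definition jstab v := v ord_max == ord_max.

Definition jasc x := forall i : 'I_m, i.+1 != m -> ~~ @desc m.+1 i x.

(** A coset of W_J on the left is determined by the image [j] of the last point; this representative
    increases on the other points, hence has minimal length. *)
Definition xr (j : 'I_m.+1) : 'S_m.+1 := lift_perm ord_max j 1.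

Lemma xr_max j : xr j ord_max = j.
Proof. exact: lift_perm_id. Qed.

Lemma jstab1 : jstab 1.
Proof. by rewrite /jstab perm1. Qed.

Lemma jstabM v w : jstab v -> jstab w -> jstab (v * w).
Proof. by rewrite /jstab permM => /eqP -> . Qed.

Lemma jstabV v : jstab v^-1 = jstab v.
Proof. by rewrite /jstab (canF_eq (permKV v)) eq_sym. Qed.

Lemma jstab_refl i : i.+1 != m -> jstab (@refl m.+1 i).
Proof. by move=> im; apply/eqP/refl_fix => /=; have := ltn_ord i; lia. Qed.

Lemma jstab_inj v (a : 'I_m.+1) : jstab v -> a != ord_max -> v a != ord_max.
Proof. by move=> /eqP vm; apply: contra_neq => va; apply: (@perm_inj _ v); rewrite va vm. Qed.

Lemma jasc_xr j : jasc (xr j).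
Proof.
move=> i im.
have lo : @slo m.+1 i = lift ord_max i by apply: val_inj; rewrite [RHS]lift_max.
have im' : (i.+1 < m)%N by have := ltn_ord i; lia.
have hi : @shi m.+1 i = lift ord_max (Ordinal im').
  by apply: val_inj; rewrite [RHS]lift_max.
rewrite /desc /xr lo hi !lift_perm_lift !perm1 /= /bump -leqNgt.
by case: leqP; case: leqP => /=; lia.
Qed.

Lemma desc_jmul v x i : jstab v -> jasc x -> i.+1 != m ->
  @desc m.+1 i (v * x) = @desc m.+1 i v.
Proof.
move=> jv jx im; have im' : (i.+1 < m)%N by have := ltn_ord i; lia.
have ltm (a : 'I_m.+1) : a != ord_max -> (a < m)%N.
  by rewrite -val_eqE /=; have := ltn_ord a; lia.
have mono (a b : 'I_m.+1) : (b < m)%N -> (a < b)%N -> (x a < x b)%N.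
  move=> bm; apply: asc_homo => k ak kb; apply: jx.
  by move: kb => /=; lia.
have nlo : v (@slo m.+1 i) != ord_max.
  by apply: jstab_inj => //; rewrite -val_eqE /=; lia.
have nhi : v (@shi m.+1 i) != ord_max.
  by apply: jstab_inj => //; rewrite -val_eqE /=; lia.
rewrite /desc !permM; case: (ltngtP (v (@shi m.+1 i)) (v (@slo m.+1 i))) => [lt|lt|e].
- by rewrite mono // ltm.
- by apply/negbTE; rewrite -leqNgt ltnW // mono // ltm.
by move/val_inj: e => ->; rewrite ltnn.
Qed.

(** Stripping descents never leaves W_J: the last transposition cannot be a descent of an element
    that fixes the last point, the largest value. *)
Lemma jstab_ind (P : 'S_m.+1 -> Prop) :
  P 1 ->
  (forall i v, i.+1 != m -> ~~ @desc m.+1 i v -> jstab v -> P v ->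
     P (@refl m.+1 i * v)) ->
  forall v, jstab v -> P v.
Proof.
move=> P1 PS v; elim/desc_ind: v => // i w d IH jv.
have [im|im] := eqVneq i.+1 m; last first.
  have jw : jstab w.
    by have := jstabM (jstab_refl im) jv; rewrite mulgA reflK mul1g.
  by apply: PS => //; apply: IH.
move/eqP: jv; rewrite permM.
have -> : ord_max = @shi m.+1 i by apply: val_inj => /=.
rewrite refl_hi => e; move: d; rewrite /desc e -leqNgt => d.
have : w (@slo m.+1 i) = w (@shi m.+1 i).
  rewrite e; apply/val_inj/eqP; rewrite eqn_leq d /=.
  have := ltn_ord (w (@shi m.+1 i)); rewrite ltnS => h.
  by apply: leq_trans h _; rewrite im.
by move/perm_inj/eqP; rewrite (negPf (slo_neq_shi i)).
Qed.

Lemma inv_jmul v x : jstab v -> jasc x -> inv (v * x) = (inv v + inv x)%N.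
Proof.
move=> + jx; move: v; apply: jstab_ind => [|i v im d jv IH]; first by rewrite inv1 mul1g.
by rewrite -mulgA !inv_asc ?IH ?desc_jmul.
Qed.

Definition vJ x : 'S_m.+1 := x * (xr (x ord_max))^-1.

Lemma jstab_vJ x : jstab (vJ x).
Proof. by rewrite /jstab /vJ permM -{2}(xr_max (x ord_max)) permK. Qed.

Lemma vJ_xr x : vJ x * xr (x ord_max) = x.
Proof. by rewrite /vJ mulgKV. Qed.

Lemma jmul_max v j : jstab v -> (v * xr j) ord_max = j.
Proof. by move/eqP=> vm; rewrite permM vm xr_max. Qed.

Lemma vJ_mul v j : jstab v -> vJ (v * xr j) = v.
Proof. by move=> jv; rewrite /vJ jmul_max // mulgK. Qed.

Lemma jasc_uniq x : jasc x -> x = xr (x ord_max).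
Proof.
move=> jx; rewrite -{1}(vJ_xr x); suff -> : vJ x = 1 by rewrite mul1g.
have jv := jstab_vJ x; apply: (@no_desc m.+1) => i.
have [im|im] := eqVneq i.+1 m; last first.
  by rewrite -(desc_jmul jv (jasc_xr (x ord_max)) im) vJ_xr; apply: jx.
rewrite /desc.
have -> : @shi m.+1 i = ord_max by apply: val_inj => /=.
by rewrite (eqP jv) -leqNgt -ltnS ltn_ord.
Qed.

Lemma jstab_word v : reflect
  (exists ks : seq (Jset m.+1), cword (C := Sn m.+1) (map val ks) = v) (jstab v).
Proof.
apply: (iffP idP) => [jv|[ks <-]].
  move: v jv; apply: jstab_ind => [|i v im d jv [ks <-]].
    by exists [::]; rewrite cword_nil.
  by exists (exist (fun i : 'I_m => i.+1 != m) i im :: ks); rewrite [map _ _]/= cword_cons.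
elim: ks => [|i ks IH]; first by rewrite cword_nil jstab1.
by rewrite [map _ _]/= cword_cons jstabM //; apply: jstab_refl; case: i.
Qed.

Lemma minLE x : reflect (jasc x) (minL (C := Sn m.+1) (@lsnd _ _ (Jlink m.+1)) x).
Proof.
apply: (iffP (asboolP _)) => [h i im|jx ks].
  have := h [:: exist (fun i : 'I_m => i.+1 != m) i im].
  rewrite /= cword_cons cword_nil mulg1 !(lenE (n := m.+1)).
  by apply: contraTN => d; rewrite (inv_desc d) ltnn.
have : jstab (cword (C := Sn m.+1) (map val ks)) by apply/jstab_word; exists ks.
by move=> jk; rewrite !(lenE (n := m.+1)) inv_jmul // leq_addl.
Qed.

Lemma minRE x : reflect (jasc x^-1) (minR (C := Sn m.+1) (@lfst _ _ (Jlink m.+1)) x).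
Proof.
apply: (iffP (asboolP _)) => [h i im|jx ks].
  have := h [:: exist (fun i : 'I_m => i.+1 != m) i im].
  rewrite /= cword_cons cword_nil mulg1 !(lenE (n := m.+1)) -(invV x) -(invV (x * _)).
  rewrite invMg reflV; by apply: contraTN => d; rewrite (inv_desc d) ltnn.
have : jstab (cword (C := Sn m.+1) (map val ks)) by apply/jstab_word; exists ks.
rewrite -jstabV => jk; rewrite !(lenE (n := m.+1)) -(invV x) -(invV (x * _)) invMg.
by rewrite inv_jmul // leq_addl.
Qed.

End Parabolic.

End MaximalParabolic.
Import MaximalParabolic.

(** * Row insertion, tableaux and Knuth equivalence *)

Module KnuthRelations.

Definition Pw (u : seq nat) : tableau := foldl (fun T x => row_insert x T) [::] u.

Lemma Pw_rcons u x : Pw (rcons u x) = row_insert x (Pw u).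
Proof. by rewrite /Pw foldl_rcons. Qed.

Lemma Pw_cat u v : Pw (u ++ v) = foldl (fun T x => row_insert x T) (Pw u) v.
Proof. by rewrite /Pw foldl_cat. Qed.

(** The row, counted from 0, in which the insertion of [x] creates its new box. *)
Fixpoint insrow (x : nat) (T : tableau) : nat :=
  if T is r :: T' then
    let i := find (fun y => x < y) r in
    if i < size r then (insrow (nth 0 r i) T').+1 else 0
  else 0.

Lemma row_insertP x r T :
  [/\ all (fun y => y <= x) r, row_insert x (r :: T) = rcons r x :: T
    & insrow x (r :: T) = 0] \/
  exists l y m, [/\ r = l ++ y :: m, all (fun y => y <= x) l, x < y,
    row_insert x (r :: T) = (l ++ x :: m) :: row_insert y T
    & insrow x (r :: T) = (insrow y T).+1].
Proof.
rewrite /=; set i := find _ _; have [ir|ri] := ltnP i (size r); last first.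
  left; split=> //; apply/allP => y yr; rewrite leqNgt; apply/negP => xy.
  by move: ri; rewrite leqNgt -has_find => /hasP[]; exists y.
right; exists (take i r), (nth 0 r i), (drop i.+1 r); split=> //.
- by rewrite -drop_nth // cat_take_drop.
- apply/(all_nthP 0) => j; rewrite size_takel ?(ltnW ir) // => ji.
  by rewrite nth_take // leqNgt; apply/negbT/(before_find 0 ji).
- by apply: (@nth_find _ 0 (fun y => x < y)); rewrite has_find.
congr (_ :: _); apply: (@eq_from_nth _ 0).
  rewrite size_set_nth size_cat size_takel ?(ltnW ir) //= size_drop; lia.
move=> j _; rewrite nth_set_nth /= nth_cat size_takel ?(ltnW ir) //.
case: ltngtP => [ji|ij|->]; last by rewrite subnn.
  by rewrite nth_take.
by rewrite -[j - i]prednK ?subn_gt0 //= nth_drop; congr nth; lia.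
Qed.

Lemma tshape_insert x T : tshape (row_insert x T) = incr_nth (tshape T) (insrow x T).
Proof.
elim: T x => // r T IH x.
have [[_ -> ->]|[l [y [m [-> _ _ -> ->]]]]] := row_insertP x r T.
  by rewrite /= size_rcons.
by rewrite /tshape /= -!/(tshape _) IH !size_cat.
Qed.

(** [r] can stand directly above [r'] in a tableau: the columns increase and [r'] is not longer. *)
Fixpoint dominates (r r' : seq nat) : bool :=
  match r, r' with
  | _, [::] => true
  | a :: s, b :: s' => (a < b) && dominates s s'
  | _, _ => false
  end.

Fixpoint tabl (T : tableau) : bool :=
  if T is r :: T' then
    [&& r != [::], pairwise ltn r, dominates r (head [::] T') & tabl T']
  else true.

Lemma tabl_cons r T : tabl (r :: T) =
  [&& r != [::], pairwise ltn r, dominates r (head [::] T) & tabl T].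
Proof. by []. Qed.

Lemma dominates_rcons r r' x : dominates r r' -> dominates (rcons r x) r'.
Proof. by elim: r r' => [|a r IH] [|b r'] //= /andP[-> /IH]. Qed.

Lemma dominates_lower l x y m r' :
  x <= y -> dominates (l ++ y :: m) r' -> dominates (l ++ x :: m) r'.
Proof.
move=> xy; elim: l r' => [|a l IH] [|b r'] //= /andP[ab]; last by move/IH->; rewrite ab.
by move=> ->; rewrite (leq_ltn_trans xy ab).
Qed.

Lemma dominates_append l x y m r' : x < y -> all (ltn^~ y) l -> all (leq^~ y) r' ->
  dominates (l ++ y :: m) r' -> dominates (l ++ x :: m) (rcons r' y).
Proof.
move=> xy; elim: l r' => [|a l IH] [|b r'] //=.
- by rewrite xy; case: (m).
- by move=> _ /andP[+ _] /andP[+ _]; lia.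
- by move=> /andP[-> _]; case: (l).
by move=> /andP[_ al] /andP[_ ar] /andP[->]; apply: IH.
Qed.

Lemma dominates_bump l x y m l' y' m' : x < y -> y < y' -> all (ltn^~ y) l ->
  all (leq^~ y) l' -> dominates (l ++ y :: m) (l' ++ y' :: m') ->
  dominates (l ++ x :: m) (l' ++ y :: m').
Proof.
move=> xy yy'; elim: l l' => [|a l IH] [|b l'] //=.
- by move=> _ _ /andP[_ ->]; rewrite xy.
- by move=> _ /andP[+ _] /andP[+ _]; lia.
- by move=> /andP[-> al] _ /andP[_ /dominates_lower ->] //; apply: ltnW.
by move=> /andP[_ al] /andP[_ ar] /andP[->]; apply: IH.
Qed.

Lemma pairwise_ltn_cat l y m : pairwise ltn (l ++ y :: m) =
  [&& all (ltn^~ y) l, allrel ltn l m, pairwise ltn l, all (ltn y) m & pairwise ltn m].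
Proof. by rewrite pairwise_cat /= allrel_consr -!andbA. Qed.

Lemma all_le_lt (x : nat) s : x \notin s -> all (fun y => y <= x) s -> all (ltn^~ x) s.
Proof.
elim: s => //= a s IH; rewrite inE negb_or => /andP[xa xs] /andP[ax /IH ->] //.
by rewrite andbT ltn_neqAle eq_sym xa.
Qed.

Lemma mem_row_insert x T : perm_eq (flatten (row_insert x T)) (x :: flatten T).
Proof.
elim: T x => [//|r T IH] x.
have [[_ -> _]|[l [y [m [-> _ _ -> _]]]]] := row_insertP x r T.
  by rewrite /= cat_rcons; apply/seq.permP => p; rewrite /= !count_cat /=; lia.
rewrite /= (perm_trans (y := (l ++ x :: m) ++ y :: flatten T)) //.
  by rewrite perm_cat2l.
apply/seq.permP => p; rewrite !count_cat /= count_cat /= !count_cat /=; lia.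
Qed.

Lemma tabl_insert x T : tabl T -> uniq (x :: flatten T) -> tabl (row_insert x T).
Proof.
elim: T x => [//|r T IH] x; rewrite tabl_cons => /and4P[r0 pr dr tT].
rewrite [uniq _]/= mem_cat cat_uniq => /andP[/norP[xr xT] /and3P[ur uT1 uT]].
have [[ax -> _]|[l [y [m [e ax xy -> _]]]]] := row_insertP x r T.
  rewrite /= dominates_rcons // tT pairwise_rcons pr !andbT (all_le_lt xr ax) /=.
  by case: (r).
have xl : x \notin l by move: xr; rewrite e mem_cat; case/norP.
have yT : y \notin flatten T.
  apply: contra uT1 => yT; apply/hasP; exists y => //=; by rewrite e mem_cat inE eqxx orbT.
have lx := all_le_lt xl ax.
move: pr; rewrite e pairwise_ltn_cat => /and5P[ly lm pl ym pm].
rewrite /= IH //=; last by rewrite yT uT.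
rewrite pairwise_ltn_cat lx lm pl pm /=.
have -> : all (ltn x) m by apply: sub_all ym => z; apply: ltn_trans.
rewrite !andbT; apply/andP; split; first by case: (l).
move: dr; rewrite e; case: T {IH tT xT uT1 uT} yT => [|r' T] yT dr.
  exact: (@dominates_append _ _ _ _ [::] xy ly isT dr).
have [[ay -> _]|[l' [y' [m' [e' ay yy' -> _]]]]] := row_insertP y r' T.
  exact: dominates_append.
by rewrite /= e' in dr *; apply: dominates_bump dr.
Qed.

Lemma perm_Pw u : perm_eq (flatten (Pw u)) u.
Proof.
elim/last_ind: u => // u x IH; rewrite Pw_rcons (perm_trans (mem_row_insert _ _)) //.
by rewrite perm_sym perm_rcons perm_cons perm_sym.
Qed.

Lemma tabl_Pw u : uniq u -> tabl (Pw u).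
Proof.
elim/last_ind: u => // u x IH; rewrite rcons_uniq => /andP[xu uu].
rewrite Pw_rcons tabl_insert ?IH //= (perm_mem (perm_Pw u)) xu.
by rewrite (perm_uniq (perm_Pw u)).
Qed.

Inductive kstep : seq nat -> seq nat -> Prop :=
| KStep1 p q a b c : a < b -> b < c ->
    kstep (p ++ [:: b; a; c] ++ q) (p ++ [:: b; c; a] ++ q)
| KStep2 p q a b c : a < b -> b < c ->
    kstep (p ++ [:: a; c; b] ++ q) (p ++ [:: c; a; b] ++ q).

Definition keq := clos_refl_sym_trans (seq nat) kstep.

Lemma keq_refl u : keq u u. Proof. exact: rst_refl. Qed.
Lemma keq_sym u v : keq u v -> keq v u. Proof. exact: rst_sym. Qed.
Lemma keq_trans v u w : keq u v -> keq v w -> keq u w. Proof. exact: rst_trans. Qed.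

Lemma kstep_cat p q u v : kstep u v -> kstep (p ++ u ++ q) (p ++ v ++ q).
Proof.
case=> p' q' a b c ab bc; rewrite -!catA !(catA p p').
  exact: (@KStep1 (p ++ p') (q' ++ q) a b c).
exact: (@KStep2 (p ++ p') (q' ++ q) a b c).
Qed.

Lemma keq_cat p q u v : keq u v -> keq (p ++ u ++ q) (p ++ v ++ q).
Proof.
elim=> {u v} [u v uv|u|u v _ uv|u v w _ uv _ vw].
- exact/rst_step/kstep_cat.
- exact: keq_refl.
- exact: keq_sym.
exact: keq_trans vw.
Qed.

Lemma kstep_perm u v : kstep u v -> perm_eq u v.
Proof.
by case=> p q a b c _ _; apply/seq.permP => f; rewrite !count_cat /=; lia.
Qed.

Lemma keq_perm u v : keq u v -> perm_eq u v.
Proof.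
elim=> {u v} [u v /kstep_perm //|//|u v _|u v w _ uv _]; first by rewrite perm_sym.
exact: perm_trans.
Qed.

Lemma keq_bump_right y m x : x < y -> pairwise ltn (y :: m) ->
  keq (y :: m ++ [:: x]) (y :: x :: m).
Proof.
elim: m y => [|z m IH] y xy; first by move=> _; apply: keq_refl.
move=> /= /andP[/andP[yz ym] pm].
apply: (@keq_trans (y :: z :: x :: m)).
  have := IH z (ltn_trans xy yz) pm => /(keq_cat [:: y] [::]).
  by rewrite /= !cats0.
exact/rst_sym/rst_step/(@KStep1 [::] m x y z).
Qed.

Lemma keq_bump_left l y x : x < y -> all (ltn^~ x) l -> pairwise ltn l ->
  keq (l ++ [:: y; x]) (y :: l ++ [:: x]).
Proof.
move=> xy; elim: l => [|e l IH] /=; first by move=> _ _; apply: keq_refl.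
move=> /andP[ex lx] /andP[el pl].
apply: (@keq_trans (e :: y :: l ++ [:: x])).
  have := IH lx pl => /(keq_cat [:: e] [::]).
  by rewrite /= !cats0.
case: l el lx {IH pl} => [|h l] /=; first by move=> _ _; apply/rst_step/(@KStep2 [::] [::] e x y).
move=> /andP[eh _] /andP[hx _].
by apply/rst_step/(@KStep2 [::] (l ++ [:: x]) e h y) => //; apply: ltn_trans xy.
Qed.

(** The row reading word, bottom row first. *)
Definition rw (T : tableau) : seq nat := flatten (rev T).

Lemma rw_cons r T : rw (r :: T) = rw T ++ r.
Proof. by rewrite /rw rev_cons flatten_rcons. Qed.

(** One bump is a chain of Knuth moves within a row: [x] travels to the left past the letters larger
    than the bumped [y], then [y] past those smaller than [x]. So [y] arrives in front of its row,
    behind the next lower row in [rw], where the induction takes over. *)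
Lemma keq_insert x T : tabl T -> uniq (x :: flatten T) ->
  keq (rw T ++ [:: x]) (rw (row_insert x T)).
Proof.
elim: T x => [|r T IH] x; first by move=> _ _; apply: keq_refl.
rewrite tabl_cons => /and4P[_ pr _ tT].
rewrite [uniq _]/= mem_cat cat_uniq => /andP[/norP[xr xT] /and3P[ur uT1 uT]].
have [[ax -> _]|[l [y [m [e ax xy -> _]]]]] := row_insertP x r T.
  by rewrite !rw_cons -cats1 catA; apply: keq_refl.
have xl : x \notin l by move: xr; rewrite e mem_cat; case/norP.
have yT : y \notin flatten T.
  apply: contra uT1 => yT; apply/hasP; exists y => //=; by rewrite e mem_cat inE eqxx orbT.
have lx := all_le_lt xl ax.
move: pr; rewrite e pairwise_ltn_cat => /and5P[ly lm pl ym pm].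
have {}IH := IH y tT; rewrite /= yT uT in IH; have {}IH := IH isT.
rewrite !rw_cons -catA.
apply: (@keq_trans (rw T ++ [:: y] ++ l ++ x :: m)); last first.
  by have := keq_cat [::] (l ++ x :: m) IH; rewrite /= -catA.
have := @keq_cat (rw T) [::] ((l ++ y :: m) ++ [:: x]) (y :: l ++ x :: m).
rewrite !cats0; apply.
apply: (@keq_trans (l ++ y :: x :: m)).
  have := @keq_cat l [::] _ _ (@keq_bump_right y m x xy _).
  by rewrite /= ym pm !cats0 -catA; apply.
by have := @keq_cat [::] m _ _ (@keq_bump_left l y x xy lx pl); rewrite /= -!catA.
Qed.

Lemma keq_Pw u : uniq u -> keq u (rw (Pw u)).
Proof.
elim/last_ind: u => [_|u x IH]; first exact: keq_refl.
rewrite rcons_uniq => /andP[xu uu]; rewrite Pw_rcons -cats1.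
apply: (@keq_trans (rw (Pw u) ++ [:: x])).
  by have := keq_cat [::] [:: x] (IH uu).
apply: keq_insert; first exact: tabl_Pw.
by rewrite /= (perm_mem (perm_Pw u)) xu (perm_uniq (perm_Pw u)).
Qed.

Lemma Pw_eq_keq u v : uniq u -> uniq v -> Pw u = Pw v -> keq u v.
Proof.
move=> uu uv uvE; apply: (keq_trans (keq_Pw uu)); rewrite uvE.
exact/keq_sym/keq_Pw.
Qed.

End KnuthRelations.
Import KnuthRelations.

(** * Column reading words *)

Module ColumnReading.

(** [d] lists the new last column from top to bottom. *)
Fixpoint appendcol (T : tableau) (d : seq nat) : tableau :=
  if d is e :: d' then rcons (head [::] T) e :: appendcol (behead T) d' else T.

Fixpoint row_bounded (T : tableau) (d : seq nat) : bool :=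
  if d is e :: d' then all (ltn^~ e) (head [::] T) && row_bounded (behead T) d'
  else true.

(** [x] exceeds the old first row and is smaller than the letters of the column, so it bumps the top
    of the column, which bumps the next letter, and so on: the column slides down by one row. *)
Lemma insert_appendcol x T d : row_bounded T (x :: d) -> pairwise ltn (x :: d) ->
  row_insert x (appendcol T d) = appendcol T (x :: d).
Proof.
elim: d x T => [|e d IH] x T.
  case: T => [|r T] //; rewrite [row_bounded _ _]/= andbT => rx _.
  have [[_ -> _] //|[l [y [m [e ax xy _ _]]]]] := row_insertP x r T.
  by move: rx; rewrite e all_cat /= => /and3P[_ + _]; lia.
rewrite [row_bounded _ _]/= [pairwise _ _]/=.
move=> /andP[hx hd] /andP[/andP[xe xd] /andP[ed pd]]; rewrite [appendcol T (e :: d)]/=.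
have := row_insertP x (rcons (head [::] T) e) (appendcol (behead T) d).
case=> [[+ _ _]|[l [y [m [/esym E ax xy -> _]]]]].
  by rewrite all_rcons; lia.
have em : l = head [::] T /\ y = e /\ m = [::].
  case/lastP: m E => [|m z].
    by rewrite cats1 => /rcons_inj[].
  rewrite -rcons_cons -rcons_cat => /rcons_inj[E _].
  by move: hx; rewrite -E all_cat /= => /and3P[_ + _]; lia.
case: em => -> [-> ->]; rewrite cats1 IH //= ?hd ?ed //.
Qed.

Lemma row_bounded_behead T x d : row_bounded T (x :: d) -> pairwise ltn (x :: d) ->
  row_bounded T d.
Proof.
elim: d x T => [|e d IH] x T //= /andP[hx /andP[he hd]] /andP[/andP[xe _] /andP[ed pd]].
rewrite (IH e) //= ?he ?hd ?ed // andbT.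
by apply: sub_all hx => y yx; apply: ltn_trans xe.
Qed.

Lemma foldl_appendcol T d : row_bounded T d -> pairwise ltn d ->
  foldl (fun T x => row_insert x T) T (rev d) = appendcol T d.
Proof.
elim: d => [|x d IH] rb pd //; rewrite rev_cons foldl_rcons IH ?insert_appendcol //.
  exact: row_bounded_behead rb pd.
by move: pd => /= /andP[].
Qed.

Definition col (j : nat) (T : tableau) : seq nat := [seq nth 0 r j | r <- T & j < size r].

Lemma dominates_size r r' : dominates r r' -> size r' <= size r.
Proof. by elim: r r' => [|a r IH] [|b r'] //= /andP[_ /IH]. Qed.

Lemma dominates_nth r r' j : dominates r r' -> j < size r' -> nth 0 r j < nth 0 r' j.
Proof. by elim: r r' j => [|a r IH] [|b r'] [|j] //= /andP[// _ /IH]; apply. Qed.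

Lemma tabl_size r T : tabl (r :: T) -> all (fun s => size s <= size r) T.
Proof.
elim: T r => // r' T IH r; rewrite tabl_cons => /and4P[_ _ /dominates_size rr' tT] /=.
by rewrite rr'; apply: sub_all (IH _ tT) => s sr'; apply: leq_trans rr'.
Qed.

Lemma col_nil j T : all (fun s => size s <= j) T -> col j T = [::].
Proof. by rewrite /col; elim: T => //= r T IH /andP[/leq_gtF -> /IH]. Qed.

Lemma col_sorted j T : tabl T -> pairwise ltn (col j T).
Proof.
rewrite -(sorted_pairwise ltn_trans) /col.
elim: T => //= r T IH /and4P[_ _ dr tT].
case: ifP => _; last exact: IH.
case: T dr tT IH => [|r' T] //= dr tT IH; have := IH tT.
case: ifP => jr' /=; first by rewrite (dominates_nth dr jr').
rewrite -/(col j T) col_nil //; apply: sub_all (tabl_size tT) => s; move/leq_trans; apply.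
by rewrite leqNgt jr'.
Qed.

Lemma appendcol_take j T : tabl T ->
  appendcol (map (take j) T) (col j T) = map (take j.+1) T.
Proof.
elim: T => // r T IH tT; have := tT; rewrite tabl_cons => /and4P[_ _ _ tT'].
rewrite /col /=; case: (ltnP j (size r)) => jr /=.
  by rewrite -/(col j T) IH // (take_nth 0 jr).
rewrite -/(col j T) col_nil /= ?take_oversize ?(leqW jr) //.
  congr (_ :: _); apply/eq_in_map => s /(allP (tabl_size tT)) sr.
  by rewrite !take_oversize //; apply: leq_trans sr _; rewrite ?leqW.
by apply: sub_all (tabl_size tT) => s /leq_trans; apply.
Qed.

Lemma row_bounded_col j T : tabl T -> row_bounded (map (take j) T) (col j T).
Proof.
elim: T => // r T IH tT; have := tT; rewrite tabl_cons => /and4P[_ pr _ tT'].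
rewrite /col /=; case: (ltnP j (size r)) => jr /=.
  rewrite -/(col j T) IH // andbT.
  apply/(all_nthP 0) => i; rewrite size_takel ?(ltnW jr) // => ij.
  by rewrite nth_take //; apply: (pairwiseP 0 pr); rewrite ?inE // (ltn_trans ij).
rewrite -/(col j T) col_nil //.
by apply: sub_all (tabl_size tT) => s /leq_trans; apply.
Qed.

(** Columns are read from bottom to top, so each of them is a decreasing run. *)
Definition cols (T : tableau) : seq (seq nat) :=
  [seq rev (col j T) | j <- iota 0 (size (head [::] T))].

Lemma Pw_cols T : tabl T -> Pw (flatten (cols T)) = T.
Proof.
move=> tT; rewrite /cols.
have base : appendcol [::] (col 0 T) = map (take 1) T.
  elim: T tT => // r T IH; rewrite tabl_cons => /and4P[r0 _ _ tT].
  by case: r r0 => // a r _; rewrite /col /= -/(col 0 T) IH // take0.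
have step k : Pw (flatten [seq rev (col j T) | j <- iota 0 k.+1]) = map (take k.+1) T.
  elim: k => [|k IH].
    by rewrite /= cats0 /Pw foldl_appendcol ?base ?col_sorted //; case: (col 0 T) => //= a d; elim: d.
  rewrite -addn1 iotaD map_cat flatten_cat Pw_cat IH /= cats0 add0n.
  by rewrite foldl_appendcol ?appendcol_take ?addn1 ?row_bounded_col ?col_sorted.
case: T tT base step => // r T tT _ step; rewrite [head _ _]/=.
have := tT; rewrite tabl_cons => /and4P[r0 _ _ _].
have -> : size r = (size r).-1.+1 by case: (r) r0.
rewrite step -[RHS]map_id; apply/eq_in_map => s; rewrite inE => /orP[/eqP ->|].
  by rewrite take_oversize //; case: (r) r0.
by move/(allP (tabl_size tT)) => sr; rewrite take_oversize //; case: (r) r0 sr.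
Qed.

Lemma cols_sorted T : tabl T -> all (pairwise gtn) (cols T).
Proof.
move=> tT; apply/allP => d /mapP[j _ ->].
rewrite -(sorted_pairwise (rev_trans ltn_trans)) rev_sorted.
by rewrite (sorted_pairwise ltn_trans); apply: col_sorted.
Qed.

Lemma perm_cols T : tabl T -> perm_eq (flatten (cols T)) (flatten T).
Proof. by move=> tT; rewrite -{2}(Pw_cols tT) perm_sym perm_Pw. Qed.

(* A colouring [f] with colours [< k] selects [k] disjoint increasing
   subsequences; letters of colour [>= k] are not selected. *)
Definition kcompat (k : nat) (f : nat -> nat) (x y : nat) : bool :=
  (f x == f y) && (f x < k) ==> (x < y).

(** Greene's invariant as a bound: [k] disjoint increasing subsequences with at least [m] letters in
    total. *)
Definition kcov (k : nat) (u : seq nat) (m : nat) : Prop :=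
  exists2 f : nat -> nat, pairwise (kcompat k f) u & m <= count (fun x => f x < k) u.

Lemma kcov_cat3 k f p x y z q : pairwise (kcompat k f) (p ++ [:: x; y; z] ++ q) <->
  [/\ pairwise (kcompat k f) p && pairwise (kcompat k f) q,
      (forall e e', e \in p -> e' \in q -> kcompat k f e e'),
      (forall e, e \in p -> [&& kcompat k f e x, kcompat k f e y & kcompat k f e z]),
      (forall e, e \in q -> [&& kcompat k f x e, kcompat k f y e & kcompat k f z e]) &
      [&& kcompat k f x y, kcompat k f x z & kcompat k f y z]].
Proof.
rewrite pairwise_cat /=; split.
  move=> /and3P[/allrelP a1 a2 /and4P[/and3P[b1 b2 b3] /andP[c1 c2] d1 d2]].
  split=> // [|e e' ep eq|e ep|e eq|].
  - by rewrite a2.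
  - by apply: a1; rewrite // !inE eq !orbT.
  - by rewrite !a1 // !inE eqxx ?orbT.
  - by rewrite (allP b3) // (allP c2) // (allP d1).
  by rewrite b1 b2 c1.
move=> [/andP[a2 d2] c1 pe qe /and3P[b1 b2 b3]].
rewrite a2 d2 b1 b2 b3 /= andbT; apply/and4P; split.
- apply/allrelP => e e' ep; rewrite !inE.
  by have /and3P[h1 h2 h3] := pe _ ep; case/or4P=> [/eqP ->|/eqP ->|/eqP ->|/c1 ->].
- by apply/allP => e /qe /and3P[].
- by apply/allP => e /qe /and3P[].
by apply/allP => e /qe /and3P[].
Qed.

Lemma kcompatP k f x y : reflect (f x = f y -> f x < k -> x < y) (kcompat k f x y).
Proof.
apply: (iffP implyP) => [h fxy fk|h /andP[/eqP fxy fk]]; last exact: h.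
by apply: h; rewrite fxy eqxx -fxy.
Qed.

End ColumnReading.
Import ColumnReading.

(** * Greene's theorem *)

Module Greene.

Definition cswap (i j t : nat) : nat := if t == i then j else if t == j then i else t.

Lemma cswap_lt i j t k : i < k -> j < k -> (cswap i j t < k) = (t < k).
Proof. by move=> ik jk; rewrite /cswap; case: eqP => [->|_]; [lia|case: eqP => [->|_] //; lia]. Qed.

Lemma cswap_inj i j : injective (cswap i j).
Proof. by move=> s t; rewrite /cswap; do !case: eqP; lia. Qed.

Lemma pairwise_kcompat_eq k f g u : {in u, f =1 g} ->
  pairwise (kcompat k f) u -> pairwise (kcompat k g) u.
Proof.
elim: u => //= x u IH fg /andP[ax pu]; rewrite IH //; last first.
  by move=> y yu; apply: fg; rewrite inE yu orbT.
rewrite andbT; apply/allP => y yu; have := allP ax _ yu.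
by rewrite /kcompat !fg // inE ?eqxx // yu orbT.
Qed.

Lemma pairwise_cswap k f i j u : i < k -> j < k ->
  pairwise (kcompat k f) u -> pairwise (kcompat k (fun x => cswap i j (f x))) u.
Proof.
move=> ik jk; elim: u => //= x u IH /andP[ax /IH ->]; rewrite andbT.
apply: sub_all ax => y; rewrite /kcompat cswap_lt //.
by rewrite (inj_eq (@cswap_inj i j)).
Qed.

(* Recolouring after a Knuth move: letters after the moved triple may have two
   colours exchanged, and only the triple itself is recoloured otherwise. *)
Lemma kcov_recolor k f g i j p q x y z x' y' z' m :
  i < k -> j < k ->
  pairwise (kcompat k f) (p ++ [:: x; y; z] ++ q) ->
  {in p, g =1 f} -> {in q, g =1 fun e => cswap i j (f e)} ->
  m <= count (fun e => f e < k) (p ++ [:: x; y; z] ++ q) ->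
  (f x < k) + (f y < k) + (f z < k) <= (g x' < k) + (g y' < k) + (g z' < k) ->
  (forall e e', kcompat k f e e' ->
     [&& kcompat k f e x, kcompat k f e y & kcompat k f e z] ->
     [&& kcompat k f x e', kcompat k f y e' & kcompat k f z e'] ->
     f e = cswap i j (f e') -> f e < k -> e < e') ->
  (forall e, [&& kcompat k f e x, kcompat k f e y & kcompat k f e z] ->
     [/\ f e = g x' -> f e < k -> e < x', f e = g y' -> f e < k -> e < y'
       & f e = g z' -> f e < k -> e < z']) ->
  (forall e, [&& kcompat k f x e, kcompat k f y e & kcompat k f z e] ->
     [/\ g x' = cswap i j (f e) -> g x' < k -> x' < e,
         g y' = cswap i j (f e) -> g y' < k -> y' < e
       & g z' = cswap i j (f e) -> g z' < k -> z' < e]) ->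
  [&& kcompat k g x' y', kcompat k g x' z' & kcompat k g y' z'] ->
  kcov k (p ++ [:: x'; y'; z'] ++ q) m.
Proof.
move=> ik jk /kcov_cat3[/andP[Hp Hq] Hpq Hpe Hqe Ht] gp gq cnt cnt3 Cpq Cp Cq Ct.
exists g.
  apply/kcov_cat3; split=> //.
  - apply/andP; split; first by apply: pairwise_kcompat_eq Hp => e /gp.
    by apply: pairwise_kcompat_eq (pairwise_cswap ik jk Hq) => e /gq.
  - move=> e e' ep eq; apply/kcompatP; rewrite (gp e ep) (gq e' eq) /=.
    by apply: Cpq; [apply: Hpq|apply: Hpe|apply: Hqe].
  - move=> e ep; have [h1 h2 h3] := Cp e (Hpe e ep).
    by apply/and3P; split; apply/kcompatP; rewrite (gp e ep).
  move=> e eq; have [h1 h2 h3] := Cq e (Hqe e eq).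
  by apply/and3P; split; apply/kcompatP; rewrite (gq e eq) /=.
apply: leq_trans cnt _; rewrite !count_cat /=.
have -> : count (fun e => g e < k) p = count (fun e => f e < k) p.
  by apply: eq_in_count => e ep; rewrite gp.
have -> : count (fun e => g e < k) q = count (fun e => f e < k) q.
  by apply: eq_in_count => e eq; rewrite gq //= cswap_lt.
lia.
Qed.

Lemma cswapii i t : cswap i i t = t.
Proof. by rewrite /cswap; case: eqP. Qed.

Lemma uniq_cat3 (p q : seq nat) x y z : uniq (p ++ [:: x; y; z] ++ q) ->
  [/\ {in p, forall e, [&& e \notin q, e != x, e != y & e != z]},
      {in q, forall e, [&& e != x, e != y & e != z]},
      [&& x \notin q, y \notin q & z \notin q] & [&& x != y, x != z & y != z]].
Proof.
rewrite cat_uniq => /and3P[_ /hasPn hp]; rewrite [uniq _]/= !inE !negb_or.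
move=> /and4P[/and3P[xy xz xq] /andP[yz yq] zq _]; split.
- move=> e ep; apply/and4P; split; first by apply: contraL ep => eq; apply: hp; rewrite !inE eq !orbT.
  + by apply: contraTneq ep => ->; apply: hp; rewrite !inE eqxx.
  + by apply: contraTneq ep => ->; apply: hp; rewrite !inE eqxx !orbT.
  by apply: contraTneq ep => ->; apply: hp; rewrite !inE eqxx !orbT.
- move=> e eq; apply/and3P; split; by apply: contraTneq eq => ->.
- by rewrite xq yq zq.
by rewrite xy xz yz.
Qed.

Lemma kcov_swap k f p q x y z x' y' z' m : uniq (p ++ [:: x; y; z] ++ q) ->
  perm_eq [:: x'; y'; z'] [:: x; y; z] ->
  pairwise (kcompat k f) (p ++ [:: x; y; z] ++ q) ->
  m <= count (fun e => f e < k) (p ++ [:: x; y; z] ++ q) ->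
  [&& kcompat k f x' y', kcompat k f x' z' & kcompat k f y' z'] ->
  kcov k (p ++ [:: x'; y'; z'] ++ q) m.
Proof.
move=> uu pe Hf cnt Ht; have mem3 := perm_mem pe.
move/kcov_cat3: (Hf) => [Hpq Hpq2 Hpe Hqe _]; exists f.
  apply/kcov_cat3; split=> // e ee.
    have h w : w \in [:: x'; y'; z'] -> kcompat k f e w.
      by rewrite mem3 !inE; have /and3P[h1 h2 h3] := Hpe e ee; case/or3P => /eqP ->.
    by rewrite !h // !inE eqxx ?orbT.
  have h w : w \in [:: x'; y'; z'] -> kcompat k f w e.
    by rewrite mem3 !inE; have /and3P[h1 h2 h3] := Hqe e ee; case/or3P => /eqP ->.
  by rewrite !h // !inE eqxx ?orbT.
apply: leq_trans cnt _; apply/eq_leq; apply/seq.permP.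
by rewrite perm_cat2l perm_cat2r perm_sym.
Qed.

(** The colouring survives unless the exchanged letters [a] and [c] stand in the order [a], [c] with
    the same selected colour. Then, if [b] is not selected, it replaces one of them; if it is, the
    subsequences through [a] and [b] exchange their tails after the triple. *)
Lemma kcov_kstep k u u' m : uniq u -> kstep u u' \/ kstep u' u -> kcov k u m -> kcov k u' m.
Proof.
move=> uu [] st; case: st uu => p q a b c ab bc uu [f Hf cnt].
- have [up uq /and3P[bq aq cq] /and3P[nba nbc nac]] := uniq_cat3 uu.
  have /kcov_cat3[_ _ _ _ /and3P[/kcompatP ba /kcompatP bc' /kcompatP ac]] := Hf.
  have [/andP[/eqP fac fak]|ok] := boolP ((f a == f c) && (f a < k)); last first.
    apply: kcov_swap Hf cnt _ => //; first by apply/seq.permP => P /=; lia.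
    apply/and3P; split; apply/kcompatP => //.
    by move=> e ek; move: ok; rewrite -e ek eqxx.
  have [fbk|fbk] := leqP k (f b).
    pose g e := if e == b then f a else if e == a then k else f e.
    have gb : g b = f a by rewrite /g eqxx.
    have ga : g a = k by rewrite /g eqxx eq_sym (negPf nba).
    have gc : g c = f a by rewrite /g eq_sym (negPf nbc) eq_sym (negPf nac) fac.
    apply: (@kcov_recolor _ _ g _ _ _ _ _ _ _ _ _ _ _ fak fak Hf _ _ cnt).
    + by move=> e /up/and4P[_ h1 h2 _]; rewrite /g (negPf h1) (negPf h2).
    + by move=> e /uq/and3P[h1 h2 _]; rewrite /g (negPf h1) (negPf h2) cswapii.
    + by rewrite gb ga gc; lia.
    + by move=> e e' /kcompatP h _ _; rewrite cswapii.
    + move=> e /and3P[/kcompatP h1 /kcompatP h2 /kcompatP h3]; rewrite gb gc ga.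
      by split; lia.
    + move=> e /and3P[/kcompatP h1 /kcompatP h2 /kcompatP h3]; rewrite gb gc ga cswapii.
      by split; lia.
    by apply/and3P; split; apply/kcompatP; rewrite ?gb ?ga ?gc; lia.
  have {ba bc' ac} nab : f b <> f a by move=> e; have := ba e fbk; lia.
  pose g e := if e \in q then cswap (f b) (f a) (f e) else if e == c then f b else f e.
  have gb : g b = f b by rewrite /g (negPf bq) (negPf nbc).
  have ga : g a = f a by rewrite /g (negPf aq) (negPf nac).
  have gc : g c = f b by rewrite /g (negPf cq) eqxx.
  apply: (@kcov_recolor _ _ g _ _ _ _ _ _ _ _ _ _ _ fbk fak Hf _ _ cnt).
  + by move=> e /up/and4P[h1 _ _ h2]; rewrite /g (negPf h1) (negPf h2).
  + by move=> e eq; rewrite /g eq.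
  + by rewrite gb ga gc; lia.
  + move=> e e' /kcompatP h /and3P[/kcompatP h1 /kcompatP h2 /kcompatP h3].
    move=> /and3P[/kcompatP h4 /kcompatP h5 /kcompatP h6].
    rewrite /cswap; case: eqP => [fe' fe ek|_].
      by apply: ltn_trans (h2 fe ek) (ltn_trans ab (h4 (esym fe') fbk)).
    case: eqP => [fe' fe ek|_]; last exact: h.
    by apply: ltn_trans (h1 fe ek) (ltn_trans bc (h6 _ _)); rewrite -fac.
  + move=> e /and3P[/kcompatP h1 /kcompatP h2 /kcompatP h3]; rewrite gb gc ga.
    by split; lia.
  + move=> e /and3P[/kcompatP h1 /kcompatP h2 /kcompatP h3]; rewrite gb gc ga.
    by rewrite /cswap; split; (case: eqP; [|case: eqP]); lia.
  by apply/and3P; split; apply/kcompatP; rewrite ?gb ?ga ?gc; lia.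
- have [up uq /and3P[aq cq bq] /and3P[nac nab ncb]] := uniq_cat3 uu.
  have /kcov_cat3[_ _ _ _ /and3P[/kcompatP ac /kcompatP ab' /kcompatP cb]] := Hf.
  have [/andP[/eqP fac fak]|ok] := boolP ((f a == f c) && (f a < k)); last first.
    apply: kcov_swap Hf cnt _ => //; first by apply/seq.permP => P /=; lia.
    apply/and3P; split; apply/kcompatP => //.
    by move=> e ek; move: ok; rewrite -e ek eqxx.
  have [fbk|fbk] := leqP k (f b).
    pose g e := if e == b then f a else if e == c then k else f e.
    have gb : g b = f a by rewrite /g eqxx.
    have gc : g c = k by rewrite /g eqxx (negPf ncb).
    have ga : g a = f a by rewrite /g (negPf nab) (negPf nac).
    apply: (@kcov_recolor _ _ g _ _ _ _ _ _ _ _ _ _ _ fak fak Hf _ _ cnt).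
    + by move=> e /up/and4P[_ _ h1 h2]; rewrite /g (negPf h1) (negPf h2).
    + by move=> e /uq/and3P[_ h1 h2]; rewrite /g (negPf h1) (negPf h2) cswapii.
    + by rewrite gb ga gc; lia.
    + by move=> e e' /kcompatP h _ _; rewrite cswapii.
    + move=> e /and3P[/kcompatP h1 /kcompatP h2 /kcompatP h3]; rewrite gb gc ga.
      by split; lia.
    + move=> e /and3P[/kcompatP h1 /kcompatP h2 /kcompatP h3]; rewrite gb gc ga cswapii.
      by split; lia.
    by apply/and3P; split; apply/kcompatP; rewrite ?gb ?ga ?gc; lia.
  have {ac ab' cb} nfab : f b <> f a.
    by move=> e; have := cb; rewrite -fac e; lia.
  pose g e := if e \in q then cswap (f b) (f a) (f e)
              else if e == c then f b else if e == b then f a else f e.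
  have gb : g b = f a by rewrite /g (negPf bq) eq_sym (negPf ncb) eqxx.
  have ga : g a = f a by rewrite /g (negPf aq) (negPf nac) (negPf nab).
  have gc : g c = f b by rewrite /g (negPf cq) eqxx.
  apply: (@kcov_recolor _ _ g _ _ _ _ _ _ _ _ _ _ _ fbk fak Hf _ _ cnt).
  + by move=> e /up/and4P[h1 _ h2 h3]; rewrite /g (negPf h1) (negPf h2) (negPf h3).
  + by move=> e eq; rewrite /g eq.
  + by rewrite gb ga gc; lia.
  + move=> e e' /kcompatP h /and3P[/kcompatP h1 /kcompatP h2 /kcompatP h3].
    move=> /and3P[/kcompatP h4 /kcompatP h5 /kcompatP h6].
    rewrite /cswap; case: eqP => [fe' fe ek|_].
      by apply: ltn_trans (h1 fe ek) (ltn_trans ab (h6 (esym fe') fbk)).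
    case: eqP => [fe' fe ek|_]; last exact: h.
    by apply: ltn_trans (h3 fe ek) (ltn_trans bc (h5 _ _)); rewrite -fac.
  + move=> e /and3P[/kcompatP h1 /kcompatP h2 /kcompatP h3]; rewrite gb gc ga.
    by split; lia.
  + move=> e /and3P[/kcompatP h1 /kcompatP h2 /kcompatP h3]; rewrite gb gc ga.
    by rewrite /cswap; split; (case: eqP; [|case: eqP]); lia.
  by apply/and3P; split; apply/kcompatP; rewrite ?gb ?ga ?gc; lia.
- have /kcov_cat3[_ _ _ _ /and3P[/kcompatP h1 /kcompatP h2 /kcompatP h3]] := Hf.
  apply: kcov_swap Hf cnt _ => //; first by apply/seq.permP => P /=; lia.
  by apply/and3P; split; apply/kcompatP; lia.
have /kcov_cat3[_ _ _ _ /and3P[/kcompatP h1 /kcompatP h2 /kcompatP h3]] := Hf.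
apply: kcov_swap Hf cnt _ => //; first by apply/seq.permP => P /=; lia.
by apply/and3P; split; apply/kcompatP; lia.
Qed.

Lemma kcov_keq k u u' m : uniq u -> keq u u' -> kcov k u m <-> kcov k u' m.
Proof.
move=> + h; elim: h => {u u'} [u u' st|u|u u' h IH|u v w huv IH1 _ IH2] uu.
- have uu' : uniq u' by rewrite -(perm_uniq (kstep_perm st)).
  by split; apply: kcov_kstep => //; [left|right].
- by [].
- by rewrite IH // (perm_uniq (keq_perm h)).
by rewrite IH1 // IH2 // -(perm_uniq (keq_perm huv)).
Qed.

(** A decreasing run meets an increasing subsequence at most once, so the selected letters in [d]
    have distinct colours. *)
Lemma count_decreasing k f d : pairwise (kcompat k f) d -> pairwise gtn d ->
  count (fun x => f x < k) d <= minn k (size d).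
Proof.
move=> pd gd; rewrite leq_min count_size andbT -size_filter -(size_map f).
rewrite -[X in _ <= X](size_iota 0); apply: uniq_leq_size; last first.
  by move=> y /mapP[x + ->]; rewrite mem_filter => /andP[fx _]; rewrite mem_iota.
elim: d pd gd => //= x d IH /andP[cx pd] /andP[gx gd].
case: ifP => [fx|_]; last exact: IH.
rewrite /= IH // andbT; apply/mapP => -[y]; rewrite mem_filter => /andP[_ yd] fxy.
have /kcompatP/(_ fxy fx) := allP cx _ yd.
by have := allP gx _ yd; rewrite /=; lia.
Qed.

Lemma kcov_decreasing k ds m : all (pairwise gtn) ds -> kcov k (flatten ds) m ->
  m <= \sum_(d <- ds) minn k (size d).
Proof.
move=> gds [f pf /leq_trans]; apply; elim: ds gds pf => [|d ds IH] //=.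
move=> /andP[gd gds]; rewrite pairwise_cat => /and3P[_ pd pds].
by rewrite count_cat big_cons leq_add ?IH ?count_decreasing.
Qed.

Lemma sum_cols k T N : tabl T -> size (head [::] T) <= N ->
  \sum_(j <- iota 0 N) minn k (size (col j T)) = sumn (take k (tshape T)).
Proof.
elim: T k => [|r T IH] k.
  by move=> _ _; rewrite big1_seq //= => j _; rewrite minn0.
move=> tT; have := tT; rewrite tabl_cons => /and4P[_ _ dr tT'] /= rN.
case: k => [|k]; first by rewrite big1_seq // => j _; rewrite min0n.
rewrite /= -(IH k tT'); last by apply: leq_trans (dominates_size dr) rN.
rewrite (eq_bigr (fun j => (j < size r) + minn k (size (col j T)))); last first.
  move=> j _; rewrite /col /=; case: ltnP => jr; first by rewrite /= add1n minnSS.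
  rewrite -/(col j T) col_nil ?minn0 //.
  by apply: sub_all (tabl_size tT) => s /leq_trans; apply.
rewrite big_split /=; congr (_ + _).
rewrite -(subnKC rN) iotaD big_cat /= [X in _ + X]big1_seq => [|j]; last first.
  by rewrite mem_iota add0n => /andP[_ /andP[jr _]]; rewrite ltnNge jr.
rewrite addn0 (eq_big_seq (fun=> 1)) => [|j]; last by rewrite mem_iota => /andP[_ ->].
by rewrite big_const_seq count_predT size_iota iter_addn_0 mul1n.
Qed.

Lemma sum_size_cols k T : tabl T ->
  \sum_(d <- cols T) minn k (size d) = sumn (take k (tshape T)).
Proof.
move=> tT; rewrite /cols big_map -(sum_cols k tT (leqnn _)).
by apply: eq_bigr => j _; rewrite size_rev.
Qed.

(** The increasing subsequences are the first [k] rows: the top row takes colour 0 and the colours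
    of the rows below are shifted by one. *)
Lemma kcov_rw k T : uniq (flatten T) -> tabl T ->
  kcov k (rw T) (sumn (take k (tshape T))).
Proof.
elim: T k => [|r T IH] k; first by move=> _ _; exists (fun=> k); rewrite ?take_nil.
rewrite tabl_cons => uT /and4P[_ pr _ tT].
case: k => [|k]; first by exists id => //; apply/(pairwiseP 0) => i j _ _ _; rewrite /kcompat ltn0 andbF.
move: uT; rewrite /= cat_uniq => /and3P[ur hT uT].
have [f pf cf] := IH k uT tT; rewrite rw_cons.
have nr x : x \in rw T -> x \notin r.
  move=> xT; apply: contra hT => xr; apply/hasP; exists x => //.
  move: xT; rewrite /rw => /flattenP[s]; rewrite mem_rev => sT xs.
  by apply/flattenP; exists s.
pose g x := if x \in r then 0 else (f x).+1.
have gT x : x \in rw T -> g x = (f x).+1 by move=> /nr /negPf xr; rewrite /g xr.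
have gr x : x \in r -> g x = 0 by rewrite /g => ->.
clearbody g; exists g.
  rewrite pairwise_cat; apply/and3P; split.
  - by apply/allrelP => x y xT yr; rewrite /kcompat gT // gr.
  - elim: (rw T) pf gT {nr cf} => //= x s IHs /andP[ax ps] gT.
    rewrite IHs ?andbT //; last by move=> y ys; apply: gT; rewrite inE ys orbT.
    apply/allP => y ys; have := allP ax _ ys.
    by rewrite /kcompat !gT ?inE ?eqxx ?ys ?orbT // eqSS ltnS.
  elim: r pr gr {IH ur hT nr} => //= x s IHs /andP[ax ps] gr.
  rewrite IHs ?andbT //; last by move=> y ys; apply: gr; rewrite inE ys orbT.
  by apply: sub_all ax => y xy; apply/implyP.
rewrite [sumn _]/= count_cat [leqRHS]addnC leq_add //.
  apply/eq_leq; rewrite -count_predT; apply: eq_in_count => x xr; by rewrite gr.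
rewrite -/(tshape T); apply: leq_trans cf _; apply/eq_leq/eq_in_count => x /gT ->.
by rewrite ltnS.
Qed.

(** The row reading word attains the value and the column reading word, cut into decreasing runs,
    bounds it; both are Knuth equivalent to [u]. *)
Theorem greene k u m : uniq u -> kcov k u m <-> m <= sumn (take k (tshape (Pw u))).
Proof.
move=> uu; have tT := tabl_Pw uu.
have uT : uniq (flatten (Pw u)) by rewrite (perm_uniq (perm_Pw u)).
split=> [|mk].
  rewrite (@kcov_keq _ _ (flatten (cols (Pw u)))) //; last first.
    apply: Pw_eq_keq => //; last by rewrite Pw_cols.
    by rewrite (perm_uniq (perm_cols tT)).
  by move/(kcov_decreasing (cols_sorted tT)); rewrite sum_size_cols.
rewrite (kcov_keq _ _ uu (keq_Pw uu)).
have [f pf cf] := kcov_rw k uT tT; exists f => //.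
exact: leq_trans cf.
Qed.

Lemma partial_sums_inj (s s' : seq nat) : 0 \notin s -> 0 \notin s' ->
  (forall k, sumn (take k s) = sumn (take k s')) -> s = s'.
Proof.
elim: s s' => [|a s IH] [|b s'] //=.
- by rewrite inE negb_or => _ /andP[b0 _] /(_ 1) /=; lia.
- by rewrite inE negb_or => /andP[b0 _] _ /(_ 1) /=; lia.
rewrite !inE !negb_or => /andP[a0 s0] /andP[b0 s0'] h.
have ab : a = b by have := h 1; rewrite /= !take0 /=; lia.
by rewrite ab (IH s') // => k; have := h k.+1; rewrite /= ab; lia.
Qed.

Lemma tabl_shape0 T : tabl T -> 0 \notin tshape T.
Proof.
elim: T => // r T IH; rewrite tabl_cons => /and4P[r0 _ _ tT].
by rewrite /= inE negb_or IH // andbT eq_sym size_eq0.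
Qed.

Lemma tshape_Pw_eq u v : uniq u -> uniq v ->
  (forall k m, kcov k u m <-> kcov k v m) -> tshape (Pw u) = tshape (Pw v).
Proof.
move=> uu uv h; apply: partial_sums_inj; try exact/tabl_shape0/tabl_Pw.
move=> k; apply/eqP; rewrite eqn_leq; apply/andP; split.
  by rewrite -greene // -h greene.
by rewrite -greene // h greene.
Qed.

End Greene.
Import Greene.

(** * The largest letter; Knuth invariance of the insertion tableau *)

Module LargestLetter.

Definition addrow (q c : nat) (T : tableau) : tableau :=
  set_nth [::] T q (rcons (nth [::] T q) c).

Lemma addrow0 c r T : addrow 0 c (r :: T) = rcons r c :: T. Proof. by []. Qed.

Lemma addrowS q c r T : addrow q.+1 c (r :: T) = r :: addrow q c T. Proof. by []. Qed.

Lemma row_insert_max c T : all (all (ltn^~ c)) T -> row_insert c T = addrow 0 c T.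
Proof.
case: T => // r T /andP[rc _].
have [[_ -> _] //|[l [y [m [e _ cy _ _]]]]] := row_insertP c r T.
by move: rc; rewrite e all_cat /= => /and3P[_ + _]; lia.
Qed.

(** The largest letter [c], at the end of row [q], is disturbed only when the insertion into the
    rest would end in that row; then [c] is bumped and goes to the end of the next row. *)
Lemma insert_addrow x c q T : q <= size T -> x < c -> all (all (ltn^~ c)) T ->
  row_insert x (addrow q c T) =
  addrow (if insrow x T == q then q.+1 else q) c (row_insert x T).
Proof.
elim: T q x => [|r T IH] [|q] x //.
  by move=> _ xc _; rewrite /addrow /= xc.
- move=> _ xc /andP[rc Tc]; rewrite addrow0.
  have [[ax -> ->]|[l [y [m [e ax xy -> ->]]]]] := row_insertP x r T.
    have [[+ _ _]|[l [y [m [/esym e ay xy -> _]]]]] := row_insertP x (rcons r c) T.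
      by rewrite all_rcons leqNgt xc.
    case/lastP: m e => [|m z].
      by rewrite cats1 => /rcons_inj[-> ->]; rewrite cats1 row_insert_max.
    rewrite -rcons_cons -rcons_cat => /rcons_inj[e _].
    by move: ax; rewrite -e all_cat /= => /and3P[_ + _]; lia.
  have [[+ _ _]|[l' [y' [m' [/esym e' ax' xy' -> _]]]]] := row_insertP x (rcons r c) T.
    by rewrite all_rcons leqNgt xc.
  have [el [ey em]] : l' = l /\ y' = y /\ m' = rcons m c.
    move: e'; rewrite e rcons_cat rcons_cons; move: ax ax'; clear e rc.
    elim: l l' => [|a l IHl] [|a' l'] //=.
    + by move=> _ _ [-> ->].
    + by move=> _ /andP[+ _] [ea]; rewrite ea; lia.
    + by move=> /andP[+ _] _ [ea]; rewrite -ea; lia.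
    by move=> /andP[_ al] /andP[_ al'] [-> e]; have [-> [-> ->]] := IHl _ al al' e.
  by rewrite el ey em /addrow /= -rcons_cons -rcons_cat.
move=> qT xc /andP[rc Tc]; rewrite addrowS.
have [[ax -> ->]|[l [y [m [e ax xy -> ->]]]]] := row_insertP x r T.
  have [[_ -> _] //|[l [y [m [e ay xy _ _]]]]] := row_insertP x r (addrow q c T).
  by move: ax; rewrite e all_cat /= => /and3P[_ + _]; lia.
have [[ax' _ _]|[l' [y' [m' [e' ax' xy' -> _]]]]] := row_insertP x r (addrow q c T).
  by move: ax'; rewrite e all_cat /= => /and3P[_ + _]; lia.
have [el [ey em]] : l' = l /\ y' = y /\ m' = m.
  move: e'; rewrite e; move: ax ax'; clear e rc.
  elim: l l' => [|a l IHl] [|a' l'] //=.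
  + by move=> _ _ [-> ->].
  + by move=> _ /andP[+ _] [ea]; rewrite ea; lia.
  + by move=> /andP[+ _] _ [ea]; rewrite -ea; lia.
  by move=> /andP[_ al] /andP[_ al'] [-> e]; have [-> [-> ->]] := IHl _ al al' e.
have yc : y < c by move: rc; rewrite e all_cat /= => /and3P[].
by rewrite el ey em IH // eqSS; case: ifP.
Qed.

Lemma size_row_insert x T : insrow x T < size (row_insert x T).
Proof.
elim: T x => // r T IH x.
by have [[_ -> ->] //|[l [y [m [e ax xy -> ->]]]]] := row_insertP x r T; apply: IH.
Qed.

Lemma size_row_insert_le x T : size T <= size (row_insert x T).
Proof.
elim: T x => // r T IH x.
by have [[_ -> _] //|[l [y [m [e ax xy -> _]]]]] := row_insertP x r T; apply: IH.
Qed.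

Lemma all_Pw (p : pred nat) u : all (all p) (Pw u) = all p u.
Proof.
rewrite -(perm_all p (perm_Pw u)); elim: (Pw u) => //= r T ->.
by rewrite all_cat.
Qed.

Lemma Pw_max u1 u2 c : all (ltn^~ c) u1 -> all (ltn^~ c) u2 ->
  exists2 q, q <= size (Pw (u1 ++ u2)) & Pw (u1 ++ c :: u2) = addrow q c (Pw (u1 ++ u2)).
Proof.
move=> c1; elim/last_ind: u2 => [|u2 x IH].
  by exists 0; rewrite // cats0 cats1 Pw_rcons row_insert_max // all_Pw.
rewrite all_rcons => /andP[xc c2]; have [q qs e] := IH c2.
rewrite -rcons_cons -!rcons_cat !Pw_rcons e insert_addrow ?all_Pw ?all_cat ?c1 //.
exists (if insrow x (Pw (u1 ++ u2)) == q then q.+1 else q) => //.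
case: eqP => [<-|_]; first exact: size_row_insert.
exact: leq_trans qs (size_row_insert_le _ _).
Qed.

Lemma tshape_addrow q c T : q <= size T -> tshape (addrow q c T) = incr_nth (tshape T) q.
Proof.
elim: T q => [|r T IH] [|q] //=; first by rewrite size_rcons.
by move=> qT; rewrite -/(addrow q c T) IH.
Qed.

Lemma incr_nth_inj (s : seq nat) : injective (incr_nth s).
Proof.
move=> i j e; have := congr1 (fun s => nth 0 s i) e.
by rewrite !nth_incr_nth eqxx; case: eqP => //; lia.
Qed.

(** By [Pw_max] the largest letter below [c + 1] stands at the end of a row of the tableau of the
    smaller letters, and the change of shape tells which row. *)
Lemma Pw_ext u v : uniq u -> perm_eq u v ->
  (forall c, tshape (Pw [seq x <- u | x < c]) = tshape (Pw [seq x <- v | x < c])) ->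
  Pw u = Pw v.
Proof.
move=> uu uv h; have vv : uniq v by rewrite -(perm_uniq uv).
have step w c : uniq w -> if c \in w then
    exists w1 w2, [/\ all (ltn^~ c) w1, all (ltn^~ c) w2,
      [seq x <- w | x < c.+1] = w1 ++ c :: w2 & [seq x <- w | x < c] = w1 ++ w2]
  else [seq x <- w | x < c.+1] = [seq x <- w | x < c].
  move=> uw; case: ifP => cw; last first.
    apply: eq_in_filter => x xw; rewrite ltnS leq_eqVlt.
    by case: eqP => // xc; rewrite -xc xw in cw.
  case/splitPr: cw uw => p q; rewrite cat_uniq /= => /and3P[_ /norP[cp _] /andP[cq _]].
  exists [seq x <- p | x < c], [seq x <- q | x < c]; split; try exact: filter_all.
    rewrite filter_cat /= ltnSn; congr (_ ++ _ :: _); apply: eq_in_filter => x xw.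
      by rewrite ltnS leq_eqVlt; case: eqP => // xc; rewrite -xc xw in cp.
    by rewrite ltnS leq_eqVlt; case: eqP => // xc; rewrite -xc xw in cq.
  by rewrite filter_cat /= ltnn.
have E c : Pw [seq x <- u | x < c] = Pw [seq x <- v | x < c].
  elim: c => [|c IH]; first by rewrite !(eq_filter (a2 := pred0)) ?filter_pred0.
  have := step u c uu; have := step v c vv; rewrite (perm_mem uv).
  case: ifP => _ => [|-> ->] //.
  move=> [v1 [v2 [av1 av2 ev ev']]] [u1 [u2 [au1 au2 eu eu']]].
  have := h c.+1; rewrite ev eu.
  have [q qs ->] := Pw_max au1 au2; have [q' qs' ->] := Pw_max av1 av2.
  rewrite !tshape_addrow // -eu' -ev' IH => /incr_nth_inj -> //.
have [N hN] : exists N, all (ltn^~ N) u.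
  exists (foldr maxn 0 u).+1; elim: (u) => //= x s IHs; rewrite ltnS leq_maxl /=.
  by apply: sub_all IHs => y; rewrite !ltnS => /leq_trans; apply; rewrite leq_maxr.
have := E N; rewrite !(all_filterP _) //.
by rewrite -(perm_all _ uv).
Qed.

Lemma filter_kstep (c : nat) u v : kstep u v ->
  keq [seq x <- u | x < c] [seq x <- v | x < c].
Proof.
case=> p q x y z xy yz; rewrite !filter_cat; apply: keq_cat => /=.
  have [zc|zc] := ltnP z c.
    rewrite (ltn_trans yz zc) (ltn_trans xy (ltn_trans yz zc)).
    exact/rst_step/(@KStep1 [::] [::]).
  exact: keq_refl.
have [zc|zc] := ltnP z c.
  rewrite (ltn_trans yz zc) (ltn_trans xy (ltn_trans yz zc)).
  exact/rst_step/(@KStep2 [::] [::]).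
exact: keq_refl.
Qed.

Lemma filter_keq (c : nat) u v : keq u v -> keq [seq x <- u | x < c] [seq x <- v | x < c].
Proof.
elim=> {u v} [u v /filter_kstep //|u|u v _|u v w _ uv _ vw].
- exact: keq_refl.
- exact: keq_sym.
exact: keq_trans vw.
Qed.

Lemma tshape_keq u v : uniq u -> keq u v -> tshape (Pw u) = tshape (Pw v).
Proof.
move=> uu uv; apply: tshape_Pw_eq => //; first by rewrite -(perm_uniq (keq_perm uv)).
by move=> k m; apply: kcov_keq.
Qed.

(** Shapes are invariant by Greene's theorem, and Knuth moves restrict to the letters below any
    bound, so all the shapes required by [Pw_ext] agree. *)
Lemma Pw_keq u v : uniq u -> keq u v -> Pw u = Pw v.
Proof.
move=> uu uv; apply: Pw_ext => //; first exact: keq_perm.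
by move=> c; apply: tshape_keq; [apply: filter_uniq|apply: filter_keq].
Qed.

(** Half of the row bumping lemma. In each row the second, smaller letter bumps a letter no larger
    than the one just inserted there, so the letters passed on to the next row are again in
    decreasing order. *)
Lemma insrow_desc x x' T : all (pairwise ltn) T -> x' < x ->
  insrow x T < insrow x' (row_insert x T).
Proof.
elim: T x x' => [|r T IH] x x'; first by move=> _ xx; rewrite /= xx.
move=> /andP[pr pT] xx.
have [[ax -> ->]|[l [y [m [e ax xy -> ->]]]]] := row_insertP x r T.
  have [[+ _ _]|[l [y [m [_ _ _ _ ->]]]] //] := row_insertP x' (rcons r x) T.
  by rewrite all_rcons; lia.
have [[+ _ _]|[l' [y' [m' [e' ax' xy' _ ->]]]]] := row_insertP x' (l ++ x :: m) (row_insert y T).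
  by rewrite all_cat /=; lia.
rewrite ltnS IH //; suff : y' <= x by lia.
have : y' \in l ++ x :: m by rewrite e' mem_cat inE eqxx orbT.
rewrite mem_cat inE => /or3P[yl|/eqP -> //|ym]; first exact: (allP ax).
have : all (leq^~ x') l'; first exact: ax'.
move: e'; clear -ym ax xx xy'.
elim: l ax l' => [|a l IHl] /= ax [|a' l'] /=.
- by case=> <- _.
- by case=> <- _ /andP[+ _]; lia.
- by case=> <- _ _; case/andP: ax.
by case=> _ e /andP[_ al]; case/andP: ax => _ /IHl /(_ _ e al).
Qed.

Lemma insrow_asc x x' T : all (pairwise ltn) T -> x < x' ->
  insrow x' (row_insert x T) <= insrow x T.
Proof.
elim: T x x' => [|r T IH] x x'; first by move=> _ xx; rewrite /= (leq_gtF (ltnW xx)).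
move=> /andP[pr pT] xx.
have [[ax -> ->]|[l [y [m [e ax xy -> ->]]]]] := row_insertP x r T.
  have [[_ _ ->] //|[l [y [m [e _ xy' _ _]]]]] := row_insertP x' (rcons r x) T.
  have : all (leq^~ x) (rcons r x) by rewrite all_rcons leqnn.
  by rewrite e all_cat /= => /and3P[_ + _]; lia.
have [[_ _ ->] //|[l' [y' [m' [e' ax' xy' _ ->]]]]] := row_insertP x' (l ++ x :: m) (row_insert y T).
rewrite ltnS IH //.
have : y' \in l ++ x :: m by rewrite e' mem_cat inE eqxx orbT.
rewrite mem_cat inE => /or3P[yl|/eqP e1|ym]; last 1 first.
- move: pr; rewrite e pairwise_ltn_cat => /and5P[_ _ _ /allP ym' _]; exact: ym'.
- by have := allP ax _ yl; move=> /= ?; lia.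
by lia.
Qed.

End LargestLetter.
Import LargestLetter.

(** * Reverse bumping *)

Module ReverseBumping.

Lemma cat_cons_eq (l m l' m' : seq nat) x x' : l ++ x :: m = l' ++ x' :: m' ->
  [\/ [/\ l = l', x = x' & m = m'],
      exists t, l' = l ++ x :: t /\ m = t ++ x' :: m'
    | exists t, l = l' ++ x' :: t /\ m' = t ++ x :: m].
Proof.
elim: l l' => [|a l IH] [|a' l'] //=.
- by case=> -> ->; constructor 1.
- by case=> -> ->; constructor 2; exists l'.
- by case=> -> <-; constructor 3; exists l.
case=> -> /IH[[-> -> ->]|[t [-> ->]]|[t [-> ->]]].
- by constructor 1.
- by constructor 2; exists t.
by constructor 3; exists t.
Qed.

Lemma row_insert_append x r T : all (leq^~ x) r ->
  row_insert x (r :: T) = rcons r x :: T /\ insrow x (r :: T) = 0.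
Proof.
move=> ax; have [[_ -> ->] //|[l [y [m [e _ xy _ _]]]]] := row_insertP x r T.
by move: ax; rewrite e all_cat /= => /and3P[_ + _]; lia.
Qed.

Lemma row_insert_bump x l y m T : all (leq^~ x) l -> x < y ->
  row_insert x ((l ++ y :: m) :: T) = (l ++ x :: m) :: row_insert y T /\
  insrow x ((l ++ y :: m) :: T) = (insrow y T).+1.
Proof.
move=> ax xy; have [[+ _ _]|[l' [y' [m' [e ax' xy' -> ->]]]]] := row_insertP x (l ++ y :: m) T.
  by rewrite all_cat /=; lia.
case/cat_cons_eq: e => [[-> -> ->] //|[t [el _]]|[t [el _]]].
  by move: ax'; rewrite el all_cat /= => /and3P[_ + _]; lia.
by move: ax; rewrite el all_cat /= => /and3P[_ + _]; lia.
Qed.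

Lemma row_insert_inj x x' T T' : all (pairwise ltn) T -> all (pairwise ltn) T' ->
  tshape T = tshape T' -> row_insert x T = row_insert x' T' -> x = x' /\ T = T'.
Proof.
elim: T T' x x' => [|r S IH] [|r' S'] x x' //; first by move=> _ _ _ [->].
move=> /andP[pr pS] /andP[pr' pS'] [sr sS].
have [[_ -> _]|[l [y [m [e ax xy -> _]]]]] := row_insertP x r S;
  have [[_ -> _]|[l' [y' [m' [e' ax' xy' -> _]]]]] := row_insertP x' r' S'.
- by case=> /rcons_inj[-> ->] ->.
- by case=> /(congr1 size); rewrite size_rcons sr e' !size_cat /=; lia.
- by case=> /(congr1 size); rewrite size_rcons -sr e !size_cat /=; lia.
case=> el /(IH _ _ _ pS pS' sS)[ey ->]; subst y' r r'.
case/cat_cons_eq: el => [[-> -> ->] //|[t [el em]]|[t [el em]]].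
  move: pr; rewrite pairwise_ltn_cat em => /and5P[_ _ _ + _].
  by rewrite all_cat /= => /and3P[_ + _]; lia.
move: pr'; rewrite pairwise_ltn_cat em => /and5P[_ _ _ + _].
by rewrite all_cat /= => /and3P[_ + _]; lia.
Qed.

Lemma dominates_rconsI r x r' : size r' <= size r ->
  dominates (rcons r x) r' -> dominates r r'.
Proof. by elim: r r' => [|a r IH] [|b r'] //= sr /andP[-> /IH]; apply. Qed.

Lemma dominates_no m l y m' : all (ltn y) m -> ~~ dominates m (l ++ y :: m').
Proof.
elim: m l => [|a m IH] [|b l] //=; first by case: ltngtP.
by move=> /andP[_ /IH h]; rewrite negb_and h orbT.
Qed.

Lemma dominates_appendI l z m s y : all (ltn y) m ->
  dominates (l ++ z :: m) (rcons s y) -> dominates (l ++ y :: m) s.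
Proof.
move=> ym; elim: l s => [|b l IH] [|a s] //=.
  by rewrite -cats1 (negPf (dominates_no _ _ ym)) andbF.
by move=> /andP[-> /IH].
Qed.

Lemma dominates_raise l z m s y : all (ltn y) s ->
  dominates (l ++ z :: m) s -> dominates (l ++ y :: m) s.
Proof.
elim: l s => [|b l IH] [|a s] //=; first by move=> /andP[-> _] /andP[_ ->].
by move=> /andP[_ /IH h] /andP[-> /h].
Qed.

Lemma dominates_bumpI l z m l' y m' y' : y < y' -> all (ltn y) m -> all (ltn y) m' ->
  dominates (l ++ z :: m) (l' ++ y :: m') -> dominates (l ++ y :: m) (l' ++ y' :: m').
Proof.
move=> yy' ym ym'; elim: l l' => [|b l IH] [|a l'] //=.
- by move=> /andP[_ ->]; rewrite yy'.
- by rewrite (negPf (dominates_no _ _ ym)) andbF.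
- by move=> /andP[bY /(dominates_raise ym') ->]; rewrite (ltn_trans bY yy').
by move=> /andP[-> /IH].
Qed.

Lemma split_row r y : pairwise ltn r -> y \notin r -> head 0 r < y -> r != [::] ->
  exists l z m, [/\ r = l ++ z :: m, z < y, all (leq^~ z) l & all (ltn y) m].
Proof.
elim: r => // a r IH /= /andP[ar pr]; rewrite inE negb_or => /andP[ya yr] ay _.
case: r ar pr yr IH => [|b r] ar pr yr IH.
  by exists [::], a, [::].
have [by_|yb] := ltnP b y.
  have [l [z [m [e zy lz ym]]]] := IH pr yr by_ isT.
  exists (a :: l), z, m; split=> //; first by rewrite e.
  rewrite /= lz andbT; have /(allP ar) : z \in b :: r by rewrite e mem_cat inE eqxx orbT.
  by move/ltnW.
exists [::], a, (b :: r); split=> //.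
have {}yb : y < b by rewrite ltn_neqAle yb andbT; apply: contraNneq yr => ->; rewrite inE eqxx.
move: pr => /= /andP[br _]; rewrite yb; apply: sub_all br => c; exact: ltn_trans.
Qed.

(** The last letter of row [q] is pushed upwards; in each higher row it replaces the largest letter
    smaller than itself, which [split_row] finds and which exists because columns increase. *)
Lemma unbump q T : tabl T -> uniq (flatten T) -> q < size T ->
  size (nth [::] T q.+1) < size (nth [::] T q) ->
  exists T' x, [/\ tabl T', row_insert x T' = T & insrow x T' = q].
Proof.
elim: q T => [|q IH] [|r S] // tT uT qT sz.
  case/lastP: r tT uT sz {qT} => [//|r x] tT uT sz.
  have := tT; rewrite tabl_cons => /and4P[_ pr dr tS].
  move: pr; rewrite pairwise_rcons => /andP[rx pr].
  have {}rx : all (leq^~ x) r by apply: sub_all rx => y /ltnW.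
  case: r pr rx uT sz dr {tT} => [|a r] pr rx uT sz dr.
    have S0 : S = [::].
      by case: S tS sz {uT dr} => //= s S /andP[s0 _]; rewrite ltnS leqn0 size_eq0 (negPf s0).
    by exists [::], x; rewrite S0.
  have [e1 e2] := row_insert_append S rx.
  exists ((a :: r) :: S), x; split=> //; rewrite tabl_cons pr tS andbT /=.
  by apply: dominates_rconsI dr; move: sz; rewrite /= size_rcons ltnS -nth0.
have := tT; rewrite tabl_cons => /and4P[r0 pr dr tS].
have := uT; rewrite /= cat_uniq => /and3P[_ rS uS].
have [S' [y [tS' eS iS]]] := IH S tS uS qT sz.
have yS : y \in flatten S by rewrite -eS (perm_mem (mem_row_insert _ _)) inE eqxx.
have yr : y \notin r by apply: contra rS => yr; apply/hasP; exists y.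
have hy : head 0 r < y.
  have [b [s [es bs]]] : exists b s, head [::] S = b :: s /\ b <= y.
    rewrite -eS; case: S' tS' {eS iS} => [|s' S']; first by exists y, [::].
    rewrite tabl_cons => /and4P[+ _ _ _].
    have [[ay -> _]|[l [z [m [-> ay yz -> _]]]]] := row_insertP y s' S'.
      by case: s' ay => // b s' /= /andP[by_ _] _; exists b, (rcons s' y).
    by case: l ay => [|b l] /= ay _; [exists y, m|exists b, (l ++ y :: m); case/andP: ay].
  by move: dr; rewrite es; case: (r) r0 => //= a r' _ /andP[ab _]; apply: leq_trans bs.
have [l [z [m [e zy lz ym]]]] := split_row pr yr hy r0.
have [e1 e2] := row_insert_bump m S' lz zy.
exists ((l ++ y :: m) :: S'), z; split; last by rewrite e2 iS.
  move: pr; rewrite e pairwise_ltn_cat => /and5P[lz' lm pl zm pm].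
  rewrite tabl_cons pairwise_ltn_cat lm pl ym pm tS' !andbT.
  apply/and3P; split; first by case: (l).
    by apply: sub_all lz' => c /ltn_trans; apply.
  case: S' tS' eS {iS e1 e2} => [|s' S']; first by case: (l ++ _).
  rewrite tabl_cons [head _ _]/= => /and4P[_ ps' _ _].
  have [[ay -> _]|[l' [y' [m' [es' ay yy' -> _]]]]] := row_insertP y s' S' => eS.
    by move: dr; rewrite -eS e; apply: dominates_appendI.
  move: dr; rewrite -eS e es'; apply: dominates_bumpI => //.
  move: ps'; rewrite es' pairwise_ltn_cat => /and5P[_ _ _ ym' _].
  by apply: sub_all ym' => c; apply: ltn_trans.
by rewrite e1 eS e.
Qed.

Definition insrun (T : tableau) (d : seq nat) : tableau :=
  foldl (fun T x => row_insert x T) T d.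

Fixpoint insrows (T : tableau) (d : seq nat) : seq nat :=
  if d is x :: d' then insrow x T :: insrows (row_insert x T) d' else [::].

Lemma insrows_rcons T d x : insrows T (rcons d x) = rcons (insrows T d) (insrow x (insrun T d)).
Proof. by elim: d T => //= y d IH T; rewrite IH. Qed.

Lemma perm_insrun T d : perm_eq (flatten (insrun T d)) (d ++ flatten T).
Proof.
elim/last_ind: d => // d x IH; rewrite /insrun foldl_rcons -/(insrun T d).
rewrite (perm_trans (mem_row_insert _ _)) // cat_rcons.
by rewrite perm_sym -[x :: flatten T]cat1s perm_catCA perm_cons perm_sym.
Qed.

Lemma tabl_rows T : tabl T -> all (pairwise ltn) T.
Proof. by elim: T => //= r T IH /and4P[_ -> _ /IH]. Qed.

Lemma insrow_le_size x T : insrow x T <= size T.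
Proof.
elim: T x => // r T IH x.
by have [[_ _ ->] //|[l [y [m [e ax xy _ ->]]]]] := row_insertP x r T; apply: IH.
Qed.

Lemma tabl_size_nth T i j : tabl T -> i <= j ->
  size (nth [::] T j) <= size (nth [::] T i).
Proof.
elim: T i j => [|r T IH] i j; first by rewrite !nth_nil.
move=> tT; have := tT; rewrite tabl_cons => /and4P[_ _ _ tT'].
case: i j => [|i] [|j] //=; last by rewrite ltnS; apply: IH.
have [jT|Tj] := ltnP j (size T); last by rewrite nth_default.
by move=> _; apply: (all_nthP [::] (tabl_size tT)).
Qed.

(** Boxes are removed from row [K - 1] upwards: once a row has lost its last box it is strictly
    shorter than the row above, whose last box can then be removed. The expelled letters, in reverse
    order, form [d]. *)
Lemma unbump_run K T : tabl T -> uniq (flatten T) -> K <= size T ->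
  (0 < K -> size (nth [::] T K) < size (nth [::] T K.-1)) ->
  exists T' d, [/\ tabl T', insrun T' d = T & insrows T' d = iota 0 K].
Proof.
elim: K T => [|K IH] T tT uT KT sz; first by exists T, [::].
have [T1 [x [tT1 eT iT]]] := unbump tT uT KT (sz isT).
have uxT : uniq (x :: flatten T1) by rewrite -(perm_uniq (mem_row_insert x T1)) eT.
have KT1 : K <= size T1.
  rewrite leqNgt; apply/negP => h; have := insrow_le_size x T1.
  by rewrite iT; lia.
have shE i : size (nth [::] T i) = (i == K) + size (nth [::] T1 i).
  have nthE (U : tableau) : size (nth [::] U i) = nth 0 (tshape U) i.
    by have [iU|Ui] := ltnP i (size U); [rewrite (nth_map [::])|rewrite !nth_default ?size_map].
  by rewrite !nthE -eT tshape_insert iT nth_incr_nth eq_sym.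
have szT1 : 0 < K -> size (nth [::] T1 K) < size (nth [::] T1 K.-1).
  move=> K0; have := shE K; have := shE K.-1; rewrite eqxx.
  have -> : K.-1 == K = false by lia.
  have : size (nth [::] T K) <= size (nth [::] T K.-1) by apply: tabl_size_nth => //; lia.
  lia.
have uT1 : uniq (flatten T1) by case/andP: uxT.
have [T' [d [tT' eT1 iT']]] := IH T1 tT1 uT1 KT1 szT1.
exists T', (rcons d x); split=> //; first by rewrite /insrun foldl_rcons -/(insrun T' d) eT1.
by rewrite insrows_rcons iT' eT1 iT -addn1 iotaD cats1.
Qed.

End ReverseBumping.
Import ReverseBumping.

(** * Decreasing runs at the end of a word *)

Module DecreasingRuns.

Lemma insrun_Pw u d : insrun (Pw u) d = Pw (u ++ d).
Proof. by rewrite Pw_cat. Qed.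

Lemma sorted_insrows_gt T d : tabl T -> uniq (d ++ flatten T) ->
  sorted ltn (insrows T d) -> sorted gtn d.
Proof.
elim: d T => // x d IH T tT u.
have ux : uniq (x :: flatten T).
  by move: u; rewrite /= mem_cat negb_or cat_uniq => /andP[/andP[_ ->] /and3P[_ _ ->]].
have tT1 := tabl_insert tT ux.
have u1 : uniq (d ++ flatten (row_insert x T)).
  move: u; rewrite -(perm_uniq (s1 := d ++ x :: flatten T)).
    by rewrite !(perm_uniq (perm_cat (perm_refl d) (mem_row_insert x T))).
  by rewrite -cat1s perm_catCA.
have {}IH := IH _ tT1 u1; case: d u u1 IH => // y d u u1 IH /= /andP[lt_xy s].
have := IH s; rewrite [sorted _ _]/= => ->; rewrite andbT.
rewrite ltnNge leq_eqVlt negb_or; apply/andP; split.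
  by apply: contraTneq u => ->; rewrite /= inE eqxx.
by apply: contraTN lt_xy => xy; rewrite -leqNgt insrow_asc // tabl_rows.
Qed.

Lemma sorted_insrows T d : tabl T -> uniq (d ++ flatten T) ->
  sorted gtn d -> sorted ltn (insrows T d).
Proof.
elim: d T => // x d IH T tT u.
have ux : uniq (x :: flatten T).
  by move: u; rewrite /= mem_cat negb_or cat_uniq => /andP[/andP[_ ->] /and3P[_ _ ->]].
have tT1 := tabl_insert tT ux.
have u1 : uniq (d ++ flatten (row_insert x T)).
  move: u; rewrite -(perm_uniq (s1 := d ++ x :: flatten T)).
    by rewrite !(perm_uniq (perm_cat (perm_refl d) (mem_row_insert x T))).
  by rewrite -cat1s perm_catCA.
have {}IH := IH _ tT1 u1; case: d u u1 IH => // y d u u1 IH /= /andP[lt_yx s].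
by rewrite insrow_desc ?tabl_rows //=; apply: IH.
Qed.

(** [c] enters row 0, and each letter of [d] ends exactly in the row where [c] stands, so it pushes
    [c] down by one row. *)
Lemma Pw_max_run v c d K : all (ltn^~ c) v -> all (ltn^~ c) d ->
  insrows (Pw v) d = iota 0 K -> Pw (v ++ c :: d) = addrow K c (Pw (v ++ d)).
Proof.
move=> cv; elim/last_ind: d K => [|d x IH] [|K].
- by rewrite cats0 cats1 Pw_rcons => _ _; apply: row_insert_max; rewrite all_Pw.
- by [].
- by rewrite insrows_rcons; case: (insrows _ _).
rewrite all_rcons insrows_rcons -addn1 iotaD cats1 => /andP[xc cd] /rcons_inj[e iK].
rewrite -rcons_cons -!rcons_cat !Pw_rcons (IH K) // insert_addrow ?all_Pw ?all_cat ?cv //.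
  by rewrite -insrun_Pw iK add0n eqxx addn1.
have := insrow_le_size x (insrun (Pw v) d).
by rewrite iK insrun_Pw.
Qed.

Lemma nth_tshape_insrun T d i : nth 0 (tshape T) i <= nth 0 (tshape (insrun T d)) i.
Proof.
elim: d T => // x d IH T; apply: leq_trans (IH _).
by rewrite tshape_insert nth_incr_nth leq_addl.
Qed.

Lemma tshape_insrun_last T d x i : tabl T -> uniq (rcons d x ++ flatten T) ->
  sorted gtn (rcons d x) -> insrow x (insrun T d) < i ->
  nth 0 (tshape (insrun T (rcons d x))) i = nth 0 (tshape T) i.
Proof.
move=> tT u s; have := sorted_insrows tT u s; rewrite insrows_rcons.
have E e y : nth 0 (tshape (insrun T (rcons e y))) i =
    (insrow y (insrun T e) == i) + nth 0 (tshape (insrun T e)) i.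
  by rewrite /insrun foldl_rcons -/(insrun T e) tshape_insert nth_incr_nth.
rewrite E => + lt; rewrite (ltn_eqF lt) add0n.
elim/last_ind: d {u s E} x lt => // d y IH x lt.
rewrite !insrows_rcons => h.
have lt_yx : insrow y (insrun T d) < insrow x (insrun T (rcons d y)).
  move: h; rewrite -!cats1 -catA /= => /cat_sorted2[_] /=.
  by rewrite cats1 andbT.
have lt_y := ltn_trans lt_yx lt.
rewrite /insrun foldl_rcons -/(insrun T d) tshape_insert nth_incr_nth (ltn_eqF lt_y).
apply: IH lt_y _; move: h; rewrite -[X in sorted ltn X]cats1.
by case/cat_sorted2.
Qed.

Lemma nth0_inj (s s' : seq nat) : 0 \notin s -> 0 \notin s' ->
  (forall i, nth 0 s i = nth 0 s' i) -> s = s'.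
Proof.
elim: s s' => [|a s IH] [|b s'] //=.
- by rewrite inE negb_or => _ /andP[b0 _] /(_ 0) /=; lia.
- by rewrite inE negb_or => /andP[b0 _] _ /(_ 0) /=; lia.
rewrite !inE !negb_or => /andP[a0 s0] /andP[b0 s0'] h.
have /= -> := h 0; rewrite (IH s') // => i; exact: (h i.+1).
Qed.

(** A decreasing run adds boxes in rows further and further down, so its last box lies in the lowest
    row where the shape differs from that of the prefix. This row is the same for both words, and
    injectivity of row insertion strips the last letters. *)
Lemma Pw_run_inj p p' d d' : uniq (p ++ d) -> uniq (p' ++ d') ->
  sorted gtn d -> sorted gtn d' -> size d = size d' ->
  tshape (Pw p) = tshape (Pw p') -> Pw (p ++ d) = Pw (p' ++ d') ->
  d = d' /\ Pw p = Pw p'.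
Proof.
elim/last_ind: d d' => [|d x IH] d'.
  by case: d' => // _ _ _ _ _ _; rewrite !cats0.
case/lastP: d' => [|d' x']; first by rewrite size_rcons.
move=> u u' s s' [sz] sh eP.
have U q e y : uniq (q ++ rcons e y) -> [/\ tabl (Pw q), uniq (rcons e y ++ flatten (Pw q)),
    uniq (q ++ e) & tabl (Pw (q ++ e))].
  move=> uq; have uqe : uniq (q ++ e).
    by move: uq; rewrite -rcons_cat rcons_uniq => /andP[].
  split=> //; try apply: tabl_Pw => //; first by move: uqe; rewrite cat_uniq => /andP[].
  by rewrite uniq_catC (perm_uniq (perm_cat (perm_Pw q) (perm_refl _))).
have [tp up upd tpd] := U _ _ _ u; have [tp' up' upd' tpd'] := U _ _ _ u'.
set q := insrow x (Pw (p ++ d)); set q' := insrow x' (Pw (p' ++ d')).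
have E : row_insert x (Pw (p ++ d)) = row_insert x' (Pw (p' ++ d')).
  by rewrite -!Pw_rcons !rcons_cat.
have sE : incr_nth (tshape (Pw (p ++ d))) q = incr_nth (tshape (Pw (p' ++ d'))) q'.
  by rewrite -!tshape_insert E.
have hi i : q < i -> nth 0 (tshape (Pw (p ++ rcons d x))) i = nth 0 (tshape (Pw p)) i.
  by move=> qi; rewrite -insrun_Pw tshape_insrun_last // insrun_Pw.
have hi' i : q' < i -> nth 0 (tshape (Pw (p' ++ rcons d' x'))) i = nth 0 (tshape (Pw p')) i.
  by move=> qi; rewrite -insrun_Pw tshape_insrun_last // insrun_Pw.
have gt : nth 0 (tshape (Pw p)) q < nth 0 (tshape (Pw (p ++ rcons d x))) q.
  rewrite -rcons_cat Pw_rcons tshape_insert nth_incr_nth eqxx add1n ltnS.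
  by rewrite -insrun_Pw nth_tshape_insrun.
have gt' : nth 0 (tshape (Pw p')) q' < nth 0 (tshape (Pw (p' ++ rcons d' x'))) q'.
  rewrite -rcons_cat Pw_rcons tshape_insert nth_incr_nth eqxx add1n ltnS.
  by rewrite -insrun_Pw nth_tshape_insrun.
have qq : q = q'.
  have [lt|lt|//] := ltngtP q q'.
    by move: gt'; rewrite -eP hi // sh ltnn.
  by move: gt; rewrite eP hi' // sh ltnn.
have shE : tshape (Pw (p ++ d)) = tshape (Pw (p' ++ d')).
  apply: nth0_inj; try exact: tabl_shape0.
  move=> i; have := congr1 (fun s => nth 0 s i) sE.
  by rewrite !nth_incr_nth qq => /addnI.
have [xx eP'] := row_insert_inj (tabl_rows tpd) (tabl_rows tpd') shE E.
have s1 : sorted gtn d by move: s; rewrite -cats1 => /cat_sorted2[].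
have s1' : sorted gtn d' by move: s'; rewrite -cats1 => /cat_sorted2[].
have sz' : size d = size d' by move: sz; rewrite !size_rcons => -[].
by have [-> ->] := IH d' upd upd' s1 s1' sz' sh eP'; rewrite xx.
Qed.

Lemma gtn_pairwise s : pairwise gtn s = sorted gtn s.
Proof. by rewrite (sorted_pairwise (rev_trans ltn_trans)). Qed.

(** If the decreasing runs attain Greene's bound, then so do the initial ones: an optimal colouring
    selects at most the bound within [ds2], hence at least the bound within [ds1]. *)
Lemma kcov_prefix k ds1 ds2 : uniq (flatten (ds1 ++ ds2)) -> all (pairwise gtn) (ds1 ++ ds2) ->
  sumn (take k (tshape (Pw (flatten (ds1 ++ ds2))))) = \sum_(d <- ds1 ++ ds2) minn k (size d) ->
  sumn (take k (tshape (Pw (flatten ds1)))) = \sum_(d <- ds1) minn k (size d).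
Proof.
rewrite flatten_cat all_cat big_cat => u /andP[g1 g2] sE.
have u1 : uniq (flatten ds1) by move: u; rewrite cat_uniq => /andP[].
apply/eqP; rewrite eqn_leq; apply/andP; split.
  by apply: kcov_decreasing g1 _; apply/greene.
have [f pf cf] : kcov k (flatten ds1 ++ flatten ds2) (\sum_(d <- ds1) minn k (size d) + \sum_(d <- ds2) minn k (size d)).
  by apply/greene; rewrite // -sE.
rewrite -greene //; exists f; first by move: pf; rewrite pairwise_cat => /and3P[].
have pf2 : pairwise (kcompat k f) (flatten ds2) by move: pf; rewrite pairwise_cat => /and3P[].
have : count (fun x => f x < k) (flatten ds2) <= \sum_(d <- ds2) minn k (size d).
  by apply: kcov_decreasing g2 _; exists f.
by move: cf; rewrite count_cat; lia.
Qed.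

(** Equality in Greene's bound makes the shape of every initial part a function of the sizes of the
    runs, so [Pw_run_inj] can peel off the last run. *)
Lemma Pw_runs_inj ds ds' : uniq (flatten ds) -> uniq (flatten ds') ->
  all (pairwise gtn) ds -> all (pairwise gtn) ds' -> map size ds = map size ds' ->
  (forall k, sumn (take k (tshape (Pw (flatten ds)))) = \sum_(d <- ds) minn k (size d)) ->
  Pw (flatten ds) = Pw (flatten ds') -> ds = ds'.
Proof.
elim/last_ind: ds ds' => [|ds d IH] ds'; first by case: ds'.
case/lastP: ds' => [|ds' d']; first by rewrite map_rcons; case: (map _ ds).
rewrite !all_rcons !map_rcons => u u' /andP[g gs] /andP[g' gs'] /rcons_inj[szs sz] sh eP.
have szE k : \sum_(e <- ds) minn k (size e) = \sum_(e <- ds') minn k (size e).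
  by have := congr1 (fun s => \sum_(n <- s) minn k n) szs; rewrite !big_map.
have pre k : sumn (take k (tshape (Pw (flatten ds)))) = \sum_(e <- ds) minn k (size e).
  by apply: (@kcov_prefix _ _ [:: d]); rewrite cats1 ?all_rcons ?g.
have pre' k : sumn (take k (tshape (Pw (flatten ds')))) = \sum_(e <- ds') minn k (size e).
  apply: (@kcov_prefix _ _ [:: d']); rewrite cats1 ?all_rcons ?g' //.
  by rewrite -eP sh -!cats1 !big_cat /= !big_seq1 szE sz.
move: u u' eP; rewrite !flatten_rcons => u u' eP.
have v : uniq (flatten ds) by move: u; rewrite cat_uniq => /andP[].
have v' : uniq (flatten ds') by move: u'; rewrite cat_uniq => /andP[].
have shE : tshape (Pw (flatten ds)) = tshape (Pw (flatten ds')).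
  apply: partial_sums_inj; try exact/tabl_shape0/tabl_Pw.
  by move=> k; rewrite pre pre' szE.
rewrite !gtn_pairwise in g g'.
have [-> eP'] := Pw_run_inj u u' g g' sz shE eP.
by rewrite (IH ds').
Qed.

End DecreasingRuns.
Import DecreasingRuns.

(** * Knuth moves as star operations *)

Module StarOperations.

Local Open Scope group_scope.

Section Words.

Context (n : nat).
Implicit Types (w : 'S_n) (i j : 'I_n.-1).

Lemma size_word w : size (word w) = n.
Proof. by rewrite size_map size_enum_ord. Qed.

Lemma nth_word w (a : 'I_n) : nth 0%N (word w) a = (w a).+1.
Proof. by rewrite (nth_map a) ?size_enum_ord ?ltn_ord // nth_ord_enum. Qed.

Lemma word_inj : injective (@word n).
Proof.
move=> w w' e; apply/permP => a; apply/val_inj.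
by have := congr1 (fun s => nth 0%N s a) e; rewrite !nth_word => -[].
Qed.

Lemma uniq_word w : uniq (word w).
Proof. by rewrite map_inj_uniq ?enum_uniq // => a b [/val_inj/perm_inj]. Qed.

Lemma mem_word w x : (x \in word w) = (0 < x <= n)%N.
Proof.
apply/mapP/idP => [[a _ ->]|/andP[x0 xn]]; first by rewrite /= ltn_ord.
have xn' : (x.-1 < n)%N by lia.
exists (w^-1 (Ordinal xn')); first by rewrite mem_enum.
by rewrite permKV /=; lia.
Qed.

Lemma perm_word w w' : perm_eq (word w) (word w').
Proof. by apply: uniq_perm; rewrite ?uniq_word // => x; rewrite !mem_word. Qed.

Lemma descE i w : desc i w = (nth 0%N (word w) i.+1 < nth 0%N (word w) i)%N.
Proof. by have := nth_word w (shi i); have := nth_word w (slo i) => /= -> ->. Qed.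

Lemma nth_cat_add (p s : seq nat) k l : size p = l ->
  nth 0%N (p ++ s) (k + l) = nth 0%N s k.
Proof. by move=> <-; rewrite nth_cat ltnNge leq_addl addnK. Qed.

Lemma word_refl i w p x y q : word w = p ++ [:: x; y] ++ q -> size p = i ->
  word (refl i * w) = p ++ [:: y; x] ++ q.
Proof.
move=> e sp; have szn := size_word w; apply: (@eq_from_nth _ 0%N).
  by rewrite size_word -szn e !size_cat.
move=> k; rewrite size_word => kn; rewrite -[k]/(nat_of_ord (Ordinal kn)) nth_word reflM.
have ex : (w (slo i)).+1 = x by rewrite -nth_word e nth_cat /= -sp ltnn subnn.
have ey : (w (shi i)).+1 = y.
  by rewrite -nth_word e nth_cat /= -sp ltnNge leqnSn subSnn.
have [k1|k1] := eqVneq k i.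
  have -> : Ordinal kn = slo i by apply: val_inj.
  by rewrite refl_lo ey /= nth_cat -sp ltnn subnn.
have [k2|k2] := eqVneq k i.+1.
  have -> : Ordinal kn = shi i by apply: val_inj.
  by rewrite refl_hi ex /= nth_cat -sp ltnNge leqnSn subSnn.
rewrite refl_fix /=; last by lia.
rewrite -nth_word e /= !nth_cat sp; case: ltngtP k1 => // ik _.
have -> : (k - i = (k - i - 2).+2)%N by lia.
by [].
Qed.

(** The star operation of Kazhdan and Lusztig. For adjacent [i] and [j] of which exactly one is a
    descent, exactly one of the two neighbours has the opposite descents; on words this is a Knuth
    move on three consecutive letters. *)
Definition star i j w : 'S_n :=
  if desc i w == desc j w then w
  else if desc j (refl i * w) == desc i w then refl i * w else refl j * w.

Lemma star_desc i j w : i.+1 = j :> nat -> desc i w != desc j w ->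
  desc i (star i j w) = desc j w /\ desc j (star i j w) = desc i w.
Proof.
move=> ij d; rewrite /star (negPf d); case: eqP => [e|/eqP e].
  by rewrite desc_refl e; move: d; do 2!case: desc.
rewrite (desc_pred _ ij) desc_refl; rewrite (desc_succ _ ij) in e.
by move: d e; case: desc; case: desc; case: ltnP.
Qed.

Lemma star_kstep i j w : i.+1 = j :> nat -> desc i w != desc j w ->
  exists p u v q, [/\ size p = i, size u = 3%N /\ size v = 3%N, word w = p ++ u ++ q,
    word (star i j w) = p ++ v ++ q & keq u v].
Proof.
move=> ij d; have szn := size_word w.
have jn : (j.+1 < n)%N by have := ltn_ord j; lia.
pose s := word w; pose p := take i s; pose q := drop i.+3 s.
pose a := nth 0%N s i; pose b := nth 0%N s i.+1; pose c := nth 0%N s i.+2.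
have es : s = p ++ [:: a; b; c] ++ q.
  rewrite -{1}(cat_take_drop i s); congr (_ ++ _).
  have h k : (k < n)%N -> drop k s = nth 0%N s k :: drop k.+1 s.
    by move=> kn; rewrite (drop_nth 0%N) // szn.
  by rewrite (h i) ?(h i.+1) ?(h i.+2) //; lia.
have sp : size p = i by rewrite size_takel // szn; lia.
have uabc : uniq [:: a; b; c].
  by have := uniq_word w; rewrite -/s es !cat_uniq => /and3P[_ _ /andP[]].
have da : desc i w = (b < a)%N by rewrite descE.
have db : desc j w = (c < b)%N by rewrite descE -ij.
have ri : word (refl i * w) = p ++ [:: b; a; c] ++ q.
  by rewrite (@word_refl i w p a b (c :: q)).
have rj : word (refl j * w) = p ++ [:: a; c; b] ++ q.
  rewrite (@word_refl j w (rcons p a) b c q) ?cat_rcons //.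
  by rewrite size_rcons sp.
have dji : desc j (refl i * w) = (c < a)%N.
  by rewrite descE ri -ij -[i.+2]/(2 + i)%N -[i.+1]/(1 + i)%N !(nth_cat_add _ _ sp).
have -> : star i j w = if (c < a)%N == (b < a)%N then refl i * w else refl j * w.
  by rewrite /star (negPf d) dji da.
move: d; rewrite da db => d.
move: uabc; rewrite /= !inE !negb_or => /andP[/andP[ab ac] /andP[bc _]].
clearbody a b c; case: ifP => /eqP e.
  exists p, [:: a; b; c], [:: b; a; c], q; split=> //.
  have [ba|ba] := ltnP b a.
    by apply/keq_sym/rst_step/(@KStep2 [::] [::] b c a); move: e d; rewrite ba; case: ltnP => //; case: ltnP => //; lia.
  by apply/rst_step/(@KStep2 [::] [::] a c b); move: e d; rewrite (leq_gtF ba); case: ltnP => //; case: ltnP => //; lia.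
exists p, [:: a; b; c], [:: a; c; b], q; split=> //.
have [ba|ba] := ltnP b a.
  by apply/rst_step/(@KStep1 [::] [::] b a c); move: e d; rewrite ?ba; case: ltnP => //; case: ltnP => //; lia.
by apply/keq_sym/rst_step/(@KStep1 [::] [::] c a b); move: e d; rewrite ?(leq_gtF ba); case: ltnP => //; case: ltnP => //; lia.
Qed.

(** A converse of [star_kstep] for a move within the prefix [u]; the bound on [j] keeps the
    operation inside that prefix. *)
Lemma kstep_star w u v : kstep u v \/ kstep v u -> forall s, u ++ s = word w ->
  exists i j, [/\ i.+1 = j :> nat, (j.+1 < size u)%N, desc i w != desc j w
    & v ++ s = word (star i j w)].
Proof.
move=> st s us.
have [p [q [u3 [v3 [[eu ev] k3]]]]] : exists p q u3 v3,
    [/\ u = p ++ u3 ++ q & v = p ++ v3 ++ q] /\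
    [\/ exists a b c, [/\ (a < b < c)%N, u3 = [:: b; a; c] & v3 = [:: b; c; a]],
        exists a b c, [/\ (a < b < c)%N, u3 = [:: b; c; a] & v3 = [:: b; a; c]],
        exists a b c, [/\ (a < b < c)%N, u3 = [:: a; c; b] & v3 = [:: c; a; b]]
      | exists a b c, [/\ (a < b < c)%N, u3 = [:: c; a; b] & v3 = [:: a; c; b]]].
  case: st => -[] p q a b c ab bc.
  - exists p, q, [:: b; a; c], [:: b; c; a]; split=> //; constructor 1.
    by exists a, b, c; rewrite ab bc.
  - exists p, q, [:: a; c; b], [:: c; a; b]; split=> //; constructor 3.
    by exists a, b, c; rewrite ab bc.
  - exists p, q, [:: b; c; a], [:: b; a; c]; split=> //; constructor 2.
    by exists a, b, c; rewrite ab bc.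
  exists p, q, [:: c; a; b], [:: a; c; b]; split=> //; constructor 4.
  by exists a, b, c; rewrite ab bc.
have [x [y [z eu3]]] : exists x y z, u3 = [:: x; y; z].
  by case: k3 => -[a [b [c [_ -> _]]]]; do 3!eexists.
have ew : word w = p ++ [:: x; y; z] ++ (q ++ s) by rewrite -us eu eu3 -!catA.
have szw : (size p + (3 + size (q ++ s)) = n)%N by rewrite -(size_word w) ew !size_cat.
have in_ : (size p < n.-1)%N by lia.
have jn_ : ((size p).+1 < n.-1)%N by lia.
pose i : 'I_n.-1 := Ordinal in_; pose j : 'I_n.-1 := Ordinal jn_.
have ij : i.+1 = j :> nat by [].
have di : desc i w = (y < x)%N.
  by rewrite descE ew -[i.+1]/(1 + i)%N -[nat_of_ord i]/(0 + i)%N !(nth_cat_add _ _ (erefl _)).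
have dj : desc j w = (z < y)%N.
  by rewrite descE ew -[j.+1]/(2 + i)%N -[nat_of_ord j]/(1 + i)%N !(nth_cat_add _ _ (erefl _)).
have ri : word (refl i * w) = p ++ [:: y; x; z] ++ q ++ s.
  by rewrite (@word_refl i w p x y (z :: q ++ s)).
have rj : word (refl j * w) = p ++ [:: x; z; y] ++ q ++ s.
  rewrite (@word_refl j w (rcons p x) y z (q ++ s)) ?cat_rcons //.
  by rewrite size_rcons.
have dji : desc j (refl i * w) = (z < x)%N.
  by rewrite descE ri -[j.+1]/(2 + i)%N -[nat_of_ord j]/(1 + i)%N !(nth_cat_add _ _ (erefl _)).
have D : desc i w != desc j w.
  rewrite di dj; case: k3 => -[a [b [c [/andP[ab bc] e3 _]]]];
    by move: eu3; rewrite e3 => -[<- <- <-]; lia.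
have stE : star i j w = if (z < x)%N == (y < x)%N then refl i * w else refl j * w.
  by rewrite /star (negPf D) dji di.
exists i, j; split=> //; first by rewrite eu eu3 !size_cat /=; lia.
rewrite ev -!catA stE.
case: k3 => -[a [b [c [/andP[ab bc] e3 ->]]]];
  move: eu3 ri rj; rewrite e3 => -[<- <- <-] ri rj.
- by have -> : (c < b)%N == (a < b)%N = false by lia.
- by have -> : (a < b)%N == (c < b)%N = false by lia.
- by have -> : (b < a)%N == (c < a)%N by lia.
by have -> : (b < c)%N == (a < c)%N by lia.
Qed.

(** Only the first [c] positions are touched. The bound is kept because [Ptab] will be recovered
    from the shapes of all the prefixes of the inverse word. *)
Inductive spath (c : nat) : 'S_n -> 'S_n -> Prop :=
| SPathNil w : spath c w w
| SPathStep i j w w' : i.+1 = j :> nat -> (j.+1 < c)%N -> desc i w != desc j w ->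
    spath c (star i j w) w' -> spath c w w'.

Lemma spath_trans c w1 w2 w3 : spath c w1 w2 -> spath c w2 w3 -> spath c w1 w3.
Proof. by elim=> // {w1 w2} i j w w' ij jc d _ IH /IH; apply: SPathStep. Qed.

Lemma kstep_sym_spath u v s w : keq u v -> u ++ s = word w ->
  exists2 w', v ++ s = word w' & spath (size u) w w'.
Proof.
move=> uv; suff [h _] : (forall w, u ++ s = word w -> exists2 w', v ++ s = word w' & spath (size u) w w')
   /\ (forall w, v ++ s = word w -> exists2 w', u ++ s = word w' & spath (size u) w w') by apply: h.
elim: uv => {u v w} [u v st|u|u v uv [h1 h2]|u v t uv [h1 h2] vt [h3 h4]].
- have sz := perm_size (kstep_perm st).
  split=> w us.
    have [i [j [ij jc d e]]] := kstep_star (or_introl st) us.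
    by exists (star i j w) => //; apply: (SPathStep ij jc d); constructor.
  have [i [j [ij jc d e]]] := kstep_star (or_intror st) us.
  by exists (star i j w) => //; rewrite sz; apply: (SPathStep ij jc d); constructor.
- by split=> w us; exists w => //; constructor.
- by rewrite -(perm_size (keq_perm uv)).
have sz := perm_size (keq_perm uv).
split=> w us.
  have [w1 e1 p1] := h1 _ us; have [w2 e2 p2] := h3 _ e1.
  by exists w2 => //; apply: spath_trans p1 _; rewrite sz.
have [w1 e1 p1] := h4 _ us; have [w2 e2 p2] := h2 _ e1.
by exists w2 => //; rewrite -sz in p1; apply: spath_trans p1 _.
Qed.

Lemma spath_take c w w' : (c <= n)%N -> spath c w w' ->
  keq (take c (word w)) (take c (word w')) /\ drop c (word w) = drop c (word w').
Proof.
move=> cn; elim=> {w w'} [w|i j w w' ij jc d _ [IH1 IH2]]; first by split; first exact: keq_refl.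
have [p [u [v [q [sp [su sv] e1 e2 uv]]]]] := star_kstep ij d.
have E x : size x = 3%N -> take c (p ++ x ++ q) = p ++ x ++ take (c - i.+3) q /\
    drop c (p ++ x ++ q) = drop (c - i.+3) q.
  move=> sx; rewrite !catA take_cat drop_cat !size_cat sp sx.
  have -> : (c < i + 3)%N = false by lia.
  by rewrite addn3 -catA.
have [t1 d1] := E u su; have [t2 d2] := E v sv.
rewrite -IH2 e1 e2 d1 d2; split=> //.
by apply: keq_trans IH1; rewrite e2 t1 t2; apply: keq_cat.
Qed.

Lemma Ptab_star i j w : i.+1 = j :> nat -> Ptab (star i j w) = Ptab w.
Proof.
move=> ij; have [e|d] := eqVneq (desc i w) (desc j w); first by rewrite /star e eqxx.
have [p [u [v [q [_ _ e1 e2 uv]]]]] := star_kstep ij d.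
rewrite -[LHS]/(Pw _) -[RHS]/(Pw _); apply/esym/Pw_keq; first exact: uniq_word.
by rewrite e1 e2; apply: keq_cat.
Qed.

Lemma Ptab_spath c w w' : spath c w w' -> Ptab w = Ptab w'.
Proof. by elim=> // {w w'} i j w w' ij _ _ _ <-; rewrite Ptab_star. Qed.

Lemma spath_of_Ptab w w' : Ptab w = Ptab w' -> spath n w w'.
Proof.
move=> e; have kw := Pw_eq_keq (uniq_word w) (uniq_word w') e.
have [w'' e1] := kstep_sym_spath (s := [::]) kw (cats0 _).
by rewrite size_word => p; rewrite cats0 in e1; rewrite (word_inj e1).
Qed.

End Words.

End StarOperations.
Import StarOperations.

(** * Inverse permutations, prefixes and descent blocks *)

Module InverseWords.

Local Open Scope group_scope.

Lemma pairwise_filter_imp (T : Type) (r : rel T) (p : pred T) s :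
  pairwise r (filter p s) = pairwise (fun x y => p x && p y ==> r x y) s.
Proof.
elim: s => //= x s IH; case: ifP => px /=; last first.
  by rewrite IH /= (eq_all (a2 := predT)) ?all_predT // => y /=.
by rewrite IH all_filter.
Qed.

Section Inverse.

Context (n : nat).
Implicit Types (y : 'S_n).

Lemma nth_wordV y v : (v < n)%N -> nth 0%N (word y) (nth 0%N (word y^-1) v).-1 = v.+1.
Proof.
by move=> vn; rewrite -[v]/(nat_of_ord (Ordinal vn)) nth_word /= nth_word permKV.
Qed.

Lemma perm_filter_word c y : (c <= n)%N -> perm_eq [seq x <- word y | (x < c.+1)%N] (iota 1 c).
Proof.
move=> cn; apply: uniq_perm; rewrite ?filter_uniq ?uniq_word ?iota_uniq // => x.
by rewrite mem_filter mem_word mem_iota; lia.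
Qed.

Lemma map_take_word c y : (c <= n)%N ->
  [seq nth 0%N (word y) x.-1 | x <- take c (word y^-1)] = iota 1 c.
Proof.
move=> cn; apply: (@eq_from_nth _ 0%N).
  by rewrite size_map size_iota size_takel ?size_word.
move=> v; rewrite size_map size_takel ?size_word // => vc.
by rewrite (nth_map 0%N) ?size_takel ?size_word // nth_take // nth_wordV ?nth_iota //; lia.
Qed.

(** Inversion exchanges positions and values and keeps increasing subsequences increasing; the
    values up to [c] become the first [c] positions, and colourings are transported along. *)
Lemma kcov_inv k c y m : (c <= n)%N ->
  kcov k [seq x <- word y | (x < c.+1)%N] m <-> kcov k (take c (word y^-1)) m.
Proof.
move=> cn; have szt : size (take c (word y^-1)) = c by rewrite size_takel ?size_word.
split=> -[f pf cf].
  exists (fun x => f (nth 0%N (word y) x.-1)); last first.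
    apply: leq_trans cf _; rewrite (seq.permP (perm_filter_word y cn)) -(map_take_word y cn).
    by rewrite count_map leqnn.
  move: pf; rewrite pairwise_filter_imp => /(pairwiseP 0%N) pf.
  apply/(pairwiseP 0%N) => i j; rewrite !inE szt => ic jc ij.
  rewrite !nth_take //; apply/kcompatP; rewrite !nth_wordV; try lia.
  set a := nth _ _ i; set b := nth _ _ j => fij fk.
  have [in_ jn] : (i < n)%N /\ (j < n)%N by lia.
  have ea : a = (y^-1 (Ordinal in_)).+1 by rewrite -nth_word.
  have eb : b = (y^-1 (Ordinal jn)).+1 by rewrite -nth_word.
  rewrite ea eb ltnS ltnNge leq_eqVlt negb_or; apply/andP; split.
    rewrite (inj_eq (@ord_inj n)) (inj_eq perm_inj) -val_eqE /=; lia.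
  apply/negP => ba; have := pf _ _ _ _ ba.
  rewrite !inE size_word !ltn_ord => /(_ isT isT).
  rewrite !nth_word !permKV /= !ltnS ic jc /= => /kcompatP/(_ (esym fij)).
  by rewrite -fij => /(_ fk); lia.
exists (fun x => f (nth 0%N (word y^-1) x.-1)); last first.
  apply: leq_trans cf _; rewrite (seq.permP (perm_filter_word y cn)).
  have := map_take_word y^-1 cn; rewrite invgK => e.
  rewrite -(map_take_word y cn) count_map; apply/eq_leq/eq_in_count => x xt /=.
  have : x \in word y^-1 by apply: mem_take xt.
  rewrite mem_word => xn; have {}xn : (x.-1 < n)%N by lia.
  congr (f _ < k)%N; move: (nth_wordV y^-1 xn); rewrite invgK => ->.
  by have : x \in word y^-1 by [apply: mem_take xt]; rewrite mem_word; lia.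
rewrite pairwise_filter_imp; apply/(pairwiseP 0%N) => i j.
rewrite !inE size_word => in_ jn ij; apply/implyP => /andP[ic jc]; apply/kcompatP.
have := nth_wordV y^-1 in_; have := nth_wordV y^-1 jn; rewrite invgK => -> -> fij fk.
have ei := nth_word y (Ordinal in_); have ej := nth_word y (Ordinal jn).
rewrite /= in ei ej; rewrite ei ej ltnS ltnNge leq_eqVlt negb_or; apply/andP; split.
  by rewrite (inj_eq (@ord_inj n)) (inj_eq perm_inj) -val_eqE /=; lia.
apply/negP => ba; move/(pairwiseP 0%N): pf => /(_ _ _ _ _ ba).
rewrite !inE szt; rewrite ei ltnS in ic; rewrite ej ltnS in jc.
move=> /(_ jc ic); rewrite !nth_take // !nth_word !permK /=.
by move/kcompatP => /(_ (esym fij)); rewrite -fij => /(_ fk); lia.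
Qed.

Lemma tshape_inv c y : (c <= n)%N ->
  tshape (Pw [seq x <- word y | (x < c.+1)%N]) = tshape (Pw (take c (word y^-1))).
Proof.
move=> cn; apply: tshape_Pw_eq; rewrite ?filter_uniq ?take_uniq ?uniq_word // => k m.
exact: kcov_inv.
Qed.

Lemma filter_word c y : (n < c)%N -> [seq x <- word y | (x < c)%N] = word y.
Proof. by move=> nc; apply/all_filterP/allP => x; rewrite mem_word; lia. Qed.

Lemma tshape_PtabV y : tshape (Ptab y^-1) = tshape (Ptab y).
Proof.
have := tshape_inv y (leqnn n); rewrite filter_word // => e.
by rewrite -[RHS]/(tshape (Pw (word y))) e take_oversize // size_word.
Qed.

(** In terms of RSK, the insertion tableau of [y] is the recording tableau of its inverse, which is
    the growth of the shapes of the prefixes. *)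
Lemma Ptab_of_inv_prefix y y' :
  (forall c, (c <= n)%N -> tshape (Pw (take c (word y^-1))) = tshape (Pw (take c (word y'^-1)))) ->
  Ptab y = Ptab y'.
Proof.
move=> h; apply: (@Pw_ext (word y) (word y')); rewrite ?uniq_word ?perm_word // => -[|c].
  by rewrite !(eq_filter (a2 := pred0)) ?filter_pred0.
have [cn|cn] := leqP c n; first by rewrite !tshape_inv // h.
by rewrite !(filter_word _ (leqW cn)); have := h n (leqnn n); rewrite -!tshape_inv // !filter_word.
Qed.

End Inverse.

(** The conjugate partition, as the sequence of column lengths. *)
Definition conjsh (lam : seq nat) : seq nat :=
  [seq count (fun s => j < s)%N lam | j <- iota 0 (head 0%N lam)].

Lemma size_cols T : map size (cols T) = conjsh (tshape T).
Proof.
rewrite /cols /conjsh -map_comp.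
have -> : head 0%N (tshape T) = size (head [::] T) by case: T.
apply: eq_map => j /=; rewrite size_rev /col size_map size_filter /tshape count_map.
by [].
Qed.

Lemma sum_conjsh k T : tabl T -> \sum_(c <- conjsh (tshape T)) minn k c = sumn (take k (tshape T)).
Proof. by move=> tT; rewrite -size_cols big_map sum_size_cols. Qed.

Lemma sumn_conjsh T : tabl T -> sumn (conjsh (tshape T)) = size (flatten T).
Proof.
by move=> tT; rewrite -size_cols -[map _ _]/(shape _) -size_flatten (perm_size (perm_cols tT)).
Qed.

Definition sameblock (cs : seq nat) (i : nat) : bool :=
  reshape_index cs i == reshape_index cs i.+1.

Lemma runsP cs (s : seq nat) : sumn cs = size s -> reflect
  (forall i, (i.+1 < size s)%N -> sameblock cs i -> (nth 0%N s i.+1 < nth 0%N s i)%N)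
  (all (pairwise gtn) (reshape cs s)).
Proof.
move=> sz; have sh : shape (reshape cs s) = cs by apply: reshapeKl; rewrite sz.
have fl : flatten (reshape cs s) = s by apply: reshapeKr; rewrite sz.
have szr r : (r < size cs)%N -> size (nth [::] (reshape cs s) r) = nth 0%N cs r.
  by move=> rs; have := congr1 (fun t => nth 0%N t r) sh; rewrite (nth_map [::]) ?size_reshape.
apply: (iffP idP) => [/(all_nthP [::]) h i is_ /eqP bl|h].
  set r := reshape_index cs i in bl.
  have rs : (r < size cs)%N by apply: reshape_indexP; lia.
  have o1 := reshape_indexK cs i; have o2 := reshape_indexK cs i.+1.
  have l2 : (reshape_offset cs i.+1 < nth 0%N cs (reshape_index cs i.+1))%N.
    by apply: reshape_offsetP; lia.
  rewrite -bl -/r /flatten_index in o1 o2 l2.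
  have offS : reshape_offset cs i.+1 = (reshape_offset cs i).+1 by lia.
  rewrite -fl !nth_flatten sh -bl -/r offS.
  have := h r; rewrite size_reshape => /(_ rs); rewrite gtn_pairwise.
  move/(sortedP 0%N); apply.
  by rewrite szr // -offS.
apply/(all_nthP [::]) => r; rewrite size_reshape => rs; rewrite gtn_pairwise.
apply/(sortedP 0%N) => j jl.
rewrite szr // in jl.
have k1 := flatten_indexKl (ltnW jl); have k2 := flatten_indexKl jl.
have r1 := flatten_indexKr (ltnW jl); have r2 := flatten_indexKr jl.
have i12 : flatten_index cs r j.+1 = (flatten_index cs r j).+1 by rewrite /flatten_index addnS.
have := h (flatten_index cs r j); rewrite -i12 -sz flatten_indexP // => /(_ isT).
rewrite /sameblock -i12 k1 k2 eqxx => /(_ isT).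
have E i : nth 0%N s i = nth 0%N (nth [::] (reshape cs s) (reshape_index cs i)) (reshape_offset cs i).
  by rewrite -{1}fl nth_flatten sh.
by rewrite !E k1 k2 r1 r2.
Qed.

Lemma runs_flatten ds : all (pairwise gtn) ds -> uniq (flatten ds) ->
  forall i, (i.+1 < size (flatten ds))%N -> sameblock (map size ds) i ->
    (nth 0%N (flatten ds) i.+1 < nth 0%N (flatten ds) i)%N.
Proof.
move=> g u; apply/runsP; first by rewrite size_flatten.
by rewrite -[map size ds]/(shape ds) flattenK.
Qed.

Lemma runs_bound cs u k : uniq u -> sumn cs = size u ->
  (forall i, (i.+1 < size u)%N -> sameblock cs i -> (nth 0%N u i.+1 < nth 0%N u i)%N) ->
  (sumn (take k (tshape (Pw u))) <= \sum_(c <- cs) minn k c)%N.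
Proof.
move=> uu sz /(runsP sz) h.
have fl : flatten (reshape cs u) = u by apply: reshapeKr; rewrite sz.
have sh : shape (reshape cs u) = cs by apply: reshapeKl; rewrite sz.
rewrite -[X in \sum_(_ <- X) _]sh big_map; apply: kcov_decreasing h _.
by rewrite fl; apply/greene.
Qed.

Section Runs.

Context (n : nat).
Implicit Types (y w : 'S_n).

(* [w] has a descent at every position inside the blocks of the composition
   [cs], i.e. its left descent set contains the corresponding parabolic. *)
Definition blockdesc (cs : seq nat) w := forall i : 'I_n.-1, sameblock cs i -> desc i w.

Lemma blockdesc_nth cs w : blockdesc cs w <->
  (forall i, (i.+1 < size (word w))%N -> sameblock cs i ->
     (nth 0%N (word w) i.+1 < nth 0%N (word w) i)%N).
Proof.
rewrite size_word; split=> h i.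
  move=> i1 b; have in_ : (i < n.-1)%N by lia.
  by have := h (Ordinal in_) b; rewrite descE.
by move=> b; rewrite descE; apply: h => //; have := ltn_ord i; lia.
Qed.

Lemma sumn_conj_Ptab w : sumn (conjsh (tshape (Ptab w))) = n.
Proof.
rewrite sumn_conjsh ?(tabl_Pw (uniq_word w)) // (perm_size (perm_Pw _)).
exact: size_word.
Qed.

(** The column reading word of the tableau serves as witness. *)
Lemma blockdesc_exists w : exists2 w', spath n w w' & blockdesc (conjsh (tshape (Ptab w))) w'.
Proof.
have tT := tabl_Pw (uniq_word w).
have uc : uniq (flatten (cols (Ptab w))).
  by rewrite (perm_uniq (perm_cols tT)) (perm_uniq (perm_Pw _)) uniq_word.
have k : keq (word w) (flatten (cols (Ptab w))).
  by apply: Pw_eq_keq; rewrite ?uniq_word // Pw_cols.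
have [w' e p] := kstep_sym_spath (s := [::]) k (cats0 _).
rewrite size_word in p; rewrite cats0 in e.
exists w' => //; apply/blockdesc_nth; rewrite -e -size_cols.
by apply: runs_flatten => //; apply: cols_sorted.
Qed.

(** Both words are cut into decreasing runs of the column lengths, for which Greene's bound is
    attained, so [Pw_runs_inj] applies. It is the reason why [eK] has rank at most one on a cell. *)
Lemma blockdesc_uniq w w' : Ptab w = Ptab w' ->
  blockdesc (conjsh (tshape (Ptab w))) w -> blockdesc (conjsh (tshape (Ptab w))) w' -> w = w'.
Proof.
move=> eP h h'; apply: word_inj; set cs := conjsh _ in h h'.
have sz (v : 'S_n) : sumn cs = size (word v) by rewrite /cs sumn_conj_Ptab size_word.
have R (v : 'S_n) : blockdesc cs v -> all (pairwise gtn) (reshape cs (word v)).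
  by move/blockdesc_nth/(runsP (sz v)).
have fl (v : 'S_n) : flatten (reshape cs (word v)) = word v by apply: reshapeKr; rewrite -sz.
have sh (v : 'S_n) : shape (reshape cs (word v)) = cs by apply: reshapeKl; rewrite -sz.
rewrite -(fl w) -(fl w'); congr flatten.
apply: Pw_runs_inj; rewrite ?fl ?uniq_word ?R //.
  by rewrite -!/(shape _) !sh.
move=> k; rewrite -(sum_conjsh k (tabl_Pw (uniq_word w))) -/cs -[in LHS](sh w).
by rewrite big_map.
Qed.

(* Parallel star moves on a prefix compare the shapes of the prefixes. *)
Lemma prefix_shape_le c w w' : (c <= n)%N ->
  (forall w1, spath c w w1 -> exists w1', spath c w' w1' /\
     forall i : 'I_n.-1, desc i w1 -> desc i w1') ->
  forall k, (sumn (take k (tshape (Pw (take c (word w'))))) <=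
     sumn (take k (tshape (Pw (take c (word w))))))%N.
Proof.
move=> cn h k; set u := take c (word w); have szu : size u = c by rewrite size_takel ?size_word.
have uu : uniq u by rewrite take_uniq ?uniq_word.
have tT := tabl_Pw uu.
have uc : uniq (flatten (cols (Pw u))).
  by rewrite (perm_uniq (perm_cols tT)) (perm_uniq (perm_Pw _)).
have ku : keq u (flatten (cols (Pw u))) by apply: Pw_eq_keq; rewrite // Pw_cols.
(* [w1] is [w] with its prefix turned into a column reading word. The parallel [w1'] inherits the
   descents inside the columns, and these decreasing runs bound its Greene invariants by the shape
   for [w]. *)
have [w1 e p] := kstep_sym_spath ku (cat_take_drop c (word w)).
rewrite szu in p; have [w1' [p' hd]] := h _ p.
have [k1 _] := spath_take cn p'.
have szt (v : 'S_n) : size (take c (word v)) = c by move=> *; rewrite size_takel ?size_word.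
rewrite (tshape_keq _ k1) ?take_uniq ?uniq_word // -(sum_conjsh k tT).
have et : take c (word w1) = flatten (cols (Pw u)).
  by rewrite -e take_size_cat // -(perm_size (keq_perm ku)) szu.
apply: runs_bound; rewrite ?take_uniq ?uniq_word //.
  by rewrite sumn_conjsh // (perm_size (perm_Pw u)) szu szt.
rewrite szt => i ic b; have in_ : (i < n.-1)%N by lia.
have := hd (Ordinal in_); rewrite !descE /= !nth_take; try lia.
apply; have := runs_flatten (cols_sorted tT) uc (i := i).
by rewrite -et size_cols szt !nth_take; try lia; apply.
Qed.

End Runs.

End InverseWords.
Import InverseWords.

(** * Finite bases over Laurent polynomials and the bar argument *)

Module FiniteBases.

Import Order.TTheory GRing.Theory Num.Theory.
Local Open Scope ring_scope.

Local Notation A := laurent.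

Section FiniteBasis.

Context (V : lmodType A) (T : finType).
Implicit Types (b c : T -> V) (v w : V).

Definition fbasis b :=
  (forall v, exists c : {ffun T -> A}, v = \sum_i c i *: b i) /\
  (forall c : T -> A, \sum_i c i *: b i = 0 -> forall i, c i = 0).

Definition co b v : {ffun T -> A} :=
  if pselect (exists c : {ffun T -> A}, v = \sum_i c i *: b i) is left e
  then projT1 (cid e) else [ffun=> 0].

Section Coord.

Context (b : T -> V) (hb : fbasis b).

Lemma coE v : v = \sum_i co b v i *: b i.
Proof. by rewrite /co; case: pselect => [e|[]]; [case: (cid e)|apply: hb.1]. Qed.

Lemma co_uniq v (c : T -> A) : v = \sum_i c i *: b i -> forall i, co b v i = c i.
Proof.
move=> e i; apply/eqP; rewrite -subr_eq0; apply/eqP.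
apply: (hb.2 (fun i => co b v i - c i)).
by under eq_bigr do rewrite scalerBl; rewrite sumrB -coE -e subrr.
Qed.

Lemma co_sum (c : T -> A) i : co b (\sum_i c i *: b i) i = c i.
Proof. exact: co_uniq. Qed.

Lemma coD v w i : co b (v + w) i = co b v i + co b w i.
Proof.
apply: (@co_uniq _ (fun i => co b v i + co b w i)).
by under eq_bigr do rewrite scalerDl; rewrite big_split -!coE.
Qed.

Lemma coZ a v i : co b (a *: v) i = a * co b v i.
Proof.
apply: (@co_uniq _ (fun i => a * co b v i)).
by under eq_bigr do rewrite -scalerA; rewrite -scaler_sumr -coE.
Qed.

Lemma coN v i : co b (- v) i = - co b v i.
Proof. by rewrite -scaleN1r coZ mulN1r. Qed.

Lemma coB v w i : co b (v - w) i = co b v i - co b w i.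
Proof. by rewrite coD coN. Qed.

Lemma co0 i : co b 0 i = 0.
Proof. by have := coZ 0 0 i; rewrite scale0r mul0r. Qed.

Lemma co_suml (I : Type) (r : seq I) (P : pred I) (F : I -> V) i :
  co b (\sum_(j <- r | P j) F j) i = \sum_(j <- r | P j) co b (F j) i.
Proof. by apply: (big_morph (fun v => co b v i) (fun v w => coD v w i) (co0 i)). Qed.

Lemma co_b j i : co b (b j) i = (i == j)%:R.
Proof.
apply: (@co_uniq _ (fun i => (i == j)%:R)).
rewrite (bigD1 j) //= eqxx scale1r big1 ?addr0 // => k /negPf ->.
by rewrite scale0r.
Qed.

Lemma co_inj v w : (forall i, co b v i = co b w i) -> v = w.
Proof. by move=> e; rewrite (coE v) (coE w); apply: eq_bigr => i _; rewrite e. Qed.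

Lemma co_linear (f : V -> V) v i :
  (forall x y, f (x + y) = f x + f y) -> (forall a x, f (a *: x) = a *: f x) ->
  co b (f v) i = \sum_j co b v j * co b (f (b j)) i.
Proof.
move=> fD fZ; have f0 : f 0 = 0 by have := fZ 0 0; rewrite !scale0r.
rewrite {1}(coE v) (big_morph f fD f0) co_suml.
by apply: eq_bigr => j _; rewrite fZ coZ.
Qed.

Lemma basis_scaler_eq0 (a : A) v : a != 0 -> a *: v = 0 -> v = 0.
Proof.
move=> a0 av; apply: co_inj => i; rewrite co0.
have /(laurent_mulf_eq0) [a_0|//] : a * co b v i = 0 by rewrite -coZ av co0.
by rewrite a_0 eqxx in a0.
Qed.

End Coord.

(* Two bases congruent modulo u^-1 span the same lattice over Z[u^-1]. *)
Definition cong b c := forall i j, deg_le (co b (c i) j - (j == i)%:R) (-1).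

Lemma co_change b c v j : fbasis b -> fbasis c ->
  co b v j = \sum_i co c v i * co b (c i) j.
Proof.
by move=> hb hc; rewrite {1}(coE hc v) co_suml //; apply: eq_bigr => i _; rewrite coZ.
Qed.

Lemma cong_deg b c v d : fbasis b -> fbasis c -> cong b c ->
  (forall i, deg_le (co c v i) d) ->
  forall i, deg_le (co b v i) d /\ (co b v i)@_d = (co c v i)@_d.
Proof.
move=> hb hc bc hd j; rewrite (co_change v j hb hc).
pose R := \sum_i co c v i * (co b (c i) j - (j == i)%:R).
have -> : \sum_i co c v i * co b (c i) j = co c v j + R.
  have -> : co c v j = \sum_i co c v i * (j == i)%:R.
    rewrite (bigD1 j) //= eqxx mulr1 big1 ?addr0 // => i.
    by rewrite eq_sym => /negPf ->; rewrite mulr0.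
  by rewrite -big_split; apply: eq_bigr => i _ /=; rewrite -mulrDr addrC subrK.
have hR : deg_le R (d - 1) by apply: deg_le_sum => i _; apply: deg_leM.
split; first by apply: deg_leD => //; apply: deg_leW hR; lia.
by rewrite mcoeffD [R@_d]hR ?addr0 //; lia.
Qed.

(** Otherwise a coefficient at the top degree of the [c]-coordinates would reappear, by [cong_deg],
    among the [b]-coordinates. *)
Lemma cong_deg_inv b c v d : fbasis b -> fbasis c -> cong b c ->
  (forall i, deg_le (co b v i) d) -> forall i, deg_le (co c v i) d.
Proof.
move=> hb hc bc hd i k dk; apply/eqP; apply: contraT => ck.
have ci : co c v i != 0 by apply: contraNneq ck => ->; rewrite mcoeff0.
have [e [he [j ej]]] := @top_degree_fam T (fun i => co c v i) i ci.
have de : d < e.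
  apply: lt_le_trans dk _; rewrite leNgt; apply/negP => ek.
  by move: ck; rewrite he ?eqxx.
have [_ h] := cong_deg hb hc bc he j.
by move: ej; rewrite -h hd ?eqxx.
Qed.

Lemma cong_trans b c d : fbasis b -> fbasis c -> fbasis d ->
  cong b c -> cong c d -> cong b d.
Proof.
move=> hb hc hd bc cd i j.
have h k : deg_le (co c (d i - c i) k) (-1).
  by rewrite coB // co_b //; apply: cd.
have [+ _] := cong_deg hb hc bc h j.
have -> : co b (d i) j - (j == i)%:R = co b (d i - c i) j + (co b (c i) j - (j == i)%:R).
  by rewrite coB // addrA subrK.
by move=> hj; apply: deg_leD.
Qed.

Lemma cong_sym b c : fbasis b -> fbasis c -> cong b c -> cong c b.
Proof.
move=> hb hc bc i j.
have -> : co c (b i) j - (j == i)%:R = - co c (c i - b i) j.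
  by rewrite coB // co_b // opprB.
apply: deg_leN; apply: (cong_deg_inv hb hc bc) => k.
by rewrite coB // co_b //; apply: bc.
Qed.

Section Bar.

Context (b : T -> V) (hb : fbasis b) (bar : V -> V).
Context (barD : forall v w, bar (v + w) = bar v + bar w).
Context (barZ : forall a v, bar (a *: v) = lbar a *: bar v).
Context (prec : T -> T -> Prop) (rk : T -> nat).
Context (prec_rk : forall j i, prec j i -> (rk j < rk i)%N).
Context (prec_trans : forall j i k, prec j i -> prec i k -> prec j k).
Context (tri1 : forall i, co b (bar (b i)) i = 1).
Context (tri0 : forall i j, co b (bar (b i)) j != 0 -> j = i \/ prec j i).

Lemma bar0 : bar 0 = 0.
Proof. by have := barZ 0 0; rewrite lbar0 !scale0r. Qed.

Lemma barN v : bar (- v) = - bar v.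
Proof. by apply/eqP; rewrite -subr_eq0 opprK -barD addNr bar0. Qed.

Lemma barB v w : bar (v - w) = bar v - bar w.
Proof. by rewrite barD barN. Qed.

Lemma bar_sum (I : Type) (r : seq I) (P : pred I) (F : I -> V) :
  bar (\sum_(i <- r | P i) F i) = \sum_(i <- r | P i) bar (F i).
Proof. by apply: (big_morph bar barD bar0). Qed.

Lemma co_bar v j : co b (bar v) j = \sum_l lbar (co b v l) * co b (bar (b l)) j.
Proof.
rewrite {1}(coE hb v) bar_sum co_suml //; apply: eq_bigr => l _.
by rewrite barZ coZ.
Qed.

Lemma co_bar_top v j : (forall l, prec j l -> co b v l = 0) ->
  co b (bar v) j = lbar (co b v j).
Proof.
move=> h; rewrite co_bar (bigD1 j) //= tri1 mulr1 big1 ?addr0 // => l lj.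
have [->|/tri0[e|/h ->]] := eqVneq (co b (bar (b l)) j) 0; first by rewrite mulr0.
  by rewrite e eqxx in lj.
by rewrite lbar0 mul0r.
Qed.

(** Downward induction on the rank: once the coefficients above [j] vanish, bar acts on the
    coefficient at [j] simply as [lbar], and [lbar_uinv_eq0] applies. Hence [Q] has to be closed
    upwards only within the support. *)
Lemma bar_fixed_zero v (Q : T -> Prop) : bar v = v ->
  (forall j, Q j -> deg_le (co b v j) (-1)) ->
  (forall j l, Q j -> prec j l -> co b v l != 0 -> Q l) ->
  forall j, Q j -> co b v j = 0.
Proof.
move=> bv hd hQ; pose N := (\max_i rk i)%N.
suff h k j : Q j -> (N - rk j < k)%N -> co b v j = 0 by move=> j Qj; apply: (h (N - rk j).+1).
elim: k j => // k IH j Qj lt_k; apply: lbar_uinv_eq0; last exact: hd.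
rewrite -co_bar_top ?bv // => l jl; apply/eqP; apply: contraT => cl.
case/eqP: (cl); apply: IH; first exact: (hQ j l Qj jl cl).
have := prec_rk jl; have lN : (rk l <= N)%N by rewrite /N; exact: (@leq_bigmax T rk l).
by lia.
Qed.

Lemma bar_uniq v : bar v = v -> (forall j, deg_le (co b v j) (-1)) -> v = 0.
Proof.
move=> bv hd; apply: (co_inj hb) => j; rewrite co0 //.
exact: (@bar_fixed_zero v (fun=> True)).
Qed.

(** The indices different from [i] and not below [i] form a set to which [bar_fixed_zero] applies;
    afterwards [i] is maximal in the support, and its coefficient minus 1 vanishes as well. *)
Lemma bar_support v i : bar v = v -> (forall j, deg_le (co b v j - (j == i)%:R) (-1)) ->
  co b v i = 1 /\ forall j, j <> i -> co b v j != 0 -> prec j i.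
Proof.
move=> bv hd; have hd' j : j <> i -> deg_le (co b v j) (-1).
  by move=> /eqP ji; have := hd j; rewrite (negPf ji) subr0.
have h j : j <> i -> co b v j != 0 -> prec j i.
  move=> ji cj; apply: contrapT => nji; case/eqP: cj.
  apply: (@bar_fixed_zero v (fun j => j <> i /\ ~ prec j i)) => //.
    by move=> k [+ _]; apply: hd'.
  move=> k l [ki nki] kl cl; split; first by move=> li; rewrite li in kl.
  by move=> li; apply: nki; apply: prec_trans li.
split=> //; have hi : lbar (co b v i) = co b v i.
  rewrite -co_bar_top ?bv // => l il; apply/eqP; apply: contraT => cl.
  have li : l <> i by move=> li; have := prec_rk il; rewrite li ltnn.
  by have := prec_rk (prec_trans il (h _ li cl)); rewrite ltnn.
apply/eqP; rewrite -subr_eq0; apply/eqP/lbar_uinv_eq0.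
  by rewrite lbarB hi lbar1.
by have := hd i; rewrite eqxx.
Qed.

(** Solved from the top rank down: [lbar_antisym] settles the coefficients of rank [N], and
    subtracting [q1 - bar q1] leaves an antisymmetric remainder of smaller rank, still supported in
    the lower set [D]. *)
Lemma bar_antisym N (D : T -> Prop) v : bar v = - v -> (forall w, bar (bar w) = w) ->
  (forall j l, D l -> prec j l -> D j) ->
  (forall j, co b v j != 0 -> D j /\ (rk j < N)%N) ->
  exists q, [/\ q - bar q = v, forall j, deg_le (co b q j) (-1)
    & forall j, co b q j != 0 -> D j].
Proof.
move=> + barK hD; elim: N v => [|N IH] v bv hv.
  have v0 : v = 0.
    by apply: (co_inj hb) => j; rewrite co0 //; apply/eqP; apply: contraT => /hv[].
  exists 0; rewrite v0 bar0 subr0; split=> // j; rewrite co0 ?eqxx //.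
  exact: deg_le0.
have hp j : exists p, deg_le p (-1) /\ (rk j = N -> p - lbar p = co b v j).
  have [rN|rN] := eqVneq (rk j) N; last by exists 0; split=> //; [apply: deg_le0|move/eqP; rewrite (negPf rN)].
  have : lbar (co b v j) = - co b v j.
    rewrite -co_bar_top ?bv ?coN // => l jl; apply/eqP; apply: contraT => /hv[_].
    by have := prec_rk jl; lia.
  by case/lbar_antisym => p pd pe; exists p.
pose p j := projT1 (cid (hp j)).
have pd j : deg_le (p j) (-1) by rewrite /p; case: cid => ? [].
have pe j : rk j = N -> p j - lbar (p j) = co b v j by rewrite /p; case: cid => ? [].
pose q1c j := if (rk j == N) && (co b v j != 0) then p j else 0.
pose q1 := \sum_j q1c j *: b j.
have cq1 j : co b q1 j = q1c j by apply: co_sum.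
have q1D j : co b q1 j != 0 -> D j /\ rk j = N.
  by rewrite cq1 /q1c; case: ifP => [/andP[/eqP -> /hv[]]|]; rewrite ?eqxx.
have bq1 j : co b (bar q1) j != 0 -> D j /\ (rk j <= N)%N.
  move=> cj; have [l cl] : exists l, lbar (co b q1 l) * co b (bar (b l)) j != 0.
    apply: contrapT => h; case/eqP: cj; rewrite co_bar big1 // => l _.
    by apply/eqP; apply: contrapT => /negP hl; apply: h; exists l.
  have l0 : co b q1 l != 0 by apply: contraNneq cl => ->; rewrite lbar0 mul0r.
  have j0 : co b (bar (b l)) j != 0 by apply: contraNneq cl => ->; rewrite mulr0.
  have [Dl rl] := q1D _ l0; have [->|jl] := tri0 j0; first by rewrite rl.
  by split; [apply: hD Dl jl|rewrite -rl ltnW // prec_rk].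
have [] := IH (v - (q1 - bar q1)).
- by rewrite !barB bv barK [RHS]opprB [LHS]addrC opprB.
- move=> j cj.
  have nN : rk j <> N.
    move=> rN; case/eqP: cj; rewrite !coB // co_bar_top => [|l jl]; last first.
      by apply/eqP; apply: contraT => /q1D[_]; have := prec_rk jl; lia.
    rewrite cq1 /q1c rN eqxx /=; have [->|v0] := eqVneq (co b v j) 0.
      by rewrite lbar0 !subr0.
    by rewrite pe // subrr.
  have [v0|/hv[]] := eqVneq (co b v j) 0; last by split=> //; lia.
  have [q0|/q1D[]//] := eqVneq (co b q1 j) 0.
  have := bq1 j; rewrite !coB // v0 q0 !sub0r opprK in cj => /(_ cj)[]; split=> //; lia.
move=> q [qe qd qD]; exists (q1 + q); split.
- by rewrite barD opprD addrACA qe addrC subrK.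
- by move=> j; rewrite coD //; apply: deg_leD => //; rewrite cq1 /q1c; case: ifP => // _; apply: deg_le0.
move=> j; rewrite coD //; have [->|/q1D[] //] := eqVneq (co b q1 j) 0.
by rewrite add0r; apply: qD.
Qed.

(* The Kazhdan-Lusztig argument producing bar-invariant elements. *)
Lemma bar_basis_exists : (forall w, bar (bar w) = w) -> forall i, exists v,
  [/\ bar v = v, forall j, deg_le (co b v j - (j == i)%:R) (-1)
    & forall j, j <> i -> co b v j != 0 -> prec j i].
Proof.
move=> barK i.
have [|||j|q [qe qd qD]] := @bar_antisym (rk i) (prec^~ i) (bar (b i) - b i).
- by rewrite barB barK opprB.
- exact: barK.
- by move=> j l li jl; apply: prec_trans li.
- rewrite coB // co_b //; have [->|/eqP ji] := eqVneq j i; first by rewrite tri1 subrr eqxx.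
  by rewrite subr0 => /tri0[//|h]; split=> //; apply: prec_rk.
have irr j : prec j i -> j <> i by move=> h e; have := prec_rk h; rewrite e ltnn.
exists (b i + q); split.
- have e : bar (b i) = (q - bar q) + b i by rewrite qe subrK.
  by rewrite barD e addrAC subrK addrC.
- by move=> j; rewrite coD // co_b // addrAC subrr add0r.
move=> j /eqP ji; rewrite coD // co_b // (negPf ji) add0r; exact: qD.
Qed.

(** A unitriangular system is inverted by induction on the rank: upwards to express each [b i] in
    terms of [c], downwards to see that a relation is trivial. *)
Lemma tri_fbasis (c : T -> V) : (forall i, co b (c i) i = 1) ->
  (forall i j, j <> i -> co b (c i) j != 0 -> prec j i) -> fbasis c.
Proof.
move=> c1 c0; split.
  have hbs i : exists x : {ffun T -> A}, b i = \sum_k x k *: c k.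
    have [N] := ubnP (rk i); elim: N i => // N IH i lt_N.
    have hx j : exists x : {ffun T -> A}, prec j i -> b j = \sum_k x k *: c k.
      have [p|np] := pselect (prec j i); last by exists [ffun=> 0].
      have [|x xe] := IH j; last by exists x.
      by have := prec_rk p; lia.
    pose x j := projT1 (cid (hx j)).
    have xe j : prec j i -> b j = \sum_k x j k *: c k by rewrite /x; case: cid.
    exists [ffun k => (k == i)%:R - \sum_(j | j != i) co b (c i) j * x j k].
    rewrite (eq_bigr (fun k => (k == i)%:R *: c k - \sum_(j | j != i) (co b (c i) j * x j k) *: c k)); last first.
      by move=> k _; rewrite ffunE scalerBl scaler_suml.
    rewrite sumrB (bigD1 i) //= eqxx scale1r big1 ?addr0 => [|k /negPf ->]; last by rewrite scale0r.
    rewrite exchange_big /= (eq_bigr (fun j => co b (c i) j *: b j)); last first.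
      move=> j /eqP ji; have [->|/(c0 _ _ ji)/xe e] := eqVneq (co b (c i) j) 0.
        by rewrite scale0r big1 // => k _; rewrite mul0r scale0r.
      by rewrite e scaler_sumr; apply: eq_bigr => k _; rewrite scalerA.
    by rewrite {1}(coE hb (c i)) (bigD1 i) //= c1 scale1r addrK.
  pose x i := projT1 (cid (hbs i)).
  have xe i : b i = \sum_k x i k *: c k by rewrite /x; case: cid.
  move=> v; exists [ffun k => \sum_i co b v i * x i k].
  rewrite {1}(coE hb v) (eq_bigr (fun i => \sum_k (co b v i * x i k) *: c k)); last first.
    by move=> i _; rewrite {1}xe scaler_sumr; apply: eq_bigr => k _; rewrite scalerA.
  by rewrite exchange_big; apply: eq_bigr => k _; rewrite ffunE scaler_suml.
move=> x x0; suff h k i : (\max_j rk j - rk i < k)%N -> x i = 0 by move=> i; apply: (h _ i (ltnSn _)).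
elim: k i => // k IH i lt_k.
have := congr1 (fun v => co b v i) x0; rewrite co_suml // co0 // (bigD1 i) //= coZ // c1 mulr1.
rewrite big1 ?addr0 // => j ji; rewrite coZ //.
have [->|cj] := eqVneq (co b (c j) i) 0; first by rewrite mulr0.
rewrite IH ?mul0r //; have ij : i <> j by apply/eqP; rewrite eq_sym.
have := prec_rk (c0 _ _ ij cj); have : (rk j <= \max_j rk j)%N by apply: leq_bigmax.
by lia.
Qed.

End Bar.

End FiniteBasis.

End FiniteBases.
Import FiniteBases.

(** * Restriction of scalars to the Laurent ring *)

Module ScalarRestriction.

Import Order.TTheory GRing.Theory Num.Theory.
Local Open Scope ring_scope.

Local Notation A := laurent.

(** An alias of [M], which already carries its module structure over [R]; coordinates with respect
    to a basis are linear over [A]. *)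
Definition resA (R : algType A) (M : lmodType R) : Type := M.

HB.instance Definition _ (R : algType A) (M : lmodType R) :=
  GRing.Zmodule.copy (resA M) M.

Section RestrictScalars.

Context (R : algType A) (M : lmodType R).

Definition resA_scale (a : A) (m : resA M) : resA M := (a%:A : R) *: (m : M).

Lemma resA_scaleA a b m : resA_scale a (resA_scale b m) = resA_scale (a * b) m.
Proof. by rewrite /resA_scale scalerA -scalerAl mul1r scalerA. Qed.

Lemma resA_scale1 : left_id 1 resA_scale.
Proof. by move=> m; rewrite /resA_scale !scale1r. Qed.

Lemma resA_scaleDr : right_distributive resA_scale +%R.
Proof. by move=> a m m'; rewrite /resA_scale scalerDr. Qed.

Lemma resA_scaleDl m : {morph resA_scale^~ m : a b / a + b}.
Proof. by move=> a b; rewrite /resA_scale !scalerDl. Qed.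

HB.instance Definition _ := GRing.Zmodule_isLmodule.Build A (resA M)
  resA_scaleA resA_scale1 resA_scaleDr resA_scaleDl.

Lemma resAE a (m : resA M) : a *: m = (a%:A : R) *: (m : M). Proof. by []. Qed.

Lemma resA_actZ (h : R) a (m : resA M) : h *: (a *: m : M) = a *: (h *: (m : M) : resA M).
Proof. by rewrite !resAE !scalerA -scalerAr -scalerAl mulr1 mul1r. Qed.

Context (T : finType) (b : T -> M).

Lemma lincomb_fin (c : {malg A[T]}) : lincomb b c = \sum_i (c@_i)%:A *: b i.
Proof.
rewrite /lincomb big_uniq ?fset_uniq //= big_mkcond; apply: eq_bigr => i _.
by case: ifP => // /negbT/mcoeff_outdom ->; rewrite !scale0r.
Qed.

Definition malg_of (c : T -> A) : {malg A[T]} := \sum_i << c i *g i >>.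

Lemma malg_ofE c i : (malg_of c)@_i = c i.
Proof.
rewrite raddf_sum /= (bigD1 i) //= mcoeffUU big1 ?addr0 // => j ji.
by rewrite mcoeffU (negPf ji).
Qed.

Lemma lincomb_malg_of c : lincomb b (malg_of c) = \sum_i (c i)%:A *: b i.
Proof. by rewrite lincomb_fin; apply: eq_bigr => i _; rewrite malg_ofE. Qed.

Lemma is_basis_span : is_basis b -> forall m, exists c : {ffun T -> A}, m = \sum_i (c i)%:A *: b i.
Proof.
case=> g _ gK m; exists [ffun i => (g m)@_i]; rewrite -{1}(gK m) lincomb_fin.
by apply: eq_bigr => i _; rewrite ffunE.
Qed.

Lemma is_basis_free : is_basis b -> forall c : T -> A, \sum_i (c i)%:A *: b i = 0 -> forall i, c i = 0.
Proof.
move=> hb c c0 i; have inj := bij_inj hb.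
have : malg_of c = 0.
  apply: inj; rewrite lincomb_malg_of c0 lincomb_fin big1 // => j _.
  by rewrite mcoeff0 !scale0r.
by move/(congr1 (fun c => c@_i)); rewrite malg_ofE mcoeff0.
Qed.

Lemma bcoordE : is_basis b -> forall (c : T -> A) i,
  (bcoord b (\sum_i (c i)%:A *: b i))@_i = c i.
Proof.
move=> hb c i; rewrite -lincomb_malg_of /bcoord; case: pselect => [e|[]]; last by exists (malg_of c).
by case: (cid e) => /= d /(bij_inj hb) ->; rewrite malg_ofE.
Qed.

Lemma is_basis_fbasis : is_basis b -> fbasis (b : T -> resA M).
Proof.
by move=> hb; split; [apply: is_basis_span|apply: is_basis_free].
Qed.

Lemma bcoord_co : is_basis b -> forall m i, (bcoord b m)@_i = co (b : T -> resA M) m i.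
Proof.
move=> hb m i; rewrite {1}(coE (is_basis_fbasis hb) m) -[RHS](bcoordE hb).
by congr (bcoord b _)@_i.
Qed.

Lemma fbasis_is_basis : fbasis (b : T -> resA M) -> is_basis b.
Proof.
move=> hb; exists (fun m => malg_of (co (b : T -> resA M) m)) => [c|m].
  apply/malgP => i; rewrite malg_ofE lincomb_fin.
  exact: (co_sum hb (fun i => c@_i)).
by rewrite lincomb_malg_of; apply: (esym (coE hb m)).
Qed.

End RestrictScalars.

Section Regular.

Context (R : algType A) (T : finType) (b : T -> R^o).

Lemma fbasis_regular : fbasis (b : T -> resA R^o) <-> fbasis (b : T -> R).
Proof.
have E (c : T -> A) : \sum_i c i *: (b i : resA R^o) = \sum_i c i *: (b i : R).
  by apply: eq_bigr => i _; rewrite resAE /= -[RHS]mulr_algl.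
split=> -[h1 h2]; split=> [v|c].
- by have [c ->] := h1 v; exists c; rewrite -E.
- by rewrite -E; apply: h2.
- by have [c e] := h1 v; exists c; rewrite [LHS]e E.
by move=> c0; apply: h2; rewrite -E.
Qed.

Lemma bcoord_regular : is_basis b -> forall h i, (bcoord b h)@_i = co (b : T -> R) h i.
Proof.
move=> hb h i; have hb' := (fbasis_regular).1 (is_basis_fbasis hb).
rewrite {1}(coE hb' h) -[RHS](bcoordE hb); congr (bcoord b _)@_i.
by apply: eq_bigr => j _; rewrite -[LHS]mulr_algl.
Qed.

End Regular.

End ScalarRestriction.
Import ScalarRestriction.

(** * The Hecke algebra: bar, canonical basis, trace form *)

Module HeckeAlgebra.

Import Order.TTheory GRing.Theory Num.Theory.
Local Open Scope ring_scope.

Local Notation A := laurent.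

Section Hecke.

Context (n : nat) (H : hecke (Sn n)).
Implicit Types (x y h : H) (w v : 'S_n) (i : 'I_n.-1).

Definition Tt w : H := hT H w.
Definition Cc w : H := hC H w.
Definition dU : A := upow 1 - upow (-1).

Lemma basisT : fbasis Tt.
Proof. exact/(fbasis_regular (Tt : 'S_n -> H^o)).1/is_basis_fbasis/(hT_basis H). Qed.

Lemma basisC : fbasis Cc.
Proof. exact/(fbasis_regular (Cc : 'S_n -> H^o)).1/is_basis_fbasis/(hC_basis H). Qed.

Lemma Tt_ind (P : H -> Prop) : P 0 -> (forall x y, P x -> P y -> P (x + y)) ->
  (forall a w, P (a *: Tt w)) -> forall x, P x.
Proof.
move=> P0 PD PT x; rewrite (coE basisT x).
by elim/big_ind: _ => // w _; apply: PT.
Qed.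

Lemma TtM v w : inv (v * w)%g = (inv v + inv w)%N -> Tt v * Tt w = Tt (v * w)%g.
Proof. by rewrite -!(lenE (n := n)) => /(@hT_mul _ H). Qed.

Lemma inv_refl i : inv (refl i) = 1%N.
Proof.
rewrite -[refl i]mulg1 inv_asc ?inv1 // /desc !perm1 /=.
by rewrite -leqNgt leqnSn.
Qed.

Lemma Tt1 : Tt 1%g = 1.
Proof.
have h x : Tt 1%g * x = x.
  elim/Tt_ind: x => [|x y ex ey|a w]; first by rewrite mulr0.
    by rewrite mulrDr ex ey.
  by rewrite -scalerAr TtM ?mul1g // inv1.
by rewrite -[LHS]mulr1 h.
Qed.

Lemma TsT_asc i w : ~~ desc i w -> Tt (refl i) * Tt w = Tt (refl i * w)%g.
Proof. by move=> d; rewrite TtM // inv_asc // inv_refl. Qed.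

Lemma TsTs i : Tt (refl i) * Tt (refl i) = dU *: Tt (refl i) + 1.
Proof.
have := hT_quad H i; rewrite -[hT H _]/(Tt (refl i)).
move: (Tt (refl i)) => t; rewrite mulrDr !mulrBl.
rewrite -!(scalerAr, scalerAl) !mul1r !mulr1 scalerA -upowD /= => e.
have -> : dU *: t = upow 1 *: t - upow (-1) *: t by rewrite scalerBl.
apply/eqP; rewrite -subr_eq0 -[X in _ == X]e; apply/eqP.
have -> : upow (1 - 1) = 1 :> A by [].
by rewrite scale1r !opprD !opprK !addrA addrAC.
Qed.

Lemma TsT_desc i w : desc i w ->
  Tt (refl i) * Tt w = Tt (refl i * w)%g + dU *: Tt w.
Proof.
move=> d; have e : Tt w = Tt (refl i) * Tt (refl i * w)%g.
  by rewrite TsT_asc ?reflMK // desc_refl negbK.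
by rewrite {1}e mulrA TsTs mulrDl mul1r -scalerAl -e addrC.
Qed.

Lemma coTs i x j :
  co Tt (Tt (refl i) * x) j = co Tt x (refl i * j)%g + (if desc i j then dU else 0) * co Tt x j.
Proof.
elim/Tt_ind: x => [|x y ex ey|a w].
- by rewrite mulr0 !(co0 basisT) mulr0 addr0.
- by rewrite mulrDr !(coD basisT) ex ey mulrDr addrACA.
rewrite -scalerAr !(coZ basisT) [_ * (a * _)]mulrCA -mulrDr; congr (_ * _).
rewrite !(co_b basisT).
have e : (refl i * j == w)%g = (j == refl i * w)%g.
  by apply/eqP/eqP => [<-|->]; rewrite reflMK.
have [d|d] := boolP (desc i w).
  rewrite TsT_desc // (coD basisT) (coZ basisT) !(co_b basisT) e.
  by congr (_ + _); have [->|] := eqVneq j w; rewrite ?d ?mulr0.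
rewrite TsT_asc // (co_b basisT) e; have [->|] := eqVneq j w.
  by rewrite (negPf d) mul0r addr0.
by rewrite mulr0 addr0.
Qed.

Definition Cs i : H := Tt (refl i) + (upow (-1))%:A.

Lemma CsE i : hCs H i = Cs i. Proof. by []. Qed.

Lemma coCs i x j : co Tt (Cs i * x) j =
  co Tt x (refl i * j)%g + upow (if desc i j then 1 else -1) * co Tt x j.
Proof.
rewrite mulrDl (coD basisT) coTs -scalerAl mul1r (coZ basisT) -addrA -mulrDl.
by case: ifP => _; [rewrite subrK|rewrite add0r].
Qed.

Lemma TsV i : Tt (refl i) * (Tt (refl i) - dU%:A) = 1.
Proof. by rewrite mulrBr TsTs -scalerAr mulr1 addrAC subrr add0r. Qed.

Lemma VTs i : (Tt (refl i) - dU%:A) * Tt (refl i) = 1.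
Proof. by rewrite mulrBl TsTs -scalerAl mul1r addrAC subrr add0r. Qed.

Lemma inv_uniq (x y z : H) : x * y = 1 -> y * z = 1 -> x = z.
Proof. by move=> xy yz; rewrite -[x]mulr1 -yz mulrA xy mul1r. Qed.

Lemma hbar0 : hbar (0 : H) = 0.
Proof. by have := @hbarZ _ H 0 0; rewrite lbar0 !scale0r. Qed.

Lemma hbarTs i : hbar (Tt (refl i)) = Tt (refl i) - dU%:A.
Proof.
have [h _] := hbarT H (refl i); rewrite -[hT H _]/(Tt (refl i)) in h.
rewrite -[hT H _]/(Tt (refl i)^-1) reflV in h.
exact: inv_uniq h (TsV i).
Qed.

Lemma TtMr w i : ~~ desc i w^-1 -> Tt w * Tt (refl i) = Tt (w * refl i)%g.
Proof.
by move=> d; rewrite TtM // -invV invMg reflV inv_asc // inv_refl invV addn1.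
Qed.

Lemma TtMr_desc w i : desc i w^-1 ->
  Tt w * Tt (refl i) = Tt (w * refl i)%g + dU *: Tt w.
Proof.
move=> d; have e : Tt w = Tt (w * refl i)%g * Tt (refl i).
  by rewrite TtMr ?invMg ?reflV ?desc_refl ?negbK // -mulgA reflK mulg1.
by rewrite {1}e -mulrA TsTs mulrDr mulr1 -scalerAr -e addrC.
Qed.

Lemma hbar_asc i w : ~~ desc i w ->
  hbar (Tt (refl i * w)%g) = hbar (Tt (refl i)) * hbar (Tt w).
Proof.
move=> d; have [_ h2] := hbarT H (refl i * w)%g.
rewrite -[hT H _]/(Tt (refl i * w)^-1) -[hT H _]/(Tt (refl i * w)%g) in h2.
rewrite invMg reflV in h2.
apply/esym; apply: inv_uniq h2; rewrite -TtMr ?invgK //.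
have [h1 _] := hbarT H w; rewrite -mulrA [X in _ * X]mulrA.
by rewrite [X in _ * (X * _)]h1 mul1r hbarTs VTs.
Qed.

(** The record fixes bar only through the inverses of the [Tt w], so multiplicativity is derived:
    first for a left factor [Tt (refl i)], then along reduced words. *)
Lemma hbarM x y : hbar (x * y) = hbar x * hbar y.
Proof.
have step i z : hbar (Tt (refl i) * z) = hbar (Tt (refl i)) * hbar z.
  elim/Tt_ind: z => [|z t ez et|a w].
  - by rewrite mulr0 hbar0 mulr0.
  - by rewrite mulrDr !hbarD ez et mulrDr.
  rewrite -scalerAr !hbarZ -scalerAr; congr (_ *: _).
  have [d|d] := boolP (desc i w); last by rewrite TsT_asc // hbar_asc.
  have e : hbar (Tt w) = hbar (Tt (refl i)) * hbar (Tt (refl i * w)%g).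
    by rewrite -hbar_asc ?reflMK // desc_refl negbK.
  rewrite TsT_desc // hbarD hbarZ e mulrA hbarTs.
  have -> : lbar dU = - dU by rewrite /dU lbarB !lbar_upow opprB.
  set t := Tt (refl i).
  have tt : (t - dU%:A) * (t - dU%:A) = 1 - dU *: (t - dU%:A).
    by rewrite [LHS]mulrBr VTs -scalerAr mulr1.
  by rewrite tt [RHS]mulrBl mul1r scaleNr -[in RHS]scalerAl.
elim/Tt_ind: x => [|x z ex ez|a w].
- by rewrite mul0r hbar0 mul0r.
- by rewrite mulrDl !hbarD ex ez mulrDl.
rewrite -scalerAl !hbarZ -scalerAl; congr (_ *: _).
elim/desc_ind: w y => [|i w d IH] y.
  rewrite Tt1 mul1r; have [_] := hbarT H 1%g.
  rewrite -[hT H _]/(Tt 1^-1%g) -[hT H _]/(Tt 1%g) invg1 Tt1 mul1r => ->.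
  by rewrite mul1r.
by rewrite -TsT_asc // -mulrA !step IH mulrA.
Qed.

Lemma hbar1 : hbar (1 : H) = 1.
Proof. by have [_] := hbarT H 1%g; rewrite -[hT H _]/(Tt 1^-1%g) -[hT H _]/(Tt 1%g) invg1 Tt1 mul1r. Qed.

Lemma hbarB x y : hbar (x - y) = hbar x - hbar y.
Proof. by rewrite -scaleN1r hbarD hbarZ lbarN lbar1 scaleN1r. Qed.

Lemma hbarK x : hbar (hbar x) = x.
Proof.
elim/Tt_ind: x => [|x y ex ey|a w]; first by rewrite !hbar0.
  by rewrite !hbarD ex ey.
rewrite !hbarZ lbarK; congr (_ *: _).
elim/desc_ind: w => [|i w d IH]; first by rewrite Tt1 !hbar1.
rewrite -TsT_asc // !hbarM IH; congr (_ * _).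
rewrite hbarTs hbarB hbarTs hbarZ hbar1.
have -> : lbar dU = - dU by rewrite /dU lbarB !lbar_upow opprB.
by rewrite scaleNr opprK subrK.
Qed.

Lemma hbarCs i : hbar (Cs i) = Cs i.
Proof.
rewrite /Cs hbarD hbarTs hbarZ hbar1 lbar_upow opprK -addrA; congr (_ + _).
by rewrite -scaleNr -scalerDl /dU opprB subrK.
Qed.

Lemma hbar_low w j : co Tt (hbar (Tt w) - Tt w) j != 0 -> (inv j < inv w)%N.
Proof.
elim/desc_ind: w j => [|i w d IH] j.
  by rewrite Tt1 hbar1 subrr (co0 basisT) eqxx.
rewrite -TsT_asc // hbarM hbarTs mulrBl -scalerAl mul1r addrAC -mulrBr.
rewrite (coB basisT) coTs (coZ basisT) inv_asc // ltnS; apply: contraNT; rewrite -ltnNge => lt_wj.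
have z v : (inv w <= inv v)%N -> co Tt (hbar (Tt w) - Tt w) v = 0.
  by move=> le; apply/eqP; apply: contraLR le => /IH; rewrite -ltnNge.
have -> : co Tt (hbar (Tt w)) j = 0.
  have -> : hbar (Tt w) = (hbar (Tt w) - Tt w) + Tt w by rewrite subrK.
  rewrite (coD basisT) z ?(ltnW lt_wj) // add0r (co_b basisT).
  by case: eqP lt_wj => // ->; rewrite ltnn.
rewrite !z ?(ltnW lt_wj) //; first by rewrite !mulr0 subr0 addr0.
have [dj|dj] := boolP (desc i j); first by rewrite (inv_desc dj) in lt_wj.
by rewrite (inv_asc dj) ltnW // ltnW.
Qed.

Lemma tri1T w : co Tt (hbar (Tt w)) w = 1.
Proof.
have -> : hbar (Tt w) = (hbar (Tt w) - Tt w) + Tt w by rewrite subrK.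
rewrite (coD basisT) (co_b basisT) eqxx.
have [->|/hbar_low] := eqVneq (co Tt (hbar (Tt w) - Tt w) w) 0; first by rewrite add0r.
by rewrite ltnn.
Qed.

Lemma tri0T w j : co Tt (hbar (Tt w)) j != 0 -> j = w \/ (inv j < inv w)%N.
Proof.
have -> : hbar (Tt w) = (hbar (Tt w) - Tt w) + Tt w by rewrite subrK.
rewrite (coD basisT) (co_b basisT); have [->|jw] := eqVneq j w; first by left.
by rewrite addr0 => /hbar_low; right.
Qed.

Lemma lt_inv_trans (j i k : 'S_n) : (inv j < inv i)%N -> (inv i < inv k)%N -> (inv j < inv k)%N.
Proof. exact: ltn_trans. Qed.

Lemma hbar_uniq x : hbar x = x -> (forall w, deg_le (co Tt x w) (-1)) -> x = 0.
Proof.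
move=> bx hx.
exact: (bar_uniq basisT (@hbarD _ H) (@hbarZ _ H)
  (prec := fun j i : 'S_n => (inv j < inv i)%N) (rk := @inv n) (fun _ _ => id) tri1T tri0T bx hx).
Qed.

Lemma congTC : cong Tt Cc.
Proof.
move=> w j; have [c cd e] := hC_mod H w.
rewrite {1}/Cc e (coD basisT) -[hT H w]/(Tt w) (co_b basisT) addrAC subrr add0r.
rewrite (lincomb_fin (T := 'S_n)).
have -> : \sum_(v : 'S_n) (c@_v)%:A *: (hT H v : H^o) = \sum_v c@_v *: Tt v.
  by apply: eq_bigr => v _; rewrite -[RHS]mulr_algl.
by rewrite (co_sum basisT (fun v => c@_v)); apply/uinvE.
Qed.

Lemma hbarC w : hbar (Cc w) = Cc w. Proof. exact: hC_bar. Qed.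

Lemma coTC w : co Tt (Cc w) w = 1.
Proof.
have [+ _] := @bar_support H 'S_n Tt basisT (@hbar _ H) (@hbarD _ H) (@hbarZ _ H)
  (fun j i : 'S_n => (inv j < inv i)%N) (@inv n) (fun _ _ => id) lt_inv_trans tri1T tri0T
  (Cc w) w (hbarC w) (congTC w).
by [].
Qed.

Lemma coTC_lt w j : j <> w -> co Tt (Cc w) j != 0 -> (inv j < inv w)%N.
Proof.
have [_ h] := @bar_support H 'S_n Tt basisT (@hbar _ H) (@hbarD _ H) (@hbarZ _ H)
  (fun j i : 'S_n => (inv j < inv i)%N) (@inv n) (fun _ _ => id) lt_inv_trans tri1T tri0T
  (Cc w) w (hbarC w) (congTC w).
exact: h.
Qed.

Lemma coTC_deg w j : j != w -> deg_le (co Tt (Cc w) j) (-1).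
Proof. by move=> jw; have := congTC w j; rewrite (negPf jw) subr0. Qed.

Lemma coC_hbar x w : co Cc (hbar x) w = lbar (co Cc x w).
Proof.
apply: (@co_uniq _ _ _ basisC _ (fun w => lbar (co Cc x w))).
rewrite {1}(coE basisC x).
rewrite (big_morph (@hbar _ H) (@hbarD _ H) hbar0).
by apply: eq_bigr => v _; rewrite hbarZ hbarC.
Qed.

Lemma lbar_const (f : A) : lbar f = f -> deg_le f 0 -> f = (f@_0)%:~R.
Proof.
move=> bf hf; apply/eqP; rewrite -subr_eq0; apply/eqP/lbar_uinv_eq0.
  by rewrite lbarB bf lbar_int.
exact: deg_le_subconst.
Qed.

(** A bar-invariant element without positive powers of u is an integral combination of the [Cc w],
    and the integers are read off modulo u^-1, where the two bases agree. *)
Lemma coC_const x w : hbar x = x -> (forall v, deg_le (co Tt x v) 0) ->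
  co Cc x w = ((co Tt x w)@_0)%:~R.
Proof.
move=> bx hx; have hd := cong_deg_inv basisT basisC congTC hx.
have [_ ->] := cong_deg basisT basisC congTC hd w.
by apply: lbar_const => //; rewrite -coC_hbar bx.
Qed.

(** The product is bar-invariant and its [Tt]-coordinates have degree at most 0, so by [coC_const]
    only their constant terms matter. These come from the leading term of [Cc w] and from its
    coefficients at u^-1, the usual mu. *)
Lemma CsC_asc i w v : ~~ desc i w -> co Cc (Cs i * Cc w) v =
  if desc i v then ((refl i * v == w)%g%:Z + (co Tt (Cc w) v)@_(-1))%:~R else 0.
Proof.
move=> d; have degT j : deg_le (co Tt (Cs i * Cc w) j) 0.
  rewrite coCs; have [dj|dj] := boolP (desc i j).
    apply: deg_leD; last first.
      apply: (@deg_le_upowM 1 _ (-1)); apply: coTC_deg.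
      by apply: contraNneq d => <-.
    have [<-|jw] := eqVneq (refl i * j)%g w; first by rewrite coTC; apply: deg_le_upow.
    by apply: (@deg_leW _ (-1)) => //; apply: coTC_deg.
  have sj : (refl i * j)%g != w by apply: contraNneq d => <-; rewrite desc_refl.
  apply: deg_leD; first by apply: (@deg_leW _ (-1)) => //; apply: coTC_deg.
  have [->|jw] := eqVneq j w; first by rewrite coTC mulr1; apply: (@deg_leW _ (-1)) => //; apply: deg_le_upow.
  by apply: (@deg_leW _ (-1 + -1)) => //; apply: deg_le_upowM; apply: coTC_deg.
rewrite coC_const //; last by rewrite hbarM hbarCs hbarC.
rewrite coCs mcoeffD mcoeff_upowM; have [dv|dv] := boolP (desc i v).
  congr (_ + _)%:~R.
  have [->|jw] := eqVneq (refl i * v)%g w; first by rewrite coTC mcoeff_upow.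
  by rewrite (coTC_deg jw).
have sj : (refl i * v)%g != w by apply: contraNneq d => <-; rewrite desc_refl.
rewrite (coTC_deg sj) // add0r opprK add0r.
have [->|vw] := eqVneq v w; first by rewrite coTC mcoeff_upow.
by rewrite (coTC_deg vw).
Qed.

Lemma CsCs i : Cs i * Cs i = qint 2 *: Cs i.
Proof.
rewrite qint2E scalerDl {1 2}/Cs mulrDr !mulrDl TsTs -!(scalerAl, scalerAr) !mul1r mulr1.
rewrite /Cs !scalerDr !scalerA -!upowD scalerBl.
have -> : upow (1 + -1) = 1 :> A by [].
rewrite scale1r.
move: (upow 1 *: _) (upow (-1) *: _) (upow (-1 + -1) *: _) => a b c.
by rewrite [a - b + 1 + b]addrAC subrK.
Qed.

(** With [w' = refl i * w], the product [Cs i * Cc w'] is [Cc w] plus terms shorter than [w], all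
    with descent [i]; these are covered by induction, and the product itself by [CsCs]. *)
Lemma CsC_desc i w : desc i w -> Cs i * Cc w = qint 2 *: Cc w.
Proof.
have [k] := ubnP (inv w); elim: k w => // k IH w lt_k d.
pose w' := (refl i * w)%g.
have d' : ~~ desc i w' by rewrite desc_refl negbK.
have iw : inv w = (inv w').+1 by apply: inv_desc.
pose X := Cs i * Cc w' - Cc w.
have hX : Cs i * X = qint 2 *: X.
  rewrite (coE basisC X) mulr_sumr scaler_sumr; apply: eq_bigr => v _.
  rewrite -scalerAr scalerA mulrC -scalerA.
  have [->|cv] := eqVneq (co Cc X v) 0; first by rewrite !scale0r.
  have [vw|vw] := eqVneq v w.
    case/eqP: cv; rewrite vw (coB basisC) CsC_asc // (co_b basisC) d eqxx.
    have w0 : co Tt (Cc w') w = 0.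
      apply/eqP; apply: contraT => /coTC_lt; rewrite iw => h.
      by suff : ((inv w').+1 < inv w')%N; [rewrite ltnNge leqnSn|apply: h => e; move: d'; rewrite -e d].
    by rewrite w0 mcoeff0 eqxx addr0 subrr.
  move: cv; rewrite (coB basisC) CsC_asc // (co_b basisC) (negPf vw) subr0.
  case: ifP => [dv|]; last by rewrite eqxx.
  have -> : (refl i * v == w')%g = false.
    by rewrite /w'; apply/negP => /eqP/mulgI e; rewrite e eqxx in vw.
  rewrite add0r => cv; congr (_ *: _); apply: IH => //.
  have : co Tt (Cc w') v != 0.
    by apply: contraNneq cv => ->; rewrite mcoeff0.
  move/coTC_lt => h; apply: leq_trans (_ : inv v < inv w)%N _; last by rewrite -ltnS.
  by rewrite iw ltnS ltnW // h // => e; move: d'; rewrite -e dv.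
have -> : Cc w = Cs i * Cc w' - X by rewrite /X opprB addrC subrK.
by rewrite mulrBr hX mulrA CsCs -scalerAl -scalerBr.
Qed.

(** Since [s] is a descent of [y], the coordinate of [Cc y] at [d] is u^-1 times the one at
    [refl s * d]; so it has a term in degree -1 only when the latter is the leading one. *)
Lemma star_coef (s t : 'I_n.-1) (y d : 'S_n) : desc s y -> ~~ desc t y -> desc t d -> ~~ desc s d ->
  co Cc (Cs t * Cc y) d = ((refl t * d == y)%g + (refl s * d == y)%g)%:R.
Proof.
move=> sy nty td nsd; rewrite CsC_asc // td.
have e : co Tt (Cc y) d = upow (-1) * co Tt (Cc y) (refl s * d)%g.
  have := congr1 (fun x => co Tt x (refl s * d)%g) (CsC_desc sy).
  rewrite /= coCs desc_refl nsd reflMK (coZ basisT) qint2E mulrDl.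
  by rewrite [RHS]addrC => /addIr.
have -> : (co Tt (Cc y) d)@_(-1) = (refl s * d == y)%g.
  rewrite e mcoeff_upowM opprK addNr; have [->|sd] := eqVneq (refl s * d)%g y.
    by rewrite coTC; apply: (mcoeff_int 1).
  by rewrite (coTC_deg sd).
by rewrite -PoszD.
Qed.

(** The anti-involution inverting the indices of the [Tt w]; it exchanges left and right
    statements. *)
Definition hs x : H := \sum_v co Tt x v *: Tt v^-1%g.

Lemma hsT w : hs (Tt w) = Tt w^-1%g.
Proof.
rewrite /hs (bigD1 w) //= (co_b basisT) eqxx scale1r big1 ?addr0 // => v vw.
by rewrite (co_b basisT) (negPf vw) scale0r.
Qed.

Lemma hsD x y : hs (x + y) = hs x + hs y.
Proof.
by rewrite /hs -big_split; apply: eq_bigr => v _; rewrite (coD basisT) scalerDl.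
Qed.

Lemma hsZ a x : hs (a *: x) = a *: hs x.
Proof.
by rewrite /hs scaler_sumr; apply: eq_bigr => v _; rewrite (coZ basisT) scalerA.
Qed.

Lemma hs0 : hs 0 = 0.
Proof. by have := hsZ 0 0; rewrite !scale0r. Qed.

Lemma hs1 : hs 1 = 1.
Proof. by rewrite -Tt1 hsT invg1. Qed.

Lemma hsK x : hs (hs x) = x.
Proof.
elim/Tt_ind: x => [|x y ex ey|a w]; first by rewrite !hs0.
  by rewrite !hsD ex ey.
by rewrite !hsZ !hsT invgK.
Qed.

Lemma hsM x y : hs (x * y) = hs y * hs x.
Proof.
have step i z : hs (Tt (refl i) * z) = hs z * Tt (refl i).
  elim/Tt_ind: z => [|z t ez et|a w].
  - by rewrite mulr0 hs0 mul0r.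
  - by rewrite mulrDr !hsD ez et mulrDl.
  rewrite -scalerAr !hsZ -scalerAl; congr (_ *: _).
  have [d|d] := boolP (desc i w).
    rewrite TsT_desc // hsD hsZ !hsT TtMr_desc ?invgK //.
    by rewrite invMg reflV.
  by rewrite TsT_asc // !hsT TtMr ?invgK // invMg reflV.
elim/Tt_ind: x => [|x z ex ez|a w].
- by rewrite mul0r hs0 mulr0.
- by rewrite mulrDl !hsD ex ez mulrDr.
rewrite -scalerAl !hsZ -scalerAr; congr (_ *: _).
elim/desc_ind: w y => [|i w d IH] y.
  by rewrite Tt1 mul1r hs1 mulr1.
by rewrite -TsT_asc // -mulrA !step IH mulrA.
Qed.

Lemma hs_hbar x : hbar (hs x) = hs (hbar x).
Proof.
elim/Tt_ind: x => [|x y ex ey|a w].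
- by rewrite hs0 hbar0 hs0.
- by rewrite hbarD !hsD hbarD ex ey.
rewrite hbarZ !hsZ hbarZ; congr (_ *: _); rewrite hsT.
have [h _] := hbarT H w^-1%g; rewrite -[hT H _]/(Tt w^-1) -[hT H _]/(Tt w^-1^-1) in h.
apply: inv_uniq h _; rewrite invgK.
have [h _] := hbarT H w; have := congr1 hs h; rewrite hsM hs1.
by rewrite -[hT H w^-1]/(Tt w^-1) hsT invgK.
Qed.

Lemma coT_hs x w : co Tt (hs x) w = co Tt x w^-1%g.
Proof.
apply: (@co_uniq _ _ _ basisT _ (fun w => co Tt x w^-1%g)).
rewrite /hs (reindex_inj invg_inj); apply: eq_bigr => v _.
by rewrite invgK.
Qed.

Lemma hsC w : hs (Cc w) = Cc w^-1%g.
Proof.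
apply/eqP; rewrite -subr_eq0; apply/eqP/hbar_uniq.
  by rewrite hbarB hs_hbar !hbarC.
move=> v; rewrite (coB basisT) coT_hs.
have h1 := congTC w v^-1%g; have h2 := congTC w^-1%g v.
have e : (v^-1%g == w) = (v == w^-1%g) by rewrite eqg_invLR.
have -> : co Tt (Cc w) v^-1%g - co Tt (Cc w^-1%g) v =
   (co Tt (Cc w) v^-1%g - (v^-1%g == w)%:R) - (co Tt (Cc w^-1%g) v - (v == w^-1%g)%:R).
  by rewrite e opprB addrA subrK.
by apply: deg_leD h1 _; apply: deg_leN.
Qed.

Lemma coC_hs x w : co Cc (hs x) w = co Cc x w^-1%g.
Proof.
apply: (@co_uniq _ _ _ basisC _ (fun w => co Cc x w^-1%g)).
rewrite {1}(coE basisC x) (big_morph hs hsD hs0) (reindex_inj invg_inj).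
by apply: eq_bigr => v _; rewrite hsZ hsC invgK.
Qed.

Lemma hsCs i : hs (Cs i) = Cs i.
Proof. by rewrite /Cs hsD hsZ hs1 hsT reflV. Qed.

(** The trace form: the coefficient of [hs x * y] at the identity. The [Tt w] are orthonormal for
    it. *)
Definition form x y : A := \sum_w co Tt x w * co Tt y w.

Lemma formC x y : form x y = form y x.
Proof. by apply: eq_bigr => w _; rewrite mulrC. Qed.

Lemma formDl x y z : form (x + y) z = form x z + form y z.
Proof. by rewrite /form -big_split; apply: eq_bigr => w _; rewrite (coD basisT) mulrDl. Qed.

Lemma formZl a x y : form (a *: x) y = a * form x y.
Proof. by rewrite /form mulr_sumr; apply: eq_bigr => w _; rewrite (coZ basisT) mulrA. Qed.

Lemma form0l x : form 0 x = 0.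
Proof. by have := formZl 0 0 x; rewrite scale0r mul0r. Qed.

Lemma form_eq0 x : form x x = 0 -> x = 0.
Proof.
by move/sum_sqr_eq0 => h; apply: (co_inj basisT) => w; rewrite h (co0 basisT).
Qed.

Lemma form_hs x y : form (hs x) (hs y) = form x y.
Proof.
by rewrite /form (reindex_inj invg_inj); apply: eq_bigr => w _; rewrite !coT_hs invgK.
Qed.

Lemma form_mull h x y : form (h * x) y = form x (hs h * y).
Proof.
have step i z t : form (Tt (refl i) * z) t = form z (Tt (refl i) * t).
  pose e w : A := if desc i w then dU else 0.
  transitivity (\sum_w co Tt z (refl i * w)%g * co Tt t w + \sum_w e w * co Tt z w * co Tt t w).
    by rewrite -big_split; apply: eq_bigr => w _; rewrite coTs mulrDl.
  transitivity (\sum_w co Tt z w * co Tt t (refl i * w)%g + \sum_w e w * co Tt z w * co Tt t w).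
    refine (congr1 (fun a : A => a + _) _).
    have inj : injective (fun w : 'S_n => (refl i * w)%g) := can_inj (@reflMK _ i).
    rewrite [LHS](reindex_inj inj); apply: eq_bigr => w _.
    by rewrite reflMK.
  by rewrite -big_split; apply: eq_bigr => w _; rewrite coTs mulrDr -/(e w) mulrCA mulrA.
elim/Tt_ind: h => [|h g eh eg|a w].
- by rewrite mul0r hs0 mul0r form0l formC form0l.
- by rewrite mulrDl hsD mulrDl formDl eh eg !(formC x) formDl.
rewrite -scalerAl hsZ -scalerAl formZl [RHS]formC formZl [in RHS]formC; congr (_ * _).
rewrite hsT; elim/desc_ind: w y x => [|i w d IH] y x.
  by rewrite invg1 Tt1 !mul1r.
rewrite -TsT_asc // -mulrA step IH invMg reflV -TtMr ?invgK //.
by rewrite mulrA.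
Qed.

Lemma form_mulr h x y : form (x * h) y = form x (y * hs h).
Proof. by rewrite -form_hs hsM form_mull -form_hs hsM !hsK. Qed.

End Hecke.

End HeckeAlgebra.
Import HeckeAlgebra.

(** * The left preorder and right star operations *)

Module RightStars.

Import Order.TTheory GRing.Theory Num.Theory.
Local Open Scope ring_scope.

Local Notation A := laurent.

Section Star.

Context (n : nat).
Implicit Types (w z d : 'S_n) (i j : 'I_n.-1).

Lemma star_cases i j w : i.+1 = j :> nat -> desc i w != desc j w ->
  star i j w = (refl i * w)%g \/ star i j w = (refl j * w)%g.
Proof. by move=> ij dw; rewrite /star (negPf dw); case: ifP; [left|right]. Qed.

Lemma star_uniq i j d z : i.+1 = j :> nat -> desc i d != desc j d ->
  z = (refl i * d)%g \/ z = (refl j * d)%g ->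
  desc i z = desc j d -> desc j z = desc i d -> z = star i j d.
Proof.
move=> ij dd zE zi zj; rewrite /star (negPf dd).
case: zE => e; first by rewrite -e zj eqxx.
case: ifP => // /eqP h; move: zi; rewrite e (desc_pred _ ij) -(desc_succ _ ij) h.
by move=> e'; rewrite e' eqxx in dd.
Qed.

Lemma starK i j w : i.+1 = j :> nat -> star i j (star i j w) = w.
Proof.
move=> ij; have [e|dw] := eqVneq (desc i w) (desc j w).
  by rewrite {2}/star e eqxx /star e eqxx.
have [d1 d2] := star_desc ij dw.
apply/esym/star_uniq => //; first by rewrite d1 d2 eq_sym.
by have [->|->] := star_cases ij dw; rewrite reflMK; [left|right].
Qed.

End Star.

Section Cells.

Context (n : nat) (H : hecke (Sn n)).
Implicit Types (x h : H) (y z w : 'S_n) (i j s t : 'I_n.-1).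

Local Notation Tt := (Tt H).
Local Notation Cc := (Cc H).
Local Notation hbC := (basisC H).

Definition sh y := tshape (Ptab y).

Definition appL z y := exists h, co Cc (h * Cc y) z != 0.

Lemma appearsE z y : appears (M := (halg H)^o) (hC H) z y <-> appL z y.
Proof.
split=> -[h hz]; exists h; move: hz.
  by rewrite (bcoord_regular (T := 'S_n) (hC_basis H)).
by rewrite (bcoord_regular (T := 'S_n) (hC_basis H)).
Qed.

Definition leL := clos_refl_trans 'S_n appL.

Lemma leL_refl y : leL y y. Proof. exact: rt_refl. Qed.

Lemma leL_trans y z w : leL y z -> leL z w -> leL y w. Proof. exact: rt_trans. Qed.

Lemma leLE z y : cell_le (M := (halg H)^o) (hC H) z y <-> leL z y.
Proof.
by split; elim=> {z y} [z y /appearsE|z|z w y _ h1 _ h2];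
  [apply: rt_step|apply: rt_refl|apply: rt_trans h1 h2|apply: rt_step|apply: rt_refl|apply: rt_trans h1 h2].
Qed.

(** Multiplication by [Cs i] produces only basis elements with descent [i], and [2] can be
    cancelled. *)
Lemma CsP i x : Cs H i * x = qint 2 *: x -> forall z, co Cc x z != 0 -> desc i z.
Proof.
move=> e z; apply: contraR => nd.
have : co Cc (Cs H i * x) z = 0.
  rewrite (co_linear hbC (f := fun x => Cs H i * x)); last first.
  - by move=> a v; rewrite -scalerAr.
  - by move=> v v'; rewrite mulrDr.
  rewrite big1 // => w _; have [dw|dw] := boolP (desc i w).
    rewrite CsC_desc // (coZ hbC) (co_b hbC); have [zw|_] := eqVneq z w.
      by rewrite zw dw in nd.
    by rewrite !mulr0.
  by rewrite CsC_asc // (negPf nd) mulr0.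
rewrite e (coZ hbC) => /laurent_mulf_eq0[h|->] //.
by have := qint2_neq0; rewrite h eqxx.
Qed.

Lemma coC_CCs i y z : co Cc (Cc y * Cs H i) z = co Cc (Cs H i * Cc y^-1%g) z^-1%g.
Proof. by rewrite -coC_hs hsM hsC hsCs invgK. Qed.

Lemma CCs_desc i y : desc i y^-1%g -> Cc y * Cs H i = qint 2 *: Cc y.
Proof.
by move=> d; rewrite -[LHS]hsK hsM hsC hsCs CsC_desc // hsZ hsC invgK.
Qed.

Lemma CsPr i x : x * Cs H i = qint 2 *: x -> forall z, co Cc x z != 0 -> desc i z^-1%g.
Proof.
move=> e z cz; apply: (@CsP i (hs x)); last by rewrite coC_hs invgK.
by rewrite -[Cs H i in LHS]hsCs -hsM e hsZ.
Qed.

(** A right descent of [y] is an eigenvector condition for right multiplication, which left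
    multiplication preserves. *)
Lemma appL_descR i z y : appL z y -> desc i y^-1%g -> desc i z^-1%g.
Proof.
by case=> h hz d; apply: CsPr hz; rewrite -mulrA CCs_desc // -scalerAr.
Qed.

Lemma leL_descR i z y : leL z y -> desc i y^-1%g -> desc i z^-1%g.
Proof.
elim=> {z y} [z y /appL_descR|z|z w y _ h1 _ h2] //; first by apply.
by move/h2.
Qed.

Lemma refl_inj : injective (@refl n).
Proof.
move=> s t; wlog st : s t / (s <= t)%N => [W|e].
  by case: (leqP s t) => [/W //|/ltnW/W h /esym/h].
apply/val_inj/eqP; rewrite eqn_leq st leqNgt; apply/negP => lt.
have := refl_fix (i := t) (a := slo s); rewrite -e refl_lo lt => /(_ isT)/(congr1 val) /=.
by lia.
Qed.

Definition starpair i j s t := i.+1 = j :> nat /\ ((s = i /\ t = j) \/ (s = j /\ t = i)).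

Lemma starpair_desc i j s t y : starpair i j s t -> desc s y -> ~~ desc t y ->
  [/\ desc i y != desc j y, desc t (star i j y) & ~~ desc s (star i j y)].
Proof.
case=> ij st sy ty; have dy : desc i y != desc j y.
  by case: st sy ty => -[-> ->] -> /negPf->.
have [d1 d2] := star_desc ij dy.
by case: st sy ty => -[-> ->] sy ty; split; rewrite ?d1 ?d2.
Qed.

(** By [star_coef] the terms without descent [s] differ from [y] by one of the two transpositions,
    and their descents leave only the star of [y]. So a star operation can be isolated by a
    multiplication. *)
Lemma star_co i j s t y d : starpair i j s t -> desc s y -> ~~ desc t y ->
  ~~ desc s d -> co Cc (Cs H t * Cc y) d = (d == star i j y)%:R.
Proof.
move=> st sy ty sd; have [dy tS sS] := starpair_desc st sy ty.
have [td|td] := boolP (desc t d); last first.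
  rewrite CsC_asc // (negPf td); case: eqP => // e.
  by rewrite e tS in td.
have neq : s != t by apply/eqP => e; rewrite e td in sd.
rewrite (star_coef H sy ty td sd).
have ij := st.1; have dd : desc i d != desc j d.
  by case: st.2 sd td => -[-> ->] /negPf-> ->.
have E : ((refl t * d == y)%g || (refl s * d == y)%g) = (d == star i j y).
  apply/idP/eqP => [h|e].
    apply: star_uniq => //.
    - have {}h : d = (refl t * y)%g \/ d = (refl s * y)%g.
        by case/orP: h => /eqP <-; rewrite reflMK; [left|right].
      by case: st.2 h => -[-> ->] []; auto.
    - by case: st.2 => -[<- <-]; rewrite ?(negPf sd) ?td ?sy ?(negPf ty).
    by case: st.2 => -[<- <-]; rewrite ?(negPf sd) ?td ?sy ?(negPf ty).
  have {}e : y = star i j d by rewrite e starK.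
  by case: st.2 (star_cases ij dd) => -[-> ->] [] <-; rewrite e eqxx ?orbT.
rewrite -E; case: eqP => [e1|_]; case: eqP => [e2|_] //.
by case/eqP: neq; apply: refl_inj; apply: (mulIg d); rewrite e1 e2.
Qed.

Lemma appL_star i j y : i.+1 = j :> nat -> appL (star i j y) y.
Proof.
move=> ij; have [e|dy] := eqVneq (desc i y) (desc j y).
  by exists 1; rewrite mul1r /star e eqxx (co_b hbC) eqxx oner_eq0.
have [s [t [st sy ty]]] : exists s t, [/\ starpair i j s t, desc s y & ~~ desc t y].
  case: (boolP (desc i y)) dy => di; [rewrite eq_sym eqb_id|rewrite eq_sym eqbF_neg negbK] => dj.
    by exists i, j; split=> //; split=> //; left.
  by exists j, i; split=> //; split=> //; right.
exists (Cs H t); have [_ _ sd] := starpair_desc st sy ty.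
by rewrite (star_co st sy ty sd) eqxx oner_eq0.
Qed.

Lemma leL_spath c y y' : spath c y y' -> leL y' y /\ leL y y'.
Proof.
elim=> {y y'} [y|i j y y' ij _ _ _ [IH1 IH2]]; first by split; apply: leL_refl.
split; first exact: leL_trans IH1 (rt_step _ _ _ _ (appL_star y ij)).
by apply: leL_trans IH2; apply: rt_step; rewrite -{1}(starK y ij); apply: appL_star.
Qed.

Lemma leL_Ptab y y' : Ptab y = Ptab y' -> leL y y' /\ leL y' y.
Proof. by move/spath_of_Ptab/leL_spath => []. Qed.

Definition rst i j y : 'S_n := (star i j y^-1)^-1%g.

Lemma rst_co i j s t y d : starpair i j s t -> desc s y^-1%g -> ~~ desc t y^-1%g ->
  ~~ desc s d^-1%g -> co Cc (Cc y * Cs H t) d = (d == rst i j y)%:R.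
Proof.
move=> st sy ty sd; rewrite coC_CCs (star_co st) //.
by rewrite -(inj_eq invg_inj) invgK.
Qed.

Lemma co_mulr x h z : co Cc (x * h) z = \sum_y co Cc x y * co Cc (Cc y * h) z.
Proof.
rewrite (co_linear hbC (f := fun x => x * h)) // => [v v'|a v]; first by rewrite mulrDl.
by rewrite scalerAl.
Qed.

Lemma co_mull x h z : co Cc (h * x) z = \sum_y co Cc x y * co Cc (h * Cc y) z.
Proof.
rewrite (co_linear hbC (f := fun x => h * x)) // => [v v'|a v]; first by rewrite mulrDr.
by rewrite scalerAr.
Qed.

(** Right multiplication by [Cs t], read at elements without right descent [s], performs the right
    star on the terms of [x]; these are not merged, the star being injective. *)
Lemma co_rst x i j s t z : starpair i j s t ->
  (forall w, co Cc x w != 0 -> desc s w^-1%g) -> desc s z^-1%g -> ~~ desc t z^-1%g ->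
  co Cc (x * Cs H t) (rst i j z) = co Cc x z.
Proof.
move=> st hx sz tz; have [dz tS sS] := starpair_desc st sz tz.
rewrite co_mulr (bigD1 z) //= (rst_co st) ?invgK // eqxx mulr1.
rewrite big1 ?addr0 // => w wz; have [->|/hx sw] := eqVneq (co Cc x w) 0; first by rewrite mul0r.
have [tw|tw] := boolP (desc t w^-1%g).
  rewrite CCs_desc // (coZ hbC) (co_b hbC); case: eqP => [e|_]; last by rewrite !mulr0.
  by move: sw; rewrite -e invgK (negPf sS).
rewrite (rst_co st) ?invgK //; case: eqP => [|_]; last by rewrite mulr0.
move/invg_inj => e; case/eqP: wz; apply: invg_inj.
by rewrite -(starK w^-1%g st.1) -e starK // st.1.
Qed.

(** The product [h * Cc y * Cs t] is expanded in two ways, with [co_rst] for the outer and [rst_co]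
    for the inner right multiplication. So right stars preserve the coefficients of the left
    action. *)
Lemma co_rst_appL i j s t z y h : starpair i j s t ->
  desc s y^-1%g -> ~~ desc t y^-1%g -> desc s z^-1%g -> ~~ desc t z^-1%g ->
  co Cc (h * Cc (rst i j y)) (rst i j z) = co Cc (h * Cc y) z.
Proof.
move=> st sy ty sz tz; have [dz tS sS] := starpair_desc st sz tz.
rewrite -(@co_rst (h * Cc y) i j s t z) //; last first.
  by move=> w cw; apply: (@appL_descR s w y) => //; exists h.
rewrite -mulrA (co_mull (Cc y * Cs H t)) (bigD1 (rst i j y)) //= (rst_co st) ?eqxx ?mul1r //; last first.
  by rewrite invgK; have [] := starpair_desc st sy ty.
rewrite big1 ?addr0 // => w wy; have [sw|sw] := boolP (desc s w^-1%g).
  have [->|h0] := eqVneq (co Cc (h * Cc w) (rst i j z)) 0; first by rewrite mulr0.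
  by have := @appL_descR s _ w (ex_intro _ h h0) sw; rewrite invgK (negPf sS).
by rewrite (rst_co st) // (negPf wy) mul0r.
Qed.

End Cells.

End RightStars.
Import RightStars.

(** * Left cells and dominance *)

Module CellOrder.

Import Order.TTheory GRing.Theory Num.Theory.
Local Open Scope ring_scope.

Local Notation A := laurent.

Section CellOrder.

Context (n : nat) (H : hecke (Sn n)).
Implicit Types (x h : H) (y z w : 'S_n) (i j s t : 'I_n.-1).

Local Notation Tt := (Tt H).
Local Notation Cc := (Cc H).
Local Notation hbC := (basisC H).
Local Notation leL := (leL H).

(** Right descents only grow on the way down the preorder, so equality at both ends forces it at
    every intermediate element, where [co_rst_appL] then applies. *)
Lemma leL_rst i j z y : i.+1 = j :> nat -> leL z y ->
  desc i z^-1%g = desc i y^-1%g -> desc j z^-1%g = desc j y^-1%g ->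
  leL (rst i j z) (rst i j y).
Proof.
move=> ij; elim=> {z y} [z y [h hz]|z|z w y zw IH1 wy IH2] ei ej.
- have [e|dy] := eqVneq (desc i y^-1%g) (desc j y^-1%g).
    rewrite /rst /star ei ej e eqxx !invgK; apply: rt_step.
    by exists h.
  have [s [t [st sy ty]]] : exists s t, [/\ starpair i j s t, desc s y^-1%g & ~~ desc t y^-1%g].
    case: (boolP (desc i y^-1%g)) dy => di;
      [rewrite eq_sym eqb_id|rewrite eq_sym eqbF_neg negbK] => dj.
      by exists i, j; split=> //; split=> //; left.
    by exists j, i; split=> //; split=> //; right.
  have [sz tz] : desc s z^-1%g /\ ~~ desc t z^-1%g.
    by case: st.2 sy ty => -[-> ->]; rewrite ei ej.
  by apply: rt_step; exists h; rewrite (co_rst_appL _ st).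
- exact: rt_refl.
have E k : desc k z^-1%g = desc k y^-1%g -> desc k z^-1%g = desc k w^-1%g.
  move=> e; apply/idP/idP => [dz|]; last exact: leL_descR zw.
  by apply: leL_descR wy _; rewrite -e.
have [e1 e2] := (E _ ei, E _ ej).
apply: leL_trans (IH1 e1 e2) (IH2 _ _); first by rewrite -e1.
by rewrite -e2.
Qed.

Lemma leL_spath_inv c y z w1 : leL z y -> leL y z -> spath c y^-1%g w1 ->
  exists w1', [/\ spath c z^-1%g w1', leL w1'^-1%g w1^-1%g & leL w1^-1%g w1'^-1%g].
Proof.
move e: (y^-1)%g => v zy yz sp; elim: sp y z e zy yz => {v w1} [v|i j v w1 ij jc dv _ IH] y z e zy yz.
  exists z^-1%g; split; first exact: SPathNil.
    by rewrite -e !invgK.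
  by rewrite -e !invgK.
have E k : desc k z^-1%g = desc k y^-1%g.
  by apply/idP/idP => ?; [apply: leL_descR yz _|apply: leL_descR zy _].
have [|||w1' [sp l1 l2]] := IH (rst i j y) (rst i j z).
- by rewrite invgK e.
- by apply: leL_rst.
- by apply: leL_rst.
exists w1'; split=> //; apply: SPathStep ij jc _ _; first by rewrite !E e.
by rewrite /rst invgK in sp.
Qed.

(** Elements of one left cell have the same right descents and remain in a common left cell under
    parallel right stars. Seen on the inverse words this is the hypothesis of [prefix_shape_le], in
    both directions and for every prefix. *)
Lemma Ptab_of_leL z y : leL z y -> leL y z -> Ptab z = Ptab y.
Proof.
move=> zy yz; apply: Ptab_of_inv_prefix => c cn.
have U w : uniq (take c (word w)) by apply/take_uniq/uniq_word.
apply: partial_sums_inj => [||k]; try exact/tabl_shape0/tabl_Pw/U.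
have D a b : leL a b -> leL b a -> (sumn (take k (tshape (Pw (take c (word a^-1)%g)))) <=
    sumn (take k (tshape (Pw (take c (word b^-1)%g)))))%N.
  move=> ab ba; apply: prefix_shape_le => // w1 sp.
  have [w1' [sp' l1 l2]] := leL_spath_inv ab ba sp.
  by exists w1'; split=> // i; have := leL_descR (i := i) l1; rewrite !invgK.
by apply/eqP; rewrite eqn_leq !D.
Qed.

Definition dom_le (a b : seq nat) := forall k, (sumn (take k a) <= sumn (take k b))%N.

Lemma dom_le_refl a : dom_le a a. Proof. by []. Qed.

Lemma dom_le_trans a b c : dom_le a b -> dom_le b c -> dom_le a c.
Proof. by move=> h1 h2 k; apply: leq_trans (h1 k) (h2 k). Qed.

Lemma sh0 y : 0%N \notin sh y.
Proof. exact/tabl_shape0/tabl_Pw/uniq_word. Qed.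

Lemma dom_le_antisym a b : 0%N \notin a -> 0%N \notin b -> dom_le a b -> dom_le b a -> a = b.
Proof.
move=> a0 b0 h1 h2; apply: partial_sums_inj => // k.
by apply/eqP; rewrite eqn_leq h1 h2.
Qed.

Lemma shV y : sh y^-1%g = sh y. Proof. exact: tshape_PtabV. Qed.

Hypothesis hD : Dom.

(** (Dom) for the chain with a single group, where every element is its own local representative. *)
Lemma leL_dom z y : leL z y -> Ptab z = Ptab y \/ dom_lt (sh z) (sh y).
Proof.
move=> zy; have [yz|nyz] := pselect (leL y z); first by left; apply: Ptab_of_leL.
right; have R w : @is_local_rep (Sn n) (ChainLast (Sn n)) w w.
  by exists (w : gtuple (ChainLast (Sn n))); split=> //; apply: rst_refl.
apply: (hD (IteratedLast H) (y := z) (z := y)) (R z) (R y).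
  exact/leLE.
by case=> _ /leLE.
Qed.

Lemma leL_sh z y : leL z y -> dom_le (sh z) (sh y).
Proof.
by move/leL_dom => [e|[]//]; rewrite /sh e; apply: dom_le_refl.
Qed.

Lemma leL_sh_eq z y : leL z y -> sh z = sh y -> Ptab z = Ptab y.
Proof. by move/leL_dom => [//|[]]. Qed.

Lemma leL_dom_lt lam z y : leL z y -> dom_lt (sh y) lam -> dom_lt (sh z) lam.
Proof.
move=> /leL_sh zy [ne yl]; split; last exact: dom_le_trans zy yl.
move=> e; apply: ne; rewrite -e in yl *.
by apply: dom_le_antisym => //; apply: sh0.
Qed.

Definition supp (Q : 'S_n -> Prop) x := forall w, co Cc x w != 0 -> Q w.

Lemma supp0 Q : supp Q 0.
Proof. by move=> w; rewrite (co0 hbC) eqxx. Qed.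

Lemma suppD Q x x' : supp Q x -> supp Q x' -> supp Q (x + x').
Proof.
move=> hx hy w; rewrite (coD hbC); have [x0|/hx //] := eqVneq (co Cc x w) 0.
by rewrite x0 add0r => /hy.
Qed.

Lemma suppZ Q a x : supp Q x -> supp Q (a *: x).
Proof.
move=> hx w; rewrite (coZ hbC); have [x0|/hx //] := eqVneq (co Cc x w) 0.
by rewrite x0 mulr0 eqxx.
Qed.

Lemma suppN Q x : supp Q x -> supp Q (- x).
Proof. by move=> hx w; rewrite (coN hbC) oppr_eq0 => /hx. Qed.

Lemma supp_sum Q (I : Type) (r : seq I) (P : pred I) (F : I -> H) :
  (forall k, P k -> supp Q (F k)) -> supp Q (\sum_(k <- r | P k) F k).
Proof. by move=> h; apply: big_ind => //; [apply: supp0|move=> *; apply: suppD]. Qed.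

Lemma suppC Q w : Q w -> supp Q (Cc w).
Proof. by move=> q v; rewrite (co_b hbC); have [->|_] := eqVneq v w; rewrite ?eqxx. Qed.

Lemma supp_mull Q h x : (forall z y, leL z y -> Q y -> Q z) -> supp Q x -> supp Q (h * x).
Proof.
move=> cl hx; rewrite (coE hbC x) mulr_sumr; apply: supp_sum => y _.
rewrite -scalerAr; have [->|/hx qy] := eqVneq (co Cc x y) 0.
  by rewrite scale0r; apply: supp0.
by apply: suppZ => w hw; apply: cl qy; apply: rt_step; exists h.
Qed.

Lemma supp_hs Q x : (forall y, Q y^-1%g -> Q y) -> supp Q (hs x) <-> supp Q x.
Proof.
move=> qV; split=> hx w cw; apply: qV; apply: hx; first by rewrite coC_hs invgK.
by rewrite -coC_hs.
Qed.

Lemma supp_mulr Q h x : (forall z y, leL z y -> Q y -> Q z) -> (forall y, Q y^-1%g -> Q y) ->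
  supp Q x -> supp Q (x * h).
Proof.
move=> cl qV hx; apply/(supp_hs _ qV); rewrite hsM.
by apply: supp_mull => //; apply/supp_hs.
Qed.

End CellOrder.

End CellOrder.
Import CellOrder.

(** * Parabolic symmetrizers and Gram-Schmidt *)

Module Symmetrizers.

Import Order.TTheory GRing.Theory Num.Theory.
Local Open Scope ring_scope.

Local Notation A := laurent.

Section Parabolic.

Context (n : nat) (H : hecke (Sn n)) (K : pred 'I_n.-1).
Implicit Types (x h v : H) (y z w : 'S_n) (i j s t : 'I_n.-1).

Local Notation Tt := (Tt H).
Local Notation Cc := (Cc H).
Local Notation hbC := (basisC H).
Local Notation hbT := (basisT H).

Definition blk (a : 'I_n) := #|[pred i : 'I_n.-1 | (i < a)%N && ~~ K i]|.

(** The parabolic subgroup generated by [K], as the stabilizer of its blocks of points; [blk]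
    numbers the blocks. *)
Definition WK : {pred 'S_n} := fun w => [forall a, blk (w a) == blk a].

Lemma WKP w : reflect (forall a, blk (w a) = blk a) (w \in WK).
Proof. exact: 'forall_eqP. Qed.

Lemma blk_refl i a : K i -> blk (refl i a) = blk a.
Proof.
move=> Ki; have e : blk (slo i) = blk (shi i).
  apply: eq_card => j; rewrite !inE /=; have [->|ji] := eqVneq j i.
    by rewrite Ki !andbF.
  by rewrite ltnS [in RHS]leq_eqVlt (inj_eq val_inj) (negPf ji).
by rewrite /refl; case: tpermP => // ->.
Qed.

Lemma WK_refl i w : K i -> ((refl i * w)%g \in WK) = (w \in WK).
Proof.
move=> Ki; have E w' : w' \in WK -> (refl i * w')%g \in WK.
  by move/WKP => h; apply/WKP => a; rewrite permM h blk_refl.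
by apply/idP/idP => /E //; rewrite reflMK.
Qed.

Lemma WKV w : (w^-1%g \in WK) = (w \in WK).
Proof.
have E w' : w' \in WK -> w'^-1%g \in WK.
  by move/WKP => h; apply/WKP => a; rewrite -h permKV.
by apply/idP/idP => /E //; rewrite invgK.
Qed.

Lemma WK_desc w : w \in WK -> (forall i, K i -> ~~ desc i w) -> w = 1%g.
Proof.
move/WKP => h d; apply: no_desc => i; have [/d //|nK] := boolP (K i).
have mono (a b : 'I_n) : (b <= a)%N -> (blk b <= blk a)%N.
  move=> ba; apply: subset_leq_card; apply/subsetP => j; rewrite !inE => /andP[jb ->].
  by rewrite (leq_trans jb).
rewrite /desc -leqNgt leqNgt; apply/negP => /ltnW/mono; rewrite !h leqNgt => /negP; apply.
apply: proper_card; apply/properP; split.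
  by apply/subsetP => j; rewrite !inE => /andP[jb ->]; rewrite /= andbT ltnS ltnW.
by exists i; rewrite !inE /= ?nK ?ltnSn ?ltnn.
Qed.

Definition eK : H := \sum_(w in WK) upow (inv w)%:Z *: Tt w.

Lemma co_eK w : co Tt eK w = if w \in WK then upow (inv w)%:Z else 0.
Proof.
rewrite /eK big_mkcond /= -(co_sum hbT (fun w => if w \in WK then upow (inv w)%:Z else 0)).
by congr (co Tt _ w); apply: eq_bigr => v _; case: ifP; rewrite ?scale0r.
Qed.

Lemma CsT_eq i x : Tt (refl i) * x = upow 1 *: x <-> Cs H i * x = qint 2 *: x.
Proof.
have E : Cs H i * x = Tt (refl i) * x + upow (-1) *: x by rewrite /Cs mulrDl mulr_algl.
rewrite E qint2E scalerDl; split=> [->//|]; exact: addIr.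
Qed.

Lemma TeK i : K i -> Tt (refl i) * eK = upow 1 *: eK.
Proof.
move=> Ki; apply: (co_inj hbT) => w.
rewrite coTs (coZ hbT) !co_eK WK_refl //; case: ifP => _; last by rewrite !mulr0 addr0.
have [d|d] := boolP (desc i w).
  rewrite (inv_desc d) /dU mulrBl -!upowD addrCA.
  set k := inv _; have -> : -1 + k.+1%:Z = k by lia.
  by rewrite subrr addr0.
by rewrite mul0r addr0 (inv_asc d) -upowD; congr upow; lia.
Qed.

Lemma hs_eK : hs eK = eK.
Proof. by apply: (co_inj hbT) => w; rewrite coT_hs !co_eK WKV invV. Qed.

Definition Kfix v := forall i, K i -> Cs H i * v = qint 2 *: v.

Lemma Kfix_eK x : Kfix (eK * x).
Proof. by move=> i Ki; apply/CsT_eq; rewrite mulrA TeK // scalerAl. Qed.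

Lemma TwK v w : Kfix v -> w \in WK -> Tt w * v = upow (inv w)%:Z *: v.
Proof.
move=> fv; elim: {w}_.+1 {-2}w (ltnSn (inv w)) => // N IH w le wK.
have [w1|[i /andP[Ki d]]] : w = 1%g \/ exists i, K i && desc i w.
  have [/existsP h|] := boolP [exists i, K i && desc i w]; first by right.
  rewrite negb_exists => /forallP h; left; apply: WK_desc wK _ => i Ki.
  by have := h i; rewrite Ki.
  by rewrite w1 Tt1 mul1r inv1 -[upow _]/(1 : A) scale1r.
have d' : ~~ desc i (refl i * w)%g by rewrite desc_refl d.
have := TsT_asc H d'; rewrite reflMK => <-.
rewrite -mulrA IH ?WK_refl //; last by rewrite (inv_desc d) in le.
rewrite -scalerAr; have /CsT_eq-> := fv _ Ki.
by rewrite scalerA -upowD (inv_desc d); congr (upow _ *: _); lia.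
Qed.

(** The Poincare polynomial of the parabolic subgroup in u^2, by which [eK] acts on vectors fixed by
    [K]. *)
Definition piK : A := \sum_(w in WK) upow ((inv w).*2)%:Z.

Lemma eK_Kfix v : Kfix v -> eK * v = piK *: v.
Proof.
move=> fv; rewrite /eK /piK mulr_suml scaler_suml; apply: eq_bigr => w wK.
by rewrite -scalerAl TwK // scalerA -upowD -addnn PoszD.
Qed.

Lemma piK_neq0 : piK != 0.
Proof.
apply/eqP => /(congr1 (fun f : A => f@_0)); rewrite mcoeff0 /piK raddf_sum.
have h1 : (1%g : 'S_n) \in WK by apply/WKP => a; rewrite perm1.
rewrite (bigD1 1%g) //= mcoeff_upow inv1 /= => e.
have : (0 : int) < 1%:R + \sum_(w in WK | w != 1%g) (upow (inv w).*2%:Z)@_0.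
  by rewrite ltr_wpDr // sumr_ge0 // => w _; rewrite mcoeff_upow ler0n.
by rewrite e ltxx.
Qed.

Lemma Kfix_supp v w : Kfix v -> co Cc v w != 0 -> forall i, K i -> desc i w.
Proof. by move=> fv cw i Ki; apply: CsP cw; apply: fv. Qed.

End Parabolic.

Section GramSchmidt.

Context (n : nat) (H : hecke (Sn n)).
Implicit Types (x h m : H) (w z : 'S_n).

Local Notation Cc := (Cc H).
Local Notation hbC := (basisC H).

Lemma formDr x (v v' : H) : form x (v + v') = form x v + form x v'.
Proof. by rewrite formC formDl !(formC _ x). Qed.

Lemma formZr a x (v : H) : form x (a *: v) = a * form x v.
Proof. by rewrite formC formZl (formC _ x). Qed.

Lemma supp_cons w (l : seq 'S_n) x : supp (fun v => v \in w :: l) x ->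
  supp (fun v => v \in l) (x - co Cc x w *: Cc w).
Proof.
move=> hx v; rewrite (coB hbC) (coZ hbC) (co_b hbC).
have [->|vw] := eqVneq v w; first by rewrite mulr1 subrr eqxx.
by rewrite mulr0 subr0 => /hx; rewrite inE (negPf vw).
Qed.

(** [A] is not a field, so denominators are absorbed in the factor [a]. Definiteness gives
    [form v v] nonzero unless [v] vanishes, and in that case [w] imposes no new condition. *)
Lemma gram_schmidt (l : seq 'S_n) m : exists a i, [/\ a != 0 :> A, supp (fun v => v \in l) i &
  forall x, supp (fun v => v \in l) x -> form (a *: m - i) x = 0].
Proof.
have NB x (v v' : H) : form (x - v) v' = form x v' - form v v'.
  by rewrite formDl -scaleN1r formZl mulN1r.
elim: l m => [|w l IH] m.
  exists 1, 0; split; [exact: oner_neq0|exact: supp0|move=> x hx].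
  have -> : x = 0 by apply: (co_inj hbC) => v; rewrite (co0 hbC); apply/eqP; apply: contraT => /hx.
  by rewrite formC form0l.
have [b [j [b0 hj jo]]] := IH (Cc w); have [a [i [a0 hi io]]] := IH m.
set v := b *: Cc w - j in jo; set x0 := a *: m - i in io.
have sub x : supp (fun v => v \in l) x -> supp (fun v => v \in w :: l) x.
  by move=> hx u /hx; rewrite inE orbC => ->.
have red y : (forall x, supp (fun v => v \in l) x -> form y x = 0) -> form y v = 0 ->
    forall x, supp (fun v => v \in w :: l) x -> form y x = 0.
  move=> yl yv x hx; rewrite -(subrK (co Cc x w *: Cc w) x) formDr yl ?add0r; last exact: supp_cons.
  rewrite formZr; have : b * form y (Cc w) = 0.
    by rewrite -formZr -(subrK j (b *: Cc w)) formDr yv yl // addr0.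
  by case/laurent_mulf_eq0 => [e|->]; [rewrite e eqxx in b0|rewrite mulr0].
have [v0|v0] := eqVneq v 0.
  exists a, i; split=> //; first exact: sub.
  by apply: red => //; rewrite v0 formC form0l.
have N0 : form v v != 0 by apply: contraNneq v0 => /form_eq0 ->.
exists (form v v * a), (form v v *: i + form x0 v *: v).
have E : (form v v * a) *: m - (form v v *: i + form x0 v *: v) =
    form v v *: x0 - form x0 v *: v.
  by rewrite opprD addrA -scalerA -scalerBr.
split; first exact: laurent_mulf_neq0.
  apply: suppD; apply: suppZ; first exact: sub.
  by rewrite /v; apply: suppD; [apply: suppZ; apply: suppC; rewrite inE eqxx|apply: suppN; apply: sub].
rewrite E; clearbody v x0; apply: red => [x hx|]; rewrite NB !formZl.
  by rewrite (io x hx) (jo x hx) !mulr0 subrr.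
by rewrite mulrC subrr.
Qed.

End GramSchmidt.

End Symmetrizers.
Import Symmetrizers.

(** * Nondegeneracy of the symmetrizer on cell modules *)

Module Nondegeneracy.

Import Order.TTheory GRing.Theory Num.Theory.
Local Open Scope ring_scope.

Local Notation A := laurent.

Section Nondegenerate.

Context (n : nat) (H : hecke (Sn n)) (lam : seq nat).
Implicit Types (x h m : H) (y z w : 'S_n) (i j s t : 'I_n.-1).

Local Notation Tt := (Tt H).
Local Notation Cc := (Cc H).
Local Notation hbC := (basisC H).

Hypothesis hD : Dom.

Definition shK : pred 'I_n.-1 := fun i => sameblock (conjsh lam) i.
Local Notation eK := (eK H shK).

Definition Qeq w := sh w = lam.
Definition Qlt w := dom_lt (sh w) lam.

Definition pr (D : pred 'S_n) x : H := \sum_(w | D w) co Cc x w *: Cc w.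

Lemma co_pr D x w : co Cc (pr D x) w = if D w then co Cc x w else 0.
Proof.
rewrite /pr big_mkcond /= -(co_sum hbC (fun w => if D w then co Cc x w else 0)).
by congr (co Cc _ w); apply: eq_bigr => v _; case: ifP; rewrite ?scale0r.
Qed.

Lemma Qlt_closed z y : leL H z y -> Qlt y -> Qlt z. Proof. exact: leL_dom_lt. Qed.
Lemma QltV y : Qlt y^-1%g -> Qlt y. Proof. by rewrite /Qlt shV. Qed.

Lemma Qlt_mull h x : supp Qlt x -> supp Qlt (h * x).
Proof. by apply: supp_mull; apply: Qlt_closed. Qed.

Lemma Qlt_mulr h x : supp Qlt x -> supp Qlt (x * h).
Proof. by apply: supp_mulr; [apply: Qlt_closed|apply: QltV]. Qed.

Lemma Qeq_Qlt w : Qeq w -> ~ Qlt w.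
Proof. by move=> e []. Qed.

(** The elements of the two-sided cell module that [eK H] kills modulo lower shapes. *)
Definition degen m := supp Qeq m /\ forall h, supp Qlt (eK * (h * m)).

Lemma co_left_support x h w : co Cc (h * x) w != 0 ->
  exists2 y, co Cc x y != 0 & leL H w y.
Proof.
move=> hw; have : supp (fun w => exists2 y, co Cc x y != 0 & leL H w y) (h * x).
  apply: supp_mull => [z y zy [y' xy' yy']|v hv].
    by exists y' => //; apply: leL_trans zy yy'.
  by exists v => //; apply: leL_refl.
by apply.
Qed.

(** Modulo lower shapes the two-sided cell module is the direct sum of its left cells, so the
    condition passes to each sum of left cells. *)
Lemma degen_pr (D : pred 'S_n) m : (forall y z, Ptab y = Ptab z -> D y = D z) ->
  degen m -> degen (pr D m).
Proof.
move=> hDp [mQ mZ]; have pQ (E : pred 'S_n) : supp Qeq (pr E m).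
  by move=> w; rewrite co_pr; case: ifP => _; [apply: mQ|rewrite eqxx].
have key (E : pred 'S_n) h w : (forall y z, Ptab y = Ptab z -> E y = E z) ->
    co Cc (h * pr E m) w != 0 -> E w \/ Qlt w.
  move=> hE /co_left_support[y]; rewrite co_pr; case: ifP => [Ey my|_]; last by rewrite eqxx.
  case/(leL_dom hD) => [e|]; first by left; rewrite (hE _ _ e).
  by rewrite (mQ y my); right.
split=> // h w; rewrite mulrA => hw; have [Dw|//] := key _ _ _ hDp hw.
have hC y z : Ptab y = Ptab z -> predC D y = predC D z by move=> e; rewrite /= (hDp _ _ e).
have [e|/(key _ _ _ hC)[/=|//]] := eqVneq (co Cc (eK * h * pr (predC D) m) w) 0; last by rewrite Dw.
apply: (mZ h); rewrite mulrA; have -> : m = pr D m + pr (predC D) m.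
  apply: (co_inj hbC) => v; rewrite (coD hbC) !co_pr /=.
  by case: (D v); rewrite ?addr0 ?add0r.
by rewrite mulrDr (coD hbC) e addr0.
Qed.

Definition Deq : pred 'S_n := fun w => sh w == lam.

Lemma degen_mulr m g : degen m -> degen (pr Deq (m * g)).
Proof.
move=> [mQ mZ]; split=> [w|h]; first by rewrite co_pr; case: ifP => [/eqP //|_]; rewrite eqxx.
have low : supp Qlt (m * g - pr Deq (m * g)).
  move=> w; rewrite (coB hbC) co_pr; case: ifPn => [_|ne]; first by rewrite subrr eqxx.
  rewrite subr0 => hw; split; first by move/eqP: ne.
  have cl y z : leL H z y -> dom_le (sh y) lam -> dom_le (sh z) lam.
    by move=> zy; apply: dom_le_trans; apply: leL_sh zy.
  apply: (@supp_mulr _ _ (fun w => dom_le (sh w) lam) g m _ _ _ _ hw) => [z y|y|y].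
  - exact: cl.
  - by rewrite shV.
  by move/mQ ->; apply: dom_le_refl.
move: low; set l := m * g - _ => low.
have -> : pr Deq (m * g) = m * g - l by rewrite /l opprB addrC subrK.
clearbody l; rewrite mulrBr mulrBr; apply: suppD; last by apply: suppN; apply: Qlt_mull; apply: Qlt_mull.
by rewrite (mulrA h) mulrA; apply: Qlt_mulr.
Qed.

Lemma Ptab_descR i y z : Ptab y = Ptab z -> desc i y^-1%g = desc i z^-1%g.
Proof.
move=> /(leL_Ptab H)[yz zy]; apply/idP/idP; first exact: leL_descR zy.
exact: leL_descR yz.
Qed.

(** After projection to the left cells with right descent [s], multiplication by [Cs t] on the right
    moves the coefficient at [y] to its right star, by [co_rst]; both steps preserve [degen]. *)
Lemma degen_rst c y w m : spath c y^-1%g w -> degen m -> co Cc m y != 0 ->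
  exists2 m', degen m' & co Cc m' w^-1%g != 0.
Proof.
move e: (y^-1)%g => v sp; elim: sp y e m => {v w} [v|i j v w ij _ dv _ IH] y e m mZ my.
  by exists m => //; rewrite -e invgK.
have [s [t [st sy ty]]] : exists s t, [/\ starpair i j s t, desc s y^-1%g & ~~ desc t y^-1%g].
  rewrite -e in dv; case: (boolP (desc i y^-1%g)) dv => di;
    [rewrite eq_sym eqb_id|rewrite eq_sym eqbF_neg negbK] => dj.
    by exists i, j; split=> //; split=> //; left.
  by exists j, i; split=> //; split=> //; right.
pose D1 : pred 'S_n := fun z => desc s z^-1%g.
have Z1 : degen (pr D1 m) by apply: degen_pr => // a b; apply: Ptab_descR.
apply: (IH (rst i j y) _ (pr Deq (pr D1 m * Cs H t))).
- by rewrite /rst invgK e.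
- exact: degen_mulr.
rewrite co_pr /Deq; have -> : sh (rst i j y) = lam.
  rewrite /rst shV /sh Ptab_star ?st.1 //; rewrite -/(sh _) shV.
  exact: mZ.1.
rewrite eqxx (co_rst st) // => [|u]; first by rewrite co_pr /D1 sy.
by rewrite co_pr; case: ifP => // _; rewrite eqxx.
Qed.

(** Right stars lead from a term of [m] to one whose right descents contain [K]; the projection to
    the left cells with these descents is then an eigenvector for [K] from the right. *)
Lemma degen_Kfix m : degen m -> m != 0 ->
  exists m', [/\ degen m', m' != 0 & forall i, shK i -> m' * Cs H i = qint 2 *: m'].
Proof.
move=> mZ m0; have [y my] : exists y, co Cc m y != 0.
  apply: contrapT => h; case/eqP: m0; apply: (co_inj hbC) => y; rewrite (co0 hbC).
  by apply/eqP; apply: contraT => hy; case: h; exists y.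
have [w sp bw] := blockdesc_exists y^-1%g.
have [m1 Z1 m1w] := degen_rst sp mZ my.
pose D : pred 'S_n := fun z => [forall i, shK i ==> desc i z^-1%g].
exists (pr D m1); split.
- apply: degen_pr => // a b ab; apply: eq_forallb => i.
  by rewrite (Ptab_descR i ab).
- apply/eqP => /(congr1 (fun x => co Cc x w^-1%g)); rewrite co_pr (co0 hbC) ifT.
    exact/eqP.
  apply/forallP => i; apply/implyP; rewrite invgK /shK => Ki; apply: bw.
  by rewrite -/(sh _) shV mZ.1.
move=> i Ki; rewrite /pr mulr_suml scaler_sumr; apply: eq_bigr => w' /forallP/(_ i).
by rewrite Ki => d; rewrite -scalerAl CCs_desc // !scalerA mulrC.
Qed.

(** For [m'] orthogonal to the lower ideal, [eK * h * m'] lies in that ideal, hence is orthogonal to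
    itself and vanishes. As [m'] ends in [eK], the choice [h = hs m'] gives [hs m' * m' = 0], so
    [m' = 0]. Then a nonzero multiple of [m] lies in the lower ideal, against its shape. *)
Lemma nondegenerate m : degen m -> m = 0.
Proof.
move=> mZ; apply/eqP; apply: contraT => /(degen_Kfix mZ){mZ m}[m [[mQ mZ] m0 mK]].
pose l := [seq w <- enum 'S_n | `[< Qlt w >]].
have lE w : (w \in l) = `[< Qlt w >] by rewrite mem_filter mem_enum andbT.
have lQ x : supp (fun w => w \in l) x <-> supp Qlt x.
  by split=> hx w /hx; rewrite lE; [move/asboolP|move/asboolP].
have [a [i [a0 /lQ hi ort]]] := gram_schmidt l m.
set mh := a *: m - i in ort.
pose m' := mh * eK.
have hsKf x : (forall i, shK i -> x * Cs H i = qint 2 *: x) -> Kfix shK (hs x).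
  by move=> hx k Kk; rewrite -[Cs H k]hsCs -hsM hx // hsZ.
have meK x : Kfix shK (hs x) -> x * eK = piK shK *: x.
  by move=> hx; rewrite -[LHS]hsK hsM hs_eK eK_Kfix // hsZ hsK.
have m'K : Kfix shK (hs m') by rewrite /m' hsM hs_eK; apply: Kfix_eK.
have m'E : m' = (a * piK shK) *: m - i * eK.
  by rewrite /m' mulrBl -scalerAl (meK m (hsKf m mK)) scalerA.
have m'ort x : supp Qlt x -> form m' x = 0.
  move=> hx; rewrite /m' form_mulr hs_eK ort //; apply/lQ; exact: Qlt_mulr.
have z1 h : eK * h * m' = 0.
  apply: form_eq0; rewrite form_mull; apply: m'ort; apply: Qlt_mull.
  rewrite m'E mulrBr -scalerAr -mulrA; apply: suppD; first exact: suppZ.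
  by rewrite -!mulrA; apply: suppN; apply: Qlt_mull; apply: Qlt_mull; apply: Qlt_mulr.
have m'0 : m' = 0.
  have := z1 (hs m'); rewrite eK_Kfix // -scalerAl.
  move/(basis_scaler_eq0 hbC (piK_neq0 shK)) => e; apply: form_eq0.
  by rewrite -[X in form m' X]mulr1 -[X in X * 1]hsK -form_mull e form0l.
have [y my] : exists y, co Cc m y != 0.
  apply: contrapT => h; case/eqP: m0; apply: (co_inj hbC) => y; rewrite (co0 hbC).
  by apply/eqP; apply: contraT => hy; case: h; exists y.
case: (Qeq_Qlt (mQ _ my)); apply: (@Qlt_mulr eK i hi).
have /eqP := m'E; rewrite m'0 eq_sym subr_eq0 => /eqP <-.
by rewrite (coZ hbC) laurent_mulf_neq0 // laurent_mulf_neq0 // piK_neq0.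
Qed.

End Nondegenerate.

End Nondegeneracy.
Import Nondegeneracy.

(** * Endomorphisms of a cell module *)

Module CellEndomorphisms.

Import Order.TTheory GRing.Theory Num.Theory.
Local Open Scope ring_scope.

Local Notation A := laurent.

Section CellEndo.

Context (n : nat) (H : hecke (Sn n)) (T : tableau).
Implicit Types (x y h m : H) (z w : 'S_n) (i j s t : 'I_n.-1).

Local Notation Tt := (Tt H).
Local Notation Cc := (Cc H).
Local Notation hbC := (basisC H).
Local Notation lam := (tshape T).
Local Notation eK := (eK H (@shK n lam)).

Hypothesis hD : Dom.

Definition inU : pred 'S_n := fun w => Ptab w == T.
Local Notation prU := (@pr n H inU).

Lemma inU_sh w : inU w -> sh w = lam. Proof. by move/eqP; rewrite /sh => ->. Qed.

Lemma prD x y : prU (x + y) = prU x + prU y.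
Proof. by apply: (co_inj hbC) => w; rewrite (coD hbC) !co_pr (coD hbC); case: ifP; rewrite ?addr0. Qed.

Lemma prZ a x : prU (a *: x) = a *: prU x.
Proof. by apply: (co_inj hbC) => w; rewrite (coZ hbC) !co_pr (coZ hbC); case: ifP; rewrite ?mulr0. Qed.

Lemma pr_lt x : supp (Qlt lam) x -> prU x = 0.
Proof.
move=> hx; apply: (co_inj hbC) => w; rewrite co_pr (co0 hbC); case: ifP => // /inU_sh uw.
by apply/eqP; apply: contraT => /hx; rewrite /Qlt uw => -[].
Qed.

Lemma pr_id m : supp inU m -> prU m = m.
Proof.
move=> hm; apply: (co_inj hbC) => w; rewrite co_pr; case: ifPn => // nw; apply/esym/eqP.
by apply: contraT => /hm; rewrite (negPf nw).
Qed.

Lemma supp_pr m : supp inU (prU m).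
Proof. by move=> w; rewrite co_pr; case: ifP => //; rewrite eqxx. Qed.

Lemma supp_mulU h m : supp inU m -> supp (Qlt lam) (h * m - prU (h * m)).
Proof.
move=> hm w; rewrite (coB hbC) co_pr; case: ifPn => [_|nw]; first by rewrite subrr eqxx.
rewrite subr0 => /co_left_support[y /hm/eqP uy /(leL_dom hD)[e|]].
  by move: nw; rewrite /inU e uy eqxx.
by rewrite /Qlt /sh uy.
Qed.

Lemma pr_mull g h m : supp inU m -> prU (g * (h * m)) = prU (g * prU (h * m)).
Proof.
move=> hm; rewrite -{1}(subrK (prU (h * m)) (h * m)) mulrDr prD pr_lt ?add0r //.
by apply: Qlt_mull => //; apply: supp_mulU.
Qed.

Lemma Cs_ind (P : H -> Prop) : P 1 -> (forall x x', P x -> P x' -> P (x + x')) ->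
  (forall a x, P x -> P (a *: x)) -> (forall i x, P x -> P (Cs H i * x)) -> forall x, P x.
Proof.
move=> P1 PD PZ PC x.
have P0 : P 0 by have := PZ 0 _ P1; rewrite scale0r.
elim/Tt_ind: x => [//|x y|a w]; first exact: PD.
apply: (PZ a); elim/desc_ind: w => [|i w d IH]; first by rewrite Tt1.
rewrite -TsT_asc //; have -> : Tt (refl i) * Tt w = Cs H i * Tt w + (- upow (-1)) *: Tt w.
  by rewrite /Cs mulrDl mulr_algl scaleNr addrK.
by apply: PD; [apply: PC|apply: PZ].
Qed.

Context (f : H -> H) (fD : forall x y, f (x + y) = f x + f y).
Context (fZ : forall a x, f (a *: x) = a *: f x).
Context (fU : forall m, supp inU m -> supp inU (f m)).
Context (fCs : forall i m, supp inU m -> f (prU (Cs H i * m)) = prU (Cs H i * f m)).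

Lemma endo_mull h m : supp inU m -> f (prU (h * m)) = prU (h * f m).
Proof.
move=> hm; elim/Cs_ind: h => [|x x' ex ex'|a x ex|i x ex].
- by rewrite !mul1r !pr_id //; apply: fU.
- by rewrite !mulrDl !prD fD ex ex'.
- by rewrite -!scalerAl !prZ fZ ex.
by rewrite -!mulrA pr_mull // fCs ?ex; [rewrite -pr_mull //; apply: fU|apply: supp_pr].
Qed.

Lemma pr_eK k m : inU k -> blockdesc (conjsh lam) k ->
  prU (eK * m) = co Cc (eK * m) k *: Cc k.
Proof.
move=> uk bk; apply: (co_inj hbC) => w; rewrite co_pr (coZ hbC) (co_b hbC).
case: ifPn => [uw|uw]; last first.
  by case: eqP => [e|_]; rewrite ?mulr0 //; move: uw; rewrite e uk.
case: eqP => [->|ne]; first by rewrite mulr1.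
rewrite mulr0; apply/eqP; apply: contraT => hw; case: ne.
have bw : blockdesc (conjsh lam) w by move=> i Ki; apply: Kfix_supp hw _ Ki; apply: Kfix_eK.
have [e1 e2] : Ptab w = T /\ Ptab k = T by split; apply/eqP.
by apply: blockdesc_uniq; rewrite ?e1 ?e2.
Qed.

(** [k] is the only element of the cell with all descents in [K], and [c] the eigenvalue on [Cc k].
    For [f' = f - c], the class of [eK * h * f' m] is the image under [f'] of a multiple of [Cc k],
    hence zero for all [h], and [nondegenerate] gives [f' m = 0]. *)
Lemma endo_scalar : exists c, forall m, supp inU m -> f m = c *: m.
Proof.
have [[w0 w0U]|nU] := pselect (exists w, inU w); last first.
  exists 0 => m hm; rewrite scale0r; apply: (co_inj hbC) => w; rewrite (co0 hbC).
  by apply/eqP; apply: contraT => /(fU hm) uw; case: nU; exists w.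
have [k sp bk] := blockdesc_exists w0.
have uk : inU k by rewrite /inU -(Ptab_spath sp).
rewrite (eqP w0U) in bk.
have Kk : Kfix (@shK n lam) (Cc k) by move=> i Ki; rewrite CsC_desc //; apply: bk.
have hk : supp inU (Cc k) by apply: suppC.
exists (co Cc (f (Cc k)) k).
pose f' m := f m - co Cc (f (Cc k)) k *: m.
have f'U m : supp inU m -> supp inU (f' m).
  by move=> hm; apply: suppD; [apply: fU|apply: suppN; apply: suppZ].
have f'M h m : supp inU m -> f' (prU (h * m)) = prU (h * f' m).
  move=> hm; rewrite /f' endo_mull // mulrBr -scalerAr -prZ -scaleN1r -[in RHS]scaleN1r.
  by rewrite -prZ -prD.
have f'k : f' (Cc k) = 0.
  have := endo_mull eK hk; rewrite eK_Kfix // prZ pr_id // fZ (pr_eK _ uk bk) => e.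
  have fk : f (Cc k) = co Cc (f (Cc k)) k *: Cc k.
    apply: (co_inj hbC) => w; rewrite (coZ hbC) (co_b hbC).
    case: eqP => [->|/eqP ne]; first by rewrite mulr1.
    have := congr1 (fun x => co Cc x w) e; rewrite !(coZ hbC) (co_b hbC) (negPf ne) !mulr0.
    by case/laurent_mulf_eq0 => // p0; have := piK_neq0 (@shK n lam); rewrite p0 eqxx.
  by rewrite /f' -fk subrr.
move=> m hm; apply/eqP; rewrite -subr_eq0; apply/eqP.
apply: (@nondegenerate _ _ lam hD (f' m)); split.
  by move=> w /(f'U _ hm)/inU_sh.
move=> h w hw; have e : prU (eK * (h * f' m)) = 0.
  rewrite pr_mull; last exact: f'U.
  rewrite -f'M // -f'M; last exact: supp_pr.
  rewrite (pr_eK _ uk bk) /f' fZ !scalerA mulrC -scalerA -scalerBr -/(f' (Cc k)) f'k.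
  by rewrite scaler0.
have := @supp_mulU (eK * h) _ (f'U _ hm); rewrite -mulrA e subr0; exact.
Qed.

End CellEndo.

End CellEndomorphisms.
Import CellEndomorphisms.

(** * A model of the induced regular module *)

Module TensorProduct.

Import Order.TTheory GRing.Theory Num.Theory.
Local Open Scope ring_scope.

Local Notation A := laurent.

Section Tensor.

Context (m : nat) (H : hecke (Sn m.+1)).
Implicit Types (x y h e : H) (w v z : 'S_m.+1) (j : 'I_m.+1) (i : 'I_m).

Local Notation Tt := (Tt H).
Local Notation Cc := (Cc H).
Local Notation hbC := (basisC H).
Local Notation hbT := (basisT H).

(* [H] is free over the parabolic subalgebra on the right of [J], with basis
   the T_(xr j); [hJ j e] is the coordinate of [e] on T_(xr j). *)
Definition hJ j e : H := \sum_(v | jstab v) co Tt e (v * xr j)%g *: Tt v.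

Lemma co_hJ j e v : co Tt (hJ j e) v = if jstab v then co Tt e (v * xr j)%g else 0.
Proof.
rewrite /hJ big_mkcond /= -(co_sum hbT (fun v => if jstab v then co Tt e (v * xr j)%g else 0)).
by congr (co Tt _ v); apply: eq_bigr => u _; case: ifP; rewrite ?scale0r.
Qed.

Lemma hJD j e e' : hJ j (e + e') = hJ j e + hJ j e'.
Proof.
apply: (co_inj hbT) => v; rewrite (coD hbT) !co_hJ (coD hbT).
by case: ifP; rewrite ?addr0.
Qed.

Lemma hJZ j a e : hJ j (a *: e) = a *: hJ j e.
Proof.
apply: (co_inj hbT) => v; rewrite (coZ hbT) !co_hJ (coZ hbT).
by case: ifP; rewrite ?mulr0.
Qed.

Lemma hJ_Ts j i e : i.+1 != m -> hJ j (Tt (@refl m.+1 i) * e) = Tt (@refl m.+1 i) * hJ j e.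
Proof.
move=> im; apply: (co_inj hbT) => v; rewrite coTs !co_hJ coTs mulgA.
have -> : jstab (@refl m.+1 i * v)%g = jstab v.
  have J u : jstab u -> jstab (@refl m.+1 i * u)%g by apply: jstabM; apply: jstab_refl.
  by apply/idP/idP => /J //; rewrite (reflMK (n := m.+1) i).
case: ifP => [jv|_]; last by rewrite mulr0 addr0.
by rewrite desc_jmul //; apply: jasc_xr.
Qed.

Lemma TtJ v j : jstab v -> Tt v * Tt (xr j) = Tt (v * xr j)%g.
Proof. by move=> jv; apply: TtM; apply: inv_jmul => //; apply: jasc_xr. Qed.

Lemma hJ_T j j' v : jstab v -> hJ j (Tt (v * xr j')%g) = if j == j' then Tt v else 0.
Proof.
move=> jv; apply: (co_inj hbT) => u; rewrite co_hJ (co_b hbT).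
have E : jstab u -> (u * xr j == v * xr j')%g = (j == j') && (u == v).
  move=> ju; apply/eqP/andP => [e|[/eqP-> /eqP->//]].
  have jj : j = j' by rewrite -(jmul_max j ju) e jmul_max.
  by split; apply/eqP => //; rewrite -(vJ_mul j ju) e vJ_mul.
case: ifPn => ju; first by rewrite E //; case: eqP => _ /=; rewrite ?(co_b hbT) ?(co0 hbT).
case: ifP => _; rewrite ?(co0 hbT) // (co_b hbT); case: eqP => [e|//].
by rewrite e jv in ju.
Qed.

Lemma hJ_sum e : e = \sum_j hJ j e * Tt (xr j).
Proof.
apply: (co_inj hbT) => z; rewrite (co_suml hbT).
pose j0 := z ord_max; rewrite (bigD1 j0) //= big1 => [|j ne].
  rewrite addr0 /hJ mulr_suml (co_suml hbT) (bigD1 (vJ z)) ?jstab_vJ //=.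
  rewrite -scalerAl TtJ ?jstab_vJ // vJ_xr (coZ hbT) (co_b hbT) eqxx mulr1.
  rewrite big1 ?addr0 // => v /andP[jv ne]; rewrite -scalerAl TtJ // (coZ hbT) (co_b hbT).
  case: eqP => [e1|_]; last by rewrite mulr0.
  by case/eqP: ne; rewrite e1 vJ_mul.
rewrite /hJ mulr_suml (co_suml hbT) big1 // => v jv.
rewrite -scalerAl TtJ // (coZ hbT) (co_b hbT); case: eqP => [e1|_]; last by rewrite mulr0.
by case/eqP: ne; rewrite /j0 e1 jmul_max.
Qed.

(** A function [x] stands for the sum over [j] of [x j] tensored with [Tt (xr j)]; these elements
    form a basis of [H] as a left module over the parabolic subalgebra. *)
Definition HH := {ffun 'I_m.+1 -> (halg H)^o}.

Definition tHH (h : H) (e : (halg H)^o) : HH := [ffun j => h * hJ j e].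

Lemma tHHDl h h' e : tHH (h + h') e = tHH h e + tHH h' e.
Proof. by apply/ffunP => j; rewrite !ffunE mulrDl. Qed.

Lemma tHHDr h e e' : tHH h (e + e') = tHH h e + tHH h e'.
Proof. by apply/ffunP => j; rewrite !ffunE hJD mulrDr. Qed.

Lemma tHHMl h h' e : tHH (h * h') e = h *: tHH h' e.
Proof. by apply/ffunP => j; rewrite !ffunE -mulrA. Qed.

Lemma tHHZl a h e : tHH (a *: h) e = (a%:A : H) *: tHH h e.
Proof. by rewrite -tHHMl mulr_algl. Qed.

Lemma tHHZr a h e : tHH h (a *: e : H) = (a%:A : H) *: tHH h e.
Proof. by rewrite -tHHZl; apply/ffunP => j; rewrite !ffunE hJZ -scalerAr -scalerAl. Qed.

Definition balanced x := forall h e, tHH (h * x) e = tHH h (x * e).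

Lemma balancedM x y : balanced x -> balanced y -> balanced (x * y).
Proof. by move=> bx b_y h e; rewrite mulrA b_y bx mulrA. Qed.

Lemma balancedD x y : balanced x -> balanced y -> balanced (x + y).
Proof. by move=> bx b_y h e; rewrite mulrDr mulrDl tHHDl tHHDr bx b_y. Qed.

Lemma balancedZ a x : balanced x -> balanced (a *: x).
Proof. by move=> bx h e; rewrite -scalerAr -scalerAl tHHZl tHHZr bx. Qed.

Lemma balanced1 : balanced 1.
Proof. by move=> h e; rewrite mulr1 mul1r. Qed.

Lemma balanced0 : balanced 0.
Proof. by have := balancedZ 0 balanced1; rewrite scale0r. Qed.

Lemma balanced_Ts i : i.+1 != m -> balanced (Tt (@refl m.+1 i)).
Proof. by move=> im h e; apply/ffunP => j; rewrite !ffunE hJ_Ts // mulrA. Qed.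

Lemma balanced_T v : jstab v -> balanced (Tt v) /\ balanced (hbar (Tt v)).
Proof.
elim/jstab_ind => [|i w im d _ [b1 b2]].
  by rewrite Tt1 hbar1; split; apply: balanced1.
rewrite -TsT_asc // hbarM; split; apply: balancedM => //; first exact: balanced_Ts.
rewrite hbarTs; apply: balancedD; first exact: balanced_Ts.
by rewrite -scaleNr; apply/balancedZ/balanced1.
Qed.

Lemma balanced_hbar_hJ j e : balanced (hbar (hJ j e)).
Proof.
rewrite /hJ (big_morph _ (@hbarD _ H) (hbar0 H)).
apply: big_ind => [|x y|v jv]; [exact: balanced0|exact: balancedD|].
by rewrite hbarZ; apply: balancedZ; case: (balanced_T jv).
Qed.

Lemma HH_sum (x : HH) : x = \sum_j tHH (x j) (Tt (xr j)).
Proof.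
apply/ffunP => j; rewrite sum_ffunE (bigD1 j) //= big1 => [|k ne].
  by rewrite addr0 ffunE -{1}(mul1g (xr j)) hJ_T ?jstab1 // eqxx Tt1 mulr1.
by rewrite ffunE -{1}(mul1g (xr k)) hJ_T ?jstab1 // eq_sym (negPf ne) mulr0.
Qed.

(** The coordinates [hJ j e] lie in the parabolic subalgebra, so a balanced map moves them to the
    first argument and is determined by its values at the [Tt (xr j)]. *)
Lemma HH_tensor : is_tensor (Jlink m.+1) tHH.
Proof.
have E (js : seq (lset (Jlink m.+1))) : jstab (cword (map (@lfst _ _ (Jlink m.+1)) js)).
  by apply/jstab_word; exists js.
split; [split| |].
- exact: tHHDl.
- exact: tHHDr.
- by move=> h e a js; have [b _] := balanced_T (E js); rewrite (balancedZ a b).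
- exact: tHHMl.
move=> V f [fDl fDr fb].
have f0l e : f 0 e = 0 by apply: (addIr (f 0 e)); rewrite -fDl !add0r.
have f0r h : f h 0 = 0 by apply: (addIr (f h 0)); rewrite -fDr !add0r.
split; last first.
  move=> F G FG x; rewrite (HH_sum x) !raddf_sum; apply: eq_bigr => j _; exact: FG.
pose F (x : HH) := \sum_j f (x j) (Tt (xr j)).
have FB : additive F.
  move=> x y; rewrite /F -sumrB; apply: eq_bigr => j _; rewrite !ffunE.
  by apply/eqP; rewrite eq_sym subr_eq -fDl subrK.
pose Fm := GRing.isZmodMorphism.Build _ _ F FB.
pose FF : {additive HH -> V} := HB.pack F Fm.
exists FF => h e; rewrite /FF /= /F.
have fJ h' e' x : (exists c : 'S_m.+1 -> A, x = \sum_(v | jstab v) c v *: Tt v) ->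
    f (h' * x) e' = f h' (x * e').
  case=> c ->; rewrite mulr_sumr mulr_suml.
  rewrite (big_morph (f^~ e') (fun a b => fDl a b e') (f0l e')).
  rewrite (big_morph (f h') (fDr h') (f0r h')); apply: eq_bigr => v /jstab_word[ks <-].
  by rewrite fb.
rewrite [in RHS](hJ_sum e) (big_morph (f h) (fDr h) (f0r h)); apply: eq_bigr => j _.
by rewrite ffunE fJ //; exists (fun v => co Tt e (v * xr j)%g).
Qed.

Definition mbar (x : HH) : HH := \sum_j tHH (hbar (x j)) (hbar (Tt (xr j))).

Lemma mbarD (x y : HH) : mbar (x + y) = mbar x + mbar y.
Proof.
by rewrite /mbar -big_split; apply: eq_bigr => j _; rewrite ffunE hbarD tHHDl.
Qed.

Lemma tHH_sumr (I : Type) (r : seq I) (P : pred I) (F : I -> H) h :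
  tHH h (\sum_(k <- r | P k) F k) = \sum_(k <- r | P k) tHH h (F k).
Proof.
apply: (big_morph (tHH h) (tHHDr h)); apply: (addIr (tHH h 0)).
by rewrite -tHHDr !add0r.
Qed.

Lemma mbar_t h e : mbar (tHH h e) = tHH (hbar h) (hbar e).
Proof.
rewrite [in RHS](hJ_sum e) (big_morph _ (@hbarD _ H) (hbar0 H)) tHH_sumr.
by apply: eq_bigr => j _; rewrite ffunE !hbarM balanced_hbar_hJ.
Qed.

Lemma mbar0 : mbar 0 = 0.
Proof. by apply: (addIr (mbar 0)); rewrite -mbarD !add0r. Qed.

Lemma mbarK (x : HH) : mbar (mbar x) = x.
Proof.
rewrite [in RHS](HH_sum x) {2}/mbar (big_morph mbar mbarD mbar0); apply: eq_bigr => j _.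
by rewrite mbar_t !hbarK.
Qed.

Lemma mbarZ (a : A) (x : HH) : mbar ((a%:A : H) *: x) = ((lbar a)%:A : H) *: mbar x.
Proof.
rewrite /mbar scaler_sumr; apply: eq_bigr => j _; rewrite ffunE -tHHZl.
by rewrite -[_ *: x j]/(a%:A * x j) mulr_algl hbarZ.
Qed.

End Tensor.

End TensorProduct.
Import TensorProduct.

(** * The canonical basis indexed by first components *)

Module CanonicalBasis.

Import Order.TTheory GRing.Theory Num.Theory.
Local Open Scope ring_scope.

Local Notation A := laurent.

Lemma fbasis_bij (V : lmodType A) (T T' : finType) (b : T -> V) (r : T' -> T) :
  fbasis b -> bijective r -> fbasis (b \o r) /\ (forall v i, co (b \o r) v i = co b v (r i)).
Proof.
move=> hb [r' rK r'K].
have S (c : T' -> A) : \sum_i c i *: b (r i) = \sum_j c (r' j) *: b j.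
  rewrite (reindex r) /=; last by exists r' => ? _; [apply: rK|apply: r'K].
  by apply: eq_bigr => i _; rewrite rK.
have hbr : fbasis (b \o r).
  split=> [v|c /= e i]; last by rewrite S in e; have := hb.2 _ e (r i); rewrite rK.
  exists [ffun i => co b v (r i)] => /=.
  rewrite (eq_bigr (fun i => co b v (r i) *: b (r i))) => [|i _]; last by rewrite ffunE.
  by rewrite (S (fun i => co b v (r i))) {1}(coE hb v); apply: eq_bigr => j _; rewrite r'K.
split=> // v i; apply: (co_uniq hbr (c := fun i => co b v (r i))).
by rewrite /= (S (fun i => co b v (r i))) {1}(coE hb v); apply: eq_bigr => j _; rewrite r'K.
Qed.

Lemma cong_bij (V : lmodType A) (T T' : finType) (b c : T -> V) (r : T' -> T) :
  fbasis b -> bijective r -> cong b c -> cong (b \o r) (c \o r).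
Proof.
move=> hb hr bc i j; rewrite (fbasis_bij hb hr).2 /=; have := bc (r i) (r j).
by rewrite (inj_eq (bij_inj hr)).
Qed.

Section Bases.

Context (m : nat) (H : hecke (Sn m.+1)).
Implicit Types (h e : H) (w v z : 'S_m.+1) (j : 'I_m.+1) (i : 'I_m).

Local Notation Tt := (Tt H).
Local Notation Cc := (Cc H).
Local Notation hbC := (basisC H).
Local Notation hbT := (basisT H).
Local Notation V := (resA (HH H)).
Local Notation tHH := (@tHH m H).
Local Notation TI := ('S_m.+1 * 'I_m.+1)%type.

Lemma tHH_xr (h : H) j j' : tHH h (Tt (xr j)) j' = if j' == j then h else 0.
Proof.
rewrite ffunE -{1}(mul1g (xr j)) hJ_T ?jstab1 // Tt1.
by case: eqP => _; rewrite ?mulr1 ?mulr0.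
Qed.

Section Product.

Context (b : 'S_m.+1 -> H) (hb : fbasis b).

Definition bHH (p : TI) : V := tHH (b p.1) (Tt (xr p.2)).

Lemma bHH_sum (c : TI -> A) j : (\sum_p c p *: bHH p : HH H) j = \sum_z c (z, j) *: b z.
Proof.
rewrite sum_ffunE.
transitivity (\sum_(p : TI) if p.2 == j then c p *: b p.1 else 0).
  apply: eq_bigr => p _; rewrite resAE -[in LHS]tHHZl tHH_xr eq_sym.
  by [].
rewrite -big_mkcond /= (reindex (fun z => (z, j))) /=.
  by apply: eq_big => [z|z _] //; rewrite eqxx.
by exists (fun p : TI => p.1) => // -[z k]; rewrite inE /= => /eqP ->.
Qed.

Lemma fbasis_HH : fbasis bHH.
Proof.
split=> [x|c e [z j]].
  exists [ffun p : TI => co b (x p.2) p.1]; apply/ffunP => j.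
  rewrite bHH_sum {1}(coE hb (x j)); apply: eq_bigr => z _; by rewrite ffunE.
have := congr1 (fun x : HH H => x j) e; rewrite /= bHH_sum ffunE.
by move/(hb.2 (fun z => c (z, j))).
Qed.

Lemma co_HH (x : HH H) z j : co bHH x (z, j) = co b (x j) z.
Proof.
apply: (co_uniq fbasis_HH (c := fun p : TI => co b (x p.2) p.1)).
by apply/ffunP => k; rewrite bHH_sum; apply: coE.
Qed.

End Product.

Definition bT := bHH Tt.
Definition bC := bHH Cc.
Lemma fbT : fbasis bT. Proof. exact/fbasis_HH/hbT. Qed.
Lemma fbC : fbasis bC. Proof. exact/fbasis_HH/hbC. Qed.

Lemma cong_bTC : cong bT bC.
Proof.
move=> [z j] [z' j']; rewrite (co_HH hbT) tHH_xr /= xpair_eqE.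
have [_|ne] := eqVneq j' j; first by rewrite andbT; apply: congTC.
by rewrite (co0 hbT) andbF subr0; apply: deg_le0.
Qed.

(** A term of the bar of [Tt (xr j)] at [v * xr j'] has length the sum of both, so if [xr j'] is at
    least as long as [xr j] only the leading term is left. *)
Lemma hJ_hbar_xr j j' : (hJ j' (hbar (Tt (xr j))) = if j' == j then 1 else 0) \/
  (inv (xr j') < inv (xr j))%N.
Proof.
have [lt|ge] := ltnP (inv (xr j')) (inv (xr j)); first by right.
left; apply: (co_inj hbT) => v; rewrite co_hJ.
have E : co Tt (if j' == j then 1 else 0 : H) v = ((j' == j) && (v == 1%g))%:R.
  by case: eqP => _; rewrite ?(co0 hbT) // -(Tt1 H) (co_b hbT).
rewrite E; case: ifPn => [jv|nv]; last first.
  by case: (v =P 1%g) => [e|_]; rewrite ?andbF //; move: nv; rewrite e jstab1.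
have [e|/(tri0T (H := H))[e|]] := eqVneq (co Tt (hbar (Tt (xr j))) (v * xr j')%g) 0.
- rewrite e; case: (j' =P j) => [jj|] //=; case: eqP => // v1; move: e.
  by rewrite jj v1 mul1g tri1T => /eqP; rewrite oner_eq0.
- have jj : j' = j by rewrite -(jmul_max j' jv) e xr_max.
  rewrite e tri1T jj eqxx /=; move: e; rewrite jj -[RHS]mul1g => /mulIg ->.
  by rewrite eqxx.
by rewrite inv_jmul //; [lia|apply: jasc_xr].
Qed.

Hypothesis hD : Dom.

Definition precC (p q : TI) := (inv (xr p.2) < inv (xr q.2))%N /\ dom_le (sh p.1) (sh q.1).

Lemma mbar_bC p j : mbar (bC p) j = Cc p.1 * hJ j (hbar (Tt (xr p.2))).
Proof. by rewrite mbar_t ffunE hbarC. Qed.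

Lemma bC_tri1 p : co bC (mbar (bC p)) p = 1.
Proof.
case: p => z j; rewrite (co_HH hbC) mbar_bC /=; case: (hJ_hbar_xr j j) => [->|].
  by rewrite eqxx mulr1 (co_b hbC) eqxx.
by rewrite ltnn.
Qed.

Lemma dom_closed lam z w : leL H z w -> dom_le (sh w) lam -> dom_le (sh z) lam.
Proof. by move=> zw; apply: dom_le_trans; apply: leL_sh zw. Qed.

(** The first factors of the bar lie in the right ideal of [Cc z], whose shapes are at most that of
    [z]; this is why shapes can enter [precC]. *)
Lemma bC_tri0 p q : co bC (mbar (bC p)) q != 0 -> q = p \/ precC q p.
Proof.
case: p q => z j [z' j']; rewrite (co_HH hbC) mbar_bC /=.
case: (hJ_hbar_xr j j') => [->|lt].
  case: (j' =P j) => [->|_]; last by rewrite mulr0 (co0 hbC) eqxx.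
  by rewrite mulr1 (co_b hbC); case: (z' =P z) => [->|_]; [left|rewrite eqxx].
move=> hz; right; split=> //=.
apply: (@supp_mulr _ _ (fun w => dom_le (sh w) (sh z)) _ (Cc z) _ _ _ _ hz) => [u w|w|].
- exact: dom_closed.
- by rewrite shV.
by apply: suppC; apply: dom_le_refl.
Qed.

Lemma precC_trans p q r : precC p q -> precC q r -> precC p r.
Proof. by move=> [h1 h2] [h3 h4]; split; [apply: ltn_trans h3|apply: dom_le_trans h4]. Qed.

Lemma cb_exists p : exists v : V, [/\ mbar v = v,
  forall q, deg_le (co bC v q - (q == p)%:R) (-1) & forall q, q <> p -> co bC v q != 0 -> precC q p].
Proof.
apply: (bar_basis_exists fbC (bar := @mbar m H) (@mbarD _ _) (@mbarZ _ _) (prec := precC)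
  (rk := fun p => inv (xr p.2))).
- by move=> p' q [].
- exact: precC_trans.
- exact: bC_tri1.
- exact: bC_tri0.
exact: mbarK.
Qed.

Definition cb p : V := projT1 (cid (cb_exists p)).

Lemma mbar_cb p : mbar (cb p) = cb p.
Proof. by rewrite /cb; case: cid => v []. Qed.
Lemma cong_bCcb : cong bC cb.
Proof. by move=> p; rewrite /cb; case: cid => v []. Qed.
Lemma cb_tri p q : q <> p -> co bC (cb p) q != 0 -> precC q p.
Proof. by rewrite /cb; case: cid => v [] /= _ _ tr; apply: tr. Qed.

Lemma cb_diag p : co bC (cb p) p = 1.
Proof.
have [] := bar_support fbC (bar := @mbar m H) (@mbarD _ _) (@mbarZ _ _) (prec := precC)
  (rk := fun p => inv (xr p.2)) (fun _ _ pq => proj1 pq) (@precC_trans) bC_tri1 bC_tri0 (mbar_cb p)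
  (@cong_bCcb p); done.
Qed.

Lemma fcb : fbasis cb.
Proof.
apply: (tri_fbasis fbC (prec := precC) (rk := fun p => inv (xr p.2)) _ cb_diag).
- by move=> p q [].
by move=> p q; apply: cb_tri.
Qed.

Lemma cong_bTcb : cong bT cb.
Proof. exact: cong_trans fbT fbC fcb cong_bTC cong_bCcb. Qed.

End Bases.

End CanonicalBasis.
Import CanonicalBasis.

(** * Local labels and local sequences *)

Module LocalLabels.

Import Order.TTheory GRing.Theory Num.Theory.
Local Open Scope ring_scope.

Local Notation A := laurent.

(** Downward induction on the rank: outside [D] no [c i] of higher rank in the support of [v] can
    contribute at [j], so the [c]-coordinate equals the [b]-coordinate there. *)
Lemma co_support_tri (V : lmodType A) (T : finType) (b c : T -> V) (rk : T -> nat)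
    (D : T -> Prop) (v : V) : fbasis b -> fbasis c -> (forall i, co b (c i) i = 1) ->
  (forall i j, j <> i -> co b (c i) j != 0 -> (rk j < rk i)%N /\ (D i -> D j)) ->
  (forall j, co b v j != 0 -> D j) -> forall j, co c v j != 0 -> D j.
Proof.
move=> hb hc c1 ctri vD.
suff E N j : (\max_i rk i - rk j < N)%N -> co c v j != 0 -> D j.
  by move=> j; apply: (E _ j (ltnSn _)).
elim: N j => // N IH j jN vj; have [//|nD] := pselect (D j); apply: vD.
rewrite (co_change _ _ hb hc) (bigD1 j) //= c1 mulr1 big1 ?addr0 // => i ij.
have [->|bj] := eqVneq (co b (c i) j) 0; first by rewrite mulr0.
have [|lt Dij] := ctri i j _ bj; first by apply/eqP; rewrite eq_sym.
have [->|vi] := eqVneq (co c v i) 0; first by rewrite mul0r.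
case: nD; apply: Dij; apply: (IH i) => //.
have := leq_bigmax (F := rk) i; move: (\max_i _) jN lt; lia.
Qed.

Section Reindex.

Context (m : nat).
Implicit Types (w v y : 'S_m.+1) (j : 'I_m.+1) (i : 'I_m).

Definition WJ := {w : 'S_m.+1 | minR (C := Sn m.+1) (@lfst _ _ (Jlink m.+1)) w}.

(** From the normal form at the second component to that at the first: in [z = v * xr j] the factor
    [v] in W_J is handed over to the first component. *)
Definition rho (z : WJ * 'S_m.+1) : 'S_m.+1 * 'I_m.+1 := ((val z.1 * vJ z.2)%g, z.2 ord_max).

Definition toWJ w (h : minR (C := Sn m.+1) (@lfst _ _ (Jlink m.+1)) w) : WJ :=
  exist (fun w => minR (C := Sn m.+1) (@lfst _ _ (Jlink m.+1)) w) w h.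

Lemma WJ_jasc (w : WJ) : jasc (val w)^-1%g.
Proof. exact/minRE/(valP w). Qed.

Lemma inv_WJ (w : WJ) v : jstab v -> inv (val w * v)%g = (inv (val w) + inv v)%N.
Proof.
move=> jv; rewrite -invV invMg inv_jmul ?jstabV //; last exact: WJ_jasc.
by rewrite !invV addnC.
Qed.

Lemma WJ_uniq (w w' : WJ) v v' : jstab v -> jstab v' -> (val w * v = val w' * v')%g -> w = w' /\ v = v'.
Proof.
move=> jv jv' e; have {}e' : (v^-1 * (val w)^-1 = v'^-1 * (val w')^-1)%g by rewrite -!invMg e.
have a : (val w)^-1%g ord_max = (val w')^-1%g ord_max.
  have h u (x : 'S_m.+1) : jstab u -> (u^-1 * x)%g ord_max = x ord_max.
    by rewrite -jstabV => /eqP ju; rewrite permM ju.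
  by rewrite -(h v) // e' h.
have e1 : val w = val w'.
  by apply: invg_inj; rewrite (jasc_uniq (WJ_jasc w)) (jasc_uniq (WJ_jasc w')) a.
split; first exact: val_inj.
by move: e; rewrite e1 => /mulgI.
Qed.

Lemma WJ_decomp y : exists (w : WJ) v, jstab v /\ y = (val w * v)%g.
Proof.
have jw : minR (C := Sn m.+1) (@lfst _ _ (Jlink m.+1)) ((xr (y^-1%g ord_max))^-1)%g.
  by apply/minRE; rewrite invgK; apply: jasc_xr.
exists (toWJ jw), (vJ y^-1)^-1%g; split; first by rewrite jstabV jstab_vJ.
by rewrite /= -invMg vJ_xr invgK.
Qed.

Lemma vJ_jmul v (z : 'S_m.+1) : jstab v -> vJ (v * z)%g = (v * vJ z)%g.
Proof. by move=> /eqP jv; rewrite /vJ permM jv mulgA. Qed.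

Lemma rho_bij : bijective rho.
Proof.
have inj : injective rho.
  move=> [w z] [w' z'] [/= e1 e2]; have [|| -> ev] := WJ_uniq _ _ e1; try exact: jstab_vJ.
  by rewrite -(vJ_xr z) ev e2 vJ_xr.
have sur p : exists z : WJ * 'S_m.+1, rho z == p.
  case: p => y j; have [w [v [jv ->]]] := WJ_decomp y.
  by exists (w, (v * xr j)%g); rewrite /rho /= vJ_mul // jmul_max.
exists (fun p => xchoose (sur p)) => [z|p]; last exact/eqP/(xchooseP (sur p)).
by apply: inj; apply/eqP/(xchooseP (sur (rho z))).
Qed.

Local Notation gpair := (gtuple (chain2 m.+1)).

(** These two quantities are unchanged when an element of W_J changes sides, and they determine the
    normal forms, so local components are well defined. *)
Lemma gequiv_inv (t t' : gpair) : gequiv t t' ->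
  ((t.1 : 'S_m.+1) * vJ (t.2 : 'S_m.+1) = (t'.1 : 'S_m.+1) * vJ (t'.2 : 'S_m.+1))%g /\
  (t.2 : 'S_m.+1) ord_max = (t'.2 : 'S_m.+1) ord_max.
Proof.
elim=> {t t'} [t t'|t|t t' _ [-> ->]|t t' t'' _ [-> ->] _] //.
case=> [[js [e1 e2]]|[_ []]].
have jv : jstab (cword (C := Sn m.+1) (map val js)) by apply/jstab_word; exists js.
rewrite /= in e1 e2; rewrite e1 e2 /= vJ_jmul // -!mulgA; split=> //.
by rewrite permM (eqP jv).
Qed.

Definition ipair (z : WJ * 'S_m.+1) : gpair := (val z.1, z.2).

Lemma local_label z (t : gpair) : gequiv (ipair z) t -> gnormal 0 t ->
  (t.1 : 'S_m.+1) = (rho z).1.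
Proof.
case: t => a b /gequiv_inv[/= e1 _] [/minLE/jasc_uniq/= jx _]; rewrite /rho /= e1.
by rewrite jx -{1}(mul1g (xr _)) vJ_mul ?jstab1 // mulg1.
Qed.

Lemma local_second z (t : gpair) : gequiv (ipair z) t -> gnormal 1 t ->
  (t.2 : 'S_m.+1) = z.2.
Proof.
case: t => a b /gequiv_inv[/= e1 e2] [mr _].
have [_ ev] := @WJ_uniq z.1 (toWJ mr) _ _ (jstab_vJ z.2) (jstab_vJ b) e1.
by rewrite -(vJ_xr z.2) ev e2 vJ_xr.
Qed.

Lemma gequiv_label z : gequiv (ipair z) (((rho z).1, xr (z.2 ord_max)) : gpair) /\
  gnormal 0 (((rho z).1, xr (z.2 ord_max)) : gpair).
Proof.
split; last by split=> //; apply/minLE/jasc_xr.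
apply: rst_sym; apply: rst_step; left.
have /jstab_word[ks e] := jstab_vJ z.2.
by exists ks; rewrite /= e vJ_xr.
Qed.

End Reindex.

End LocalLabels.
Import LocalLabels.

(** * The induced W-graph of the regular module *)

Module InducedGraph.

Import Order.TTheory GRing.Theory Num.Theory.
Local Open Scope ring_scope.

Local Notation A := laurent.

Section InducedHH.

Context (m : nat) (H : hecke (Sn m.+1)).
Implicit Types (h e : H) (v : 'S_m.+1) (j : 'I_m.+1) (i : 'I_m).

Local Notation Tt := (Tt H).
Local Notation Cc := (Cc H).
Local Notation hbC := (basisC H).
Local Notation hbT := (basisT H).
Local Notation V := (resA (HH H)).
Local Notation tHH := (@tHH m H).
Local Notation ZI := (WJ m * 'S_m.+1)%type.

Definition bX (z : ZI) : V := tHH (Tt (val z.1)) (Cc z.2).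
Definition bTT (z : ZI) : V := tHH (Tt (val z.1)) (Tt z.2).

Lemma TtWJ (w : WJ m) v : jstab v -> Tt (val w) * Tt v = Tt (val w * v)%g.
Proof. by move=> jv; apply: TtM; apply: inv_WJ. Qed.

(** Moving the W_J-part across the tensor sign identifies the two bases of products of the [Tt];
    hence both indexings lead to the same lattice modulo u^-1. *)
Lemma bTT_rho : bTT = bT H \o @rho m.
Proof.
apply: funext => -[w z]; rewrite /bTT /bT /bHH /rho /= -TtWJ ?jstab_vJ //.
have [b _] := balanced_T H (jstab_vJ z).
by rewrite b TtJ ?jstab_vJ // vJ_xr.
Qed.

Lemma fbTT : fbasis bTT.
Proof. by rewrite bTT_rho; apply: (fbasis_bij (fbT H) (rho_bij m)).1. Qed.

Lemma tHH_sumA (I : Type) (r : seq I) (P : pred I) (c : I -> A) (F : I -> H) h :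
  tHH h (\sum_(k <- r | P k) c k *: F k) = \sum_(k <- r | P k) (c k *: (tHH h (F k) : V)).
Proof. by rewrite tHH_sumr; apply: eq_bigr => k _; rewrite tHHZr. Qed.

Lemma co_bX_TT (w0 : WJ m) (z0 : 'S_m.+1) (z : ZI) : co bTT (bX (w0, z0)) z = (z.1 == w0)%:R * co Tt (Cc z0) z.2.
Proof.
apply: (co_uniq fbTT (c := fun z : ZI => (z.1 == w0)%:R * co Tt (Cc z0) z.2)).
rewrite -(pair_bigA _ (fun (w : WJ m) z => ((w == w0)%:R * co Tt (Cc z0) z) *: bTT (w, z))) /=.
rewrite (bigD1 w0) //= [X in _ + X]big1 ?addr0 => [|w /negPf ne]; last first.
  by apply: big1 => z' _; rewrite ne mul0r scale0r.
rewrite /bX [in LHS](coE hbT (Cc z0)) tHH_sumA; apply: eq_bigr => z' _.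
by rewrite eqxx mul1r.
Qed.

Lemma fbX : fbasis bX.
Proof.
apply: (tri_fbasis fbTT (prec := fun z z' : ZI => (inv z.2 < inv z'.2)%N)
  (rk := fun z : ZI => inv z.2)) => [//|[w z]|[w z] [w' z'] ne]; rewrite co_bX_TT /=.
  by rewrite eqxx mul1r coTC.
have [ew|_] := eqVneq w' w; last by rewrite mul0r eqxx.
rewrite mul1r; apply: coTC_lt => ez; apply: ne; by rewrite ew ez.
Qed.

Lemma cong_TTX : cong bTT bX.
Proof.
move=> [w z] [w' z']; rewrite co_bX_TT xpair_eqE /=.
have [_|_] := eqVneq w' w; last by rewrite mul0r subr0; apply: deg_le0.
by rewrite mul1r; apply: congTC.
Qed.

Lemma co_tX (w0 : WJ m) v h z : jstab v ->
  co bX (tHH (Tt (val w0 * v)%g) h) z = (z.1 == w0)%:R * co Cc (Tt v * h) z.2.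
Proof.
move=> jv; have [b _] := balanced_T H jv; rewrite -TtWJ // b.
apply: (co_uniq fbX (c := fun z : ZI => (z.1 == w0)%:R * co Cc (Tt v * h) z.2)).
rewrite -(pair_bigA _ (fun (w : WJ m) z => ((w == w0)%:R * co Cc (Tt v * h) z) *: bX (w, z))) /=.
rewrite (bigD1 w0) //= [X in _ + X]big1 ?addr0 => [|w /negPf ne]; last first.
  by apply: big1 => z' _; rewrite ne mul0r scale0r.
rewrite [in LHS](coE hbC (Tt v * h)) tHH_sumA; apply: eq_bigr => z' _.
by rewrite eqxx mul1r.
Qed.

Hypothesis hD : Dom.

(** The basis [cb] reindexed by the pairs used in induction. By [cong_XmbH] it is also congruent to
    [bX], so it is the canonical basis of the induced W-graph. *)
Definition mbH (z : ZI) : V := cb H hD (rho z).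

Lemma fmbH : fbasis mbH.
Proof. exact: (fbasis_bij (fcb H hD) (rho_bij m)).1. Qed.

Lemma co_mbH x z : co mbH x z = co (cb H hD) x (rho z).
Proof. exact: (fbasis_bij (fcb H hD) (rho_bij m)).2. Qed.

Lemma cong_XmbH : cong bX mbH.
Proof.
apply: (cong_trans fbX fbTT fmbH); first exact: cong_sym fbTT fbX cong_TTX.
rewrite bTT_rho; apply: (cong_bij (fbT H) (rho_bij m)); exact: cong_bTcb.
Qed.

Lemma mbar_mbH z : mbar (mbH z) = mbH z. Proof. exact: mbar_cb. Qed.

Definition precX (z z' : ZI) :=
  (inv (val z.1 : 'S_m.+1) < inv (val z'.1 : 'S_m.+1))%N /\ dom_le (sh z.2) (sh z'.2).

Lemma precX_trans z1 z2 z3 : precX z1 z2 -> precX z2 z3 -> precX z1 z3.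
Proof. by move=> [a b] [c d]; split; [apply: ltn_trans c|apply: dom_le_trans d]. Qed.

Lemma tHH_suml (I : Type) (r : seq I) (P : pred I) (F : I -> H) (h : H) :
  tHH (\sum_(k <- r | P k) F k) h = \sum_(k <- r | P k) tHH (F k) h.
Proof.
apply: (big_morph (fun x => tHH x h) (fun a b => tHHDl a b h)).
by apply: (addIr (tHH 0 h)); rewrite -tHHDl !add0r.
Qed.

Lemma mulT_sh v (z0 z : 'S_m.+1) : co Cc (Tt v * Cc z0) z != 0 -> dom_le (sh z) (sh z0).
Proof. by move=> hz; apply: (leL_sh hD (H := H)); apply: rt_step; exists (Tt v). Qed.

(** Bar changes [Tt w] by shorter terms [Tt (w0 * v)] with [v] in W_J; then [Tt v] acts on the
    second factor and can only lower its shape. *)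
Lemma mbar_bX z z' : co bX (mbar (bX z)) z' - (z' == z)%:R != 0 -> precX z' z.
Proof.
case: z => w z; have -> : mbar (bX (w, z)) =
    (tHH (hbar (Tt (val w)) - Tt (val w)) (Cc z) : V) + bX (w, z).
  by rewrite mbar_t hbarC -[RHS]tHHDl subrK.
rewrite (coD fbX) (co_b fbX) addrK.
rewrite (coE hbT (hbar (Tt (val w)) - Tt (val w))) tHH_suml (co_suml fbX) => hs.
have [x hx] : exists x, co bX (tHH (co Tt (hbar (Tt (val w)) - Tt (val w)) x *: Tt x) (Cc z)) z' != 0.
  apply: contrapT => nx; case/eqP: hs; apply: big1 => x _; apply/eqP; apply: contraT => hx.
  by case: nx; exists x.
move: hx; rewrite tHHZl -resAE (coZ fbX); set a := co Tt _ _ => hx.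
have /hbar_low lt : a != 0 by apply: contraNneq hx => ->; rewrite mul0r.
move: hx; have [w0 [v [jv ex]]] := WJ_decomp x; rewrite ex co_tX //=.
have [e|_] := eqVneq z'.1 w0; last by rewrite mul0r mulr0 eqxx.
rewrite mul1r => hx; split=> /=.
  by rewrite e; apply: leq_ltn_trans lt; rewrite ex inv_WJ // leq_addr.
by apply: (mulT_sh (v := v)); apply: contraNneq hx => ->; rewrite mulr0.
Qed.

Lemma bX_tri1 z : co bX (mbar (bX z)) z = 1.
Proof.
apply/eqP; rewrite -subr_eq0; apply: contraT => h.
have : precX z z by apply: mbar_bX; rewrite eqxx.
by case; rewrite ltnn.
Qed.

Lemma bX_tri0 z z' : co bX (mbar (bX z)) z' != 0 -> z' = z \/ precX z' z.
Proof.
move=> h; have [->|ne] := eqVneq z' z; first by left.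
by right; apply: mbar_bX; rewrite (negPf ne) subr0.
Qed.

Lemma mbH_support z : co bX (mbH z) z = 1 /\
  forall z', z' <> z -> co bX (mbH z) z' != 0 -> precX z' z.
Proof.
apply: (bar_support fbX (bar := @mbar m H) (@mbarD _ _) (@mbarZ _ _) (prec := precX)
  (rk := fun z : ZI => inv (val z.1 : 'S_m.+1))).
- by move=> a b [].
- exact: precX_trans.
- exact: bX_tri1.
- exact: bX_tri0.
- exact: mbar_mbH.
by move=> j; apply: cong_XmbH.
Qed.

Lemma cbarE (T : choiceType) (c : {malg A[T]}) k : (cbar c)@_k = lbar c@_k.
Proof.
rewrite /cbar raddf_sum /=; have [kc|kc] := boolP (k \in msupp c).
  rewrite (big_fsetD1 k) //= mcoeffUU big1_fset ?addr0 // => l; rewrite !inE => /andP[lk _] _.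
  by rewrite mcoeffU (negPf lk).
rewrite mcoeff_outdom // lbar0 big1_fset // => l lc _; rewrite mcoeffU.
by case: eqP => // e; rewrite -e lc in kc.
Qed.

Lemma mbH_induced : @is_induced_wgraph (Sn m.+1) (Sn m.+1) H H (Jlink m.+1)
  (chain_index (ChainLast (Sn m.+1))) (halg H)^o (@hC _ H) (HH H) tHH mbH.
Proof.
split.
- exact: HH_tensor.
- exact: (@fbasis_is_basis _ _ _ mbH fmbH).
- exists (@mbar m H); split; [exact: mbarD| |exact: mbar_mbH].
  move=> h c; rewrite mbar_t; congr (tHH _ _).
  rewrite !(lincomb_fin (T := 'S_m.+1)).
  rewrite (big_morph _ (@hbarD _ H) (hbar0 H)); apply: eq_bigr => k _.
  have S a (x : H) : (a%:A : H) *: (x : (halg H)^o) = (a *: x : H) by rewrite -[LHS]/((a%:A : H) * x) mulr_algl.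
  by rewrite cbarE [in LHS]S [in RHS]S hbarZ hC_bar.
move=> w z.
exists (malg_of (fun z' : ZI => co bX (mbH (w, z)) z' - (z' == (w, z))%:R)).
  by move=> z'; apply/uinvE; rewrite (malg_ofE (T := ZI)); apply: cong_XmbH.
rewrite (lincomb_malg_of (T := ZI) bX) [LHS](coE fbX (mbH (w, z))).
rewrite -[tHH _ _]/(bX (w, z)) [X in _ = X + _](coE fbX (bX (w, z))) -big_split; apply: eq_bigr => z' _.
rewrite (co_b fbX); set a := co bX _ _.
by have := @scalerDl _ V (bX z') (z' == (w, z))%:R (a - (z' == (w, z))%:R); rewrite addrC subrK.
Qed.

Definition ch2 := chain2 m.+1.

(** Brings the model within the scope of (Dom). *)
Lemma mbH_iterated : @iterated (Sn m.+1) H ch2 (HH H) mbH.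
Proof.
apply: (IteratedLink (l := Jlink m.+1) (is_coxeter_Sn m.+1) (IteratedLast H) mbH_induced).
Qed.

Definition leZ (z z' : ZI) := cell_le (M := HH H) (mbH : chain_index ch2 -> HH H) z z'.

Lemma leZ_dom z z' : leZ z z' -> ~ leZ z' z -> dom_lt (sh (rho z).1) (sh (rho z').1).
Proof.
move=> zz' nz; have L (x : ZI) : @is_local_rep (Sn m.+1) ch2 x (rho x).1.
  by have [g1 g2] := gequiv_label x; eexists; split; [exact: g1|exact: g2|].
apply: (hD mbH_iterated (y := z) (z := z')) (L z) (L z') => //.
by case.
Qed.

End InducedHH.

End InducedGraph.
Import InducedGraph.

(** * Structure coefficients of the induced W-graph *)

Module InducedCoefficients.

Import Order.TTheory GRing.Theory Num.Theory.
Local Open Scope ring_scope.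

Local Notation A := laurent.

Section SupportIn.

Context (V : lmodType A) (T : finType) (b : T -> V) (hb : fbasis b).

Definition suppin (D : T -> Prop) v := forall i, co b v i != 0 -> D i.

Lemma suppinD D v w : suppin D v -> suppin D w -> suppin D (v + w).
Proof.
move=> hv hw i; rewrite (coD hb); have [->|/hv //] := eqVneq (co b v i) 0.
by rewrite add0r => /hw.
Qed.

Lemma suppinZ D a v : suppin D v -> suppin D (a *: v).
Proof.
move=> hv i; rewrite (coZ hb); have [->|/hv //] := eqVneq (co b v i) 0.
by rewrite mulr0 eqxx.
Qed.

Lemma suppin_sum D (I : Type) (r : seq I) (P : pred I) (F : I -> V) :
  (forall k, P k -> suppin D (F k)) -> suppin D (\sum_(k <- r | P k) F k).
Proof.
move=> h; apply: big_ind => //; last by move=> *; apply: suppinD.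
by move=> i; rewrite (co0 hb) eqxx.
Qed.

Lemma suppin_lin D v (f : V -> V) : (forall x y, f (x + y) = f x + f y) ->
  (forall a x, f (a *: x) = a *: f x) -> (forall i, D i -> suppin D (f (b i))) ->
  suppin D v -> suppin D (f v).
Proof.
move=> fD fZ fb hv; rewrite (coE hb v).
have f0 : f 0 = 0 by have := fZ 0 0; rewrite !scale0r.
rewrite (big_morph f fD f0); apply: suppin_sum => i _; rewrite fZ.
have [->|/hv di] := eqVneq (co b v i) 0; first by rewrite scale0r => j; rewrite (co0 hb) eqxx.
by apply: suppinZ; apply: fb.
Qed.

End SupportIn.

Section Coefficients.

Context (m : nat) (H : hecke (Sn m.+1)) (hD : Dom).
Implicit Types (h e : H) (v : 'S_m.+1) (j : 'I_m.+1) (i : 'I_m).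

Local Notation Tt := (Tt H).
Local Notation Cc := (Cc H).
Local Notation hbC := (basisC H).
Local Notation hbT := (basisT H).
Local Notation V := (resA (HH H)).
Local Notation tHH := (@tHH m H).
Local Notation ZI := (WJ m * 'S_m.+1)%type.
Local Notation bX := (@bX m H).
Local Notation mbH := (@mbH m H hD).
Local Notation cb := (cb H hD).
Local Notation bC := (bC H).

Definition actV h (x : V) : V := h *: (x : HH H).

Lemma actVD h x y : actV h (x + y) = actV h x + actV h y.
Proof. exact: (@scalerDr _ (HH H) h x y). Qed.

Lemma actVZ h a x : actV h (a *: x) = a *: actV h x.
Proof. exact: (@resA_actZ _ (HH H) h a x). Qed.

Lemma suppX_act lam h (x : V) : suppin bX (fun z : ZI => dom_le (sh z.2) lam) x ->
  suppin bX (fun z : ZI => dom_le (sh z.2) lam) (actV h x).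
Proof.
apply: (suppin_lin (fbX H)) => [x1 x2|a x1|z hz]; [exact: actVD|exact: actVZ|].
rewrite /actV -tHHMl (coE hbT (h * Tt (val z.1))) tHH_suml.
apply: (suppin_sum (fbX H)) => x' _; rewrite tHHZl -resAE; apply: (suppinZ (fbX H)).
have [w0 [v [jv ->]]] := WJ_decomp x'; move=> z'; rewrite co_tX // => h0.
apply: dom_le_trans hz; apply: (mulT_sh (H := H) hD (v := v)).
by apply: contraNneq h0 => ->; rewrite mulr0.
Qed.

Lemma co_bC (x : V) q : co bC x q = co Cc ((x : HH H) q.2) q.1.
Proof. by case: q => y j; rewrite (co_HH hbC). Qed.

Lemma suppC_act lam h (x : V) : suppin bC (fun q => dom_le (sh q.1) lam) x ->
  suppin bC (fun q => dom_le (sh q.1) lam) (actV h x).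
Proof.
move=> hx q; rewrite co_bC ffunE => hq.
apply: (@supp_mull _ _ (fun w => dom_le (sh w) lam) h _ _ _ _ hq) => [z y zy|y hy].
  exact: (dom_closed hD zy).
by apply: (hx (y, q.2)); rewrite co_bC.
Qed.

Lemma mbH_supp lam (z : ZI) : dom_le (sh z.2) lam ->
  suppin bX (fun z : ZI => dom_le (sh z.2) lam) (mbH z).
Proof.
move=> hz z' h'; have [->//|/eqP ne] := eqVneq z' z.
by have [_ /(_ z' ne h')[_ /dom_le_trans]] := mbH_support H hD z; apply.
Qed.

Lemma supp_mbH lam (x : V) : suppin bX (fun z : ZI => dom_le (sh z.2) lam) x ->
  suppin mbH (fun z : ZI => dom_le (sh z.2) lam) x.
Proof.
move=> hx z; apply: (@co_support_tri _ _ bX mbH (fun z : ZI => inv (val z.1 : 'S_m.+1))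
  (fun z => dom_le (sh z.2) lam) x (fbX H) (fmbH H hD)) => [i|i j ji hj|//].
  exact: (mbH_support H hD i).1.
have [ltr le] := (mbH_support H hD i).2 j ji hj; split=> //.
exact: dom_le_trans le.
Qed.

Lemma cb_supp lam p : dom_le (sh p.1) lam -> suppin bC (fun q => dom_le (sh q.1) lam) (cb p).
Proof.
move=> hp q hq; have [->//|/eqP ne] := eqVneq q p.
by have [_ /dom_le_trans] := cb_tri ne hq; apply.
Qed.

Lemma supp_cb lam (x : V) : suppin bC (fun q => dom_le (sh q.1) lam) x ->
  suppin cb (fun q => dom_le (sh q.1) lam) x.
Proof.
move=> hx q; apply: (@co_support_tri _ _ bC cb (fun q => inv (xr q.2))
  (fun q => dom_le (sh q.1) lam) x (fbC H) (fcb H hD)) => [i|i j ji hj|//].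
  exact: cb_diag.
have [ltr le] := cb_tri ji hj; split=> //.
exact: dom_le_trans le.
Qed.

Lemma appearsZ z' z : appears (M := HH H) (mbH : chain_index (ch2 m) -> HH H) z' z <->
  exists h, co mbH (actV h (mbH z)) z' != 0.
Proof.
have bas : is_basis (mbH : chain_index (ch2 m) -> HH H).
  exact: (@fbasis_is_basis _ _ _ mbH (fmbH H hD)).
by split=> -[h hz]; exists h; move: hz; rewrite (bcoord_co (T := ZI) bas).
Qed.

(** The bound on the second component comes from the basis [bX], the one on the label from [bC]; the
    canonical basis is triangular in both. *)
Lemma appears_sh z' z : (exists h, co mbH (actV h (mbH z)) z' != 0) ->
  dom_le (sh z'.2) (sh z.2) /\ dom_le (sh (rho z').1) (sh (rho z).1).
Proof.
case=> h hz; split.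
  have /(_ z' hz) := supp_mbH (suppX_act (h := h) (mbH_supp (dom_le_refl (sh z.2)))); exact.
rewrite co_mbH in hz.
have /(_ _ hz) := supp_cb (suppC_act (h := h) (cb_supp (dom_le_refl (sh (rho z).1)))); exact.
Qed.

Lemma leZ_sh z' z : leZ H hD z' z ->
  dom_le (sh z'.2) (sh z.2) /\ dom_le (sh (rho z').1) (sh (rho z).1).
Proof.
elim=> {z z'} [z' z /appearsZ/appears_sh //|z|z' z z'' _ [a b] _ [c d]].
  by split; apply: dom_le_refl.
by split; [apply: dom_le_trans c|apply: dom_le_trans d].
Qed.

Lemma cb_last y j : (cb (y, j) : HH H) j = Cc y.
Proof.
apply: (co_inj hbC) => y'; rewrite (co_b hbC).
have := co_bC (cb (y, j)) (y', j); rewrite /= => <-.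
have [->|ne] := eqVneq y' y; first exact: cb_diag.
apply/eqP; apply: contraT => h0.
have ne' : (y', j) <> (y, j) by case=> e; rewrite e eqxx in ne.
by have [] := cb_tri ne' h0; rewrite ltnn.
Qed.

(** The action does not make representatives longer, and among those no longer than [xr j] the
    component at [j] sees only the elements [cb (y', j)], each as [Cc y']. Thus the action with
    fixed [j] is that of the regular module, and left cells yield cell equivalences. *)
Lemma co_cb_same h y j y' : co cb (actV h (cb (y, j))) (y', j) = co Cc (h * Cc y) y'.
Proof.
set x := actV _ _.
have xj : (x : HH H) j = h * Cc y by rewrite /x ffunE cb_last.
pose D (q : 'S_m.+1 * 'I_m.+1) := (inv (xr q.2) <= inv (xr j))%N.
have hx : suppin bC D x.
  move=> q; rewrite co_bC /x ffunE => h0.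
  have [y1 h1] : exists y1, co Cc ((cb (y, j) : HH H) q.2) y1 != 0.
    apply: contrapT => nx; case/eqP: h0; have -> : (cb (y, j) : HH H) q.2 = 0.
      apply: (co_inj hbC) => u; rewrite (co0 hbC); apply/eqP; apply: contraT => hu.
      by case: nx; exists u.
    by rewrite scaler0 (co0 hbC).
  have := co_bC (cb (y, j)) (y1, q.2); rewrite /= => e; rewrite -e in h1.
  have [[_ e2]|/eqP ne] := eqVneq (y1, q.2) (y, j); first by rewrite /D e2.
  by have [/ltnW] := cb_tri ne h1.
have xD : suppin cb D x.
  move=> q; apply: (@co_support_tri _ _ bC cb (fun q => inv (xr q.2)) D x (fbC H) (fcb H hD)) => // [i|i k ki hk].
    exact: cb_diag.
  have [ltr _] := cb_tri ki hk; split=> //.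
  by move=> Di; apply: leq_trans Di; apply: ltnW.
rewrite -xj; have := co_bC x (y', j); rewrite /= => <-.
rewrite (co_change _ _ (fbC H) (fcb H hD)) (bigD1 (y', j)) //= cb_diag mulr1 big1 ?addr0 // => q ne.
have [->|h1] := eqVneq (co bC (cb q) (y', j)) 0; first by rewrite mulr0.
have [->|/xD] := eqVneq (co cb x q) 0; first by rewrite mul0r.
have [|lt _] := cb_tri _ h1; first by apply/eqP; rewrite eq_sym.
by rewrite /D leqNgt lt.
Qed.

Lemma co_mbH_same h (z z' : ZI) : z.2 ord_max = z'.2 ord_max ->
  co mbH (actV h (mbH z)) z' = co Cc (h * Cc (rho z).1) (rho z').1.
Proof. by move=> e; rewrite co_mbH -(co_cb_same h _ (z'.2 ord_max)) /mbH /rho /= e. Qed.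

End Coefficients.

End InducedCoefficients.
Import InducedCoefficients.

(** * An index whose second component ends in a decreasing run *)

Module RunConstruction.

Import Order.TTheory GRing.Theory Num.Theory.
Local Open Scope ring_scope.

Lemma kcov_map k (f g : nat -> nat) u N : {in u, cancel f g} ->
  {in u &, forall x y, (f x < f y)%N = (x < y)%N} ->
  kcov k (map f u) N <-> kcov k u N.
Proof.
move=> fg fm; split=> -[c cu cN].
  exists (c \o f); last by rewrite count_map in cN.
  rewrite pairwise_map in cu; apply: sub_in_pairwise (allss u) cu => x y xu yu.
  by rewrite /= /kcompat /= fm.
exists (c \o g); last first.
  rewrite count_map; move: cN; rewrite (eq_in_count (a2 := fun x => (c (g (f x)) < k)%N)) // => x xu.
  by rewrite fg.
rewrite pairwise_map; apply: sub_in_pairwise (allss u) cu => x y xu yu.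
by rewrite /= /kcompat /= fm ?fg.
Qed.

Section Runs.

Context (m : nat).
Implicit Types (v w : 'S_m.+1) (a j : 'I_m.+1).
Local Notation rf := (@refl m.+1).

Lemma xr_lift a (k : 'I_m) : xr a (lift ord_max k) = lift a k.
Proof. by rewrite /xr lift_perm_lift perm1. Qed.

Lemma xrV_lift a (k : 'I_m) : (xr a)^-1%g (lift a k) = lift ord_max k.
Proof. by rewrite -(xr_lift a) permK. Qed.

Lemma xrV_a a : (xr a)^-1%g a = ord_max.
Proof. by rewrite -{2}(xr_max a) permK. Qed.

Lemma lift_ord (a : 'I_m.+1) (x : 'I_m.+1) : (x < a)%N -> exists k : 'I_m, x = lift a k /\ x = k :> nat.
Proof.
move=> xa; have km : (x < m)%N by rewrite (leq_trans xa) // -ltnS.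
exists (Ordinal km); split=> //; apply: val_inj; rewrite /= /bump leqNgt xa.
by [].
Qed.

Lemma xrV_low a (x : 'I_m.+1) : (x < a)%N -> (xr a)^-1%g x = x.
Proof.
move=> xa; have [k [xE xk]] := lift_ord xa; apply: val_inj.
rewrite {1}xE xrV_lift /= /bump leqNgt ltn_ord /= add0n; exact: esym.
Qed.

(** The inverse representatives are cycles forming a chain: each step moves the largest letter one
    position to the left. *)
Lemma xr_pred (i : 'I_m) : (xr (slo (n := m.+1) i))^-1%g = (rf i * (xr (shi (n := m.+1) i))^-1)%g.
Proof.
apply: invg_inj; rewrite invgK invMg invgK reflV; set x := (_ * _)%g.
have xm : x ord_max = slo (n := m.+1) i by rewrite /x permM xr_max refl_hi.
rewrite -xm; apply/esym/jasc_uniq => k km; rewrite /desc -leqNgt ltnW // /x !permM.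
apply: refl_lt.
  rewrite xpair_eqE negb_and; apply/orP; right; apply/eqP => e.
  have /perm_inj/(congr1 val)/= : xr (shi (n := m.+1) i) (shi (n := m.+1) k) = xr (shi (n := m.+1) i) ord_max.
    by rewrite xr_max.
  by move=> e'; rewrite e' eqxx in km.
by have := jasc_xr (shi (n := m.+1) i) km; rewrite /desc -leqNgt leq_eqVlt => /orP[/eqP/val_inj/perm_inj/(congr1 val)/=|//]; lia.
Qed.

Lemma xr_asc (i : 'I_m) : ~~ desc (n := m.+1) i (xr (shi (n := m.+1) i))^-1%g.
Proof. by rewrite /desc xrV_a -leqNgt -ltnS. Qed.

Lemma xr_commute (b : 'I_m) a : (b.+1 < a)%N ->
  (rf b * (xr a)^-1 = (xr a)^-1 * rf b)%g /\ ~~ desc (n := m.+1) b (xr a)^-1%g.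
Proof.
move=> ba; have e1 : (xr a)^-1%g (slo (n := m.+1) b) = slo (n := m.+1) b by apply: xrV_low => /=; lia.
have e2 : (xr a)^-1%g (shi (n := m.+1) b) = shi (n := m.+1) b by apply: xrV_low.
split; last by rewrite /desc e1 e2 /= ltnn || rewrite /desc e1 e2 /= -leqNgt.
by rewrite conjgC /refl tpermJ e1 e2.
Qed.

Lemma word_xr v a : jstab v -> word ((xr a)^-1 * v)%g =
  take a (take m (word v)) ++ m.+1 :: drop a (take m (word v)).
Proof.
move=> /eqP jv; have szt : size (take m (word v)) = m by rewrite size_takel // size_word.
have am : (a <= m)%N by rewrite -ltnS.
have sza : size (take a (take m (word v))) = a by rewrite size_takel ?szt.
apply: (@eq_from_nth _ 0%N) => [|i].
  by rewrite size_word size_cat sza /= size_drop szt; lia.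
rewrite size_word => im; pose o := Ordinal im.
have nu (k : 'I_m) : nth 0%N (take m (word v)) k = (v (lift ord_max k)).+1.
  rewrite nth_take // -(nth_word v); congr nth.
  by rewrite /= /bump leqNgt ltn_ord.
rewrite -[X in nth _ _ X = _]/(val o) nth_word permM nth_cat sza.
have [e|ne] := eqVneq o a.
  by rewrite -[i]/(val o) e ltnn subnn /= xrV_a jv.
have ne' : a != o by rewrite eq_sym.
have [k ek _] := unlift_some ne'.
have ei : i = bump a k by rewrite -[i]/(val o) ek.
rewrite ek xrV_lift -nu ei /bump; case: (leqP a k) => ak /=.
  by rewrite ltnNge ltnW ?ltnS //= add1n subSn // /= nth_drop subnKC.
by rewrite add0n ak [in RHS]nth_take.
Qed.

Lemma star_jmul v (x : 'S_m.+1) (i i' : 'I_m) : jstab v -> jasc x -> i.+1 != m -> i'.+1 != m -> i.+1 = i' :> nat ->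
  star (n := m.+1) i i' (v * x)%g = (star (n := m.+1) i i' v * x)%g /\ jstab (star (n := m.+1) i i' v).
Proof.
move=> jv jx im im' ii; have jr (k : 'I_m) : k.+1 != m -> jstab (rf k * v)%g.
  by move=> km; apply: jstabM => //; apply: jstab_refl.
rewrite /star !(mulgA (rf _)) (desc_jmul jv jx im) (desc_jmul jv jx im') (desc_jmul (jr i im) jx im').
by do 2?[case: ifP => _]; split; rewrite ?jr.
Qed.

(** Star operations on the first [m] positions use only [J], and left descents in [J] are not
    affected by the factor [x]. *)
Lemma spath_jmul c v v1 (x : 'S_m.+1) : (c <= m)%N -> jasc x -> spath (n := m.+1) c v v1 -> jstab v ->
  jstab v1 /\ Ptab (v1 * x)%g = Ptab (v * x)%g.
Proof.
move=> cm jx; elim=> {v v1} [w|i i' w w' ii ic dw _ IH] jv //.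
have [im im'] : i.+1 != m /\ i'.+1 != m by lia.
have [e js] := star_jmul jv jx im im' ii; have [j1 ->] := IH js; split=> //.
by rewrite -e Ptab_star.
Qed.

Lemma tshape_map (f g : nat -> nat) u : uniq u -> {in u, cancel f g} ->
  {in u &, forall x y, (f x < f y)%N = (x < y)%N} -> tshape (Pw (map f u)) = tshape (Pw u).
Proof.
move=> uu fg fm; apply: tshape_Pw_eq => //; last by move=> k N; apply: kcov_map fg fm.
by rewrite map_inj_in_uniq // => x y xu yu e; rewrite -(fg x xu) e fg.
Qed.

Lemma word_jstab v : jstab v -> word v = rcons (take m (word v)) m.+1.
Proof.
move=> /eqP jv; rewrite -{1}(cat_take_drop m (word v)) -cats1; congr cat.
have sz := size_word v; apply: (@eq_from_nth _ 0%N); first by rewrite size_drop sz subSnn.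
case=> [|i]; rewrite size_drop sz subSnn // => _.
by rewrite nth_drop addn0 -[X in nth _ _ X]/(val (@ord_max m)) nth_word jv.
Qed.

(** Letters count from 1: those from [j + 1] on are raised by one, which frees the letter [j + 1]
    for the last position. *)
Definition up (j x : nat) := (bump j x.-1).+1.

Lemma up_mono j x y : (0 < x)%N -> (0 < y)%N -> (up j x < up j y)%N = (x < y)%N.
Proof. by rewrite /up ltnS /bump; lia. Qed.

Lemma word_jmul v j : jstab v -> word (v * xr j)%g = rcons (map (up j) (take m (word v))) j.+1.
Proof.
move=> jv; have szt : size (take m (word v)) = m by rewrite size_takel // size_word.
apply: (@eq_from_nth _ 0%N) => [|i]; first by rewrite size_word size_rcons size_map szt.
rewrite size_word => im; rewrite -[X in nth _ _ X = _]/(val (Ordinal im)) nth_word permM.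
rewrite nth_rcons size_map szt; have [lt|ge] := ltnP i m.
  rewrite (nth_map 0%N) ?szt // nth_take // -[X in nth _ _ X]/(val (Ordinal im)) nth_word /up /=.
  have ne : Ordinal im != ord_max by rewrite -val_eqE /= ltn_eqF.
  have ne' : ord_max != v (Ordinal im) by rewrite eq_sym; apply: jstab_inj.
  have [k ek _] := unlift_some ne'; rewrite ek xr_lift /=; congr (bump _ _).+1.
  by rewrite /bump leqNgt ltn_ord.
have e : i = m by lia.
have -> : Ordinal im = ord_max by apply: val_inj.
by rewrite (eqP jv) xr_max e eqxx.
Qed.

(** The label has the word [u] with [m + 1] inserted at position [a0]. Reverse bumping of the rows
    [K - 1] to 0 yields a word [p ++ d] Knuth equivalent to [u]; placing [m + 1] between [p] and [d]
    pushes it to row [K] again, by [Pw_max_run]. So both tableaux are kept, with [d] now at the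
    end. *)
Lemma find_run v (a0 j : 'I_m.+1) P1 K : jstab v -> Ptab ((xr a0)^-1 * v)%g = P1 ->
  tshape P1 = tshape (Ptab (v * xr j)%g) ->
  (size (nth [::] (tab_lt P1 m.+1) K) < size (nth [::] P1 K))%N ->
  exists v1 (a1 : 'I_m.+1), [/\ jstab v1, (a1 + K = m)%N, Ptab ((xr a1)^-1 * v1)%g = P1,
    Ptab (v1 * xr j)%g = Ptab (v * xr j)%g &
    forall i : 'I_m, (a1 <= i)%N -> desc (n := m.+1) i (v1 * xr j)%g].
Proof.
move=> jv e1 shE hrow; have wv := word_jstab jv; set u := take m (word v) in wv.
have szu : size u = m by rewrite size_takel // size_word.
have uu : uniq u by apply/take_uniq/uniq_word.
have u_in x : x \in u -> (0 < x <= m)%N.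
  move=> xu; have := uniq_word v; rewrite wv rcons_uniq => /andP[nu _].
  have := mem_word v x; rewrite wv mem_rcons inE xu orbT => /esym/andP[x0].
  rewrite leq_eqVlt x0 => /orP[/eqP e|//]; by rewrite -e xu in nu.
have u_lt : all (ltn^~ m.+1) u by apply/allP => x /u_in/andP[_]; rewrite /= ltnS.
have eP : P1 = Pw (take a0 u ++ m.+1 :: drop a0 u) by rewrite -e1 -(word_xr a0 jv).
have ut : all (ltn^~ m.+1) (take a0 u) /\ all (ltn^~ m.+1) (drop a0 u).
  by apply/andP; rewrite -all_cat cat_take_drop.
have [q qT] := Pw_max ut.1 ut.2; rewrite cat_take_drop in qT *; rewrite -eP => eq1.
set T := Pw u in qT eq1.
have nthP i : nth [::] P1 i = if i == q then rcons (nth [::] T q) m.+1 else nth [::] T i.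
  by rewrite eq1 /addrow nth_set_nth.
have tabT : tabl T by apply: tabl_Pw.
have rowT i : all (ltn^~ m.+1) (nth [::] T i).
  have [iT|iT] := ltnP i (size T); last by rewrite nth_default.
  have : all (all (ltn^~ m.+1)) T by rewrite all_Pw.
  by move/allP; apply; apply: mem_nth.
have Kq : K = q.
  apply/eqP; apply: contraT => ne; move: hrow.
  have -> : nth [::] (tab_lt P1 m.+1) K = [seq x <- nth [::] P1 K | (x < m.+1)%N].
    have [iT|iT] := ltnP K (size P1); first by rewrite (nth_map [::]).
    by rewrite !nth_default // size_map.
  by rewrite nthP (negPf ne) (all_filterP (rowT K)) ltnn.
rewrite -Kq in qT eq1 nthP.
have tabP : tabl P1 by rewrite -e1; apply: tabl_Pw; apply: uniq_word.
have uT : uniq (flatten T) by rewrite (perm_uniq (perm_Pw u)).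
(* Row [K] of [P1] has one letter more than row [K] of [T], and is not longer than row [K - 1]. *)
have cond : (0 < K)%N -> (size (nth [::] T K) < size (nth [::] T K.-1))%N.
  move=> K0; have := @tabl_size_nth P1 K.-1 K tabP (leq_pred K).
  by rewrite !nthP eqxx size_rcons; case: eqP => // e; lia.
have [T0 [d [tT0 Td rd]]] := unbump_run tabT uT qT cond.
pose p := flatten (cols T0); have Pp : Pw p = T0 by apply: Pw_cols.
have pu : perm_eq (p ++ d) u.
  rewrite perm_catC (perm_trans _ (perm_Pw u)) // -/T -Td perm_sym.
  by rewrite (perm_trans (perm_insrun T0 d)) // perm_cat2l perm_sym; apply: perm_cols.
have upd : uniq (p ++ d) by rewrite (perm_uniq pu).
have Pd : Pw (p ++ d) = T by rewrite -insrun_Pw Pp.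
have szd : size d = K.
  rewrite -(size_iota 0 K) -rd; elim/last_ind: (d) => // d' x IH.
  by rewrite insrows_rcons !size_rcons IH.
have szp : (size p + K = m)%N by rewrite -szd -size_cat (perm_size pu).
have am : (size p < m.+1)%N by lia.
have uw : u ++ [:: m.+1] = word v by rewrite cats1 -wv.
have ku : keq u (p ++ d) by apply: Pw_eq_keq => //; rewrite Pd.
have [v1 wv1 sp] := kstep_sym_spath ku uw; rewrite szu in sp.
have [jv1 Pj] := spath_jmul (leqnn m) (jasc_xr j) sp jv.
have tk : take m (word v1) = p ++ d by rewrite -wv1 take_size_cat // size_cat szd.
have pd_lt : all (ltn^~ m.+1) p /\ all (ltn^~ m.+1) d.
  by apply/andP; rewrite -all_cat (perm_all _ pu).
have ud : uniq (d ++ flatten T0).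
  by rewrite -(perm_uniq (perm_insrun T0 d)) Td.
have dsort : sorted gtn d by apply: sorted_insrows_gt ud _ => //; rewrite rd; apply: iota_ltn_sorted.
exists v1, (Ordinal am); split=> //.
  rewrite -[Ptab _]/(Pw (word _)) (word_xr _ jv1) /= tk take_size_cat // drop_size_cat //.
  by rewrite (Pw_max_run pd_lt.1 pd_lt.2 (K := K)) ?Pp // Pd -eq1.
move=> i /= pi; have [im|im] := eqVneq i.+1 m; last first.
  have lt : (i.+1 < m)%N by rewrite ltn_neqAle im ltn_ord.
  rewrite (desc_jmul jv1 (jasc_xr j) im) descE -wv1 -catA !nth_cat.
  rewrite [(i < _)%N]ltnNge pi [(i.+1 < _)%N]ltnNge leqW //=.
  have l2 : (i.+1 - size p < size d)%N by rewrite szd ltn_subLR ?leqW // szp.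
  have -> : (i - size p < size d)%N by rewrite szd ltn_subLR // szp ltn_ord.
  rewrite ?l2; have /(sortedP 0%N)/(_ (i - size p)%N) := dsort.
  rewrite -subSn //; move=> /(_ l2); exact.
(* The descent at the last position compares the end of the run with the letter [j + 1]. The tableau
   of [v * xr j] has the shape of [P1], so the last letter adds its box in row [K], while the
   preceding letter added one in row [K - 1]; by [insrow_asc] this is not an ascent. *)
have K0 : (0 < K)%N by move: szp im pi; clear; lia.
move: szd; case/lastP: d Td rd pu upd Pd ku wv1 tk pd_lt ud dsort => [|d x] Td rd pu upd Pd ku wv1 tk pd_lt ud dsort szd.
  by rewrite -szd in K0.
have pos y : y \in p ++ rcons d x -> (0 < y)%N by rewrite (perm_mem pu) => /u_in/andP[].
have fg : {in p ++ rcons d x, cancel (up j) (fun y => (fintype.unbump j y.-1).+1)}.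
  by move=> y /pos y0; rewrite /up /= bumpK prednK.
have fm : {in p ++ rcons d x &, forall y z, (up j y < up j z)%N = (y < z)%N}.
  by move=> y z /pos y0 /pos z0; exact: up_mono.
have sub : {subset p ++ d <= p ++ rcons d x}.
  by move=> y; rewrite !mem_cat mem_rcons inE => /orP[->//|->]; rewrite !orbT.
set f := up j in fg fm.
have upd' : uniq (p ++ d) by move: upd; rewrite -rcons_cat rcons_uniq => /andP[].
have s1 : tshape (Pw (map f (p ++ d))) = tshape (Pw (p ++ d)).
  by apply: tshape_map upd' (sub_in1 sub fg) (sub_in2 sub fm).
have s2 : tshape (Pw (map f (p ++ rcons d x))) = tshape T by rewrite (tshape_map upd fg fm) Pd.
have r1 : insrow x (Pw (p ++ d)) = K.-1.
  have := congr1 (last 0%N) rd; rewrite insrows_rcons last_rcons -nth_last size_iota.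
  by rewrite nth_iota ?add0n ?prednK // -insrun_Pw Pp.
have r2 : insrow (f x) (Pw (map f (p ++ d))) = K.-1.
  apply: (@incr_nth_inj (tshape (Pw (p ++ d)))); rewrite -{1}s1 -tshape_insert -Pw_rcons.
  by rewrite -map_rcons rcons_cat s2 -r1 -tshape_insert -Pw_rcons rcons_cat Pd.
have wj : word (v1 * xr j)%g = rcons (rcons (map f (p ++ d)) (f x)) j.+1.
  by rewrite (word_jmul j jv1) tk -rcons_cat map_rcons.
have r3 : insrow j.+1 (Pw (rcons (map f (p ++ d)) (f x))) = K.
  apply: (@incr_nth_inj (tshape T)); rewrite -{1}s2 -rcons_cat map_rcons -tshape_insert -Pw_rcons -wj.
  by rewrite -[Pw _]/(Ptab _) Pj -shE eq1 tshape_addrow.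
rewrite descE wj; have szi : size (map f (p ++ d)) = i.
  by rewrite size_map size_cat; rewrite size_rcons in szd; move: szd szp im; clear; lia.
rewrite nth_rcons size_rcons szi ltnn eqxx nth_rcons size_rcons szi ltnSn nth_rcons szi ltnn eqxx.
have nej : j.+1 != f x.
  apply/eqP => e; have := uniq_word (v1 * xr j)%g; rewrite wj rcons_uniq mem_rcons inE.
  by rewrite e eqxx.
rewrite ltn_neqAle nej leqNgt; apply/negP => lt.
have tr : all (pairwise ltn) (Pw (map f (p ++ d))).
  apply/tabl_rows/tabl_Pw; have := uniq_word (v1 * xr j)%g.
  by rewrite wj !rcons_uniq => /and3P[].
by have := insrow_asc tr lt; rewrite -Pw_rcons r3 r2 -ltnS prednK // ltnn.
Qed.

End Runs.

End RunConstruction.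
Import RunConstruction.

(** * The module induced from a two-sided cell *)

Module InducedCell.

Import Order.TTheory GRing.Theory Num.Theory.
Local Open Scope ring_scope.

Local Notation A := laurent.

(** A spanning family of the right size is free, since a one-sided inverse of a square matrix over a
    commutative ring is two-sided. It makes the [tT z] a basis, as [M] is known to be free only
    through [mb]. *)
Lemma fbasis_of_span (V : lmodType A) (T : finType) (b c : T -> V) (p : T -> T -> A) :
  fbasis b -> (forall i, b i = \sum_j p i j *: c j) -> fbasis c.
Proof.
move=> hb bc.
pose P : 'M[A]_#|T| := \matrix_(i, j) p (enum_val i) (enum_val j).
pose Q : 'M[A]_#|T| := \matrix_(i, j) co b (c (enum_val i)) (enum_val j).
have sumE (F : T -> A) : \sum_i F i = \sum_(k < #|T|) F (enum_val k).
  rewrite (reindex (@enum_val T T)) //=.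
  by exists enum_rank => k _; rewrite ?enum_valK ?enum_rankK.
have PQ : P *m Q = 1%:M.
  apply/matrixP => i j; rewrite !mxE.
  have := co_b hb (enum_val i) (enum_val j); rewrite bc (co_suml hb) sumE.
  rewrite (inj_eq enum_val_inj) eq_sym => <-.
  by apply: eq_bigr => k _; rewrite !mxE (coZ hb).
have QP := mulmx1C PQ.
split=> [v|d e i].
  exists [ffun j => \sum_i co b v i * p i j].
  rewrite {1}(coE hb v); under eq_bigr do rewrite bc scaler_sumr.
  rewrite exchange_big /=; apply: eq_bigr => j _; rewrite ffunE scaler_suml.
  by apply: eq_bigr => k _; rewrite scalerA.
have dQ k : \sum_l d l * co b (c l) k = 0.
  transitivity (co b (\sum_l d l *: c l) k); last by rewrite e (co0 hb).
  by rewrite (co_suml hb); apply: eq_bigr => l _; rewrite (coZ hb).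
pose D : 'rV[A]_#|T| := \row_k d (enum_val k).
have DQ : D *m Q = 0.
  apply/rowP => k; rewrite !mxE; apply: etrans (dQ (enum_val k)); rewrite sumE.
  by apply: eq_bigr => l _; rewrite !mxE.
have /rowP/(_ (enum_rank i)) : D = 0 by rewrite -(mulmx1 D) -QP mulmxA DQ mul0mx.
by rewrite !mxE enum_rankK.
Qed.

Section TensorX.

Context (m : nat) (lam : seq nat) (H : hecke (Sn m.+1)) (hD : Dom).
Local Notation XI := {w : 'S_m.+1 | tshape (Ptab w) == lam}.
Local Notation JI := (WJ m * XI)%type.
Local Notation ZI := (WJ m * 'S_m.+1)%type.
Context (X : lmodType H) (xb : XI -> X).
Hypothesis hX : is_cellular_subquotient (M := (halg H)^o) (hC H)
  (xb : Xindex m.+1 lam -> X).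
Context (M : lmodType H) (t : H -> X -> M) (mb : JI -> M).
Hypothesis hM : is_induced_wgraph (l := Jlink m.+1) (xb : Xindex m.+1 lam -> X) t
  (mb : JXindex m.+1 lam -> M).
Implicit Types (h e : H) (v : 'S_m.+1) (g : XI).

Local Notation Tt := (Tt H).
Local Notation Cc := (Cc H).
Local Notation hbC := (basisC H).
Local Notation hbT := (basisT H).
Local Notation V := (resA (HH H)).
Local Notation tHH := (@tHH m H).
Local Notation bX := (@bX m H).
Local Notation mbH := (@mbH m H hD).
Local Notation XA := (resA X).
Local Notation MA := (resA M).

Lemma fxb : fbasis (xb : XI -> XA).
Proof. exact: (is_basis_fbasis (T := XI) hX.1). Qed.

Lemma mb_basis : is_basis (mb : JXindex m.+1 lam -> M). Proof. by case: hM. Qed.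

Lemma fmb : fbasis (mb : JI -> MA).
Proof. exact: (is_basis_fbasis (T := JI) mb_basis). Qed.

Lemma tDl h h' x : t (h + h') x = t h x + t h' x.
Proof. by case: hM => -[[]]. Qed.

Lemma tDr h x x' : t h (x + x') = t h x + t h x'.
Proof. by case: hM => -[[]]. Qed.

Lemma tM h h' x : t (h * h') x = h *: t h' x.
Proof. by case: hM => -[]. Qed.

Lemma t_bal h v x : jstab v -> t (h * Tt v) x = t h (Tt v *: x).
Proof.
case: hM => -[[_ _ tb] _ _] _ _ _ /jstab_word[ks <-].
by have := tb h x 1 ks; rewrite !scale1r.
Qed.

Lemma t0r h : t h 0 = 0.
Proof. by apply: (addIr (t h 0)); rewrite -tDr !add0r. Qed.

Lemma t0l x : t 0 x = 0.
Proof. by apply: (addIr (t 0 x)); rewrite -tDl !add0r. Qed.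

Lemma tZl a h x : t (a *: h) x = a *: (t h x : MA).
Proof. by rewrite -mulr_algl tM. Qed.

Lemma tZr a h x : t h (a *: (x : XA)) = a *: (t h x : MA).
Proof.
case: hM => -[[_ _ tb] _ _] _ _ _; have := tb h x a [::].
rewrite /= cword_nil -[hT H 1%g]/(Tt 1%g) Tt1 -scalerAr mulr1 => e.
by rewrite -tZl e.
Qed.

Lemma t_sumr (I : Type) (r : seq I) (P : pred I) (F : I -> X) h :
  t h (\sum_(k <- r | P k) F k) = \sum_(k <- r | P k) t h (F k).
Proof. exact: (big_morph (t h) (tDr h) (t0r h)). Qed.

Lemma t_suml (I : Type) (r : seq I) (P : pred I) (F : I -> H) x :
  t (\sum_(k <- r | P k) F k) x = \sum_(k <- r | P k) t (F k) x.
Proof. exact: (big_morph (fun h => t h x) (fun a b => tDl a b x) (t0l x)). Qed.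

Definition tT (z : JI) : MA := t (Tt (val z.1)) (xb z.2).

Lemma mb_tT z : exists p : JI -> A, (forall z', deg_le (p z' - (z' == z)%:R) (-1)) /\
  (mb z : MA) = \sum_z' p z' *: tT z'.
Proof.
case: hM => _ _ _ /(_ z.1 z.2)[c hc e].
exists (fun z' => (z' == z)%:R + c@_z'); split.
  by move=> z'; rewrite addrAC subrr add0r; apply/uinvE; apply: hc.
move: e; rewrite -surjective_pairing (lincomb_fin (T := JI)) => ->.
have E (F G : JI -> MA) : \sum_z' (F z' + G z') = \sum_z' F z' + \sum_z' G z' by rewrite big_split.
under [RHS]eq_bigr do rewrite scalerDl.
rewrite E [X in _ = X + _](bigD1 z) //= eqxx scale1r [X in _ = _ + X + _]big1 ?addr0 // => z' /negPf->.
by rewrite scale0r.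
Qed.

Lemma ftT : fbasis tT.
Proof.
apply: (fbasis_of_span (p := fun z => projT1 (cid (mb_tT z))) fmb) => z.
by case: cid => p [].
Qed.

Lemma cong_tTmb : cong tT (mb : JI -> MA).
Proof.
move=> z z'; have [p [hp e]] := mb_tT z.
by rewrite e (co_sum ftT).
Qed.

(** The projection onto [X] by the coordinates of shape [lam]; it is compatible with the action only
    on the span of shapes at most [lam]. *)
Definition pi0 e : XA := \sum_g co Cc e (val g) *: (xb g : XA).

Lemma pi0D e e' : pi0 (e + e') = pi0 e + pi0 e'.
Proof. by rewrite /pi0 -big_split; apply: eq_bigr => g _; rewrite (coD hbC) scalerDl. Qed.

Lemma pi0Z a e : pi0 (a *: e) = a *: pi0 e.
Proof. by rewrite /pi0 scaler_sumr; apply: eq_bigr => g _; rewrite (coZ hbC) scalerA. Qed.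

Lemma pi0_0 : pi0 0 = 0.
Proof. by have := pi0Z 0 0; rewrite !scale0r. Qed.

Lemma pi0_sum (I : Type) (r : seq I) (P : pred I) (F : I -> H) :
  pi0 (\sum_(k <- r | P k) F k) = \sum_(k <- r | P k) pi0 (F k).
Proof. exact: (big_morph pi0 pi0D pi0_0). Qed.

Lemma pi0_C g : pi0 (Cc (val g)) = xb g.
Proof.
rewrite /pi0 (bigD1 g) //= (co_b hbC) eqxx scale1r big1 ?addr0 // => g' ne.
by rewrite (co_b hbC) (inj_eq val_inj) (negPf ne) scale0r.
Qed.

Lemma pi0_lt e : supp (Qlt lam) e -> pi0 e = 0.
Proof.
move=> he; apply: big1 => g _; have [->|/he[]] := eqVneq (co Cc e (val g)) 0.
  by rewrite scale0r.
by rewrite /sh (eqP (valP g)).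
Qed.

Lemma Qle_cases v : dom_le (sh v) lam -> (exists g, v = val g) \/ Qlt lam v.
Proof.
move=> le; have [e|ne] := eqVneq (sh v) lam; last by right; split=> //; apply/eqP.
left; exists (exist (fun w => tshape (Ptab w) == lam) v (introT eqP e)); by [].
Qed.

Local Notation Qle := (fun v : 'S_m.+1 => dom_le (sh v) lam).

Lemma pi0_act h e : supp Qle e -> h *: (pi0 e : X) = pi0 (h * e).
Proof.
move=> he; rewrite (coE hbC e) mulr_sumr !pi0_sum scaler_sumr; apply: eq_bigr => v _.
rewrite -scalerAr !pi0Z resA_actZ.
have [->|/he/Qle_cases hv] := eqVneq (co Cc e v) 0; first by rewrite !scale0r.
congr (_ *: _); case: hv => [[g ->]|lt]; last first.
  by rewrite !pi0_lt ?scaler0 //; [apply: Qlt_mull => //|]; apply: suppC.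
rewrite pi0_C {1}(coE fxb (h *: xb g)); apply: eq_bigr => d _; congr (_ *: _).
have := hX.2 h g d; rewrite (bcoord_co (T := XI) hX.1) => ->.
by rewrite (bcoord_regular (T := 'S_m.+1) (hC_basis H)).
Qed.

Definition emb (z : JI) : ZI := (z.1, val z.2).

Lemma emb_inj : injective emb.
Proof. by move=> [w g] [w' g'] [-> /val_inj->]. Qed.

Definition pi (x : V) : MA := \sum_z co bX x (emb z) *: tT z.

Lemma piD x y : pi (x + y) = pi x + pi y.
Proof. by rewrite /pi -big_split; apply: eq_bigr => z _; rewrite (coD (fbX H)) scalerDl. Qed.

Lemma piZ a x : pi (a *: x) = a *: pi x.
Proof. by rewrite /pi scaler_sumr; apply: eq_bigr => z _; rewrite (coZ (fbX H)) scalerA. Qed.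

Lemma pi_0 : pi 0 = 0.
Proof. by have := piZ 0 0; rewrite !scale0r. Qed.

Lemma pi_sum (I : Type) (r : seq I) (P : pred I) (F : I -> V) :
  pi (\sum_(k <- r | P k) F k) = \sum_(k <- r | P k) pi (F k).
Proof. exact: (big_morph pi piD pi_0). Qed.

Lemma pi_bX z : pi (bX z) = t (Tt (val z.1)) (pi0 (Cc z.2)).
Proof.
case: z => w v; rewrite /= /pi /pi0 t_sumr.
transitivity (\sum_w' \sum_g ((w' == w) && (val g == v))%:R *: tT (w', g)).
  by rewrite pair_bigA; apply: eq_bigr => -[w' g] _; rewrite (co_b (fbX H)).
rewrite (bigD1 w) //= [X in _ + X]big1 ?addr0 => [|w' /negPf ne]; last first.
  by apply: big1 => g _; rewrite ne scale0r.
by apply: eq_bigr => g _; rewrite eqxx (co_b hbC) tZr.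
Qed.

Local Notation Zle := (fun z : ZI => dom_le (sh z.2) lam).

Lemma pi_tT (w : WJ m) e : pi (tHH (Tt (val w)) e) = t (Tt (val w)) (pi0 e).
Proof.
rewrite [in LHS](coE hbC e) tHH_sumA pi_sum [in RHS](coE hbC e) pi0_sum t_sumr.
by apply: eq_bigr => v _; rewrite piZ -[tHH _ _]/(bX (w, v)) pi_bX pi0Z tZr.
Qed.

Lemma pi_t h e : supp Qle e -> pi (tHH h e) = t h (pi0 e).
Proof.
move=> he; rewrite (coE hbT h) tHH_suml t_suml pi_sum; apply: eq_bigr => y _.
rewrite tHHZl -resAE piZ tZl; congr (_ *: _).
have [w [v [jv ->]]] := WJ_decomp y; have [b _] := balanced_T H jv.
by rewrite -TtWJ // b pi_tT t_bal // pi0_act.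
Qed.

Lemma supp_Cle v : dom_le (sh v) lam -> supp Qle (Cc v).
Proof. by move=> hv; apply: suppC. Qed.

Lemma pi_act h (x : V) : suppin bX Zle x -> pi (actV h x) = h *: (pi x : M).
Proof.
move=> hx; rewrite (coE (fbX H) x).
have a0 : actV h 0 = 0 by have := actVZ h 0 (0 : V); rewrite !scale0r.
rewrite (big_morph _ (@actVD m H h) a0) !pi_sum scaler_sumr; apply: eq_bigr => z _.
rewrite actVZ !piZ resA_actZ.
have [->|/hx hz] := eqVneq (co bX x z) 0; first by rewrite !scale0r.
by rewrite pi_bX -tM /actV -tHHMl pi_t //; apply: supp_Cle.
Qed.

Lemma Mbar_exists : exists f : MA -> MA, [/\ forall x y, f (x + y) = f x + f y,
  forall h e, supp Qle e -> hbar e = e -> f (t h (pi0 e)) = t (hbar h) (pi0 e),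
  forall a x, f (a *: x) = lbar a *: f x & forall z, f (mb z) = mb z].
Proof.
case: hM => _ _ [f [fD ft fmbz]] _.
have ftx h g : f (t h (xb g)) = t (hbar h) (xb g).
  have L (c : XI) : lincomb (xb : Xindex m.+1 lam -> X) << (1 : A) *g c >> = xb c.
    rewrite (lincomb_fin (T := XI)) (bigD1 c) //= mcoeffUU scale1r scale1r.
    by rewrite big1 ?addr0 // => c' /negPf ne; rewrite mcoeffU eq_sym ne scale0r scale0r.
  have := ft h << (1 : A) *g g >>; rewrite L => ->; congr (t _ _).
  rewrite -[RHS]L; congr lincomb; apply/malgP => k; rewrite cbarE !mcoeffU.
  by case: eqP => _; rewrite ?lbar1 ?lbar0.
have f0 : f 0 = 0 by apply: (addIr (f 0)); rewrite -fD !add0r.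
have fZ a (x : MA) : f (a *: x : MA) = lbar a *: (f x : MA).
  rewrite (coE ftT x) scaler_sumr !(big_morph f fD f0) scaler_sumr; apply: eq_bigr => z _.
  by rewrite scalerA -!tZl !ftx !hbarZ !tZl lbarM scalerA.
exists f; split=> // h e he be.
rewrite /pi0 !t_sumr (big_morph f fD f0); apply: eq_bigr => g _.
by rewrite !tZr fZ ftx -coC_hbar be.
Qed.

Lemma mb_uniq (f : MA -> MA) z x : (forall x y, f (x + y) = f x + f y) ->
  (forall a x, f (a *: x) = lbar a *: f x) -> (forall z, f (mb z) = mb z) ->
  f x = x -> (forall z', deg_le (co tT x z' - (z' == z)%:R) (-1)) -> x = mb z.
Proof.
move=> fD fZ fm fx hx.
have f0 : f 0 = 0 by apply: (addIr (f 0)); rewrite -fD !add0r.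
pose d := x - mb z.
have fN y : f (- y) = - f y by apply: (addIr (f y)); rewrite -fD !addNr.
have fd : f d = d by rewrite /d fD fN fx fm.
have co_f y z' : co (mb : JI -> MA) (f y) z' = lbar (co (mb : JI -> MA) y z').
  apply: (co_uniq fmb (c := fun z' => lbar (co (mb : JI -> MA) y z'))).
  rewrite {1}(coE fmb y) (big_morph f fD f0); apply: eq_bigr => y' _.
  by rewrite fZ fm.
have dT z' : deg_le (co tT d z') (-1).
  rewrite /d (coB ftT) -(subrKA (z' == z)%:R); apply: deg_leD.
    exact: hx.
  by rewrite -opprB; apply/deg_leN/cong_tTmb.
apply/eqP; rewrite -subr_eq0; apply/eqP/(co_inj fmb) => z'; rewrite (co0 fmb).
apply: lbar_uinv_eq0; first by rewrite -co_f fd.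
exact: (cong_deg_inv ftT fmb cong_tTmb dT).
Qed.

(** On the part of second shape at most [lam], [pi] commutes with bar and sends [bX] to [tT] or 0,
    so the image has the two properties that characterize [mb z]. *)
Lemma pi_mbH z : pi (mbH (emb z)) = mb z.
Proof.
have [f [fD ft fZ fm]] := Mbar_exists.
have f0 : f 0 = 0 by apply: (addIr (f 0)); rewrite -fD !add0r.
have hz : suppin bX Zle (mbH (emb z)).
  by apply: mbH_supp; rewrite /= /sh (eqP (valP z.2)); apply: dom_le_refl.
have fpi : f (pi (mbH (emb z))) = pi (mbH (emb z)).
  rewrite -[in RHS](@mbar_mbH m H hD (emb z)) (coE (fbX H) (mbH (emb z))).
  rewrite pi_sum (big_morph f fD f0) (big_morph _ (@mbarD m H) (@mbar0 m H)) pi_sum.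
  apply: eq_bigr => y _; rewrite (@mbarZ m H) -resAE !piZ fZ.
  have [->|/hz hy] := eqVneq (co bX (mbH (emb z)) y) 0; first by rewrite lbar0 !scale0r.
  rewrite pi_bX ft ?hbarC //; last exact: supp_Cle.
  by rewrite mbar_t hbarC pi_t //; apply: supp_Cle.
apply: (mb_uniq fD fZ fm fpi) => z'; rewrite (co_sum ftT).
by have := @cong_XmbH m H hD (emb z) (emb z'); rewrite (inj_eq emb_inj).
Qed.

Lemma pi_mbH_lt (z : ZI) : Qlt lam z.2 -> pi (mbH z) = 0.
Proof.
case=> ne le; apply: big1 => z' _.
have [->|h0] := eqVneq (co bX (mbH z) (emb z')) 0; first by rewrite scale0r.
have /(_ _ h0) /= := mbH_supp (H := H) (hD := hD) (dom_le_refl (sh z.2)).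
rewrite /sh (eqP (valP z'.2)) => le'; case: ne.
by apply: dom_le_antisym le le'; [apply: sh0|rewrite -(eqP (valP z'.2)); apply: sh0].
Qed.

Lemma pi_mbH_sum (y : ZI) : dom_le (sh y.2) lam ->
  pi (mbH y) = \sum_(z | emb z == y) (mb z : MA).
Proof.
move=> hy; case: (Qle_cases hy) => [[g e]|lt].
  have -> : y = emb (y.1, g) by rewrite /emb /= -e -surjective_pairing.
  by rewrite pi_mbH (eq_bigl _ _ (fun z => inj_eq emb_inj z _)) big_pred1_eq.
rewrite pi_mbH_lt // big_pred0 // => z; apply/eqP => e; move: lt; rewrite -e /=.
by rewrite /Qlt /sh (eqP (valP z.2)) => -[].
Qed.

Lemma act_mb h z : h *: mb z = \sum_z' co mbH (actV h (mbH (emb z))) (emb z') *: (mb z' : MA).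
Proof.
have hz : suppin bX Zle (mbH (emb z)).
  by apply: mbH_supp; rewrite /= /sh (eqP (valP z.2)); apply: dom_le_refl.
have hh := suppX_act (h := h) hD hz.
rewrite -pi_mbH -pi_act //; set x := actV h _ in hh *.
rewrite [in LHS](coE (fmbH H hD) x) pi_sum.
transitivity (\sum_i \sum_(z' | emb z' == i) co mbH x i *: (mb z' : MA)).
  apply: eq_bigr => i _; rewrite piZ -scaler_sumr.
  have [->|/(supp_mbH hh)/= hi] := eqVneq (co mbH x i) 0; first by rewrite !scale0r.
  by rewrite pi_mbH_sum.
rewrite (exchange_big_dep xpredT) //=; apply: eq_bigr => z' _.
by rewrite (eq_bigl _ _ (fun i => eq_sym (emb z') i)) big_pred1_eq.
Qed.

Lemma co_mb h z z' : co (mb : JI -> MA) (h *: mb z) z' =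
  co mbH (actV h (mbH (emb z))) (emb z').
Proof. by rewrite act_mb (co_sum fmb). Qed.

Definition leM (z z' : JI) := cell_le (mb : JXindex m.+1 lam -> M) z z'.

Lemma appearsM z' z : appears (mb : JXindex m.+1 lam -> M) z' z <->
  exists h, co mbH (actV h (mbH (emb z))) (emb z') != 0.
Proof.
split=> -[h hz]; exists h; move: hz; rewrite -co_mb.
  by rewrite (bcoord_co (T := JI) mb_basis).
by rewrite (bcoord_co (T := JI) mb_basis).
Qed.

Lemma leM_leZ z' z : leM z' z <-> leZ H hD (emb z') (emb z).
Proof.
split.
  elim=> {z z'} [z' z /appearsM/appearsZ|z|z' z z'' _ a _ b]; first exact: rt_step.
    exact: rt_refl.
  exact: rt_trans a b.
move ey' : (emb z') => y'; move ey : (emb z) => y l.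
elim: l z' z ey' ey => {y' y} [y' y /appearsZ hy|y|y' y y'' l1 IH1 l2 IH2] z' z e' e.
- by apply/rt_step/appearsM; rewrite e e'.
- by rewrite -e' in e; move/emb_inj: e => ->; apply: rt_refl.
have [a _] := leZ_sh l1; have [b _] := leZ_sh l2.
move: a b; rewrite -e -e' /= /sh (eqP (valP z.2)) (eqP (valP z'.2)) => a b.
have e2 : sh y.2 = lam.
  apply: dom_le_antisym b a; first exact: sh0.
  by rewrite -(eqP (valP z.2)); apply: sh0.
pose u : JI := (y.1, exist (fun w => tshape (Ptab w) == lam) y.2 (introT eqP e2)).
have eu : emb u = y by rewrite /emb /= -surjective_pairing.
exact: rt_trans (IH1 _ _ e' eu) (IH2 _ _ eu e).
Qed.

Definition lab (z : JI) := (rho (emb z)).1.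

Lemma leM_lab z' z : leM z' z -> dom_le (sh (lab z')) (sh (lab z)).
Proof. by move/leM_leZ/leZ_sh => []. Qed.

Lemma leM_dom z' z : leM z' z -> ~ leM z z' -> dom_lt (sh (lab z')) (sh (lab z)).
Proof. by move=> /leM_leZ a nb; apply: leZ_dom a _ => /leM_leZ. Qed.

Lemma leZ_of_leL y' y (z' z : ZI) : leL H y' y -> (rho z').1 = y' -> (rho z).1 = y ->
  z'.2 ord_max = z.2 ord_max -> leZ H hD z' z.
Proof.
move=> l; elim: l z' z => {y' y} [y' y [h hy]|y|y' y y'' _ IH1 _ IH2] z' z e' e ej.
- by apply: rt_step; apply/appearsZ; exists h; rewrite co_mbH_same ?ej // e e'.
- have -> : z' = z.
    apply: (bij_inj (rho_bij m)); rewrite (surjective_pairing (rho z')) e'.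
    by rewrite (surjective_pairing (rho z)) e /rho /= ej.
  exact: rt_refl.
have [r rK rK'] := rho_bij m; pose u := r (y, z.2 ord_max).
have eu : rho u = (y, z.2 ord_max) by rewrite rK'.
have uj : u.2 ord_max = z.2 ord_max by rewrite -[LHS]/((rho u).2) eu.
apply: rt_trans (IH1 z' u e' _ _) (IH2 u z _ e _); rewrite ?eu ?uj //.
Qed.

Lemma leM_same (z z' : JI) : val z.2 ord_max = val z'.2 ord_max ->
  Ptab (lab z) = Ptab (lab z') -> leM z z'.
Proof.
move=> e /(leL_Ptab H)[l _]; apply/leM_leZ.
exact: (@leZ_of_leL _ _ (emb z) (emb z') l erefl erefl e).
Qed.

Context (beta : {linear M -> X}) (hbeta : forall h x, beta (t h x) = h *: x).

(** The multiplication map H (x)_J H -> H in the coordinates of the model. *)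
Definition betaH (x : V) : H := \sum_j (x : HH H) j * Tt (xr j).

Lemma betaH_t h e : betaH (tHH h e) = h * e.
Proof.
rewrite /betaH [in RHS](hJ_sum e) mulr_sumr; apply: eq_bigr => j _.
by rewrite ffunE mulrA.
Qed.

Lemma betaHD x y : betaH (x + y) = betaH x + betaH y.
Proof. by rewrite /betaH -big_split; apply: eq_bigr => j _; rewrite ffunE mulrDl. Qed.

Lemma betaHZ a x : betaH (a *: x) = a *: betaH x.
Proof.
rewrite /betaH scaler_sumr; apply: eq_bigr => j _; rewrite resAE ffunE.
by rewrite -[_ *: (x : HH H) j]/((a%:A : H) * (x : HH H) j) mulr_algl scalerAl.
Qed.

Lemma betaZ a (x : MA) : beta (a *: x : MA) = a *: (beta x : XA).
Proof. exact: linearZ. Qed.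

Lemma beta_sum (I : Type) (r : seq I) (P : pred I) (F : I -> MA) :
  beta (\sum_(k <- r | P k) F k : MA) = \sum_(k <- r | P k) (beta (F k) : XA).
Proof. exact: (raddf_sum beta). Qed.

Lemma beta_pi x : suppin bX Zle x -> (beta (pi x) : XA) = pi0 (betaH x).
Proof.
move=> hx; rewrite (coE (fbX H) x) pi_sum beta_sum.
have b0 : betaH 0 = 0 by have := betaHZ 0 0; rewrite !scale0r.
rewrite (big_morph betaH betaHD b0) pi0_sum; apply: eq_bigr => z _.
rewrite piZ betaZ betaHZ pi0Z; have [->|/hx hz] := eqVneq (co bX x z) 0; first by rewrite !scale0r.
by rewrite pi_bX hbeta betaH_t pi0_act //; apply: supp_Cle.
Qed.

Lemma beta_mb_lt z : Qlt lam (lab z) -> beta (mb z) = 0.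
Proof.
move=> hz; have hs : suppin bX Zle (mbH (emb z)).
  by apply: mbH_supp; rewrite /= /sh (eqP (valP z.2)); apply: dom_le_refl.
rewrite -pi_mbH; have -> : beta (pi (mbH (emb z))) = pi0 (betaH (mbH (emb z))) by exact: beta_pi.
apply: pi0_lt; rewrite /betaH; apply: supp_sum => j _; apply: Qlt_mulr => // y hy.
have hq : co (bC H) (mbH (emb z)) (y, j) != 0 by rewrite co_bC.
have /(_ _ hq) /= le := cb_supp (H := H) (hD := hD) (dom_le_refl (sh (rho (emb z)).1)).
split; last by apply: dom_le_trans le _; case: hz.
case: hz => ne le' e; apply: ne; apply: dom_le_antisym => //; first exact: sh0.
  by rewrite -e; apply: sh0.
by rewrite -e.
Qed.

Lemma co_xb h g d : co (xb : XI -> XA) (h *: xb g) d = co Cc (h * Cc (val g)) (val d).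
Proof.
have := hX.2 h g d; rewrite (bcoord_co (T := XI) hX.1) => ->.
by rewrite (bcoord_regular (T := 'S_m.+1) (hC_basis H)).
Qed.

Lemma xb_le d g : cell_le (xb : Xindex m.+1 lam -> X) d g <-> leL H (val d) (val g).
Proof.
have ap d' g' : appears (xb : Xindex m.+1 lam -> X) d' g' <-> appL H (val d') (val g').
  by split=> -[h hz]; exists h; move: hz; rewrite (bcoord_co (T := XI) hX.1) co_xb.
split.
  elim=> {d g} [d g /ap|g|d g g' _ a _ b]; [exact: rt_step|exact: rt_refl|exact: rt_trans a b].
move ed : (val d) => y'; move eg : (val g) => y l.
elim: l d g ed eg => {y' y} [y' y hy|y|y' y y'' l1 IH1 l2 IH2] d g e' e.
- by apply/rt_step/ap; rewrite e e'.
- by rewrite -e' in e; move/val_inj: e => ->; apply: rt_refl.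
have a := leL_sh hD l1; have b := leL_sh hD l2.
move: a b; rewrite -e -e' /= {1 4}/sh (eqP (valP d)) (eqP (valP g)) => a b.
have e2 : sh y = lam.
  apply: dom_le_antisym b a; first exact: sh0.
  by rewrite -(eqP (valP d)); apply: sh0.
pose u : XI := exist (fun w => tshape (Ptab w) == lam) y (introT eqP e2).
exact: rt_trans (IH1 d u e' erefl) (IH2 u g erefl e).
Qed.

Lemma xb_cell (Ups : XI -> Prop) : is_cell (xb : Xindex m.+1 lam -> X) Ups ->
  exists2 g0, Ups g0 & forall g, Ups g <-> Ptab (val g) = Ptab (val g0).
Proof.
case=> g0 h0; have E g : Ups g <-> Ptab (val g) = Ptab (val g0).
  rewrite h0; split=> [[/xb_le a /xb_le b]|/(leL_Ptab H)[a b]]; first exact: Ptab_of_leL a b.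
  by split; apply/xb_le.
by exists g0 => //; apply/E.
Qed.

(** What lies below [Gam] and outside it has a strictly smaller label and is killed by [beta]; so
    [beta] behaves on the cell module as on a submodule. *)
Lemma cell_lab (Gam : JI -> Prop) z0 : is_cell (mb : JXindex m.+1 lam -> M) Gam -> Gam z0 ->
  sh (lab z0) = lam ->
  (forall z, Gam z -> sh (lab z) = lam) /\ (forall z z', Gam z -> leM z' z -> Gam z' \/ beta (mb z') = 0) /\
  (forall z, leM z z0 -> leM z0 z -> Gam z).
Proof.
case=> c hc Gz0 lz0; have E z : Gam z <-> leM z z0 /\ leM z0 z.
  have [a b] := (hc z0).1 Gz0; rewrite hc; split=> -[p q]; split.
  - exact: rt_trans p b.
  - exact: rt_trans a q.
  - exact: rt_trans p a.
  - exact: rt_trans b q.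
have sE z : Gam z -> sh (lab z) = lam.
  move=> /E[/leM_lab a /leM_lab b]; rewrite -lz0.
  by apply: dom_le_antisym => //; apply: sh0.
split=> //; split; last by move=> z a b; apply/E.
move=> z z' Gz z'z; have [zz'|n] := pselect (leM z z').
  left; have [a b] := (E z).1 Gz; apply/E; split; first exact: rt_trans z'z a.
  exact: rt_trans b zz'.
by right; apply: beta_mb_lt; have := leM_dom z'z n; rewrite (sE _ Gz).
Qed.

Lemma wcoef (N : lmodType H) (T : finType) (b : T -> N) (mu : T -> T -> int)
    (L : T -> pred (cgen (Sn m.+1))) : is_wgraph (b : (T : choiceType) -> N) mu L ->
  forall s (g d : T), co (b : T -> resA N) (Cs H s *: b g : N) d =
    if L g s then qint 2 * (d == g)%:R else if L d s then (mu d g)%:~R else 0.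
Proof.
case=> bas act s g d; have fb := is_basis_fbasis bas; have := act s g; rewrite CsE.
case: ifP => [_ ->|_ [c hc ->]].
  by have := coZ fb (qint 2) (b g) d; rewrite (co_b fb).
rewrite -hc (lincomb_fin (T := T)); exact: (co_sum fb (fun d => c@_d) d).
Qed.

Section Endo.

Context (Ups : XI -> Prop) (g0 : XI) (Ug0 : forall g, Ups g <-> Ptab (val g) = Ptab (val g0)).
Context (Gam : JI -> Prop).
Hypothesis hGam : forall z z', Gam z -> leM z' z -> Gam z' \/ beta (mb z') = 0.
Context (muX : XI -> XI -> int) (LX : XI -> pred (cgen (Sn m.+1))).
Hypothesis hWX : is_wgraph (xb : Xindex m.+1 lam -> X) muX LX.
Context (muM : JI -> JI -> int) (LM : JI -> pred (cgen (Sn m.+1))).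
Hypothesis hWM : is_wgraph (mb : JXindex m.+1 lam -> M) muM LM.
Local Notation VU := {i : XI | `[< Ups i >]}.
Local Notation VG := {i : JI | `[< Gam i >]}.
Context (phi : VU -> VG).
Hypothesis hphi : is_wgraph_iso (I1 := Xindex m.+1 lam) (I2 := JXindex m.+1 lam)
  muX LX muM LM phi.
Local Notation T := (Ptab (val g0)).
Local Notation prU := (pr (inU T)).

Definition liftU (x : XA) : H := \sum_(v : VU) co (xb : XI -> XA) x (val v) *: Cc (val (val v)).

(** The cell module is realized inside [H], on the [Cc w] with [w] in [Ups], and sent to [M] along
    [phi]; [liftU] leads back from [X], so [endo_scalar] applies to [liftU (beta (Phi e))]. *)
Definition Phi (e : H) : MA := \sum_(v : VU) co Cc e (val (val v)) *: (mb (val (phi v)) : MA).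

Lemma VU_T (v : VU) : Ptab (val (val v)) = T.
Proof. by apply/Ug0/asboolP/(valP v). Qed.

Lemma co_liftU x (v : VU) : co Cc (liftU x) (val (val v)) = co (xb : XI -> XA) x (val v).
Proof.
rewrite /liftU (co_suml hbC) (bigD1 v) //= (coZ hbC) (co_b hbC) eqxx mulr1.
rewrite big1 ?addr0 // => v' ne; rewrite (coZ hbC) (co_b hbC) !(inj_eq val_inj) eq_sym (negPf ne).
by rewrite mulr0.
Qed.

Lemma supp_liftU x : supp (inU T) (liftU x).
Proof. by apply: supp_sum => v _; apply: suppZ; apply: suppC; rewrite /inU VU_T. Qed.

Lemma U_ex w : inU T w -> exists v : VU, w = val (val v).
Proof.
move=> /eqP wT; have ws : tshape (Ptab w) == lam by rewrite wT; apply: (valP g0).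
pose g : XI := exist (fun w => tshape (Ptab w) == lam) w ws.
have gU : `[< Ups g >] by apply/asboolP/Ug0.
by exists (exist (fun i => `[< Ups i >]) g gU).
Qed.

Lemma U_eq x x' : supp (inU T) x -> supp (inU T) x' ->
  (forall v : VU, co Cc x (val (val v)) = co Cc x' (val (val v))) -> x = x'.
Proof.
move=> hx hx' e; apply: (co_inj hbC) => w; have [uw|nw] := boolP (inU T w).
  by have [v ->] := U_ex uw.
have Z y : supp (inU T) y -> co Cc y w = 0.
  by move=> hy; apply/eqP; apply: contraT => /hy; rewrite (negPf nw).
by rewrite !Z.
Qed.

Lemma liftUD x y : liftU (x + y) = liftU x + liftU y.
Proof. by rewrite /liftU -big_split; apply: eq_bigr => v _; rewrite (coD fxb) scalerDl. Qed.

Lemma liftUZ a x : liftU (a *: x) = a *: liftU x.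
Proof. by rewrite /liftU scaler_sumr; apply: eq_bigr => v _; rewrite (coZ fxb) scalerA. Qed.

Lemma liftU_sum (I : Type) (r : seq I) (P : pred I) (F : I -> XA) :
  liftU (\sum_(k <- r | P k) F k) = \sum_(k <- r | P k) liftU (F k).
Proof.
apply: (big_morph liftU liftUD); have := liftUZ 0 0; by rewrite !scale0r.
Qed.

Lemma PhiD x y : Phi (x + y) = Phi x + Phi y.
Proof. by rewrite /Phi -big_split; apply: eq_bigr => v _; rewrite (coD hbC) scalerDl. Qed.

Lemma PhiZ a x : Phi (a *: x) = a *: Phi x.
Proof. by rewrite /Phi scaler_sumr; apply: eq_bigr => v _; rewrite (coZ hbC) scalerA. Qed.

Lemma liftU_act h x : liftU (h *: (x : X)) = prU (h * liftU x).
Proof.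
have prU_sum (F : XI -> H) : prU (\sum_k F k) = \sum_k prU (F k).
  apply: (big_morph _ (@prD m.+1 H T)); have := @prZ m.+1 H T 0 0; by rewrite !scale0r.
rewrite (coE fxb x) scaler_sumr !liftU_sum mulr_sumr prU_sum; apply: eq_bigr => g _.
rewrite resA_actZ !liftUZ -scalerAr prZ; congr (_ *: _).
apply: U_eq => [||v]; [exact: supp_liftU|exact: supp_pr|].
rewrite co_liftU co_pr /inU VU_T eqxx co_xb.
have [/eqP/Ug0 ug|ng] := boolP (Ptab (val g) == T).
  have [v0 e0] : exists v0 : VU, g = val v0.
    have gU : `[< Ups g >] by apply/asboolP.
    by exists (exist (fun i => `[< Ups i >]) g gU).
  have -> : liftU (xb g) = Cc (val g).
    apply: U_eq => [||v']; [exact: supp_liftU|by apply: suppC; rewrite /inU e0 VU_T|].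
    by rewrite co_liftU (co_b fxb) (co_b hbC) (inj_eq val_inj).
  by [].
have -> : liftU (xb g) = 0.
  rewrite /liftU big1 // => v' _; rewrite (co_b fxb); case: eqP => [e|_]; last by rewrite scale0r.
  by case/eqP: ng; rewrite -e VU_T.
rewrite mulr0 (co0 hbC); apply/eqP; apply: contraT => hv.
have l : leL H (val (val v)) (val g) by apply: rt_step; exists h.
case/eqP: ng; rewrite -(leL_sh_eq hD l) ?VU_T //.
by rewrite /sh (eqP (valP g)) (eqP (valP (val v))).
Qed.

(** [phi] preserves weights only where one descent set is not contained in the other; the
    coefficients of [Cs H s] involve just such pairs, as [s] lies in the difference. *)
Lemma Phi_Cs s (v : VU) : beta (Phi (prU (Cs H s * Cc (val (val v)))) : M) =
  Cs H s *: beta (mb (val (phi v))).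
Proof.
rewrite -linearZ /= (coE fmb (Cs H s *: mb (val (phi v)) : M)) /Phi !beta_sum.
have [[r rK rK'] hL hmu] := hphi.
rewrite [RHS](bigID (fun z => `[< Gam z >])) /= [X in _ = _ + X]big1 ?addr0; last first.
  move=> z nz; have [->|hz] := eqVneq (co (mb : JI -> MA) (Cs H s *: mb (val (phi v)) : M) z) 0.
    by rewrite scale0r raddf0.
  have gv : Gam (val (phi v)) by apply/asboolP/(valP (phi v)).
  have lz : leM z (val (phi v)).
    by apply: rt_step; exists (Cs H s); rewrite (bcoord_co (T := JI) mb_basis).
  have [gz|b0] := hGam gv lz; first by move/asboolP: nz.
  by rewrite betaZ b0 scaler0.
rewrite [RHS](reindex_omap (fun v' : VU => val (phi v')) (fun z => omap r (insub z))) /=; last first.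
  move=> z gz; rewrite (insubT (fun z => `[< Gam z >]) gz) /= rK'.
  by [].
apply: eq_big => [v'|v' _].
  rewrite /= (valP (phi v')) /= valK /= rK eqxx.
  by [].
rewrite co_pr /inU VU_T eqxx (wcoef hWM) hL hL (inj_eq val_inj) (inj_eq (can_inj rK)).
rewrite -co_xb (wcoef hWX) (inj_eq val_inj).
case: ifP => // lv; case: ifP => // lv'; rewrite hmu // => h.
by move: lv; rewrite -[LX _ s]/(LX (val v) s) h.
Qed.

Lemma endo_cell : exists c : A, forall v v' : VU,
  co (xb : XI -> XA) (beta (mb (val (phi v)))) (val v') = c * (v' == v)%:R.
Proof.
pose f e := liftU (beta (Phi e : M)).
have bD (a b : MA) : (beta (a + b : MA) : XA) = (beta a : XA) + (beta b : XA) by exact: raddfD.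
have fD x y : f (x + y) = f x + f y by rewrite /f PhiD bD liftUD.
have fZ a x : f (a *: x) = a *: f x by rewrite /f PhiZ betaZ liftUZ.
have Phi_C (v : VU) : Phi (Cc (val (val v))) = mb (val (phi v)).
  rewrite /Phi (bigD1 v) //= (co_b hbC) eqxx scale1r big1 ?addr0 // => v' ne.
  by rewrite (co_b hbC) !(inj_eq val_inj) (negPf ne) scale0r.
have prU0 : prU (0 : H) = 0 by have := @prZ m.+1 H T 0 0; rewrite !scale0r.
have f0 : f 0 = 0 by have := fZ 0 0; rewrite !scale0r.
have [||c hc] := @endo_scalar m.+1 H T hD f fD fZ.
- by move=> e _; apply: supp_liftU.
- move=> s e he; rewrite (coE hbC e) mulr_sumr (big_morph _ (@prD m.+1 H T) prU0).
  rewrite !(big_morph f fD f0) mulr_sumr (big_morph _ (@prD m.+1 H T) prU0).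
  apply: eq_bigr => w _; rewrite -scalerAr prZ !fZ -scalerAr prZ.
  have [->|/he uw] := eqVneq (co Cc e w) 0; first by rewrite !scale0r.
  have [v ->] := U_ex uw; congr (_ *: _).
  by rewrite /f Phi_Cs liftU_act Phi_C.
exists c => v v'; rewrite -co_liftU -Phi_C -/(f _) hc; last first.
  by apply: suppC; rewrite /inU VU_T.
by rewrite (coZ hbC) (co_b hbC) !(inj_eq val_inj).
Qed.

End Endo.

Lemma wa_exists (a : 'I_m.+1) : exists w : WJ m, val w = (xr a)^-1%g.
Proof.
have h : minR (C := Sn m.+1) (@lfst _ _ (Jlink m.+1)) (xr a)^-1%g.
  by apply/minRE; rewrite invgK; apply: jasc_xr.
by exists (toWJ h).
Qed.

Definition wa a : WJ m := projT1 (cid (wa_exists a)).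
Lemma waE a : val (wa a) = (xr a)^-1%g. Proof. by rewrite /wa; case: cid. Qed.

Lemma pred_lt (i : nat) : (0 < m)%N -> (m.-1 - i < m)%N.
Proof. by move=> m0; rewrite (leq_ltn_trans (leq_subr _ _)) // prednK. Qed.

Lemma wi_lt (l : nat) : (m - l < m.+1)%N. Proof. by rewrite ltnS leq_subr. Qed.
(** A cycle on the last [l + 1] points, of Coxeter length [l]. Rows are counted from 0 below, so row
    [k] of the theorem is [K = k - 1]. *)
Definition wl l : WJ m := wa (Ordinal (wi_lt l)).

Section Chain.

Context (m0 : (0 < m)%N) (g : XI) (K : nat) (Km : (K <= m)%N).
Hypothesis hdesc : forall i : 'I_m, (m - K <= i)%N -> desc (n := m.+1) i (val g).

Definition si (i : nat) : 'I_m := Ordinal (pred_lt i m0).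

Lemma si_desc i : (i < K)%N -> Cs H (si i) *: xb g = qint 2 *: (xb g : XA).
Proof.
move=> iK; have d : desc (n := m.+1) (si i) (val g) by apply: hdesc => /=; lia.
have hg : supp Qle (Cc (val g)).
  by apply: supp_Cle; rewrite /sh (eqP (valP g)); apply: dom_le_refl.
by rewrite -pi0_C (pi0_act _ hg) CsC_desc // pi0Z.
Qed.

(** The pair of D_i and D_(i+1), since the recursion has order two; it starts with D_0 = 1 and D_1
    the generator [Cs] of the last transposition. *)
Fixpoint E2 (i : nat) : H * H :=
  if i is i'.+1 then ((E2 i').2, Cs H (si i'.+1) * (E2 i').2 - (E2 i').1) else (1, Cs H (si 0)).

Lemma hbarE2 i : hbar (E2 i).1 = (E2 i).1 /\ hbar (E2 i).2 = (E2 i).2.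
Proof.
elim: i => [|i [IH1 IH2]] /=; first by rewrite hbar1 hbarCs.
by rewrite hbarB hbarM hbarCs IH1 IH2.
Qed.

Lemma E2_xb i : (i < K)%N -> (E2 i).1 *: xb g = qint i.+1 *: (xb g : XA) /\
  (E2 i).2 *: xb g = qint i.+2 *: (xb g : XA).
Proof.
elim: i => [|i IH] iK /=.
  by rewrite scale1r qint1 scale1r si_desc.
have [IH1 IH2] := IH (ltnW iK); split=> //.
rewrite scalerBl -scalerA IH2 IH1 resA_actZ si_desc // scalerA.
by rewrite [qint i.+2 * _]mulrC qint_rec scalerDl addrK.
Qed.

Lemma wl0 : Tt (val (wl 0)) = 1.
Proof.
rewrite /wl waE; have -> : Ordinal (wi_lt 0) = ord_max by apply: val_inj; rewrite /= subn0.
have : jasc (1%g : 'S_m.+1) by move=> i _; rewrite /desc !perm1 -leqNgt /=.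
by move/jasc_uniq; rewrite perm1 => <-; rewrite invg1 Tt1.
Qed.

Lemma wlS l : (l < m)%N -> Tt (@refl m.+1 (si l)) * Tt (val (wl l)) = Tt (val (wl l.+1)).
Proof.
move=> lm; rewrite /wl !waE.
have -> : Ordinal (wi_lt l) = shi (n := m.+1) (si l) by apply: val_inj => /=; lia.
have -> : Ordinal (wi_lt l.+1) = slo (n := m.+1) (si l) by apply: val_inj => /=; lia.
by rewrite TsT_asc ?xr_asc // xr_pred.
Qed.

(** For [i > l] the transposition commutes with the cycle and lies in [J], so it passes to the
    second factor, where it is a descent of [g]. *)
Lemma t_wl_comm l i : (l < i)%N -> (i < K)%N ->
  Cs H (si i) *: t (Tt (val (wl l))) (xb g) = qint 2 *: (t (Tt (val (wl l))) (xb g) : MA).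
Proof.
move=> li iK; have b1 : ((si i).+1 < Ordinal (wi_lt l))%N by rewrite /=; lia.
have [cm na] := xr_commute b1; have bm : (si i).+1 != m by rewrite /=; lia.
have e : Cs H (si i) * Tt (val (wl l)) = Tt (val (wl l)) * Cs H (si i).
  rewrite /Cs mulrDl mulrDr mulr_algl mulr_algr; congr (_ + _).
  by rewrite (TtWJ H) ?jstab_refl // /wl waE -cm TsT_asc.
rewrite -tM e /Cs mulrDr tDl t_bal ?jstab_refl //.
have -> : t (Tt (val (wl l)) * (upow (-1))%:A) (xb g) = t (Tt (val (wl l))) ((upow (-1))%:A *: xb g).
  by rewrite mulr_algr tZl -[_%:A *: xb g]resAE tZr.
by rewrite -tDr -scalerDl si_desc // tZr.
Qed.

(** Applied to the sum for D_(i+1), [Cs] turns the top term into the new top term plus u^-1 times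
    the old one, and multiplies the others by u + u^-1. Subtracting D_i cancels exactly the part
    with the factor u, so only powers of u^-1 remain below the top term. *)
Lemma tE2 i : (i < K)%N ->
  (t (E2 i).1 (xb g) : MA) = \sum_(l < i.+1) upow (- (i%:Z - l%:Z)) *: (t (Tt (val (wl l))) (xb g) : MA) /\
  (t (E2 i).2 (xb g) : MA) = \sum_(l < i.+2) upow (- (i.+1%:Z - l%:Z)) *: (t (Tt (val (wl l))) (xb g) : MA).
Proof.
have u0 : upow 0 = 1 by [].
have CsT l : (l < m)%N -> (Cs H (si l) *: t (Tt (val (wl l))) (xb g) : MA) =
    (t (Tt (val (wl l.+1))) (xb g) : MA) + upow (-1) *: (t (Tt (val (wl l))) (xb g) : MA).
  by move=> lm; rewrite -tM /Cs mulrDl tDl wlS // mulr_algl tZl.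
elim: i => [|i IH] iK /=.
  have q0 : upow (- (0%:Z - 0%:Z)) = 1 by [].
  have q1 : upow (- (1%:Z - 1%:Z)) = 1 by [].
  have q2 : upow (- (1%:Z - 0%:Z)) = upow (-1) by [].
  have E : (t (Cs H (si 0)) (xb g) : MA) = (t (Tt (val (wl 1))) (xb g) : MA) + upow (-1) *: (t (Tt (val (wl 0))) (xb g) : MA).
    by rewrite -CsT // -tM wl0 mulr1.
  split; first by rewrite big_ord_recr big_ord0 /= add0r q0 scale1r wl0.
  by rewrite E !big_ord_recr big_ord0 /= add0r q1 q2 scale1r addrC.
have [IH1 IH2] := IH (ltnW iK); split=> //.
have im : (i.+1 < m)%N by apply: leq_trans iK Km.
rewrite -scaleN1r tDl tM IH2; have -> : t (-1 *: (E2 i).1) (xb g) = - (t (E2 i).1 (xb g) : MA).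
  by rewrite tZl scaleN1r.
rewrite IH1 big_ord_recr /= subrr oppr0 u0 scale1r scalerDr CsT // scaler_sumr.
rewrite [RHS]big_ord_recr /= subrr oppr0 u0 scale1r [X in _ = X + _]big_ord_recr /=.
set a := t (Tt (val (wl i.+2))) _; set b := t (Tt (val (wl i.+1))) _.
have -> : - (i.+2%:Z - i.+1%:Z) = -1 by lia.
have R (S1 S2 S3 p q : MA) : S1 - S2 = S3 -> S1 + (p + q) - S2 = S3 + q + p.
  by move=> <-; rewrite addrAC [p + q]addrC addrA.
apply: R; rewrite -sumrB; apply: eq_bigr => l _.
set tl : MA := t (Tt (val (wl l))) (xb g); set c := upow (- (i.+1%:Z - l%:Z)).
have hl : (l < i.+1)%N by [].
have C : (Cs H (si i.+1) *: (c *: tl : M) : MA) = (c * qint 2) *: tl.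
  exact: (etrans (@resA_actZ _ M (Cs H (si i.+1)) c tl)
    (etrans (congr1 (fun y : MA => c *: y) (t_wl_comm hl iK)) (scalerA _ _ _))).
apply: (etrans (congr1 (fun y : MA => y - _) C)); rewrite -scalerBl /c; congr (_ *: _).
rewrite qint2E mulrDr -!upowD.
have -> : - (i.+1%:Z - l%:Z) + 1 = - (i%:Z - l%:Z) by lia.
have -> : - (i.+1%:Z - l%:Z) + -1 = - (i.+2%:Z - l%:Z) by lia.
by rewrite addrAC subrr add0r.
Qed.

Lemma chain_mb : (0 < K)%N -> (mb (wl K, g) : MA) = t (E2 K.-1).2 (xb g) /\
  beta (mb (wl K, g)) = qint K.+1 *: (xb g : XA).
Proof.
move=> K0; have K1 : (K.-1 < K)%N by rewrite prednK.
have e : (mb (wl K, g) : MA) = t (E2 K.-1).2 (xb g).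
  have [f [fD ft fZ fm]] := Mbar_exists.
  apply/esym/(mb_uniq fD fZ fm) => [|z'].
    have hg : supp Qle (Cc (val g)).
      by apply: supp_Cle; rewrite /sh (eqP (valP g)); apply: dom_le_refl.
    by rewrite -pi0_C ft ?hbarC // (hbarE2 _).2.
  have [_ ->] := tE2 K1; rewrite prednK // big_ord_recr /= subrr oppr0.
  rewrite (coD ftT) (coZ ftT) -[t _ _]/(tT (wl K, g)) (co_b ftT).
  rewrite -[upow 0]/(1 : A) mul1r addrK (co_suml ftT); apply: deg_le_sum => l _.
  rewrite (coZ ftT) -[t _ _]/(tT (wl l, g)) (co_b ftT).
  have h1 : deg_le (upow (- (K%:Z - l%:Z))) (-1).
    by apply: (deg_leW _ (@deg_le_upow (- (K%:Z - l%:Z)))); have := ltn_ord l; lia.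
  have h2 : deg_le ((z' == (wl l, g))%:R : A) 0.
    by case: eqP => _; [exact: (deg_le_int 1)|exact: deg_le0].
  exact: (deg_leM h1 h2).
split=> //; rewrite [LHS](congr1 (fun x : M => beta x : XA) e) hbeta.
by have [_ ->] := E2_xb K1; rewrite prednK.
Qed.

End Chain.

Lemma chain0 (g : XI) : beta (mb (wl 0, g)) = (xb g : XA).
Proof.
have e : (mb (wl 0, g) : MA) = t 1 (xb g).
  have [f [fD ft fZ fm]] := Mbar_exists.
  apply/esym/(mb_uniq fD fZ fm) => [|z'].
    have hg : supp Qle (Cc (val g)).
      by apply: supp_Cle; rewrite /sh (eqP (valP g)); apply: dom_le_refl.
    by rewrite -pi0_C ft ?hbarC // hbar1.
  by rewrite -wl0 -[t _ _]/(tT (wl 0, g)) (co_b ftT) subrr; apply: deg_le0.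
by rewrite [LHS](congr1 (fun x : M => beta x : XA) e) hbeta scale1r.
Qed.

Lemma chain_beta (g : XI) K : (K <= m)%N ->
  (forall i : 'I_m, (m - K <= i)%N -> desc (n := m.+1) i (val g)) ->
  beta (mb (wl K, g)) = qint K.+1 *: (xb g : XA).
Proof.
case: K => [|K] Km hd; first by rewrite qint1 scale1r chain0.
have m0 : (0 < m)%N by apply: leq_trans Km.
by have [] := chain_mb m0 Km hd.
Qed.

(** The new index has the same label tableau as [z0] and the same image of the last point, so
    [leM_same] puts it in the same cell, and [chain_beta] evaluates [beta] there. *)
Lemma find_z1 (Gam : JI -> Prop) z0 P1 K : is_cell (mb : JXindex m.+1 lam -> M) Gam -> Gam z0 ->
  Ptab (lab z0) = P1 -> tshape P1 = lam ->
  (size (nth [::] (tab_lt P1 m.+1) K) < size (nth [::] P1 K))%N ->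
  exists z1, [/\ Gam z1, Ptab (val z1.2) = Ptab (val z0.2) &
    beta (mb z1) = qint K.+1 *: (xb z1.2 : XA)].
Proof.
move=> hG G0 e0 shP hrow; pose gam := val z0.2.
have sg : tshape (Ptab gam) = lam by apply/eqP/(valP z0.2).
have labE : lab z0 = ((xr ((val z0.1)^-1%g ord_max))^-1 * vJ gam)%g.
  by rewrite /lab /rho /= -(jasc_uniq (WJ_jasc z0.1)) invgK.
have [v1 [a1 [jv1 aK e1 e2 hd]]] := @find_run m (vJ gam) ((val z0.1)^-1%g ord_max) (gam ord_max) P1 K
  (jstab_vJ gam) (etrans (congr1 _ (esym labE)) e0)
  (etrans shP (esym (etrans (congr1 (fun x => tshape (Ptab x)) (vJ_xr gam)) sg))) hrow.
rewrite vJ_xr in e2.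
have s1 : tshape (Ptab (v1 * xr (gam ord_max))%g) == lam by rewrite e2 sg.
pose g1 : XI := exist (fun w => tshape (Ptab w) == lam) (v1 * xr (gam ord_max))%g s1.
have Km : (K <= m)%N by rewrite -aK leq_addl.
have ea : a1 = Ordinal (wi_lt K) by apply: val_inj => /=; move: aK; clear; lia.
have lab1 : lab (wl K, g1) = ((xr a1)^-1 * v1)%g.
  by rewrite /lab /rho /= /wl waE -ea vJ_mul.
have l0 : sh (lab z0) = lam by rewrite /sh e0.
have [_ [_ hcl]] := cell_lab hG G0 l0.
have last1 : val g1 ord_max = val z0.2 ord_max by rewrite /= jmul_max.
exists (wl K, g1); split=> //.
  by apply: hcl; apply: leM_same; rewrite ?lab1 ?e1 ?e0.
apply: chain_beta => // i hi; apply: hd; move: aK hi; clear; lia.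
Qed.

End TensorX.

End InducedCell.
Import InducedCell.

(** * Reading off the scalar *)

Module Main.

Import Order.TTheory GRing.Theory Num.Theory.
Local Open Scope ring_scope.

Local Notation A := laurent.

Lemma linext_fin (T : finType) (W : lmodType A) (f : T -> W) (c : {malg A[T]}) :
  linext f c = \sum_i c@_i *: f i.
Proof.
rewrite /linext big_uniq ?fset_uniq //= big_mkcond; apply: eq_bigr => i _.
by case: ifP => // /negbT/mcoeff_outdom ->; rewrite scale0r.
Qed.

Lemma sum_delta (T : finType) (a : T -> A) (k : T) : \sum_i a i * (i == k)%:R = a k.
Proof.
rewrite (bigD1 k) //= eqxx mulr1 big1 ?addr0 // => i /negPf->.
by rewrite mulr0.
Qed.

Section Main.

Context (m : nat) (lam : seq nat) (H : hecke (Sn m.+1)).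
Local Notation XI := {w : 'S_m.+1 | tshape (Ptab w) == lam}.
Local Notation JI := (WJ m * XI)%type.
Context (X : lmodType H) (xb : XI -> X) (M : lmodType H) (mb : JI -> M).
Context (bx : is_basis (xb : Xindex m.+1 lam -> X)).
Context (Ups : XI -> Prop) (Gam : JI -> Prop).
Local Notation VU := {i : XI | `[< Ups i >]}.
Local Notation VG := {i : JI | `[< Gam i >]}.
Context (phi : VU -> VG) (beta : {linear M -> X}).

Lemma cell_projE x (v : VU) :
  (cell_proj (xb : Xindex m.+1 lam -> X) Ups x)@_v = co (xb : XI -> resA X) x (val v).
Proof.
pose F (w : XI) : {malg A[VU]} := if insub w is Some u then << u >> else 0.
have FE g : (F g)@_v = (g == val v)%:R.
  rewrite /F; case: insubP => [u _ eu|nu].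
    by rewrite mcoeffU -eu (inj_eq val_inj); case: (u == v).
  by rewrite mcoeff0; case: eqP nu => // ->; rewrite (valP v).
rewrite -(bcoord_co (T := XI) bx).
have -> : cell_proj (xb : Xindex m.+1 lam -> X) Ups x = \sum_(i : XI) (bcoord (xb : Xindex m.+1 lam -> X) x)@_i *: F i.
  exact: (linext_fin (T := XI)).
set q := bcoord _ _; clearbody q; rewrite raddf_sum -[RHS](sum_delta (fun i : XI => q@_i) (val v)).
by apply: eq_bigr => g _; rewrite -FE; exact: mcoeffZ.
Qed.

Lemma relabelE (q : {malg A[VU]}) (v : VU) : injective phi ->
  (relabel (Ups := Ups : Xindex m.+1 lam -> Prop) (Gam := Gam : JXindex m.+1 lam -> Prop) phi q)@_(phi v) = q@_v.
Proof.
move=> pinj; have -> : relabel (Ups := Ups : Xindex m.+1 lam -> Prop) (Gam := Gam : JXindex m.+1 lam -> Prop) phi q =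
    \sum_(u : VU) q@_u *: (<< phi u >> : {malg A[VG]}).
  exact: (linext_fin (T := VU)).
rewrite raddf_sum -[RHS](sum_delta (fun u : VU => q@_u) v).
apply: eq_bigr => u _; apply: (etrans (mcoeffZ _ _ _)); rewrite mcoeffU (inj_eq pinj).
by case: (u == v).
Qed.

Lemma relabel_scalar (c : A) (y : {malg A[VG]}) (x : M) : bijective phi ->
  (forall v v' : VU, co (xb : XI -> resA X) (beta (mb (val (phi v)))) (val v') = c * (v' == v)%:R) ->
  beta x = beta (cell_lift (mb : JXindex m.+1 lam -> M) (Gam := Gam : JXindex m.+1 lam -> Prop) y) ->
  relabel (Ups := Ups : Xindex m.+1 lam -> Prop) (Gam := Gam : JXindex m.+1 lam -> Prop) phi
    (cell_proj (xb : Xindex m.+1 lam -> X) Ups (beta x)) = c *: y.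
Proof.
move=> pb hc ->; have fx := is_basis_fbasis (T := XI) bx.
apply/malgP => g; have [r rK rK'] := pb; rewrite -(rK' g) relabelE; last exact: bij_inj.
rewrite cell_projE (mcoeffZ c) /cell_lift (lincomb_fin (T := VG)) raddf_sum (co_suml fx).
have -> : c * y@_(phi (r g)) = \sum_(k : VG) (c * y@_k) * (k == phi (r g))%:R.
  by rewrite (sum_delta (fun k => c * y@_k)).
apply: eq_bigr => k _; rewrite -(rK' k) (inj_eq (bij_inj pb)).
have := coZ fx (y@_(phi (r k))) (beta (mb (val (phi (r k))))) (val (r g)).
rewrite hc [r g == r k]eq_sym mulrA [y@_ _ * c]mulrC => <-.
congr (co _ _ _); exact: linearZ.
Qed.

End Main.

Lemma corollary_succ (hDom : Dom) (m : nat) (lam : seq nat)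
  (H : hecke (Sn m.+1)) (X : lmodType H) (xb : Xindex m.+1 lam -> X)
  (hX : is_cellular_subquotient (M := (halg H)^o) (hC H) xb)
  (M : lmodType H) (t : H -> X -> M) (mb : JXindex m.+1 lam -> M)
  (hM : is_induced_wgraph xb t mb)
  (muX : Xindex m.+1 lam -> Xindex m.+1 lam -> int)
  (LX : Xindex m.+1 lam -> pred (cgen (Sn m.+1)))
  (hWX : is_wgraph xb muX LX)
  (muM : JXindex m.+1 lam -> JXindex m.+1 lam -> int)
  (LM : JXindex m.+1 lam -> pred (cgen (Sn m.+1)))
  (hWM : is_wgraph mb muM LM)
  (Gam : JXindex m.+1 lam -> Prop) (hGam : is_cell mb Gam)
  (P1 P2 : tableau) (hseq : exists2 z, Gam z & has_local_sequence z P1 P2)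
  (hP1 : tshape P1 = lam)
  (Ups : Xindex m.+1 lam -> Prop) (hUps : is_cell xb Ups)
  (beta : {linear M -> X}) (hbeta : forall h e, beta (t h e) = h *: e)
  (phi : vertex Ups -> vertex Gam) (hphi : is_wgraph_iso muX LX muM LM phi)
  (k : nat) (hk : (0 < k)%N)
  (hrow : (size (nth [::] (tab_lt P1 m.+1) k.-1) < size (nth [::] P1 k.-1))%N)
  (y : {malg laurent[vertex Gam]}) (x : M) :
  in_lower mb (x - cell_lift mb y) ->
    (labeled_by Ups P2 ->
       relabel phi (cell_proj xb Ups (beta x)) = qint k *: y) /\
    (~ labeled_by Ups P2 ->
       relabel phi (cell_proj xb Ups (beta x)) = 0).
Proof.
move=> hlow; have [z0 G0 [[t1 [ge1 gn1 e1]] [t2 [ge2 gn2 e2]]]] := hseq.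
have labE (z : JXindex m.+1 lam) (s : gtuple (chain2 m.+1)) : gequiv (JXtuple z) s -> gnormal 0 s ->
    (s.1 : 'S_m.+1) = lab (m := m) (lam := lam) z.
  by move=> g1 g2; apply: (@local_label m (emb z)).
rewrite (labE _ _ ge1 gn1) in e1.
have {}e2 : Ptab (val z0.2) = P2 by rewrite -e2 (@local_second m (emb z0) t2 ge2 gn2).
have [g0 U0 Ug0] := xb_cell hDom hX hUps.
have l0 : sh (lab (m := m) (lam := lam) z0) = lam by rewrite /sh e1.
have [_ [hlo _]] := cell_lab hDom hX hM hbeta hGam G0 l0.
have [c hc] := endo_cell hDom hX hM Ug0 hlo hWX hWM hphi.
have [z1 [G1 eg1 b1]] := find_z1 hDom hX hM hbeta hGam G0 e1 hP1 hrow.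
rewrite prednK // in b1.
have bij : bijective phi by case: hphi.
(* Two representatives of a class differ by lower cells, which [beta] kills. *)
have bx : beta x = beta (cell_lift mb y).
  apply/eqP; rewrite -subr_eq0 -raddfB /=; apply/eqP.
  have [cc -> hcc] := hlow; rewrite (lincomb_fin (T := (WJ m * {w : 'S_m.+1 | tshape (Ptab w) == lam})%type)).
  rewrite raddf_sum big1 // => z _; have [->|nz] := eqVneq (cc@_z) 0.
    by rewrite !scale0r raddf0.
  have [P [s [g1 g2 eP]] dl] := hcc z nz.
  have b0 : beta (mb z) = 0.
    by apply: (beta_mb_lt hDom hX hM hbeta); rewrite /Qlt -(labE _ _ g1 g2) /sh eP.
  have e3 : beta ((cc@_z)%:A *: mb z) = (cc@_z)%:A *: beta (mb z) by exact: linearZ.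
  by apply: (etrans e3); rewrite b0 scaler0.
have key : relabel phi (cell_proj xb Ups (beta x)) = c *: y.
  exact: (relabel_scalar hX.1 bij hc bx).
have [v1 ev1] : exists v1, z1 = val (phi v1).
  have gz : `[< Gam z1 >] by apply/asboolP.
  have [r _ rK] := bij; exists (r (exist (fun i => `[< Gam i >]) z1 gz)).
  by rewrite rK.
have fx := is_basis_fbasis (T := {w : 'S_m.+1 | tshape (Ptab w) == lam}) hX.1.
(* The unknown scalar [c] is tested at [z1], the element of [Gam] where [beta] is known. *)
have E v' : qint k * (val v' == z1.2)%:R = c * (v' == v1)%:R.
  by have := hc v1 v'; rewrite -ev1 b1 (coZ fx) (co_b fx).
rewrite key; split=> [lab2|nlab].
  have u1 : `[< Ups z1.2 >] by apply/asboolP/lab2; rewrite eg1 e2.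
  pose v2 : vertex Ups := exist (fun i => `[< Ups i >]) z1.2 u1.
  have t2' : (val v2 == z1.2) = true by apply/eqP.
  have E2 := E v2; rewrite t2' mulr1 in E2.
  have E1 := E v1; rewrite eqxx mulr1 in E1.
  (* If [v1] and [v2] differed, the two instances of [E] would make both [c] and [qint k] zero,
     hence equal all the same. *)
  have ec : c = qint k.
    have [e|ne] := eqVneq v2 v1.
      by rewrite e eqxx mulr1 in E2; exact: (esym E2).
    have t1' : (val v1 == z1.2) = false.
      by apply/eqP => e; case/eqP: ne; apply: val_inj; rewrite e.
    rewrite t1' mulr0 in E1; rewrite (negPf ne) mulr0 in E2.
    exact: (etrans (esym E1) (esym E2)).
  exact: (congr1 (fun a : A => a *: y) ec).
have E1 := E v1; rewrite eqxx mulr1 in E1.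
(* The tableau of [z1.2] is [P2], so equality would label [Ups] by [P2]; otherwise the left side of
   [E1] vanishes and [c = 0]. *)
have [e|/negPf ne] := eqVneq (val v1) z1.2; last first.
  rewrite ne mulr0 in E1.
  exact: (etrans (congr1 (fun a : A => a *: y) (esym E1)) (scale0r y)).
case: nlab => w; rewrite (Ug0 w); have /asboolP/Ug0 <- := valP v1.
by rewrite e eg1 e2.
Qed.

End Main.
Import Main.

Import GRing.Theory.

Local Open Scope ring_scope.

Theorem corollary6p3 (hDom : Dom)
  (n : nat) (lam : seq nat) (hlam : is_partition lam n)
  (H : hecke (Sn n))
  (* X_lam with its basis *)
  (X : lmodType H) (xb : Xindex n lam -> X)
  (hX : is_cellular_subquotient (M := (halg H)^o) (hC H) xb)
  (* H (x)_J X_lam with its canonical basis *)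
  (M : lmodType H) (t : H -> X -> M) (mb : JXindex n lam -> M)
  (hM : is_induced_wgraph xb t mb)
  (* the W-graph structures on these bases *)
  (muX : Xindex n lam -> Xindex n lam -> int)
  (LX : Xindex n lam -> pred (cgen (Sn n)))
  (hWX : is_wgraph xb muX LX)
  (muM : JXindex n lam -> JXindex n lam -> int)
  (LM : JXindex n lam -> pred (cgen (Sn n)))
  (hWM : is_wgraph mb muM LM)
  (* Gamma and its local sequence P1, P2 *)
  (Gam : JXindex n lam -> Prop) (hGam : is_cell mb Gam)
  (P1 P2 : tableau)
  (hseq : exists2 z, Gam z & has_local_sequence z P1 P2)
  (hP1 : tshape P1 = lam) (hP2 : tshape P2 = lam)
  (Ups : Xindex n lam -> Prop) (hUps : is_cell xb Ups)
  (* the counit *)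
  (beta : {linear M -> X}) (hbeta : forall h e, beta (t h e) = h *: e)
  (* the isomorphism of W-graphs from Upsilon to Gamma *)
  (phi : vertex Ups -> vertex Gam)
  (hphi : is_wgraph_iso muX LX muM LM phi)
  (* the square P1 \ (P1)_{<n} lies in the k-th row *)
  (k : nat) (hk : (0 < k)%N)
  (hrow : (size (nth [::] (tab_lt P1 n) k.-1) < size (nth [::] P1 k.-1))%N) :
  (* x runs over all the representatives in H (x)_J X_lam of the class y in
     A Gamma, a submodule of the quotient by the lower cells *)
  forall (y : {malg laurent[vertex Gam]}) (x : M),
    in_lower mb (x - cell_lift mb y) ->
    (labeled_by Ups P2 ->
       relabel phi (cell_proj xb Ups (beta x)) = qint k *: y) /\
    (~ labeled_by Ups P2 ->
       relabel phi (cell_proj xb Ups (beta x)) = 0).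
Proof.
destruct n as [|m].
  (* For n = 0 the tableau is empty and no row can lose a square. *)
  have P10 : P1 = [::].
    move: hlam => /and3P[_ l0 /eqP ls]; move: hP1 l0 ls; case: (lam) => [|a l].
      by case: (P1).
    by move=> _; rewrite inE negb_or => /andP[a0 _] /= /eqP; rewrite addn_eq0 eq_sym (negPf a0).
  by move: hrow; rewrite P10 nth_nil.
move=> y x; exact: (corollary_succ hDom hX hM hWX hWM hGam hseq hP1 hUps hbeta hphi hk hrow).
Qed.
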